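(* For every integer $N\geq 2$, the modular functions $j$ and $\Delta(N\cdot)/\Delta$ generate the function field $\mathbb{C}(X_0(N))$ over $\mathbb{C}$; that is, $\mathbb{C}(X_0(N))=\mathbb{C}\left(j,\Delta(N\cdot)/\Delta\right)$.
   Context: $X_0(N)$ is the compact Riemann surface (modular curve) obtained from $\Gamma_0(N)\backslash\mathbb{H}$ by adding the $\Gamma_0(N)$-orbits of cusps, and $\mathbb{C}(X_0(N))$ is its field of meromorphic (rational) functions. With $q=e^{2\pi i z}$, $\Delta(z)=q+\sum_{n=2}^\infty\tau(n)q^n$ is the Ramanujan delta function, $E_4(z)=1+240\sum_{n=1}^\infty\sigma_3(n)q^n$ with $\sigma_3(n)=\sum_{d\mid n}d^3$ is the Eisenstein series of weight $4$, $j=E_4^3/\Delta$ is the modular $j$-function, and $\Delta(N\cdot)$ denotes the function $z\mapsto\Delta(Nz)$. *)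

(* Defs.v *)
From Stdlib Require Export Reals ZArith List.
From Stdlib Require Import QArith Qcanon Lra Lia.
From Coquelicot Require Export Coquelicot.
Open Scope R_scope.

(** * Classical modular forms, as functions on C (only meaningful on Im z > 0) *)

Definition Cexp (z : C) : C := (exp (Re z) * cos (Im z), exp (Re z) * sin (Im z)).

(* Sum of a convergent complex series. *)
Definition CSeries (a : nat -> C) : C :=
  (Series (fun n => Re (a n)), Series (fun n => Im (a n))).

Definition qpar (z : C) : C := Cexp (2 * PI * Ci * z)%C.

Definition sigma3 (n : nat) : nat :=
  list_sum (map (fun d => (d ^ 3)%nat)
                (filter (fun d => (n mod d =? 0)%nat) (seq 1 n))).

(* Integer power series in q are represented by their coefficient functions;
   this is multiplication by 1 - q^k. *)
Definition mul_one_minus_qpow (k : nat) (a : nat -> Z) : nat -> Z :=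
  fun n => if (k <=? n)%nat then (a n - a (n - k)%nat)%Z else a n.

(* prod_(1 <= k <= m) (1 - q^k)^24 *)
Fixpoint euler_prod24 (m : nat) : nat -> Z :=
  match m with
  | O => fun n => if (n =? 0)%nat then 1%Z else 0%Z
  | S m' => Nat.iter 24 (mul_one_minus_qpow m) (euler_prod24 m')
  end.

(* Ramanujan's tau: the coefficient of q^n in q * prod_(k >= 1) (1 - q^k)^24.
   The factors with k >= n do not contribute to it. *)
Definition tau (n : nat) : Z :=
  match n with
  | O => 0%Z
  | S m => euler_prod24 m m
  end.

Definition Delta (z : C) : C :=
  (qpar z + CSeries (fun n => RtoC (IZR (tau (n + 2))) * qpar z ^ (n + 2)))%C.

Definition E4 (z : C) : C :=
  (1 + 240 * CSeries (fun n => RtoC (INR (sigma3 (n + 1))) * qpar z ^ (n + 1)))%C.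

Definition jfun (z : C) : C := (E4 z ^ 3 / Delta z)%C.

(** * SL2(Z), Gamma_0(N) and the action on the extended upper half plane *)

Record SL2Z := mkSL2Z {
  ma : Z; mb : Z; mc : Z; md : Z;
  SL2Z_det : (ma * md - mb * mc = 1)%Z }.

Program Definition SL2Z_mul (g h : SL2Z) : SL2Z :=
  mkSL2Z (ma g * ma h + mb g * mc h) (ma g * mb h + mb g * md h)
         (mc g * ma h + md g * mc h) (mc g * mb h + md g * md h) _.
Next Obligation.
  destruct g as [a b c d H], h as [a' b' c' d' H']; simpl.
  transitivity ((a * d - b * c) * (a' * d' - b' * c'))%Z; [ring|].
  now rewrite H, H'.
Qed.

Program Definition SL2Z_inv (g : SL2Z) : SL2Z :=
  mkSL2Z (md g) (- mb g) (- mc g) (ma g) _.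
Next Obligation. destruct g as [a b c d H]; simpl; lia. Qed.

(* The translation z |-> z + h. *)
Program Definition SL2Z_T (h : Z) : SL2Z := mkSL2Z 1 h 0 1 _.
Next Obligation. now rewrite Z.mul_0_r. Qed.

Definition Gamma0 (N : nat) (g : SL2Z) : Prop := (Z.of_nat N | mc g)%Z.

Record UHP := mkUHP { uhp_val :> C; uhp_pos : 0 < Im uhp_val }.

Definition mobius (g : SL2Z) (z : C) : C :=
  ((RtoC (IZR (ma g)) * z + RtoC (IZR (mb g))) /
   (RtoC (IZR (mc g)) * z + RtoC (IZR (md g))))%C.

Lemma mobius_pos (g : SL2Z) (z : UHP) : 0 < Im (mobius g z).
Proof.
  destruct g as [a b c d H], z as [[x y] Hy]; unfold mobius, Im in *; simpl in *.
  apply (f_equal IZR) in H; rewrite minus_IZR, !mult_IZR in H.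
  revert H; generalize (IZR a) (IZR b) (IZR c) (IZR d); clear a b c d.
  intros a b c d H.
  assert (Hp : 0 < (c * x + d) ^ 2 + (c * y) ^ 2).
  { destruct (Req_dec c 0) as [->|Hc].
    - assert (d <> 0) by (intros ->; lra). nra.
    - assert (0 < (c * y) ^ 2) by (apply pow2_gt_0, Rmult_integral_contrapositive; split; lra).
      pose proof (pow2_ge_0 (c * x + d)). lra. }
  match goal with |- 0 < ?e =>
    replace e with (y * (a * d - b * c) / ((c * x + d) ^ 2 + (c * y) ^ 2)) end.
  - rewrite H, Rmult_1_r. now apply Rdiv_lt_0_compat.
  - field. nra.
Qed.

Definition actH (g : SL2Z) (z : UHP) : UHP := mkUHP (mobius g z) (mobius_pos g z).

(* P^1(Q), with [None] the cusp at infinity. *)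
Definition cusp := option Qc.

Definition QcZ (n : Z) : Qc := Q2Qc (inject_Z n).

Definition actCusp (g : SL2Z) (s : cusp) : cusp :=
  match s with
  | None => if Z.eq_dec (mc g) 0 then None else Some (QcZ (ma g) / QcZ (mc g))%Qc
  | Some r =>
      let den := (QcZ (mc g) * r + QcZ (md g))%Qc in
      if Qc_eq_dec den (QcZ 0) then None
      else Some ((QcZ (ma g) * r + QcZ (mb g)) / den)%Qc
  end.

Inductive Hstar := HPoint (z : UHP) | HCusp (s : cusp).

Definition act (g : SL2Z) (p : Hstar) : Hstar :=
  match p with
  | HPoint z => HPoint (actH g z)
  | HCusp s => HCusp (actCusp g s)
  end.

(** * The modular curve X_0(N) and its meromorphic functions *)

Definition orbit (N : nat) (p : Hstar) : Hstar -> Prop :=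
  fun p' => exists g, Gamma0 N g /\ p' = act g p.

Definition X0 (N : nat) : Type :=
  { S : Hstar -> Prop | exists p, S = orbit N p }.

Definition proj (N : nat) (p : Hstar) : X0 N :=
  exist _ (orbit N p) (ex_intro _ p eq_refl).

(* The Riemann sphere, with [None] the point at infinity. *)
Definition sphere := option C.

Definition sphere_inv (w : C) : sphere :=
  if Ceq_dec w 0 then None else Some (/ w)%C.

(* Near z0, G is either a holomorphic function or the inverse of a holomorphic
   function with an isolated zero at z0 (i.e. G has a pole at z0). *)
Definition meromorphic_at (G : C -> sphere) (z0 : C) : Prop :=
  (exists phi : C -> C,
     locally z0 (fun z => ex_derive phi z /\ G z = Some (phi z)))
  \/
  (exists phi : C -> C,
     phi z0 = RtoC 0 /\
     locally z0 (fun z => ex_derive phi z /\ (z <> z0 -> phi z <> RtoC 0) /\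
                          G z = sphere_inv (phi z))).

(* Pullback to the upper half plane; the value outside of it is irrelevant. *)
Definition pullback (N : nat) (F : X0 N -> sphere) : C -> sphere :=
  fun z => match Rlt_dec 0 (Im z) with
           | left Hz => F (proj N (HPoint (mkUHP z Hz)))
           | right _ => None
           end.

(* h is the width of the cusp g(oo): the least h >= 1 such that g T^h g^-1
   belongs to Gamma_0(N) (which contains -1). *)
Definition cusp_width (N : nat) (g : SL2Z) (h : nat) : Prop :=
  let fixes k := Gamma0 N (SL2Z_mul (SL2Z_mul g (SL2Z_T (Z.of_nat k))) (SL2Z_inv g)) in
  (1 <= h)%nat /\ fixes h /\ forall k, (1 <= k)%nat -> fixes k -> (h <= k)%nat.

(* A neighbourhood of the cusp g(oo) in X_0(N) is the image of g{Im z > Y}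
   together with the cusp itself, and exp(2 pi i z / h), equal to 0 at the cusp,
   is the local coordinate there. *)
Definition meromorphic_at_cusp (N : nat) (F : X0 N -> sphere) (g : SL2Z) : Prop :=
  exists (h : nat) (G : C -> sphere) (Y : R),
    cusp_width N g h /\
    meromorphic_at G (RtoC 0) /\
    F (proj N (HCusp (actCusp g None))) = G (RtoC 0) /\
    forall z : UHP, Y < Im z ->
      F (proj N (HPoint (actH g z))) = G (qpar (z / RtoC (INR h))%C).

(* C(X_0(N)). On Gamma_0(N)\H the complex structure is the quotient one: a
   function is meromorphic when its pullback to the upper half plane is (this
   covers the elliptic points as well). Every cusp is g(oo) for some g. *)
Definition function_field (N : nat) (F : X0 N -> sphere) : Prop :=
  (forall z : UHP, meromorphic_at (pullback N F) z) /\
  (forall g : SL2Z, meromorphic_at_cusp N F g).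

(** * Subfields of C(X_0(N)) *)

(* S is the sum (resp. product) of F and G in C(X_0(N)): a meromorphic function
   is determined by its values away from the (isolated) poles of F and G. *)
Definition is_sum (N : nat) (F G S : X0 N -> sphere) : Prop :=
  function_field N S /\
  forall p a b, F p = Some a -> G p = Some b -> S p = Some (a + b)%C.

Definition is_prod (N : nat) (F G P : X0 N -> sphere) : Prop :=
  function_field N P /\
  forall p a b, F p = Some a -> G p = Some b -> P p = Some (a * b)%C.

Definition const (N : nat) (c : C) : X0 N -> sphere := fun _ => Some c.

(* Subfields of C(X_0(N)) containing C. Closure under opposite follows from
   multiplication by the constant -1. *)
Record is_subfield (N : nat) (K : (X0 N -> sphere) -> Prop) : Prop := {
  subfield_sub : forall F, K F -> function_field N F;
  subfield_const : forall c, K (const N c);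
  subfield_add : forall F G S, K F -> K G -> is_sum N F G S -> K S;
  subfield_mul : forall F G P, K F -> K G -> is_prod N F G P -> K P;
  subfield_inv : forall F G,
    K F -> function_field N G -> is_prod N F G (const N (RtoC 1)) -> K G }.

(* C(J, Phi), the smallest subfield containing C, J and Phi. *)
Definition generated (N : nat) (J Phi F : X0 N -> sphere) : Prop :=
  forall K, is_subfield N K -> K J -> K Phi -> K F.

(* F is the element of C(X_0(N)) given by the function f on the upper half plane. *)
Definition represents (N : nat) (F : X0 N -> sphere) (f : C -> C) : Prop :=
  function_field N F /\ forall z : UHP, F (proj N (HPoint z)) = Some (f z).

(* Main.v *)
From Stdlib Require Import Lra Lia Psatz Classical ClassicalEpsilon Wf_nat Permutation
  FunctionalExtensionality PropExtensionality QArith Qcanon.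
Require Import Defs.
Open Scope R_scope.

(** Write [h] for the function [Delta (N z) / Delta z], and [h_g (z) = h (g z)] for its conjugates, with
    [g] running over representatives of the finitely many cosets of [Gamma0 N] in [SL2Z], the first
    of which is 1.

    Let [F] be a meromorphic function on [X0 N]. Multiplying it by a polynomial [D (j)] that vanishes
    to a high order at its poles makes it holomorphic on the upper half plane ([clear_poles]). For
    a holomorphic [f], the polynomial [sum_g f_g prod_(k <> g) (X - h_k)] has coefficients that are
    symmetric in the cosets: they are invariant under [SL2Z], holomorphic, and meromorphic at the
    cusp. Such functions are polynomials in [j] ([level_one]): subtracting multiples of powers of [j]
    removes the pole at the cusp, and what remains tends to zero at the cusp, so that it vanishes by
    the maximum principle. Evaluating the polynomial at [X = h] leaves only the term of the trivial
    coset, so that [f A] is a polynomial in [j] and [h] for [A = prod_(k <> 1) (h - h_k)]; the case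
    [f = 1] shows the same of [A] itself ([interpolation]). And [A] is not zero: [Delta] has a simple
    zero at the cusp, whence [h] vanishes there to order [N - 1], which is more than the order of any
    other conjugate ([hfun_separates]). Hence [F] is the quotient of [f A] by [D (j) A], where
    [f = D (j) F] ([function_field_quotient]).

    The transformation laws of [Delta] and [E4] are proved from their [q]-expansions. For a lattice
    sum over [Z i y + Z], the inner sums are given by Lipschitz' formulas, which follow from the
    uniqueness part of the Herglotz trick ([Herglotz]). In weight 4 the exchange of the two summations
    gives the law of [E4] under [z -> - 1 / z] on the imaginary axis, and everywhere by the identity
    theorem; in weight 2 the exchange produces a correction term ([latsum2_swap]) and the
    quasi-modularity of [E2]. As [E2] is the logarithmic derivative of [Delta], by the recursion for
    the coefficients of the product ([tau_recursion]), the law of [Delta] follows ([Delta_S]).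

    On [X0 N] itself, a function on the upper half plane with Laurent expansions at the cusps extends
    to an element of the function field ([lift]), its values at the cusps being limits. By
    continuity, sums and products can be compared on the upper half plane ([relation_intro]).

    The complex analysis consists of Cauchy's theorem for rectangles, which gives power series
    expansions ([hol_power_series]), the maximum principle and the identity theorem, and expansions in
    [q] of periodic functions ([q_expansion]). *)

(** * Complex differentiability *)

Notation CD f z l := (is_derive (K := C_AbsRing) (V := C_NormedModule) f z l).

(** The form in which derivatives are computed and estimated below: the filter and the norm of the
    general definition are unfolded once and for all. *)
Lemma is_derive_C_iff (f : C -> C) (z l : C) :
  CD f z l <->
  forall eps, 0 < eps -> exists d, 0 < d /\ forall w, Cmod (w - z) < d ->
    Cmod (f w - f z - l * (w - z)) <= eps * Cmod (w - z).
Proof.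
  unfold is_derive, filterdiff, is_domin.
  split.
  - intros [_ H] eps He. specialize (H z (fun P HP => HP) (mkposreal eps He)).
    destruct H as [d Hd]. exists d. split; [apply cond_pos|].
    intros w Hw. rewrite (Cmult_comm l). exact (Hd w Hw).
  - intros H. split.
    + apply is_linear_scal_l.
    + intros x Hx eps.
      rewrite <- (@is_filter_lim_locally_unique C_AbsRing
                    (AbsRing_NormedModule C_AbsRing) z x Hx).
      destruct (H eps (cond_pos eps)) as [d [Hd Hw]].
      exists (mkposreal d Hd). intros w Hb. specialize (Hw w Hb).
      rewrite (Cmult_comm l) in Hw. exact Hw.
Qed.

(** The product and chain rules are stated for the structure of C as a module over itself. *)
Lemma is_derive_C_abs (f : C -> C) (z l : C) :
  CD f z l <-> @is_derive C_AbsRing (AbsRing_NormedModule C_AbsRing) f z l.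
Proof.
  rewrite is_derive_C_iff. unfold is_derive, filterdiff, is_domin.
  split.
  - intros H. split.
    + apply is_linear_scal_l.
    + intros x Hx eps.
      rewrite <- (@is_filter_lim_locally_unique C_AbsRing
                    (AbsRing_NormedModule C_AbsRing) z x Hx).
      destruct (H eps (cond_pos eps)) as [d [Hd Hw]].
      exists (mkposreal d Hd). intros w Hb. specialize (Hw w Hb).
      rewrite (Cmult_comm l) in Hw. exact Hw.
  - intros [_ H] eps He. specialize (H z (fun P HP => HP) (mkposreal eps He)).
    destruct H as [d Hd]. exists d. split; [apply cond_pos|].
    intros w Hw. rewrite (Cmult_comm l). exact (Hd w Hw).
Qed.

Lemma locally_C (z : C) (P : C -> Prop) :
  locally z P <-> exists d, 0 < d /\ forall w, Cmod (w - z) < d -> P w.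
Proof.
  split; intros [d H].
  - exists d. split; [apply cond_pos|]. intros w Hw. apply H.
    apply C_NormedModule_mixin_compat1. exact Hw.
  - destruct H as [Hd H].
    assert (H0 : 0 < d / 2) by lra.
    exists (mkposreal _ H0). intros w Hw. apply H.
    apply (C_NormedModule_mixin_compat2 z w) in Hw. simpl in Hw.
    change (minus w z) with (w - z)%C in Hw.
    assert (sqrt 2 < 2).
    { apply Rsqr_incrst_0; try lra.
      rewrite Rsqr_sqrt; unfold Rsqr; lra. apply sqrt_pos. }
    nra.
Qed.

Lemma CD_ext_loc (f g : C -> C) z l d : 0 < d ->
  (forall w, Cmod (w - z) < d -> f w = g w) -> CD f z l -> CD g z l.
Proof.
  intros Hd Hw. apply is_derive_ext_loc. exists (mkposreal d Hd). exact Hw.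
Qed.

(** Derivatives are found by applying the rules and then matching the result up to [ring] or
    [field]. *)
Lemma CD_eq (f g : C -> C) (z l l' : C) : CD f z l ->
  (forall w, f w = g w) -> l = l' -> CD g z l'.
Proof.
  intros H E <-. apply (CD_ext_loc f g z l 1); auto; lra.
Qed.

Lemma CD_const (c z : C) : CD (fun _ => c) z (RtoC 0).
Proof.
  apply is_derive_C_iff. intros eps He. exists 1. split; [lra|]. intros w _.
  replace (c - c - 0 * (w - z))%C with (RtoC 0) by ring. rewrite Cmod_0.
  apply Rmult_le_pos; [lra|apply Cmod_ge_0].
Qed.

Lemma CD_id (z : C) : CD (fun w => w) z (RtoC 1).
Proof.
  apply is_derive_C_iff. intros eps He. exists 1. split; [lra|]. intros w _.
  replace (w - z - 1 * (w - z))%C with (RtoC 0) by ring. rewrite Cmod_0.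
  apply Rmult_le_pos; [lra|apply Cmod_ge_0].
Qed.

Lemma CD_plus (f g : C -> C) (z a b : C) : CD f z a -> CD g z b ->
  CD (fun w => f w + g w)%C z (a + b)%C.
Proof. intros Hf Hg. exact (is_derive_plus f g z a b Hf Hg). Qed.

Lemma CD_mult (f g : C -> C) (z a b : C) : CD f z a -> CD g z b ->
  CD (fun w => f w * g w)%C z (a * g z + f z * b)%C.
Proof.
  rewrite !is_derive_C_abs. intros Hf Hg.
  exact (is_derive_mult (K:=C_AbsRing) f g z a b Hf Hg Cmult_comm).
Qed.

Lemma CD_comp (f g : C -> C) (z a b : C) : CD f (g z) a -> CD g z b ->
  CD (fun w => f (g w)) z (a * b)%C.
Proof.
  rewrite (is_derive_C_abs g), (Cmult_comm a). intros Hf Hg.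
  exact (is_derive_comp (K:=C_AbsRing) f g z a b Hf Hg).
Qed.

Lemma CD_scal (c : C) (f : C -> C) (z a : C) : CD f z a ->
  CD (fun w => c * f w)%C z (c * a)%C.
Proof.
  intros Hf. replace (c * a)%C with (0 * f z + c * a)%C by ring.
  apply (CD_mult (fun _ => c) f); auto using CD_const.
Qed.

Lemma CD_opp (f : C -> C) (z a : C) : CD f z a ->
  CD (fun w => - f w)%C z (- a)%C.
Proof. intros Hf. exact (is_derive_opp f z a Hf). Qed.

Lemma CD_minus (f g : C -> C) (z a b : C) : CD f z a -> CD g z b ->
  CD (fun w => f w - g w)%C z (a - b)%C.
Proof. intros Hf Hg. apply CD_plus; auto using CD_opp. Qed.

Lemma CD_cont (f : C -> C) z l : CD f z l -> forall eps, 0 < eps ->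
  exists d, 0 < d /\ forall w, Cmod (w - z) < d -> Cmod (f w - f z) < eps.
Proof.
  rewrite is_derive_C_iff. intros H eps He.
  destruct (H 1 Rlt_0_1) as [d [Hd Hw]].
  pose proof (Cmod_ge_0 l) as Hl.
  exists (Rmin d (eps / (2 + Cmod l))). split.
  - apply Rmin_pos; auto. apply Rdiv_lt_0_compat; lra.
  - intros w Hwz.
    assert (H1 : Cmod (w - z) < d) by (eapply Rlt_le_trans; [apply Hwz|apply Rmin_l]).
    assert (H2 : Cmod (w - z) < eps / (2 + Cmod l))
      by (eapply Rlt_le_trans; [apply Hwz|apply Rmin_r]).
    specialize (Hw w H1).
    replace (f w - f z)%C with ((f w - f z - l * (w - z)) + l * (w - z))%C by ring.
    eapply Rle_lt_trans; [apply Cmod_triangle|]. rewrite Cmod_mult.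
    apply (Rmult_lt_compat_r (2 + Cmod l)) in H2; [|lra].
    unfold Rdiv in H2. rewrite Rmult_assoc, Rinv_l, Rmult_1_r in H2 by lra.
    pose proof (Cmod_ge_0 (w - z)). nra.
Qed.

Lemma CD_inv (z : C) : z <> RtoC 0 -> CD Cinv z (- / (z * z))%C.
Proof.
  intros Hz. apply is_derive_C_iff. intros eps He.
  assert (Hm : 0 < Cmod z) by now apply Cmod_gt_0.
  set (m := Cmod z) in *.
  exists (Rmin (m / 2) (eps * m * m * m / 2)). split.
  - apply Rmin_pos; [lra|]. assert (0 < m * m * m) by (repeat apply Rmult_lt_0_compat; lra).
    nra.
  - intros w Hw.
    assert (H1 : Cmod (w - z) < m / 2) by (eapply Rlt_le_trans; [apply Hw|apply Rmin_l]).
    assert (H2 : Cmod (w - z) < eps * m * m * m / 2)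
      by (eapply Rlt_le_trans; [apply Hw|apply Rmin_r]).
    assert (Hw2 : m / 2 < Cmod w).
    { pose proof (Cmod_triangle w (- (w - z))).
      replace (w + - (w - z))%C with z in H by ring. rewrite Cmod_opp in H.
      fold m in H. lra. }
    assert (Hw0 : w <> RtoC 0) by (apply Cmod_gt_0; lra).
    replace (/ w - / z - - / (z * z) * (w - z))%C
      with ((w - z) * (w - z) * / (w * (z * z)))%C by (field; auto).
    rewrite !Cmod_mult, Cmod_inv, !Cmod_mult by (repeat apply Cmult_neq_0; auto).
    fold m.
    assert (H3 : / (Cmod w * (m * m)) <= / (m / 2 * (m * m))).
    { assert (0 < m * m) by nra. apply Rinv_le_contravar.
      - apply Rmult_lt_0_compat; lra.
      - apply Rmult_le_compat_r; lra. }
    replace (/ (m / 2 * (m * m))) with (2 / (m * m * m)) in H3 by (field; lra).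
    pose proof (Cmod_ge_0 (w - z)) as H0.
    rewrite Rmult_assoc, Rmult_comm.
    apply Rmult_le_compat_r; auto.
    apply Rle_trans with (Cmod (w - z) * (2 / (m * m * m))).
    + now apply Rmult_le_compat_l.
    + apply Rle_trans with ((eps * m * m * m / 2) * (2 / (m * m * m))).
      * apply Rmult_le_compat_r; [|lra]. apply Rlt_le, Rdiv_lt_0_compat; [lra|].
        repeat apply Rmult_lt_0_compat; lra.
      * right. field. lra.
Qed.

Lemma CD_div (f g : C -> C) (z a b : C) : CD f z a -> CD g z b ->
  g z <> RtoC 0 ->
  CD (fun w => f w / g w)%C z ((a * g z - f z * b) / (g z * g z))%C.
Proof.
  intros Hf Hg H0.
  replace ((a * g z - f z * b) / (g z * g z))%C
    with (a * / g z + f z * (- / (g z * g z) * b))%C by (field; auto).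
  apply (CD_mult f (fun w => / g w)%C); auto.
  apply (CD_comp Cinv g); auto using CD_inv.
Qed.

Lemma CD_pow (z : C) n : CD (fun w => w ^ n)%C z (INR n * z ^ (pred n))%C.
Proof.
  induction n as [|n IH].
  - simpl INR. replace (RtoC 0 * z ^ pred 0)%C with (RtoC 0) by ring.
    exact (CD_const (RtoC 1) z).
  - replace (INR (S n) * z ^ pred (S n))%C with (1 * z ^ n + z * (INR n * z ^ pred n))%C.
    + exact (CD_mult (fun w => w) (fun w => w ^ n)%C z _ _ (CD_id z) IH).
    + rewrite S_INR, RtoC_plus. destruct n as [|n].
      * simpl. ring.
      * simpl pred. rewrite (Cpow_S z n). ring.
Qed.

Notation hol f z := (ex_derive (K := C_AbsRing) (V := C_NormedModule) f z).

Lemma hol_const c z : hol (fun _ => c) z.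
Proof. eexists; apply CD_const. Qed.
Lemma hol_id z : hol (fun w => w) z.
Proof. eexists; apply CD_id. Qed.
Lemma hol_plus f g z : hol f z -> hol g z -> hol (fun w => f w + g w)%C z.
Proof. intros [a Ha] [b Hb]. eexists; apply CD_plus; eassumption. Qed.
Lemma hol_minus f g z : hol f z -> hol g z -> hol (fun w => f w - g w)%C z.
Proof. intros [a Ha] [b Hb]. eexists; apply CD_minus; eassumption. Qed.
Lemma hol_opp f z : hol f z -> hol (fun w => - f w)%C z.
Proof. intros [a Ha]. eexists; apply CD_opp; eassumption. Qed.
Lemma hol_mult f g z : hol f z -> hol g z -> hol (fun w => f w * g w)%C z.
Proof. intros [a Ha] [b Hb]. eexists; apply CD_mult; eassumption. Qed.
Lemma hol_div f g z : hol f z -> hol g z -> g z <> RtoC 0 -> hol (fun w => f w / g w)%C z.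
Proof. intros [a Ha] [b Hb] H. eexists; apply CD_div; eassumption. Qed.
Lemma hol_inv f z : hol f z -> f z <> RtoC 0 -> hol (fun w => / f w)%C z.
Proof.
  intros [a Ha] H. eexists. apply (CD_comp Cinv f); [|eassumption]. now apply CD_inv.
Qed.
Lemma hol_pow f n z : hol f z -> hol (fun w => f w ^ n)%C z.
Proof.
  intros [a Ha]. eexists. apply (CD_comp (fun w => w ^ n)%C f); [|eassumption].
  apply CD_pow.
Qed.
Lemma hol_comp (f g : C -> C) z : hol f (g z) -> hol g z -> hol (fun w => f (g w)) z.
Proof. intros [a Ha] [b Hb]. eexists. apply CD_comp; eassumption. Qed.
Lemma hol_ext_loc (f g : C -> C) z d : 0 < d ->
  (forall w, Cmod (w - z) < d -> f w = g w) -> hol f z -> hol g z.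
Proof. intros Hd H [a Ha]. exists a. eapply CD_ext_loc; eassumption. Qed.
Lemma hol_cont f z : hol f z -> forall eps, 0 < eps ->
  exists d, 0 < d /\ forall w, Cmod (w - z) < d -> Cmod (f w - f z) < eps.
Proof. intros [a Ha]. eapply CD_cont; eassumption. Qed.

Create HintDb hol.
#[export] Hint Resolve hol_const hol_id hol_plus hol_minus hol_opp hol_mult hol_div
  hol_inv hol_pow : hol.

Lemma Cmod_rtriangle (a b : C) : Cmod a - Cmod b <= Cmod (a - b).
Proof.
  pose proof (Cmod_triangle (a - b) b). replace (a - b + b)%C with a in H by ring. lra.
Qed.

Lemma hol_neq0 f z : hol f z -> f z <> RtoC 0 ->
  exists d, 0 < d /\ forall w, Cmod (w - z) < d -> f w <> RtoC 0.
Proof.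
  intros H H0. apply Cmod_gt_0 in H0.
  destruct (hol_cont f z H _ H0) as [d [Hd Hw]]. exists d. split; auto.
  intros w Hwz E. specialize (Hw w Hwz). rewrite E in Hw.
  replace (0 - f z)%C with (- f z)%C in Hw by ring. rewrite Cmod_opp in Hw. lra.
Qed.

Lemma punctured_limit (f : C -> C) z c d : 0 < d ->
  (forall eps, 0 < eps -> exists e, 0 < e /\ forall w, Cmod (w - z) < e ->
     Cmod (f w - f z) < eps) ->
  (forall w, w <> z -> Cmod (w - z) < d -> f w = c) -> f z = c.
Proof.
  intros Hd Hc Hw.
  destruct (Ceq_dec (f z) c) as [|Hn]; auto. exfalso.
  assert (Hp : 0 < Cmod (c - f z)).
  { apply Cmod_gt_0. intros E. apply Hn.
    replace c with (c - f z + f z)%C by ring. rewrite E. ring. }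
  destruct (Hc _ Hp) as [e [He H]].
  set (t := Rmin d e / 2).
  assert (Ht : 0 < t < d /\ t < e).
  { unfold t. pose proof (Rmin_l d e). pose proof (Rmin_r d e).
    assert (0 < Rmin d e) by now apply Rmin_pos. lra. }
  assert (E1 : (z + t - z)%C = RtoC t) by ring.
  assert (E2 : Cmod (z + t - z) = t) by (rewrite E1, Cmod_R; apply Rabs_pos_eq; lra).
  assert (N : (z + t)%C <> z).
  { intros E. rewrite E in E2. replace (z - z)%C with (RtoC 0) in E2 by ring.
    rewrite Cmod_0 in E2. lra. }
  specialize (H (z + t)%C). rewrite E2 in H. specialize (H (proj2 Ht)).
  rewrite (Hw (z + t)%C N) in H by (rewrite E2; lra). lra.
Qed.

(** ** Real derivatives along lines *)

Lemma Cmod_le_sum (z : C) : Cmod z <= Rabs (Re z) + Rabs (Im z).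
Proof.
  destruct z as [x y]. replace (x, y) with (RtoC x + Ci * RtoC y)%C
    by (unfold Cplus, Cmult, RtoC, Ci; simpl; f_equal; ring).
  eapply Rle_trans; [apply Cmod_triangle|]. rewrite Cmod_mult, Cmod_Ci, !Cmod_R.
  unfold Re, Im, Cplus, Cmult, RtoC, Ci; simpl.
  replace (x + (0 * y - 1 * 0)) with x by ring.
  replace (0 + (0 * 0 + 1 * y)) with y by ring. lra.
Qed.

Lemma im_le_Cmod (z : C) : Rabs (Im z) <= Cmod z.
Proof.
  eapply Rle_trans; [|apply Rmax_Cmod]. apply Rmax_r.
Qed.

Lemma is_derive_R_iff (f : R -> R) (x l : R) :
  is_derive f x l <->
  forall eps, 0 < eps -> exists d, 0 < d /\ forall y, Rabs (y - x) < d ->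
    Rabs (f y - f x - l * (y - x)) <= eps * Rabs (y - x).
Proof.
  unfold is_derive, filterdiff, is_domin.
  split.
  - intros [_ H] eps He. specialize (H x (fun P HP => HP) (mkposreal eps He)).
    destruct H as [d Hd]. exists d. split; [apply cond_pos|].
    intros w Hw. rewrite (Rmult_comm l). exact (Hd w Hw).
  - intros H. split.
    + apply is_linear_scal_l.
    + intros y Hy eps.
      rewrite <- (@is_filter_lim_locally_unique R_AbsRing
                    (AbsRing_NormedModule R_AbsRing) x y Hy).
      destruct (H eps (cond_pos eps)) as [d [Hd Hw]].
      exists (mkposreal d Hd). intros w Hb. specialize (Hw w Hb).
      rewrite (Rmult_comm l) in Hw. exact Hw.
Qed.

Lemma derive_line (f : C -> C) (p v l : C) (t : R) :
  CD f (p + t * v)%C l ->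
  is_derive (fun t : R => Re (f (p + t * v)%C)) t (Re (l * v)) /\
  is_derive (fun t : R => Im (f (p + t * v)%C)) t (Im (l * v)).
Proof.
  rewrite is_derive_C_iff, !is_derive_R_iff. intros H.
  assert (K : forall eps, 0 < eps -> exists d, 0 < d /\ forall y, Rabs (y - t) < d ->
    Cmod (f (p + y * v)%C - f (p + t * v)%C - (l * v) * (y - t)%R) <= eps * Rabs (y - t)).
  { intros eps He. pose proof (Cmod_ge_0 v) as Hv.
    destruct (H (eps / (1 + Cmod v))) as [d [Hd Hw]]; [apply Rdiv_lt_0_compat; lra|].
    exists (d / (1 + Cmod v)). split; [apply Rdiv_lt_0_compat; lra|].
    intros y Hy. specialize (Hw (p + y * v)%C).
    assert (E : (p + y * v - (p + t * v))%C = (RtoC (y - t) * v)%C)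
      by (rewrite RtoC_minus; ring).
    rewrite E, Cmod_mult, Cmod_R in Hw.
    replace (l * v * (y - t)%R)%C with (l * (RtoC (y - t) * v))%C by ring.
    pose proof (Rabs_pos (y - t)) as Ha.
    apply (Rmult_lt_compat_r (1 + Cmod v)) in Hy; [|lra].
    unfold Rdiv in Hy. rewrite Rmult_assoc, Rinv_l, Rmult_1_r in Hy by lra.
    eapply Rle_trans; [apply Hw; nra|].
    replace (eps / (1 + Cmod v) * (Rabs (y - t) * Cmod v))
      with (eps * Rabs (y - t) * (Cmod v / (1 + Cmod v))) by (field; lra).
    rewrite <- (Rmult_1_r (eps * Rabs (y - t))) at 2.
    apply Rmult_le_compat_l; [nra|].
    apply Rmult_le_reg_r with (1 + Cmod v); [lra|].
    unfold Rdiv. rewrite Rmult_assoc, Rinv_l by lra. lra. }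
  split; intros eps He; destruct (K eps He) as [d [Hd Hw]]; exists d; (split; [auto|]);
    intros y Hy; specialize (Hw y Hy); (eapply Rle_trans; [|apply Hw]);
    revert Hw; generalize (f (p + y * v)%C) (f (p + t * v)%C) (l * v)%C;
    intros A B D _.
  - eapply Rle_trans; [|apply re_le_Cmod]. right. f_equal.
    destruct A, B, D. unfold Re. simpl. ring.
  - eapply Rle_trans; [|apply im_le_Cmod]. right. f_equal.
    destruct A, B, D. unfold Im. simpl. ring.
Qed.

(** A mean value inequality: apply the real mean value theorem to real and imaginary parts, which
    costs the factor 2. *)
Lemma derive_bound (f : C -> C) (df : C -> C) (p q : C) M :
  (forall t, 0 <= t <= 1 -> CD f (p + t * (q - p))%C (df (p + t * (q - p))%C)) ->
  (forall t, 0 <= t <= 1 -> Cmod (df (p + t * (q - p))%C) <= M) ->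
  Cmod (f q - f p) <= 2 * M * Cmod (q - p).
Proof.
  intros H HM.
  assert (E0 : (p + RtoC 0 * (q - p))%C = p) by ring.
  assert (E1 : (p + RtoC 1 * (q - p))%C = q) by ring.
  assert (B : forall t, 0 <= t <= 1 ->
     Cmod (df (p + t * (q - p))%C * (q - p)) <= M * Cmod (q - p)).
  { intros t Ht. rewrite Cmod_mult. apply Rmult_le_compat_r; auto using Cmod_ge_0. }
  eapply Rle_trans; [apply Cmod_le_sum|].
  assert (Hre : Rabs (Re (f q - f p)) <= M * Cmod (q - p)).
  { destruct (MVT_gen (fun t : R => Re (f (p + t * (q - p))%C)) 0 1
      (fun t => Re (df (p + t * (q - p))%C * (q - p)))) as [c [Hc E]].
    - intros x Hx. rewrite Rmin_left, Rmax_right in Hx by lra.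
      refine (proj1 (derive_line f p (q - p)%C (df (p + x * (q - p))%C) x (H x _))). lra.
    - intros x Hx. rewrite Rmin_left, Rmax_right in Hx by lra.
      apply continuity_pt_filterlim, @ex_derive_continuous.
      eexists.
      refine (proj1 (derive_line f p (q - p)%C (df (p + x * (q - p))%C) x (H x _))). lra.
    - rewrite Rmin_left, Rmax_right in Hc by lra. cbv beta in E.
      rewrite E0, E1 in E. replace (Re (f q - f p)) with (Re (f q) - Re (f p)) by reflexivity.
      rewrite E, Rminus_0_r, Rmult_1_r. eapply Rle_trans; [apply re_le_Cmod|auto]. }
  assert (Him : Rabs (Im (f q - f p)) <= M * Cmod (q - p)).
  { destruct (MVT_gen (fun t : R => Im (f (p + t * (q - p))%C)) 0 1
      (fun t => Im (df (p + t * (q - p))%C * (q - p)))) as [c [Hc E]].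
    - intros x Hx. rewrite Rmin_left, Rmax_right in Hx by lra.
      refine (proj2 (derive_line f p (q - p)%C (df (p + x * (q - p))%C) x (H x _))). lra.
    - intros x Hx. rewrite Rmin_left, Rmax_right in Hx by lra.
      apply continuity_pt_filterlim, @ex_derive_continuous.
      eexists.
      refine (proj2 (derive_line f p (q - p)%C (df (p + x * (q - p))%C) x (H x _))). lra.
    - rewrite Rmin_left, Rmax_right in Hc by lra. cbv beta in E.
      rewrite E0, E1 in E. replace (Im (f q - f p)) with (Im (f q) - Im (f p)) by reflexivity.
      rewrite E, Rminus_0_r, Rmult_1_r. eapply Rle_trans; [apply im_le_Cmod|auto]. }
  lra.
Qed.

Lemma derive_zero_const (f : C -> C) (p q : C) :
  (forall t, 0 <= t <= 1 -> CD f (p + t * (q - p))%C (RtoC 0)) -> f q = f p.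
Proof.
  intros H. pose proof (derive_bound f (fun _ => RtoC 0) p q 0 H) as B.
  assert (B' : Cmod (f q - f p) <= 0).
  { eapply Rle_trans; [apply B; intros; rewrite Cmod_0; lra|]. lra. }
  apply Ceq_minus, Cmod_eq_0. apply Rle_antisym; auto using Cmod_ge_0.
Qed.

(** ** The complex exponential *)

Lemma Cexp_add a b : Cexp (a + b) = (Cexp a * Cexp b)%C.
Proof.
  destruct a as [a1 a2], b as [b1 b2]. unfold Cexp, Cmult, Re, Im; simpl.
  rewrite exp_plus, cos_plus, sin_plus. f_equal; ring.
Qed.

Lemma Cexp_0 : Cexp 0 = RtoC 1.
Proof. unfold Cexp, Re, Im; simpl. rewrite exp_0, cos_0, sin_0. unfold RtoC; f_equal; ring. Qed.

Lemma Cmod_Cexp z : Cmod (Cexp z) = exp (Re z).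
Proof.
  unfold Cexp, Cmod, fst, snd.
  replace ((exp (Re z) * cos (Im z)) ^ 2 + (exp (Re z) * sin (Im z)) ^ 2)
    with (exp (Re z) ^ 2 * (Rsqr (sin (Im z)) + Rsqr (cos (Im z)))) by (unfold Rsqr; ring).
  rewrite sin2_cos2, Rmult_1_r, <- Rsqr_pow2. apply sqrt_Rsqr, Rlt_le, exp_pos.
Qed.

Lemma Cexp_neq0 z : Cexp z <> RtoC 0.
Proof. apply Cmod_gt_0. rewrite Cmod_Cexp. apply exp_pos. Qed.

Lemma Cexp_opp z : Cexp (- z) = (/ Cexp z)%C.
Proof.
  assert (H : (Cexp (- z) * Cexp z = 1)%C).
  { rewrite <- Cexp_add. replace (- z + z)%C with (RtoC 0) by ring. apply Cexp_0. }
  rewrite <- (Cmult_1_r (Cexp (- z))), <- (Cinv_r (Cexp z)) by apply Cexp_neq0.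
  rewrite Cmult_assoc, H. ring.
Qed.

Lemma Cexp_INR n z : Cexp (INR n * z) = (Cexp z ^ n)%C.
Proof.
  induction n as [|n IH].
  - simpl INR. rewrite Cmult_0_l. apply Cexp_0.
  - rewrite S_INR, RtoC_plus, Cpow_S, <- IH, <- Cexp_add. f_equal. ring.
Qed.

Lemma Cexp_R (x : R) : Cexp (RtoC x) = RtoC (exp x).
Proof. unfold Cexp, Re, Im; simpl. rewrite cos_0, sin_0. unfold RtoC; f_equal; ring. Qed.

(** By the functional equation of the exponential, its derivative is needed at 0 only. *)
Lemma CD_Cexp_0 : CD Cexp (RtoC 0) (RtoC 1).
Proof.
  apply is_derive_C_iff. intros eps He.
  pose proof (is_derive_exp 0) as D1. rewrite exp_0 in D1.
  pose proof (is_derive_cos 0) as D2. rewrite sin_0, Ropp_0 in D2.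
  pose proof (is_derive_sin 0) as D3. rewrite cos_0 in D3.
  rewrite is_derive_R_iff in D1, D2, D3.
  set (e := Rmin 1 eps / 10).
  assert (Hm : 0 < Rmin 1 eps) by (apply Rmin_pos; lra).
  pose proof (Rmin_l 1 eps) as Hm1. pose proof (Rmin_r 1 eps) as Hm2.
  assert (He' : 0 < e) by (unfold e; lra).
  destruct (D1 e He') as [d1 [P1 Q1]]. destruct (D2 e He') as [d2 [P2 Q2]].
  destruct (D3 e He') as [d3 [P3 Q3]].
  assert (Hd : exists d, 0 < d /\ d <= d1 /\ d <= d2 /\ d <= d3 /\ d <= e).
  { exists (Rmin (Rmin d1 d2) (Rmin d3 e)). repeat split.
    - repeat apply Rmin_pos; auto.
    - eapply Rle_trans; apply Rmin_l.
    - eapply Rle_trans; [apply Rmin_l|apply Rmin_r].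
    - eapply Rle_trans; [apply Rmin_r|apply Rmin_l].
    - eapply Rle_trans; [apply Rmin_r|apply Rmin_r]. }
  destruct Hd as [d [Hd [L1 [L2 [L3 L4]]]]].
  exists d. split; auto. intros w. rewrite Cexp_0. intros Hw.
  replace (w - 0)%C with w in * by ring.
  pose proof (re_le_Cmod w) as Bx. pose proof (im_le_Cmod w) as By.
  destruct w as [x y]. unfold Re, Im in Bx, By; simpl in Bx, By.
  set (m := Cmod (x, y)) in *.
  specialize (Q1 x). specialize (Q2 y). specialize (Q3 y).
  rewrite !Rminus_0_r in Q1, Q2, Q3. rewrite exp_0 in Q1. rewrite cos_0 in Q2.
  rewrite sin_0 in Q3. specialize (Q1 ltac:(lra)). specialize (Q2 ltac:(lra)).
  specialize (Q3 ltac:(lra)).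
  rewrite Rmult_1_l in Q1, Q3. rewrite Rmult_0_l, Rminus_0_r in Q2. rewrite Rminus_0_r in Q3.
  assert (X1 : Rabs (exp x - 1) <= 2 * Rabs x).
  { replace (exp x - 1) with ((exp x - 1 - x) + x) by ring.
    eapply Rle_trans; [apply Rabs_triang|]. pose proof (Rabs_pos x). unfold e in *; nra. }
  assert (X2 : 0 < exp x <= 3).
  { split; [apply exp_pos|]. apply Rabs_le_between in X1. unfold e in *; lra. }
  eapply Rle_trans; [apply Cmod_le_sum|].
  unfold Cexp, Re, Im; simpl.
  replace (exp x * cos y + - (1) + - (1 * x - 0 * y))
    with (exp x * (cos y - 1) + (exp x - 1 - x)) by ring.
  replace (exp x * sin y + - 0 + - (1 * y + 0 * x))
    with (exp x * (sin y - y) + (exp x - 1) * y) by ring.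
  assert (Y1 := Rabs_triang (exp x * (cos y - 1)) (exp x - 1 - x)).
  assert (Y2 := Rabs_triang (exp x * (sin y - y)) ((exp x - 1) * y)).
  rewrite Rabs_mult, (Rabs_pos_eq (exp x)) in Y1 by lra.
  rewrite !Rabs_mult, (Rabs_pos_eq (exp x)) in Y2 by lra.
  assert (Z1 : exp x * Rabs (cos y - 1) <= 3 * (e * m)).
  { apply Rmult_le_compat; try lra. apply Rabs_pos. pose proof (Rabs_pos y). nra. }
  assert (Z2 : exp x * Rabs (sin y - y) <= 3 * (e * m)).
  { apply Rmult_le_compat; try lra. apply Rabs_pos. pose proof (Rabs_pos y). nra. }
  assert (Z3 : Rabs (exp x - 1) * Rabs y <= 2 * e * m).
  { apply Rmult_le_compat; try lra; apply Rabs_pos. }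
  assert (Z4 : e * Rabs x <= e * m) by (apply Rmult_le_compat_l; lra).
  assert (0 <= m) by apply Cmod_ge_0.
  assert (0 <= e * m) by (apply Rmult_le_pos; lra).
  assert (10 * e * m <= eps * m) by (apply Rmult_le_compat_r; unfold e; lra).
  lra.
Qed.

Lemma CD_Cexp z : CD Cexp z (Cexp z).
Proof.
  assert (D : CD (fun w => w - z)%C z (RtoC 1 - RtoC 0)%C)
    by (apply CD_minus; auto using CD_id, CD_const).
  apply (CD_eq (fun w => Cexp z * Cexp (w - z))%C _ z (Cexp z * (1 * (1 - 0)))%C).
  - apply (CD_scal (Cexp z) (fun w => Cexp (w - z))%C).
    apply (CD_comp Cexp (fun w => w - z)%C); auto.
    replace (z - z)%C with (RtoC 0) by ring. apply CD_Cexp_0.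
  - intros w. rewrite <- Cexp_add. f_equal. ring.
  - ring.
Qed.

Lemma hol_Cexp f z : hol f z -> hol (fun w => Cexp (f w)) z.
Proof. intros [a Ha]. eexists. apply (CD_comp Cexp f); [apply CD_Cexp|eassumption]. Qed.
#[export] Hint Resolve hol_Cexp : hol.

(** * Complex series and power series *)

Definition is_Clim (u : nat -> C) (l : C) : Prop :=
  forall eps, 0 < eps -> exists N : nat, forall n, (N <= n)%nat -> Cmod (u n - l) < eps.

(** [CSeries] is defined by components, the estimates are made with the modulus. *)
Lemma is_Clim_components u l :
  is_Clim u l <-> is_lim_seq (fun n => Re (u n)) (Re l) /\ is_lim_seq (fun n => Im (u n)) (Im l).
Proof.
  split.
  - intros H; split; apply is_lim_seq_spec; intros eps;
      destruct (H eps (cond_pos eps)) as [N HN]; exists N; intros n Hn;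
      (eapply Rle_lt_trans; [|apply (HN n Hn)]).
    + apply (re_le_Cmod (u n - l)).
    + apply (im_le_Cmod (u n - l)).
  - intros [H1 H2] eps He. apply is_lim_seq_spec in H1, H2.
    assert (He2 : 0 < eps / 2) by lra.
    destruct (H1 (mkposreal _ He2)) as [N1 K1]. destruct (H2 (mkposreal _ He2)) as [N2 K2].
    exists (Nat.max N1 N2). intros n Hn. specialize (K1 n ltac:(lia)). specialize (K2 n ltac:(lia)).
    simpl in K1, K2. eapply Rle_lt_trans; [apply Cmod_le_sum|].
    change (Re (u n - l)) with (Re (u n) - Re l). change (Im (u n - l)) with (Im (u n) - Im l).
    lra.
Qed.

Lemma is_Clim_unique u l l' : is_Clim u l -> is_Clim u l' -> l = l'.
Proof.
  rewrite !is_Clim_components. intros [A B] [A' B'].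
  apply is_lim_seq_unique in A, B, A', B'.
  destruct l, l'; unfold Re, Im in *; simpl in *. rewrite A in A'. rewrite B in B'.
  injection A'; injection B'; congruence.
Qed.

Lemma is_Clim_ext u v l : (forall n, u n = v n) -> is_Clim u l -> is_Clim v l.
Proof. intros E H eps He. destruct (H eps He) as [N HN]. exists N. intros; rewrite <- E; auto. Qed.

Lemma is_Clim_const c : is_Clim (fun _ => c) c.
Proof.
  intros eps He; exists 0%nat; intros. replace (c - c)%C with (RtoC 0) by ring.
  now rewrite Cmod_0.
Qed.

Lemma is_Clim_plus u v l m : is_Clim u l -> is_Clim v m ->
  is_Clim (fun n => u n + v n)%C (l + m)%C.
Proof.
  rewrite !is_Clim_components. intros [A B] [A' B'].
  split; [apply (is_lim_seq_plus' _ _ _ _ A A')|apply (is_lim_seq_plus' _ _ _ _ B B')].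
Qed.

Lemma is_Clim_scal c u l : is_Clim u l -> is_Clim (fun n => c * u n)%C (c * l)%C.
Proof.
  intros H eps He. pose proof (Cmod_ge_0 c).
  destruct (H (eps / (1 + Cmod c))) as [N HN]; [apply Rdiv_lt_0_compat; lra|].
  exists N. intros n Hn. specialize (HN n Hn).
  replace (c * u n - c * l)%C with (c * (u n - l))%C by ring. rewrite Cmod_mult.
  apply (Rmult_lt_compat_r (1 + Cmod c)) in HN; [|lra].
  unfold Rdiv in HN. rewrite Rmult_assoc, Rinv_l, Rmult_1_r in HN by lra.
  pose proof (Cmod_ge_0 (u n - l)). nra.
Qed.

Lemma is_Clim_subseq u l (phi : nat -> nat) : (forall n, (n <= phi n)%nat) ->
  is_Clim u l -> is_Clim (fun n => u (phi n)) l.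
Proof.
  intros Hp H eps He. destruct (H eps He) as [N HN]. exists N. intros n Hn.
  apply HN. specialize (Hp n). lia.
Qed.

Lemma is_Clim_0_le u (v : nat -> R) : (forall n, Cmod (u n) <= v n) -> is_lim_seq v 0 ->
  is_Clim u 0.
Proof.
  intros Hle Hv eps He. apply is_lim_seq_spec in Hv.
  destruct (Hv (mkposreal _ He)) as [N HN]. exists N. intros n Hn. specialize (HN n Hn).
  simpl in HN. replace (u n - 0)%C with (u n) by ring.
  eapply Rle_lt_trans; [apply Hle|]. apply Rabs_lt_between in HN. lra.
Qed.

Lemma is_Clim_bound u l M : is_Clim u l -> (forall n, Cmod (u n) <= M) -> Cmod l <= M.
Proof.
  intros H HM. apply Rnot_lt_le. intros Hlt.
  destruct (H (Cmod l - M)) as [N HN]; [lra|]. specialize (HN N (le_n _)). specialize (HM N).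
  pose proof (Cmod_rtriangle l (l - u N)) as T.
  replace (l - (l - u N))%C with (u N) in T by ring.
  replace (l - u N)%C with (- (u N - l))%C in T by ring. rewrite Cmod_opp in T. lra.
Qed.

Fixpoint csum (a : nat -> C) (n : nat) : C :=
  match n with O => RtoC 0 | S n => (csum a n + a n)%C end.

Lemma csum_ext a b n : (forall k, (k < n)%nat -> a k = b k) -> csum a n = csum b n.
Proof. induction n; simpl; intros H; auto. rewrite IHn, H; auto. Qed.

Lemma csum_plus a b n : csum (fun k => a k + b k)%C n = (csum a n + csum b n)%C.
Proof. induction n; simpl; [ring|]. rewrite IHn. ring. Qed.

Lemma csum_scal c a n : csum (fun k => c * a k)%C n = (c * csum a n)%C.
Proof. induction n; simpl; [ring|]. rewrite IHn. ring. Qed.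

Lemma csum_shift a n : csum a (S n) = (a O + csum (fun k => a (S k)) n)%C.
Proof. induction n; [simpl; ring|]. change (csum a (S (S n))) with (csum a (S n) + a (S n))%C.
  rewrite IHn. simpl. ring. Qed.

Lemma Re_csum a n : Re (csum a (S n)) = sum_n (fun k => Re (a k)) n.
Proof.
  induction n.
  - rewrite sum_O. apply Rplus_0_l.
  - rewrite sum_Sn, <- IHn. reflexivity.
Qed.

Lemma Im_csum a n : Im (csum a (S n)) = sum_n (fun k => Im (a k)) n.
Proof.
  induction n.
  - rewrite sum_O. apply Rplus_0_l.
  - rewrite sum_Sn, <- IHn. reflexivity.
Qed.

Lemma Cmod_csum a n : Cmod (csum a (S n)) <= sum_n (fun k => Cmod (a k)) n.
Proof.
  induction n.
  - rewrite sum_O. simpl. rewrite Cplus_0_l. lra.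
  - rewrite sum_Sn. eapply Rle_trans; [apply (Cmod_triangle (csum a (S n)))|].
    apply Rplus_le_compat_r; auto.
Qed.

Lemma is_Clim_S u l : is_Clim (fun n => u (S n)) l -> is_Clim u l.
Proof.
  intros H eps He. destruct (H eps He) as [N HN]. exists (S N). intros [|n] Hn; [lia|].
  apply HN. lia.
Qed.

Lemma CSeries_unique a l : is_Clim (csum a) l -> CSeries a = l.
Proof.
  intros H. apply (is_Clim_subseq _ _ S) in H; [|auto].
  apply is_Clim_components in H. destruct H as [H1 H2]. unfold CSeries.
  rewrite (surjective_pairing l). f_equal; apply is_series_unique.
  - exact (is_lim_seq_ext _ _ _ (Re_csum a) H1).
  - exact (is_lim_seq_ext _ _ _ (Im_csum a) H2).
Qed.

Definition abs_cv (a : nat -> C) : Prop := ex_series (fun n => Cmod (a n)).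

Lemma abs_cv_le a (b : nat -> R) : (forall n, Cmod (a n) <= b n) -> ex_series b -> abs_cv a.
Proof.
  intros H Hb. apply (ex_series_le (V := R_CompleteNormedModule) (fun n => Cmod (a n)) b); auto. intros n.
  change (Rabs (Cmod (a n)) <= b n). rewrite Rabs_pos_eq; auto using Cmod_ge_0.
Qed.

Lemma abs_cv_Re a : abs_cv a -> ex_series (fun n => Rabs (Re (a n))).
Proof.
  intros H. refine (ex_series_le (V := R_CompleteNormedModule) _ _ _ H). intros n.
  change (Rabs (Rabs (Re (a n))) <= Cmod (a n)). rewrite Rabs_Rabsolu. apply re_le_Cmod.
Qed.

Lemma abs_cv_Im a : abs_cv a -> ex_series (fun n => Rabs (Im (a n))).
Proof.
  intros H. refine (ex_series_le (V := R_CompleteNormedModule) _ _ _ H). intros n.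
  change (Rabs (Rabs (Im (a n))) <= Cmod (a n)). rewrite Rabs_Rabsolu. apply im_le_Cmod.
Qed.

Lemma CSeries_lim a : abs_cv a -> is_Clim (csum a) (CSeries a).
Proof.
  intros H. apply is_Clim_S, is_Clim_components.
  pose proof (Series_correct _ (ex_series_Rabs _ (abs_cv_Re a H))) as H1.
  pose proof (Series_correct _ (ex_series_Rabs _ (abs_cv_Im a H))) as H2.
  split.
  - exact (is_lim_seq_ext _ _ (Finite _) (fun n => eq_sym (Re_csum a n)) H1).
  - exact (is_lim_seq_ext _ _ (Finite _) (fun n => eq_sym (Im_csum a n)) H2).
Qed.

Lemma CSeries_ext a b : (forall n, a n = b n) -> CSeries a = CSeries b.
Proof. intros H. unfold CSeries. f_equal; apply Series_ext; intros; now rewrite H. Qed.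

Lemma abs_cv_ext a b : (forall n, a n = b n) -> abs_cv a -> abs_cv b.
Proof. intros H. apply ex_series_ext. intros; now rewrite H. Qed.

Lemma abs_cv_plus a b : abs_cv a -> abs_cv b -> abs_cv (fun n => a n + b n)%C.
Proof.
  intros Ha Hb. apply abs_cv_le with (fun n => Cmod (a n) + Cmod (b n)).
  - intros; apply Cmod_triangle.
  - now apply (ex_series_plus (V := R_NormedModule)).
Qed.

Lemma abs_cv_scal c a : abs_cv a -> abs_cv (fun n => c * a n)%C.
Proof.
  intros Ha. apply abs_cv_le with (fun n => Cmod c * Cmod (a n)).
  - intros; rewrite Cmod_mult; lra.
  - now apply (ex_series_scal_l (V := R_NormedModule) (Cmod c)).
Qed.

Lemma CSeries_plus a b : abs_cv a -> abs_cv b ->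
  CSeries (fun n => a n + b n)%C = (CSeries a + CSeries b)%C.
Proof.
  intros Ha Hb. apply CSeries_unique.
  eapply is_Clim_ext; [intros n; symmetry; apply csum_plus|].
  apply is_Clim_plus; now apply CSeries_lim.
Qed.

Lemma CSeries_scal c a : abs_cv a -> CSeries (fun n => c * a n)%C = (c * CSeries a)%C.
Proof.
  intros Ha. apply CSeries_unique.
  eapply is_Clim_ext; [intros n; symmetry; apply csum_scal|].
  apply is_Clim_scal; now apply CSeries_lim.
Qed.

Lemma CSeries_bound a : abs_cv a -> Cmod (CSeries a) <= Series (fun n => Cmod (a n)).
Proof.
  intros Ha.
  apply is_Clim_bound with (fun n => csum a (S n)).
  - apply (is_Clim_subseq (csum a) _ S); auto. now apply CSeries_lim.
  - intros n. eapply Rle_trans; [apply Cmod_csum|].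
    apply (is_lim_seq_incr_compare (fun n => sum_n (fun k => Cmod (a k)) n)).
    + now apply Series_correct.
    + intros k. rewrite sum_Sn. unfold plus; simpl. pose proof (Cmod_ge_0 (a (S k))). lra.
Qed.

Lemma CSeries_bound_le a (b : nat -> R) : (forall n, Cmod (a n) <= b n) -> ex_series b ->
  Cmod (CSeries a) <= Series b.
Proof.
  intros H Hb. eapply Rle_trans; [apply CSeries_bound; eapply abs_cv_le; eassumption|].
  apply Series_le; auto. intros; split; auto using Cmod_ge_0.
Qed.

Lemma abs_cv_S a : abs_cv a <-> abs_cv (fun n => a (S n)).
Proof. apply (ex_series_incr_1 (fun n => Cmod (a n))). Qed.

Lemma CSeries_S a : abs_cv a -> CSeries a = (a O + CSeries (fun n => a (S n)))%C.
Proof.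
  intros Ha. apply CSeries_unique, is_Clim_S.
  eapply is_Clim_ext; [intros n; symmetry; apply csum_shift|].
  apply is_Clim_plus; auto using is_Clim_const.
  apply CSeries_lim. now apply abs_cv_S in Ha.
Qed.

(** The Cauchy product, from the real one applied to real and imaginary parts. *)
Lemma CSeries_mult a b : abs_cv a -> abs_cv b ->
  is_Clim (csum (fun n => csum (fun k => a k * b (n - k)%nat)%C (S n)))
    (CSeries a * CSeries b).
Proof.
  intros Ha Hb. apply is_Clim_S, is_Clim_components.
  pose proof (abs_cv_Re a Ha) as A1. pose proof (abs_cv_Im a Ha) as A2.
  pose proof (abs_cv_Re b Hb) as B1. pose proof (abs_cv_Im b Hb) as B2.
  assert (K : forall f g : nat -> R, ex_series (fun n => Rabs (f n)) ->
     ex_series (fun n => Rabs (g n)) ->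
     is_series (fun n => sum_f_R0 (fun k => f k * g (n - k)%nat) n) (Series f * Series g)).
  { intros f g Hf Hg. apply is_series_mult; auto; apply Series_correct, ex_series_Rabs; auto. }
  split.
  - refine (is_lim_seq_ext _ _ (Finite _) _ (is_series_minus _ _ _ _ (K _ _ A1 B1) (K _ _ A2 B2))).
    intros n. rewrite Re_csum. apply sum_n_ext. intros m.
    rewrite Re_csum, sum_n_Reals. unfold minus, plus, opp; simpl.
    match goal with |- ?a + - ?b = _ => change (a + - b) with (a - b) end.
    rewrite <- minus_sum. apply sum_eq. reflexivity.
  - refine (is_lim_seq_ext _ _ (Finite _) _ (is_series_plus _ _ _ _ (K _ _ A1 B2) (K _ _ A2 B1))).
    intros n. rewrite Im_csum. apply sum_n_ext. intros m.
    rewrite Im_csum, sum_n_Reals. unfold plus; simpl.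
    rewrite <- plus_sum. apply sum_eq. reflexivity.
Qed.

(** ** Power series *)

(** Compare with the geometric series: its first [n] terms are at least [x ^ n]. *)
Lemma nx_pow_bound x n : 0 <= x < 1 -> INR n * x ^ n <= / (1 - x).
Proof.
  intros Hx.
  assert (H : INR n * x ^ n * (1 - x) <= 1 - x ^ n).
  { induction n as [|n IH]; [simpl; lra|].
    rewrite S_INR. simpl. pose proof (pow_le x n (proj1 Hx)) as P.
    pose proof (pos_INR n). assert (0 <= INR n * x ^ n) by now apply Rmult_le_pos.
    assert (x * (INR n * x ^ n * (1 - x)) <= x * (1 - x ^ n)) by (apply Rmult_le_compat_l; lra).
    assert (0 <= (1 - x) * (1 - x ^ n * x)).
    { apply Rmult_le_pos; [lra|]. assert (x ^ n <= 1 ^ n) by (apply pow_incr; lra).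
      rewrite pow1 in *. nra. }
    nra. }
  apply Rmult_le_reg_r with (1 - x); [lra|]. rewrite Rinv_l by lra.
  pose proof (pow_le x n (proj1 Hx)). lra.
Qed.

Lemma ex_series_n2_geom x : 0 <= x < 1 -> ex_series (fun n => INR n * INR n * x ^ n).
Proof.
  intros Hx.
  (* [t] is a cheap substitute for the cube root of [x] *)
  set (t := 1 - (1 - x) / 3).
  assert (Ht : 0 <= t < 1) by (unfold t; lra).
  assert (Hxt : x <= t ^ 3).
  { replace (t ^ 3) with (x + (1 - x) * (1 - x) * (9 - (1 - x)) / 27) by (unfold t; field).
    assert (0 <= (1 - x) * (1 - x) * (9 - (1 - x)))
      by (repeat apply Rmult_le_pos; lra). lra. }
  apply (ex_series_le (V := R_CompleteNormedModule) _
          (fun n => (/ (1 - t) * / (1 - t)) * t ^ n)).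
  - intros n. change (Rabs (INR n * INR n * x ^ n) <= / (1 - t) * / (1 - t) * t ^ n).
    pose proof (pos_INR n). pose proof (pow_le x n (proj1 Hx)). pose proof (pow_le t n (proj1 Ht)).
    pose proof (nx_pow_bound t n Ht).
    assert (x ^ n <= t ^ n * t ^ n * t ^ n).
    { replace (t ^ n * t ^ n * t ^ n) with ((t ^ 3) ^ n).
      - apply pow_incr; lra.
      - rewrite <- pow_mult, Nat.mul_comm. replace (n * 3)%nat with (n + n + n)%nat by lia.
        now rewrite !pow_add. }
    rewrite Rabs_pos_eq by (apply Rmult_le_pos; [apply Rmult_le_pos|]; auto).
    apply Rle_trans with (INR n * INR n * (t ^ n * t ^ n * t ^ n)).
    { apply Rmult_le_compat_l; auto. apply Rmult_le_pos; auto. }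
    replace (INR n * INR n * (t ^ n * t ^ n * t ^ n))
      with ((INR n * t ^ n) * (INR n * t ^ n) * t ^ n) by ring.
    apply Rmult_le_compat_r; auto.
    assert (0 <= INR n * t ^ n) by now apply Rmult_le_pos.
    apply Rmult_le_compat; auto.
  - apply (ex_series_scal_l (V := R_NormedModule)), ex_series_geom. rewrite Rabs_pos_eq; lra.
Qed.

Lemma Series_ge_0 (a : nat -> R) : (forall n, 0 <= a n) -> ex_series a -> 0 <= Series a.
Proof.
  intros H Ha. replace 0 with (Series (fun _ => 0 * 0)).
  - apply Series_le; auto. intros n. split; [lra|]. rewrite Rmult_0_l. auto.
  - rewrite (Series_scal_l 0 (fun _ => 0)). ring.
Qed.

(** Coefficients of a power series of radius of convergence at least [r]. *)
Definition geom_bounded (b : nat -> C) (r : R) : Prop :=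
  exists M, forall n, Cmod (b n) * r ^ n <= M.

Definition PS (b : nat -> C) (z : C) : C := CSeries (fun n => b n * z ^ n)%C.

(** The coefficients of the derived power series. *)
Definition PS_d (b : nat -> C) (n : nat) : C := (INR (S n) * b (S n))%C.

Lemma geom_bounded_pos b r : 0 < r -> geom_bounded b r ->
  exists M, 0 < M /\ forall n, Cmod (b n) <= M * (/ r) ^ n.
Proof.
  intros Hr [M HM]. exists (Rabs M + 1). split; [pose proof (Rabs_pos M); lra|]. intros n.
  pose proof (pow_lt r n Hr) as P.
  apply Rmult_le_reg_r with (r ^ n); auto.
  rewrite Rmult_assoc, <- Rpow_mult_distr, Rinv_l, pow1, Rmult_1_r by lra.
  pose proof (Rle_abs M). specialize (HM n). lra.
Qed.

Lemma pow_term_bound b r M : 0 < r -> (forall n, Cmod (b n) <= M * (/ r) ^ n) ->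
  forall n x, 0 <= x -> Cmod (b n) * x ^ n <= M * (x / r) ^ n.
Proof.
  intros Hr H n x Hx. unfold Rdiv. rewrite Rpow_mult_distr, (Rmult_comm (x ^ n)).
  rewrite <- Rmult_assoc. apply Rmult_le_compat_r; auto using pow_le.
Qed.

Lemma PS_abs_cv b r z : 0 < r -> geom_bounded b r -> Cmod z < r ->
  abs_cv (fun n => b n * z ^ n)%C.
Proof.
  intros Hr Hb Hz. destruct (geom_bounded_pos b r Hr Hb) as [M [HM H]].
  pose proof (Cmod_ge_0 z).
  apply abs_cv_le with (fun n => M * (Cmod z / r) ^ n).
  - intros n. rewrite Cmod_mult, Cmod_pow. now apply pow_term_bound.
  - apply (ex_series_scal_l (V := R_NormedModule)), ex_series_geom.
    assert (0 <= Cmod z / r < 1).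
    { split; [apply Rdiv_le_0_compat; lra|]. apply Rmult_lt_reg_r with r; auto.
      unfold Rdiv. rewrite Rmult_assoc, Rinv_l by lra. lra. }
    rewrite Rabs_pos_eq; lra.
Qed.

Lemma geom_bounded_d b r s : 0 < s < r -> geom_bounded b r -> geom_bounded (PS_d b) s.
Proof.
  intros Hs Hb. destruct (geom_bounded_pos b r ltac:(lra) Hb) as [M [HM H]].
  exists (M / s * / (1 - s / r)). intros n. unfold PS_d. rewrite Cmod_mult, Cmod_R.
  rewrite (Rabs_pos_eq _ (pos_INR _)).
  assert (Hx : 0 <= s / r < 1).
  { split; [apply Rdiv_le_0_compat; lra|]. apply Rmult_lt_reg_r with r; [lra|].
    unfold Rdiv. rewrite Rmult_assoc, Rinv_l by lra. lra. }
  pose proof (pow_term_bound b r M ltac:(lra) H (S n) s ltac:(lra)) as T.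
  pose proof (nx_pow_bound (s / r) (S n) Hx) as B. pose proof (pos_INR (S n)) as P.
  apply Rmult_le_reg_r with s; [lra|].
  replace (INR (S n) * Cmod (b (S n)) * s ^ n * s)
    with (INR (S n) * (Cmod (b (S n)) * s ^ S n)) by (simpl; ring).
  apply Rle_trans with (INR (S n) * (M * (s / r) ^ S n)); [now apply Rmult_le_compat_l|].
  apply Rle_trans with (M * (INR (S n) * (s / r) ^ S n)); [right; ring|].
  replace (M / s * / (1 - s / r) * s) with (M * / (1 - s / r)).
  - apply Rmult_le_compat_l; lra.
  - unfold Rdiv at 2. rewrite (Rmult_assoc M (/ s)), (Rmult_comm (/ s)).
    rewrite <- !Rmult_assoc. rewrite Rmult_assoc, Rinv_l; lra.
Qed.

Lemma geom_bounded_S b r : 0 < r -> geom_bounded b r -> geom_bounded (fun n => b (S n)) r.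
Proof.
  intros Hr [M HM]. exists (M / r). intros n. specialize (HM (S n)).
  apply Rmult_le_reg_r with r; auto. unfold Rdiv. rewrite (Rmult_assoc M), Rinv_l by lra.
  simpl in HM. lra.
Qed.

Lemma PS_S b r z : 0 < r -> geom_bounded b r -> Cmod z < r ->
  PS b z = (b O + z * PS (fun n => b (S n)) z)%C.
Proof.
  intros Hr Hb Hz. unfold PS. rewrite CSeries_S by (eapply PS_abs_cv; eassumption).
  simpl (z ^ 0)%C. rewrite Cmult_1_r. f_equal.
  rewrite <- CSeries_scal.
  - apply CSeries_ext. intros n. simpl. ring.
  - apply PS_abs_cv with r; auto using geom_bounded_S.
Qed.

Lemma PS_0 b : PS b 0 = b O.
Proof.
  apply CSeries_unique, is_Clim_S. apply is_Clim_ext with (fun _ => b O); [|apply is_Clim_const].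
  intros n. rewrite csum_shift. change (RtoC 0 ^ 0)%C with (RtoC 1).
  assert (E : csum (fun k => b (S k) * RtoC 0 ^ S k)%C n = RtoC 0).
  { clear. induction n as [|n IHn]; [reflexivity|].
    change (csum (fun k => b (S k) * RtoC 0 ^ S k)%C n + b (S n) * (RtoC 0 * RtoC 0 ^ n) = 0)%C.
    rewrite IHn. ring. }
  rewrite E. ring.
Qed.

(** The second order remainder of [w ^ n], uniformly on a disc, as needed to differentiate a power
    series term by term. *)
Lemma pow_diff2_bound (w z : C) R n : 0 <= R -> Cmod w <= R -> Cmod z <= R ->
  Cmod (w ^ n - z ^ n - INR n * z ^ pred n * (w - z)) * R ^ 2
    <= INR n * INR n * R ^ n * Cmod (w - z) ^ 2.
Proof.
  intros HR Hw Hz. induction n as [|n IH].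
  - simpl. replace (1 - 1 - 0 * 1 * (w - z))%C with (RtoC 0) by ring.
    rewrite Cmod_0. lra.
  - destruct n as [|n].
    { simpl. replace (w * 1 - z * 1 - 1 * 1 * (w - z))%C with (RtoC 0) by ring.
      rewrite Cmod_0. pose proof (pow2_ge_0 (Cmod (w - z))). simpl in *. nra. }
    set (m := S n) in *.
    replace (w ^ S m - z ^ S m - INR (S m) * z ^ pred (S m) * (w - z))%C
      with (w * (w ^ m - z ^ m - INR m * z ^ pred m * (w - z))
            + INR m * z ^ pred m * ((w - z) * (w - z)))%C.
    2:{ rewrite S_INR, RtoC_plus. unfold m. simpl pred. rewrite !Cpow_S. ring. }
    eapply Rle_trans; [apply Rmult_le_compat_r; [apply pow2_ge_0|apply Cmod_triangle]|].
    rewrite !Cmod_mult, Cmod_pow, Cmod_R, (Rabs_pos_eq _ (pos_INR m)).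
    pose proof (pos_INR m) as P. pose proof (pow_le R m HR) as P2.
    assert (A1 : Cmod w * (Cmod (w ^ m - z ^ m - INR m * z ^ pred m * (w - z)) * R ^ 2)
       <= R * (INR m * INR m * R ^ m * Cmod (w - z) ^ 2)).
    { apply Rmult_le_compat; auto using Cmod_ge_0.
      apply Rmult_le_pos; [apply Cmod_ge_0|apply pow2_ge_0]. }
    assert (A2 : Cmod z ^ pred m * R ^ 2 <= R ^ S m).
    { replace (R ^ S m) with (R ^ pred m * R ^ 2).
      - apply Rmult_le_compat_r; [apply pow2_ge_0|]. apply pow_incr. split; auto using Cmod_ge_0.
      - unfold m. simpl. ring. }
    assert (A3 : INR m * (Cmod z ^ pred m * R ^ 2) * Cmod (w - z) ^ 2
       <= INR m * R ^ S m * Cmod (w - z) ^ 2).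
    { apply Rmult_le_compat_r; [apply pow2_ge_0|]. now apply Rmult_le_compat_l. }
    rewrite S_INR.
    assert (A4 : 0 <= R ^ S m * Cmod (w - z) ^ 2)
      by (apply Rmult_le_pos; [now apply pow_le|apply pow2_ge_0]).
    replace ((INR m + 1) * (INR m + 1) * R ^ S m * Cmod (w - z) ^ 2)
      with (R * (INR m * INR m * R ^ m * Cmod (w - z) ^ 2)
        + INR m * R ^ S m * Cmod (w - z) ^ 2 + (INR m + 1) * (R ^ S m * Cmod (w - z) ^ 2))
      by (simpl; ring).
    assert (0 <= (INR m + 1) * (R ^ S m * Cmod (w - z) ^ 2)) by (apply Rmult_le_pos; lra).
    simpl in *. lra.
Qed.

(** Term by term differentiation: the remainders of the powers are summable against the
    coefficients on a slightly smaller disc. *)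
Lemma PS_derive b r z : 0 < r -> geom_bounded b r -> Cmod z < r ->
  CD (PS b) z (PS (PS_d b) z).
Proof.
  intros Hr Hb Hz. destruct (geom_bounded_pos b r Hr Hb) as [M [HM H]].
  pose proof (Cmod_ge_0 z) as Hz0.
  set (R := (Cmod z + r) / 2). assert (HR : 0 < R /\ Cmod z < R < r) by (unfold R; lra).
  assert (Hx : 0 <= R / r < 1).
  { split; [apply Rdiv_le_0_compat; lra|]. apply Rmult_lt_reg_r with r; [lra|].
    unfold Rdiv. rewrite Rmult_assoc, Rinv_l by lra. lra. }
  set (K := Series (fun n => INR n * INR n * (R / r) ^ n)).
  assert (HK : 0 <= K).
  { apply Series_ge_0; [|now apply ex_series_n2_geom].
    intros n. pose proof (pos_INR n). pose proof (pow_le (R / r) n (proj1 Hx)).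
    repeat apply Rmult_le_pos; auto. }
  assert (B : forall w, Cmod w <= R ->
     Cmod (PS b w - PS b z - PS (PS_d b) z * (w - z)) <= (M * K / R ^ 2) * Cmod (w - z) ^ 2).
  { intros w Hw.
    assert (Ez : abs_cv (fun n => INR n * b n * z ^ pred n)%C).
    { apply abs_cv_S. apply (abs_cv_ext (fun n => PS_d b n * z ^ n)%C).
      - intros n. unfold PS_d. reflexivity.
      - apply PS_abs_cv with R; [lra| |lra]. apply geom_bounded_d with r; auto; lra. }
    assert (E1 : PS (PS_d b) z = CSeries (fun n => INR n * b n * z ^ pred n)%C).
    { rewrite CSeries_S by auto. simpl INR.
      replace (0 * b O * z ^ pred 0)%C with (RtoC 0) by (simpl; ring). rewrite Cplus_0_l.
      apply CSeries_ext. intros n. reflexivity. }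
    assert (A1 : abs_cv (fun n => b n * w ^ n)%C) by (apply PS_abs_cv with r; auto; lra).
    assert (A2 : abs_cv (fun n => b n * z ^ n)%C) by (apply PS_abs_cv with r; auto; lra).
    assert (E2 : (PS b w - PS b z - PS (PS_d b) z * (w - z))%C
      = CSeries (fun n => b n * (w ^ n - z ^ n - INR n * z ^ pred n * (w - z)))%C).
    { rewrite E1. unfold PS.
      transitivity (CSeries (fun n => (b n * w ^ n + - (1) * (b n * z ^ n))
           + (- (w - z)) * (INR n * b n * z ^ pred n))%C).
      - rewrite CSeries_plus, CSeries_plus, !CSeries_scal; auto using abs_cv_scal, abs_cv_plus.
        ring.
      - apply CSeries_ext. intros n. ring. }
    rewrite E2.
    replace (M * K / R ^ 2 * Cmod (w - z) ^ 2)
      with (Series (fun n => (M / R ^ 2 * Cmod (w - z) ^ 2) * (INR n * INR n * (R / r) ^ n))).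
    - apply CSeries_bound_le.
      + intros n. rewrite Cmod_mult.
        pose proof (pow_diff2_bound w z R n ltac:(lra) Hw ltac:(lra)) as P.
        pose proof (pow_lt R 2 ltac:(lra)) as R2.
        apply Rmult_le_reg_r with (R ^ 2); auto.
        replace (M / R ^ 2 * Cmod (w - z) ^ 2 * (INR n * INR n * (R / r) ^ n) * R ^ 2)
          with (M * (R / r) ^ n * (INR n * INR n * Cmod (w - z) ^ 2)) by (field; lra).
        rewrite Rmult_assoc.
        eapply Rle_trans; [apply Rmult_le_compat_l; [apply Cmod_ge_0|apply P]|].
        replace (Cmod (b n) * (INR n * INR n * R ^ n * Cmod (w - z) ^ 2))
          with (Cmod (b n) * R ^ n * (INR n * INR n * Cmod (w - z) ^ 2)) by ring.
        apply Rmult_le_compat_r.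
        * pose proof (pos_INR n). repeat apply Rmult_le_pos; auto using Cmod_ge_0; lra.
        * apply pow_term_bound; auto; lra.
      + apply (ex_series_scal_l (V := R_NormedModule)). now apply ex_series_n2_geom.
    - rewrite Series_scal_l. fold K. field. lra. }
  apply is_derive_C_iff. intros eps He.
  set (Q := M * K / R ^ 2) in *.
  assert (HQ : 0 <= Q).
  { unfold Q. apply Rdiv_le_0_compat; [apply Rmult_le_pos; lra|]. apply pow_lt; lra. }
  exists (Rmin (R - Cmod z) (eps / (1 + Q))). split.
  - apply Rmin_pos; [lra|]. apply Rdiv_lt_0_compat; lra.
  - intros w Hw.
    pose proof (Rmin_l (R - Cmod z) (eps / (1 + Q))). pose proof (Rmin_r (R - Cmod z) (eps / (1 + Q))).
    pose proof (Cmod_rtriangle w z) as T.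
    eapply Rle_trans; [apply B; lra|].
    pose proof (Cmod_ge_0 (w - z)) as P.
    assert (Q1 : Cmod (w - z) * (1 + Q) <= eps).
    { apply Rle_trans with (eps / (1 + Q) * (1 + Q)).
      - apply Rmult_le_compat_r; lra.
      - right. field. lra. }
    replace (Q * Cmod (w - z) ^ 2) with (Q * Cmod (w - z) * Cmod (w - z)) by ring.
    apply Rmult_le_compat_r; auto. nra.
Qed.

Lemma PS_hol b r z : 0 < r -> geom_bounded b r -> Cmod z < r -> hol (PS b) z.
Proof. intros. eexists. now apply PS_derive with r. Qed.

(** * Subdivision of rectangles *)

Lemma nested_intervals (a b : nat -> R) :
  (forall n, a n <= a (S n)) -> (forall n, b (S n) <= b n) -> (forall n, a n <= b n) ->
  exists u, forall n, a n <= u <= b n.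
Proof.
  intros Ha Hb Hab.
  assert (Ha' : forall n k, a n <= a (n + k)%nat).
  { intros n k. induction k; [rewrite Nat.add_0_r; lra|].
    rewrite Nat.add_succ_r. specialize (Ha (n + k)%nat). lra. }
  assert (Hb' : forall n k, b (n + k)%nat <= b n).
  { intros n k. induction k; [rewrite Nat.add_0_r; lra|].
    rewrite Nat.add_succ_r. specialize (Hb (n + k)%nat). lra. }
  assert (H : forall m n, a m <= b n).
  { intros m n. apply Rle_trans with (a (m + n)%nat); auto.
    apply Rle_trans with (b (m + n)%nat); auto. rewrite Nat.add_comm; auto. }
  destruct (completeness (fun x => exists n, x = a n)) as [u [U1 U2]].
  - exists (b O). intros x [n ->]. auto.
  - exists (a O). now exists O.
  - exists u. intros n. split.
    + apply U1. now exists n.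
    + apply U2. intros x [m ->]. auto.
Qed.

Definition rect : Type := ((R * R) * (R * R))%type.

Section RectInduction.
Variable P : R -> R -> R -> R -> Prop.

(** A quadrant where [P] fails, provided that it fails for one of them. *)
Definition bad_quadrant (r : rect) : rect :=
  let '((a, b), (c, d)) := r in
  let m := (a + b) / 2 in let n := (c + d) / 2 in
  if excluded_middle_informative (P a m c n) then
    if excluded_middle_informative (P m b c n) then
      if excluded_middle_informative (P a m n d) then ((m, b), (n, d)) else ((a, m), (n, d))
    else ((m, b), (c, n))
  else ((a, m), (c, n)).

(** The compactness of a rectangle, in the form of an induction principle: a property
    of rectangles that can be glued from the four quadrants and holds for all small
    rectangles, similar to the given one, around each point holds globally. *)
Lemma rect_induction (a b c d : R) : a <= b -> c <= d ->
  (forall a' m b' c' n d', a' <= m <= b' -> c' <= n <= d' ->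
     a <= a' -> b' <= b -> c <= c' -> d' <= d ->
     P a' m c' n -> P m b' c' n -> P a' m n d' -> P m b' n d' -> P a' b' c' d') ->
  (forall u v, a <= u <= b -> c <= v <= d -> exists e, 0 < e /\
     forall a' b' c' d', a <= a' <= u -> u <= b' <= b -> c <= c' <= v -> v <= d' <= d ->
       b' - a' < e -> d' - c' < e -> (b' - a') * (d - c) = (d' - c') * (b - a) ->
       P a' b' c' d') ->
  P a b c d.
Proof.
  intros Hab Hcd Hmerge Hloc.
  apply NNPP. intros Hbad.
  set (s := fun n => Nat.iter n bad_quadrant ((a, b), (c, d))).
  assert (Inv : forall n, let '((a', b'), (c', d')) := s n in
    ~ P a' b' c' d' /\ a <= a' /\ a' <= b' /\ b' <= b /\ c <= c' /\ c' <= d' /\ d' <= d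
    /\ b' - a' = (b - a) * / 2 ^ n /\ d' - c' = (d - c) * / 2 ^ n).
  { induction n as [|n IH].
    - simpl. rewrite Rinv_1. repeat split; auto; lra.
    - unfold s in *. simpl Nat.iter.
      destruct (Nat.iter n bad_quadrant ((a, b), (c, d))) as [[a' b'] [c' d']].
      destruct IH as (N & I1 & I2 & I3 & I4 & I5 & I6 & I7 & I8).
      assert (E1 : (b - a) * / 2 ^ S n = (b' - a') / 2).
      { rewrite I7. simpl. field. apply pow_nonzero; lra. }
      assert (E2 : (d - c) * / 2 ^ S n = (d' - c') / 2).
      { rewrite I8. simpl. field. apply pow_nonzero; lra. }
      rewrite E1, E2.
      unfold bad_quadrant.
      destruct (excluded_middle_informative _) as [Q1|Q1]; [|repeat split; auto; lra].
      destruct (excluded_middle_informative _) as [Q2|Q2]; [|repeat split; auto; lra].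
      destruct (excluded_middle_informative _) as [Q3|Q3]; [|repeat split; auto; lra].
      repeat split; try lra.
      intros Q4. apply N.
      apply (Hmerge a' ((a' + b') / 2) b' c' ((c' + d') / 2) d'); auto; lra. }
  assert (Step : forall n,
    fst (fst (s n)) <= fst (fst (s (S n))) /\ snd (fst (s (S n))) <= snd (fst (s n)) /\
    fst (snd (s n)) <= fst (snd (s (S n))) /\ snd (snd (s (S n))) <= snd (snd (s n))).
  { intros n. specialize (Inv n). unfold s in *. simpl Nat.iter.
    destruct (Nat.iter n bad_quadrant ((a, b), (c, d))) as [[a' b'] [c' d']].
    destruct Inv as (N & I1 & I2 & I3 & I4 & I5 & I6 & _). unfold bad_quadrant.
    repeat destruct (excluded_middle_informative _); simpl; lra. }
  destruct (nested_intervals (fun n => fst (fst (s n))) (fun n => snd (fst (s n)))) as [u Hu].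
  1, 2: intros n; apply Step.
  { intros n. specialize (Inv n). destruct (s n) as [[a' b'] [c' d']]. simpl. tauto. }
  destruct (nested_intervals (fun n => fst (snd (s n))) (fun n => snd (snd (s n)))) as [v Hv].
  1, 2: intros n; apply Step.
  { intros n. specialize (Inv n). destruct (s n) as [[a' b'] [c' d']]. simpl. tauto. }
  destruct (Hloc u v) as [e [He Hsmall]].
  - apply (Hu O).
  - apply (Hv O).
  - assert (Hn : exists n, (b - a + (d - c)) * / 2 ^ n < e).
    { assert (L : is_lim_seq (fun n => (b - a + (d - c)) * (/ 2) ^ n) ((b - a + (d - c)) * 0)).
      { apply (is_lim_seq_scal_l _ _ (Finite 0)), is_lim_seq_geom. rewrite Rabs_pos_eq; lra. }
      rewrite Rmult_0_r in L. apply is_lim_seq_spec in L.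
      destruct (L (mkposreal e He)) as [n HN]. exists n. specialize (HN n (le_n _)).
      simpl in HN. rewrite Rminus_0_r in HN. apply Rabs_lt_between in HN.
      rewrite <- pow_inv. lra. }
    destruct Hn as [n Hn]. specialize (Inv n). specialize (Hu n). specialize (Hv n).
    destruct (s n) as [[a' b'] [c' d']].
    destruct Inv as (N & I1 & I2 & I3 & I4 & I5 & I6 & I7 & I8). simpl in Hu, Hv.
    apply N.
    assert (0 < / 2 ^ n) by (apply Rinv_0_lt_compat, pow_lt; lra).
    assert (0 <= (b - a) * / 2 ^ n) by (apply Rmult_le_pos; lra).
    assert (0 <= (d - c) * / 2 ^ n) by (apply Rmult_le_pos; lra).
    apply Hsmall; try lra. rewrite I7, I8. ring.
Qed.
End RectInduction.

(** * Integrals along segments *)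

Notation CInt g a b := (RInt (V := C_R_CompleteNormedModule) g a b).

(** The integral of [f dz] along the segment from [p + a v] to [p + b v]. *)
Definition seg (f : C -> C) (p v : C) (a b : R) : C :=
  CInt (fun t : R => (f (p + RtoC t * v)%C * v)%C) a b.

Definition hol_seg (f : C -> C) (p v : C) (a b : R) : Prop :=
  forall t, Rmin a b <= t <= Rmax a b -> hol f (p + RtoC t * v)%C.

Lemma hol_line_continuous f p v t : hol f (p + RtoC t * v)%C ->
  continuous (U := C_UniformSpace) (fun t : R => (f (p + RtoC t * v)%C * v)%C) t.
Proof.
  intros H. apply filterlim_locally. intros eps.
  assert (H' : hol (fun w => f w * v)%C (p + RtoC t * v)%C) by auto with hol.
  destruct (hol_cont _ _ H' eps (cond_pos eps)) as [d [Hd Hw]].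
  pose proof (Cmod_ge_0 v) as Hv.
  assert (He : 0 < d / (1 + Cmod v)) by (apply Rdiv_lt_0_compat; lra).
  exists (mkposreal _ He). intros y Hy. apply C_NormedModule_mixin_compat1.
  apply Hw. replace (p + y * v - (p + t * v))%C with (RtoC (y - t) * v)%C
    by (rewrite RtoC_minus; ring).
  rewrite Cmod_mult, Cmod_R.
  change (Rabs (y - t) < d / (1 + Cmod v)) in Hy.
  apply (Rmult_lt_compat_r (1 + Cmod v)) in Hy; [|lra].
  unfold Rdiv in Hy. rewrite Rmult_assoc, Rinv_l, Rmult_1_r in Hy by lra.
  pose proof (Rabs_pos (y - t)). nra.
Qed.

Lemma seg_ex f p v a b : hol_seg f p v a b ->
  ex_RInt (V := C_R_CompleteNormedModule) (fun t : R => (f (p + RtoC t * v)%C * v)%C) a b.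
Proof. intros H. apply ex_RInt_continuous. intros t Ht. apply hol_line_continuous; auto. Qed.

Lemma seg_correct f p v a b : hol_seg f p v a b ->
  is_RInt (V := C_R_NormedModule) (fun t : R => (f (p + RtoC t * v)%C * v)%C) a b (seg f p v a b).
Proof. intros H. apply (RInt_correct (V := C_R_CompleteNormedModule)). now apply seg_ex. Qed.

Lemma seg_unique f p v a b l :
  is_RInt (V := C_R_NormedModule) (fun t : R => (f (p + RtoC t * v)%C * v)%C) a b l ->
  seg f p v a b = l.
Proof. apply (is_RInt_unique (V := C_R_CompleteNormedModule)). Qed.

Lemma seg_Chasles f p v a b c : hol_seg f p v a b -> hol_seg f p v b c ->
  (seg f p v a b + seg f p v b c)%C = seg f p v a c.
Proof.
  intros H1 H2. exact (RInt_Chasles (V := C_R_CompleteNormedModule) _ a b c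
    (seg_ex _ _ _ _ _ H1) (seg_ex _ _ _ _ _ H2)).
Qed.

Lemma hol_seg_swap f p v a b : hol_seg f p v a b -> hol_seg f p v b a.
Proof. unfold hol_seg. now rewrite Rmin_comm, Rmax_comm. Qed.

Lemma seg_swap f p v a b : hol_seg f p v a b -> seg f p v b a = (- seg f p v a b)%C.
Proof.
  intros H. symmetry. exact (opp_RInt_swap (V := C_R_CompleteNormedModule) _ a b (seg_ex _ _ _ _ _ H)).
Qed.

Lemma seg_plus f g p v a b : hol_seg f p v a b -> hol_seg g p v a b ->
  seg (fun z => f z + g z)%C p v a b = (seg f p v a b + seg g p v a b)%C.
Proof.
  intros Hf Hg. apply seg_unique.
  apply (is_RInt_ext (V := C_R_NormedModule)) with
    (fun t => plus (G := C_R_NormedModule) (f (p + RtoC t * v)%C * v)%C (g (p + RtoC t * v)%C * v)%C).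
  - intros t _. change (@eq C (f (p + RtoC t * v)%C * v + g (p + RtoC t * v)%C * v)%C
      ((f (p + RtoC t * v)%C + g (p + RtoC t * v)%C) * v)%C). ring.
  - apply (is_RInt_plus (V := C_R_NormedModule)); now apply seg_correct.
Qed.

Lemma is_RInt_Cscal (c : C) (g : R -> C) a b (l : C) :
  is_RInt (V := C_R_NormedModule) g a b l ->
  is_RInt (V := C_R_NormedModule) (fun t => (c * g t)%C) a b (c * l)%C.
Proof.
  intros H.
  pose proof (is_RInt_fct_extend_fst (U := R_NormedModule) (V := R_NormedModule) g a b l H) as H1.
  pose proof (is_RInt_fct_extend_snd (U := R_NormedModule) (V := R_NormedModule) g a b l H) as H2.
  apply (is_RInt_fct_extend_pair (U := R_NormedModule) (V := R_NormedModule)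
    (fun t => (c * g t)%C) a b (Re (c * l)) (Im (c * l))).
  - refine (is_RInt_ext (V := R_NormedModule) _ _ _ _ _ _
      (is_RInt_minus (V := R_NormedModule) _ _ _ _ _ _
        (is_RInt_scal (V := R_NormedModule) _ _ _ (Re c) _ H1)
        (is_RInt_scal (V := R_NormedModule) _ _ _ (Im c) _ H2))).
    intros t _. reflexivity.
  - refine (is_RInt_ext (V := R_NormedModule) _ _ _ _ _ _
      (is_RInt_plus (V := R_NormedModule) _ _ _ _ _ _
        (is_RInt_scal (V := R_NormedModule) _ _ _ (Re c) _ H2)
        (is_RInt_scal (V := R_NormedModule) _ _ _ (Im c) _ H1))).
    intros t _. reflexivity.
Qed.

Lemma seg_scal c f p v a b : hol_seg f p v a b ->
  seg (fun z => c * f z)%C p v a b = (c * seg f p v a b)%C.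
Proof.
  intros Hf. apply seg_unique.
  apply (is_RInt_ext (V := C_R_NormedModule)) with
    (fun t => (c * (f (p + RtoC t * v)%C * v))%C).
  - intros t _. change (@eq C (c * (f (p + RtoC t * v)%C * v))%C
      (c * f (p + RtoC t * v)%C * v)%C). ring.
  - apply is_RInt_Cscal. now apply seg_correct.
Qed.

Lemma seg_minus f g p v a b : hol_seg f p v a b -> hol_seg g p v a b ->
  seg (fun z => f z - g z)%C p v a b = (seg f p v a b - seg g p v a b)%C.
Proof.
  intros Hf Hg. apply seg_unique.
  apply (is_RInt_ext (V := C_R_NormedModule)) with
    (fun t => minus (G := C_R_NormedModule) (f (p + RtoC t * v)%C * v)%C (g (p + RtoC t * v)%C * v)%C).
  - intros t _. change (@eq C (f (p + RtoC t * v)%C * v - g (p + RtoC t * v)%C * v)%C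
      ((f (p + RtoC t * v)%C - g (p + RtoC t * v)%C) * v)%C). ring.
  - apply (is_RInt_minus (V := C_R_NormedModule)); now apply seg_correct.
Qed.

Lemma seg_ext f g p v a b :
  (forall t, Rmin a b <= t <= Rmax a b -> f (p + RtoC t * v)%C = g (p + RtoC t * v)%C) ->
  seg f p v a b = seg g p v a b.
Proof.
  intros H. apply (RInt_ext (V := C_R_CompleteNormedModule)). intros t Ht. rewrite H; auto; lra.
Qed.

Lemma seg_bound f p v a b M : hol_seg f p v a b ->
  (forall t, Rmin a b <= t <= Rmax a b -> Cmod (f (p + RtoC t * v)%C) <= M) ->
  Cmod (seg f p v a b) <= M * Cmod v * Rabs (b - a).
Proof.
  assert (K : forall a b, a <= b -> hol_seg f p v a b ->
    (forall t, a <= t <= b -> Cmod (f (p + RtoC t * v)%C) <= M) ->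
     Cmod (seg f p v a b) <= M * Cmod v * (b - a)).
  { clear. intros a b Hab H HM. rewrite Rmult_comm, Cmod_norm.
    apply (norm_RInt_le_const (V := C_R_NormedModule)
      (fun t : R => (f (p + RtoC t * v)%C * v)%C) a b (seg f p v a b) (M * Cmod v)); auto.
    - intros t Ht. rewrite <- Cmod_norm, Cmod_mult. apply Rmult_le_compat_r; auto using Cmod_ge_0.
    - now apply seg_correct. }
  intros H HM. destruct (Rle_dec a b) as [Hab|Hab].
  - rewrite Rmin_left, Rmax_right in HM by auto. rewrite Rabs_pos_eq by lra. auto.
  - assert (b <= a) by lra. rewrite Rmin_right, Rmax_left in HM by auto.
    rewrite seg_swap by now apply hol_seg_swap.
    rewrite Cmod_opp, Rabs_minus_sym, Rabs_pos_eq by lra. apply K; auto.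
    now apply hol_seg_swap.
Qed.

Lemma seg_FTC (F f : C -> C) p v a b :
  (forall t, Rmin a b <= t <= Rmax a b -> CD F (p + RtoC t * v)%C (f (p + RtoC t * v)%C)) ->
  hol_seg f p v a b ->
  seg f p v a b = (F (p + RtoC b * v)%C - F (p + RtoC a * v)%C)%C.
Proof.
  intros HF Hf. apply seg_unique.
  set (g := fun t : R => (f (p + RtoC t * v)%C * v)%C).
  assert (Cg : forall t, Rmin a b <= t <= Rmax a b ->
    continuous (fun t => Re (g t)) t /\ continuous (fun t => Im (g t)) t).
  { intros t Ht. pose proof (hol_line_continuous f p v t (Hf t Ht)) as K. fold g in K.
    split.
    - apply (continuous_comp (U := R_UniformSpace) (V := C_UniformSpace) g Re); auto.
      apply (continuous_fst (U := R_UniformSpace) (V := R_UniformSpace)).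
    - apply (continuous_comp (U := R_UniformSpace) (V := C_UniformSpace) g Im); auto.
      apply (continuous_snd (U := R_UniformSpace) (V := R_UniformSpace)). }
  apply (is_RInt_fct_extend_pair (U := R_NormedModule) (V := R_NormedModule)
    g a b (Re (F (p + RtoC b * v)%C - F (p + RtoC a * v)%C)) (Im (F (p + RtoC b * v)%C - F (p + RtoC a * v)%C))).
  - apply (is_RInt_derive (V := R_CompleteNormedModule) (fun t => Re (F (p + RtoC t * v)%C)) (fun t => Re (g t))).
    + intros t Ht. exact (proj1 (derive_line F p v _ t (HF t Ht))).
    + intros t Ht. now apply Cg.
  - apply (is_RInt_derive (V := R_CompleteNormedModule) (fun t => Im (F (p + RtoC t * v)%C)) (fun t => Im (g t))).
    + intros t Ht. exact (proj2 (derive_line F p v _ t (HF t Ht))).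
    + intros t Ht. now apply Cg.
Qed.

(** * Cauchy's theorem for rectangles *)

(** The counterclockwise integral of [f dz] along the boundary of a rectangle. *)
Definition bdry (f : C -> C) (a b c d : R) : C :=
  (seg f (Ci * c) 1 a b + seg f b Ci c d - seg f (Ci * d) 1 a b - seg f a Ci c d)%C.

Definition hol_rect (f : C -> C) (a b c d : R) : Prop :=
  forall x y, a <= x <= b -> c <= y <= d -> hol f (x + Ci * y)%C.

Lemma hol_rect_h f a b c d a' b' y : hol_rect f a b c d ->
  a <= a' <= b -> a <= b' <= b -> c <= y <= d -> hol_seg f (Ci * y) 1 a' b'.
Proof.
  intros H Ha Hb Hy t Ht. replace (Ci * y + t * 1)%C with (t + Ci * y)%C by ring.
  apply H; auto. revert Ht. unfold Rmin, Rmax; destruct Rle_dec; lra.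
Qed.

Lemma hol_rect_v f a b c d c' d' x : hol_rect f a b c d ->
  c <= c' <= d -> c <= d' <= d -> a <= x <= b -> hol_seg f x Ci c' d'.
Proof.
  intros H Ha Hb Hy t Ht. replace (x + t * Ci)%C with (x + Ci * t)%C by ring.
  apply H; auto. revert Ht. unfold Rmin, Rmax; destruct Rle_dec; lra.
Qed.

Lemma bdry_split f a m b c n d : hol_rect f a b c d -> a <= m <= b -> c <= n <= d ->
  bdry f a b c d = (bdry f a m c n + bdry f m b c n + bdry f a m n d + bdry f m b n d)%C.
Proof.
  intros H Hm Hn. unfold bdry.
  assert (Hh : forall y, c <= y <= d ->
    (seg f (Ci * y) 1 a m + seg f (Ci * y) 1 m b = seg f (Ci * y) 1 a b)%C).
  { intros y Hy. apply seg_Chasles; eapply hol_rect_h; try eassumption; lra. }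
  assert (Hv : forall x, a <= x <= b ->
    (seg f x Ci c n + seg f x Ci n d = seg f x Ci c d)%C).
  { intros x Hx. apply seg_Chasles; eapply hol_rect_v; try eassumption; lra. }
  rewrite <- (Hh c), <- (Hh d), <- (Hv a), <- (Hv b) by lra. ring.
Qed.

Lemma bdry_primitive F f a b c d : a <= b -> c <= d -> hol_rect f a b c d ->
  (forall x y, a <= x <= b -> c <= y <= d -> CD F (x + Ci * y)%C (f (x + Ci * y)%C)) ->
  bdry f a b c d = 0.
Proof.
  intros Hab Hcd H HF. unfold bdry.
  assert (Hh : forall y, c <= y <= d -> seg f (Ci * y) 1 a b
     = (F (b + Ci * y)%C - F (a + Ci * y)%C)%C).
  { intros y Hy. replace (b + Ci * y)%C with (Ci * y + b * 1)%C by ring.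
    replace (a + Ci * y)%C with (Ci * y + a * 1)%C by ring.
    apply seg_FTC; [|eapply hol_rect_h; try eassumption; lra].
    intros t Ht. replace (Ci * y + t * 1)%C with (t + Ci * y)%C by ring.
    rewrite Rmin_left, Rmax_right in Ht by lra. apply HF; lra. }
  assert (Hv : forall x, a <= x <= b -> seg f x Ci c d
     = (F (x + Ci * d)%C - F (x + Ci * c)%C)%C).
  { intros x Hx. replace (x + Ci * d)%C with (x + d * Ci)%C by ring.
    replace (x + Ci * c)%C with (x + c * Ci)%C by ring.
    apply seg_FTC; [|eapply hol_rect_v; try eassumption; lra].
    intros t Ht. replace (x + t * Ci)%C with (x + Ci * t)%C by ring.
    rewrite Rmin_left, Rmax_right in Ht by lra. apply HF; lra. }
  rewrite (Hh c), (Hh d), (Hv a), (Hv b) by lra. ring.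
Qed.

Lemma bdry_minus f g a b c d : a <= b -> c <= d -> hol_rect f a b c d -> hol_rect g a b c d ->
  bdry (fun z => f z - g z)%C a b c d = (bdry f a b c d - bdry g a b c d)%C.
Proof.
  intros Hab Hcd Hf Hg. unfold bdry.
  rewrite !seg_minus; [ring|..];
    try (eapply hol_rect_h; try eassumption; lra);
    try (eapply hol_rect_v; try eassumption; lra).
Qed.

Lemma bdry_bound f a b c d M : a <= b -> c <= d -> hol_rect f a b c d ->
  (forall x y, a <= x <= b -> c <= y <= d -> Cmod (f (x + Ci * y)%C) <= M) ->
  Cmod (bdry f a b c d) <= 2 * M * ((b - a) + (d - c)).
Proof.
  intros Hab Hcd H HM. unfold bdry.
  assert (Hh : forall y, c <= y <= d -> Cmod (seg f (Ci * y) 1 a b) <= M * (b - a)).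
  { intros y Hy. replace (M * (b - a)) with (M * Cmod 1 * Rabs (b - a))
      by (rewrite Cmod_1, Rabs_pos_eq; lra).
    apply seg_bound; [eapply hol_rect_h; try eassumption; lra|].
    intros t Ht. replace (Ci * y + t * 1)%C with (t + Ci * y)%C by ring.
    rewrite Rmin_left, Rmax_right in Ht by lra. apply HM; lra. }
  assert (Hv : forall x, a <= x <= b -> Cmod (seg f x Ci c d) <= M * (d - c)).
  { intros x Hx. replace (M * (d - c)) with (M * Cmod Ci * Rabs (d - c))
      by (rewrite Cmod_Ci, Rabs_pos_eq; lra).
    apply seg_bound; [eapply hol_rect_v; try eassumption; lra|].
    intros t Ht. replace (x + t * Ci)%C with (x + Ci * t)%C by ring.
    rewrite Rmin_left, Rmax_right in Ht by lra. apply HM; lra. }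
  assert (T := Cmod_triangle (seg f (Ci * c) 1 a b + seg f b Ci c d - seg f (Ci * d) 1 a b)
      (- seg f a Ci c d)).
  assert (T2 := Cmod_triangle (seg f (Ci * c) 1 a b + seg f b Ci c d) (- seg f (Ci * d) 1 a b)).
  assert (T3 := Cmod_triangle (seg f (Ci * c) 1 a b) (seg f b Ci c d)).
  rewrite Cmod_opp in T, T2. unfold Cminus in *.
  pose proof (Hh c ltac:(lra)). pose proof (Hh d ltac:(lra)).
  pose proof (Hv a ltac:(lra)). pose proof (Hv b ltac:(lra)). lra.
Qed.

Lemma hol_rect_sub f a b c d a' b' c' d' : a <= a' -> b' <= b -> c <= c' -> d' <= d ->
  hol_rect f a b c d -> hol_rect f a' b' c' d'.
Proof. intros H1 H2 H3 H4 H x y Hx Hy. apply H; lra. Qed.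

Lemma Cmod_rect_le x y u v w h : Rabs (x - u) <= w -> Rabs (y - v) <= h ->
  Cmod ((x + Ci * y) - (u + Ci * v)) <= w + h.
Proof.
  intros H1 H2. eapply Rle_trans; [apply Cmod_le_sum|].
  replace (Re (x + Ci * y - (u + Ci * v))) with (x - u) by (simpl; ring).
  replace (Im (x + Ci * y - (u + Ci * v))) with (y - v) by (simpl; ring). lra.
Qed.

(** Goursat's argument: on a small rectangle [f] is affine up to an error which is small
    compared with the area; affine functions integrate to zero. *)
Lemma Goursat f a b c d : a < b -> c < d -> hol_rect f a b c d -> bdry f a b c d = 0.
Proof.
  intros Hab Hcd H.
  assert (K : forall eps, 0 < eps -> Cmod (bdry f a b c d) <= eps * ((b - a) * (d - c))).
  { intros eps He.
    apply (rect_induction (fun a' b' c' d' =>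
      Cmod (bdry f a' b' c' d') <= eps * ((b' - a') * (d' - c')))); try lra.
    - intros a' m b' c' n d' Hm Hn I1 I2 I3 I4 Q1 Q2 Q3 Q4.
      rewrite (bdry_split f a' m b' c' n d'); auto.
      2:{ eapply hol_rect_sub; [..|eassumption]; lra. }
      eapply Rle_trans; [apply Cmod_triangle|].
      eapply Rle_trans; [apply Rplus_le_compat; [|apply Q4]|].
      { eapply Rle_trans; [apply Cmod_triangle|].
        apply Rplus_le_compat; [|apply Q3].
        eapply Rle_trans; [apply Cmod_triangle|]. apply Rplus_le_compat; [apply Q1|apply Q2]. }
      right. ring.
    - intros u v Hu Hv. destruct (H u v Hu Hv) as [l Hl].
      rewrite is_derive_C_iff in Hl.
      set (W := b - a). set (T := d - c). assert (0 < W) by (unfold W; lra).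
      assert (0 < T) by (unfold T; lra).
      assert (He' : 0 < eps * (W * T) / (2 * (W + T) ^ 2)).
      { apply Rdiv_lt_0_compat; [|apply Rmult_lt_0_compat; [lra|apply pow_lt; lra]].
        repeat apply Rmult_lt_0_compat; lra. }
      set (e := eps * (W * T) / (2 * (W + T) ^ 2)) in *.
      destruct (Hl e He') as [del [Hdel Hw]].
      exists (del / 2). split; [lra|].
      intros a' b' c' d' Ha' Hb' Hc' Hd' S1 S2 Asp. fold W T in Asp.
      set (p := (u + Ci * v)%C) in *.
      set (g := fun z => (f p + l * (z - p))%C).
      assert (Hf' : hol_rect f a' b' c' d') by (eapply hol_rect_sub; [..|eassumption]; lra).
      assert (Hg : hol_rect g a' b' c' d') by (intros x y _ _; unfold g; auto 10 with hol).
      assert (Eg : bdry g a' b' c' d' = 0).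
      { apply (bdry_primitive (fun z => f p * z + l * (z * z / 2 - p * z))%C); auto; try lra.
        intros x y _ _. set (z := (x + Ci * y)%C).
        eapply CD_eq; [|reflexivity|].
        - apply CD_plus; [apply CD_scal, CD_id|]. apply CD_scal, CD_minus; [|apply CD_scal, CD_id].
          apply CD_div; [apply CD_mult; apply CD_id|apply CD_const|].
          intros E; apply RtoC_inj in E; lra.
        - unfold g. field. }
      assert (Eb : bdry f a' b' c' d' = bdry (fun z => f z - g z)%C a' b' c' d').
      { rewrite bdry_minus, Eg by (auto; lra). ring. }
      rewrite Eb. set (w := b' - a') in *. set (h := d' - c') in *.
      eapply Rle_trans; [apply (bdry_bound _ _ _ _ _ (e * (w + h))); try lra|].
      + intros x y Hx Hy. auto using hol_minus.
      + intros x y Hx Hy. unfold g.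
        replace (f (x + Ci * y)%C - (f p + l * (x + Ci * y - p)))%C
          with (f (x + Ci * y)%C - f p - l * (x + Ci * y - p))%C by ring.
        assert (B : Cmod (x + Ci * y - p) <= w + h).
        { apply Cmod_rect_le; apply Rabs_le; unfold w, h; lra. }
        eapply Rle_trans; [apply Hw; lra|]. apply Rmult_le_compat_l; lra.
      + fold w h. assert (0 <= w) by (unfold w; lra).
        assert (Eh : h = w * T / W) by (field_simplify_eq; lra).
        rewrite Eh. unfold e. right. field. split; lra. }
  apply Cmod_eq_0, Rle_antisym; [|apply Cmod_ge_0].
  apply Rnot_lt_le. intros Hp.
  set (A := (b - a) * (d - c)) in *.
  assert (HA : 0 < A) by (unfold A; apply Rmult_lt_0_compat; lra).
  specialize (K (Cmod (bdry f a b c d) / (2 * A)) ltac:(apply Rdiv_lt_0_compat; lra)).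
  replace (Cmod (bdry f a b c d) / (2 * A) * A) with (Cmod (bdry f a b c d) / 2) in K
    by (field; lra).
  lra.
Qed.

Lemma Goursat_swap f a b c d :
  hol_rect f (Rmin a b) (Rmax a b) (Rmin c d) (Rmax c d) -> bdry f a b c d = 0.
Proof.
  intros H.
  pose proof (Rmin_l a b). pose proof (Rmin_r a b). pose proof (Rmax_l a b). pose proof (Rmax_r a b).
  pose proof (Rmin_l c d). pose proof (Rmin_r c d). pose proof (Rmax_l c d). pose proof (Rmax_r c d).
  assert (Hh : forall y, Rmin c d <= y <= Rmax c d -> hol_seg f (Ci * y) 1 a b).
  { intros y Hy. eapply hol_rect_h; try eassumption; lra. }
  assert (Hv : forall x, Rmin a b <= x <= Rmax a b -> hol_seg f x Ci c d).
  { intros x Hx. eapply hol_rect_v; try eassumption; lra. }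
  assert (P0 : forall p v t, seg f p v t t = 0).
  { intros p v t. unfold seg. apply (RInt_point (V := C_R_CompleteNormedModule)). }
  destruct (Rtotal_order a b) as [Hab|[<-|Hab]].
  2:{ unfold bdry. rewrite !P0. ring. }
  all: destruct (Rtotal_order c d) as [Hcd|[<-|Hcd]].
  2, 5: unfold bdry; rewrite !P0; ring.
  - rewrite !Rmin_left, !Rmax_right in H by lra. now apply Goursat.
  - rewrite (Rmin_left a b), (Rmax_right a b), (Rmin_right c d), (Rmax_left c d) in H by lra.
    apply Goursat in H; auto. rewrite <- Copp_0, <- H. unfold bdry.
    rewrite (seg_swap f a Ci c d), (seg_swap f b Ci c d) by (apply Hv; lra). ring.
  - rewrite (Rmin_right a b), (Rmax_left a b), (Rmin_left c d), (Rmax_right c d) in H by lra.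
    apply Goursat in H; auto. rewrite <- Copp_0, <- H. unfold bdry.
    rewrite (seg_swap f (Ci * c)%C 1 a b), (seg_swap f (Ci * d)%C 1 a b) by (apply Hh; lra). ring.
  - rewrite !Rmin_right, !Rmax_left in H by lra.
    apply Goursat in H; auto. rewrite <- H. unfold bdry.
    rewrite (seg_swap f (Ci * c)%C 1 a b), (seg_swap f (Ci * d)%C 1 a b) by (apply Hh; lra).
    rewrite (seg_swap f a Ci c d), (seg_swap f b Ci c d) by (apply Hv; lra). ring.
Qed.

(** ** Primitives *)

Lemma C_eq_xy (z : C) : z = (Re z + Ci * Im z)%C.
Proof. destruct z as [x y]. unfold Cplus, Cmult, RtoC, Ci, Re, Im; simpl. f_equal; ring. Qed.

(** Integrate along the two sides of a rectangle; Cauchy's theorem says that the order of the two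
    sides does not matter, which gives both partial derivatives. *)
Lemma primitive_disc (f : C -> C) z0 r : 0 < r -> (forall z, Cmod (z - z0) < r -> hol f z) ->
  exists F : C -> C, forall z, Cmod (z - z0) < r / 2 -> CD F z (f z).
Proof.
  intros Hr H. set (x0 := Re z0). set (y0 := Im z0).
  set (F := fun z => (seg f (Ci * y0) 1 x0 (Re z) + seg f (Re z) Ci y0 (Im z))%C).
  assert (Sq : forall x y, Rabs (x - x0) < r / 2 -> Rabs (y - y0) < r / 2 ->
    hol f (x + Ci * y)%C).
  { intros x y Hx Hy. apply H. rewrite (C_eq_xy z0). fold x0 y0.
    eapply Rle_lt_trans; [apply Cmod_rect_le; apply Rle_refl|]. lra. }
  assert (Sh : forall a b y, Rabs (a - x0) < r / 2 -> Rabs (b - x0) < r / 2 ->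
     Rabs (y - y0) < r / 2 -> hol_seg f (Ci * y) 1 a b).
  { intros a b y Ha Hb Hy t Ht. replace (Ci * y + t * 1)%C with (t + Ci * y)%C by ring.
    apply Sq; auto. revert Ht. apply Rabs_lt_between in Ha, Hb. intros Ht.
    apply Rabs_lt_between. revert Ht. unfold Rmin, Rmax; destruct Rle_dec; lra. }
  assert (Sv : forall c d x, Rabs (c - y0) < r / 2 -> Rabs (d - y0) < r / 2 ->
     Rabs (x - x0) < r / 2 -> hol_seg f x Ci c d).
  { intros a b y Ha Hb Hy t Ht. replace (y + t * Ci)%C with (y + Ci * t)%C by ring.
    apply Sq; auto. revert Ht. apply Rabs_lt_between in Ha, Hb. intros Ht.
    apply Rabs_lt_between. revert Ht. unfold Rmin, Rmax; destruct Rle_dec; lra. }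
  assert (Z0 : Rabs (x0 - x0) < r / 2) by (rewrite Rminus_diag, Rabs_R0; lra).
  assert (Z1 : Rabs (y0 - y0) < r / 2) by (rewrite Rminus_diag, Rabs_R0; lra).
  exists F. intros z Hz.
  assert (In : forall w, Cmod (w - z0) < r / 2 ->
     Rabs (Re w - x0) < r / 2 /\ Rabs (Im w - y0) < r / 2).
  { intros w Hw. split; (eapply Rle_lt_trans; [|apply Hw]).
    - apply (re_le_Cmod (w - z0)).
    - apply (im_le_Cmod (w - z0)). }
  assert (Diff : forall w, Cmod (w - z0) < r / 2 ->
    (F w - F z = seg f (Ci * Im z) 1 (Re z) (Re w) + seg f (Re w) Ci (Im z) (Im w))%C).
  { intros w Hw. destruct (In w Hw) as [W1 W2]. destruct (In z Hz) as [V1 V2].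
    unfold F.
    rewrite <- (seg_Chasles f (Ci * y0) 1 x0 (Re z) (Re w)) by auto.
    rewrite <- (seg_Chasles f (Re w) Ci y0 (Im z) (Im w)) by auto.
    assert (G : bdry f (Re z) (Re w) y0 (Im z) = 0).
    { apply Goursat_swap. intros x y Hx Hy. apply Sq; apply Rabs_lt_between.
      - apply Rabs_lt_between in W1, V1. revert Hx. unfold Rmin, Rmax; destruct Rle_dec; lra.
      - apply Rabs_lt_between in V2. revert Hy. unfold Rmin, Rmax; destruct Rle_dec; lra. }
    unfold bdry in G.
    transitivity ((seg f (Ci * y0) 1 (Re z) (Re w) + seg f (Re w) Ci y0 (Im z) -
      seg f (Ci * Im z) 1 (Re z) (Re w) - seg f (Re z) Ci y0 (Im z))
      + (seg f (Ci * Im z) 1 (Re z) (Re w) + seg f (Re w) Ci (Im z) (Im w)))%C; [ring|].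
    rewrite G. ring. }
  apply is_derive_C_iff. intros eps He.
  destruct (hol_cont f z (H z ltac:(lra)) (eps / 2) ltac:(lra)) as [d [Hd Hc]].
  exists (Rmin d (r / 2 - Cmod (z - z0))). split; [apply Rmin_pos; lra|].
  intros w Hw.
  pose proof (Rmin_l d (r / 2 - Cmod (z - z0))) as M1.
  pose proof (Rmin_r d (r / 2 - Cmod (z - z0))) as M2.
  assert (Hw0 : Cmod (w - z0) < r / 2).
  { replace (w - z0)%C with ((w - z) + (z - z0))%C by ring.
    eapply Rle_lt_trans; [apply Cmod_triangle|]. lra. }
  rewrite (Diff w Hw0). destruct (In w Hw0) as [W1 W2]. destruct (In z Hz) as [V1 V2].
  set (k := fun _ : C => f z).
  assert (Hk : forall p v a b, hol_seg k p v a b) by (intros p v a b t _; unfold k; auto with hol).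
  assert (Ek : (f z * (w - z) = seg k (Ci * Im z) 1 (Re z) (Re w) + seg k (Re w) Ci (Im z) (Im w))%C).
  { assert (FT : forall p v a b, seg k p v a b = (f z * (p + b * v) - f z * (p + a * v))%C).
    { intros p v a b. apply (seg_FTC (fun z' => f z * z')%C); auto. intros t _. unfold k.
      eapply CD_eq; [apply CD_scal, CD_id|reflexivity|ring]. }
    rewrite !FT. rewrite (C_eq_xy w) at 1. rewrite (C_eq_xy z) at 2. ring. }
  rewrite Ek.
  replace (seg f (Ci * Im z) 1 (Re z) (Re w) + seg f (Re w) Ci (Im z) (Im w) -
     (seg k (Ci * Im z) 1 (Re z) (Re w) + seg k (Re w) Ci (Im z) (Im w)))%C
    with (seg (fun u => f u - k u)%C (Ci * Im z) 1 (Re z) (Re w)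
        + seg (fun u => f u - k u)%C (Re w) Ci (Im z) (Im w))%C
    by (rewrite !seg_minus by auto; ring).
  pose proof (re_le_Cmod (w - z)) as R1. pose proof (im_le_Cmod (w - z)) as R2.
  change (Re (w - z)) with (Re w - Re z) in R1. change (Im (w - z)) with (Im w - Im z) in R2.
  assert (B1 : Cmod (seg (fun u => f u - k u)%C (Ci * Im z) 1 (Re z) (Re w))
    <= eps / 2 * Cmod 1 * Rabs (Re w - Re z)).
  { apply seg_bound.
    - intros t Ht. apply hol_minus; [|unfold k; auto with hol].
      now apply (Sh (Re z) (Re w) (Im z)).
    - intros t Ht. apply Rlt_le, Hc.
      replace (Ci * Im z + t * 1 - z)%C with (RtoC (t - Re z)).
      2:{ rewrite (C_eq_xy z) at 3. rewrite RtoC_minus. ring. }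
      rewrite Cmod_R. eapply Rle_lt_trans with (Rabs (Re w - Re z)); [|lra].
      revert Ht. unfold Rmin, Rmax, Rabs. repeat destruct Rle_dec; repeat destruct Rcase_abs; lra. }
  assert (B2 : Cmod (seg (fun u => f u - k u)%C (Re w) Ci (Im z) (Im w))
    <= eps / 2 * Cmod Ci * Rabs (Im w - Im z)).
  { apply seg_bound.
    - intros t Ht. apply hol_minus; [|unfold k; auto with hol].
      now apply (Sv (Im z) (Im w) (Re w)).
    - intros t Ht. apply Rlt_le, Hc. eapply Rle_lt_trans with (Cmod (w - z)); [|lra].
      unfold Cmod. apply sqrt_le_1_alt.
      replace (fst (Re w + t * Ci - z)%C) with (Re w - Re z) by (unfold Re; simpl; ring).
      replace (snd (Re w + t * Ci - z)%C) with (t - Im z) by (unfold Im; simpl; ring).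
      change (fst (w - z)%C) with (Re w - Re z). change (snd (w - z)%C) with (Im w - Im z).
      apply Rplus_le_compat_l. rewrite <- !(pow2_abs (_ - Im z)). apply pow_incr.
      split; [apply Rabs_pos|].
      revert Ht. unfold Rmin, Rmax, Rabs. repeat destruct Rle_dec; repeat destruct Rcase_abs; lra. }
  rewrite Cmod_1 in B1. rewrite Cmod_Ci in B2.
  eapply Rle_trans; [apply Cmod_triangle|].
  assert (eps / 2 * Rabs (Re w - Re z) <= eps / 2 * Cmod (w - z)) by (apply Rmult_le_compat_l; lra).
  assert (eps / 2 * Rabs (Im w - Im z) <= eps / 2 * Cmod (w - z)) by (apply Rmult_le_compat_l; lra).
  lra.
Qed.

(** * Power series expansion of holomorphic functions *)

(** The divided difference of [F] at [z], [f] being the derivative of [F]. *)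
Definition divdiff (F f : C -> C) (z w : C) : C :=
  if Ceq_dec w z then f z else ((F w - F z) / (w - z))%C.

Lemma divdiff_ne F f z w : w <> z -> divdiff F f z w = ((F w - F z) / (w - z))%C.
Proof. intros H. unfold divdiff. destruct (Ceq_dec w z); tauto. Qed.

Lemma Cmod_neq w z : w <> z -> 0 < Cmod (w - z).
Proof. intros N. apply Cmod_gt_0. now apply Cminus_eq_contra. Qed.

Lemma C_INR_neq0 n : (0 < n)%nat -> RtoC (INR n) <> RtoC 0.
Proof. intros H E. apply RtoC_inj in E. apply lt_0_INR in H. lra. Qed.

(** If [F] is twice differentiable, its Taylor expansion of order two shows that the
    divided difference is differentiable at the exceptional point too. *)
Lemma divdiff_hol F f z r : 0 < r ->
  (forall w, Cmod (w - z) < r -> CD F w (f w)) -> hol f z ->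
  forall w, hol F w -> hol (divdiff F f z) w.
Proof.
  intros Hr HF [f' Hf'] w Hw.
  destruct (Ceq_dec w z) as [->|N].
  - exists (f' / 2)%C. apply is_derive_C_iff. intros eps He.
    rewrite is_derive_C_iff in Hf'. destruct (Hf' (eps / 2) ltac:(lra)) as [d [Hd Hw']].
    exists (Rmin d r). split; [apply Rmin_pos; lra|]. intros w Hwz.
    pose proof (Rmin_l d r). pose proof (Rmin_r d r).
    destruct (Ceq_dec w z) as [->|N].
    { replace (divdiff F f z z - divdiff F f z z - f' / 2 * (z - z))%C with (RtoC 0) by ring.
      rewrite Cmod_0. apply Rmult_le_pos; [lra|apply Cmod_ge_0]. }
    pose proof (Cmod_neq w z N) as Hp.
    set (E := fun u => (F u - f z * u - f' * ((u - z) * (u - z) / 2))%C).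
    assert (two : RtoC 2 <> RtoC 0) by (intros X; apply RtoC_inj in X; lra).
    assert (B : Cmod (E w - E z) <= 2 * (eps / 2 * Cmod (w - z)) * Cmod (w - z)).
    { assert (Seg : forall t, 0 <= t <= 1 -> Cmod (z + t * (w - z) - z) <= Cmod (w - z)).
      { intros t Ht. replace (z + t * (w - z) - z)%C with (RtoC t * (w - z))%C by ring.
        rewrite Cmod_mult, Cmod_R, Rabs_pos_eq by lra. nra. }
      apply (derive_bound E (fun u => f u - f z - f' * (u - z))%C).
      - intros t Ht. specialize (Seg t Ht). set (u := (z + t * (w - z))%C) in *.
        eapply CD_eq; [|reflexivity|].
        + apply CD_minus; [apply CD_minus; [apply HF; lra|apply CD_scal, CD_id]|].
          apply CD_scal. apply CD_div; [|apply CD_const|exact two].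
          apply CD_mult; (apply CD_minus; [apply CD_id|apply CD_const]).
        + cbv beta. field. auto.
      - intros t Ht. specialize (Seg t Ht).
        eapply Rle_trans; [apply Hw'; lra|]. apply Rmult_le_compat_l; lra. }
    unfold E in B. rewrite (divdiff_ne F f z w N).
    assert (Ez : divdiff F f z z = f z) by (unfold divdiff; destruct (Ceq_dec z z); tauto).
    rewrite Ez. apply Rmult_le_reg_r with (Cmod (w - z)); auto.
    rewrite <- Cmod_mult.
    replace (((F w - F z) / (w - z) - f z - f' / 2 * (w - z)) * (w - z))%C
      with (F w - f z * w - f' * ((w - z) * (w - z) / 2)
        - (F z - f z * z - f' * ((z - z) * (z - z) / 2)))%C.
    + lra.
    + field. now apply Cminus_eq_contra.
  - apply hol_ext_loc with (fun u => (F u - F z) / (u - z))%C (Cmod (w - z)).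
    + now apply Cmod_neq.
    + intros u Hu. symmetry. apply divdiff_ne. intros ->.
      replace (z - w)%C with (- (w - z))%C in Hu by ring. rewrite Cmod_opp in Hu. lra.
    + apply hol_div; auto with hol. now apply Cminus_eq_contra.
Qed.

Lemma Cexp_2PI : Cexp (RtoC (2 * PI) * Ci) = RtoC 1.
Proof.
  unfold Cexp, Re, Im, Cmult, RtoC, Ci; simpl.
  replace (2 * PI * 0 - 0 * 1) with 0 by ring. replace (2 * PI * 1 + 0 * 0) with (2 * PI) by ring.
  rewrite exp_0, cos_2PI, sin_2PI. f_equal; ring.
Qed.

Section Cauchy.
Variables (F f : C -> C) (r0 r : R).
Hypothesis (Hr : 0 < r < r0).
Hypothesis HF : forall w, Cmod w < r0 -> CD F w (f w).
Hypothesis Hf : forall w, Cmod w < r0 -> hol f w.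

Let s := ln r.

Lemma circle_point t : Cmod (Cexp (s + RtoC t * Ci)) = r.
Proof.
  rewrite Cmod_Cexp. replace (Re (s + RtoC t * Ci)) with s by (simpl; ring).
  apply exp_ln; lra.
Qed.

(** The integral over the circle of radius [r], in the coordinate [w = log z], so that [H] is a
    function of [log z] and [dz / z] becomes [dw]. *)
Definition circ (H : C -> C) : C := seg H s Ci 0 (2 * PI).

Lemma Hpi : 0 < 2 * PI. Proof. pose proof PI_RGT_0; lra. Qed.

Lemma hol_exp_disc G w : (forall z, Cmod z < r0 -> hol G z) -> Re w <= s ->
  hol (fun w => G (Cexp w)) w.
Proof.
  intros HG Hw. apply hol_comp; [apply HG|eexists; apply CD_Cexp].
  rewrite Cmod_Cexp. apply Rle_lt_trans with (exp s).
  - destruct Hw as [Hw| ->]; [left; now apply exp_increasing|right; auto].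
  - unfold s. rewrite exp_ln; lra.
Qed.

(** Integrals over concentric circles agree: in the coordinate [log z] this is Cauchy's
    theorem for a rectangle with periodic sides; the limit of small circles is zero. *)
Lemma circ_zero G : (forall z, Cmod z < r0 -> hol G z) ->
  circ (fun w => G (Cexp w) * Cexp w)%C = 0.
Proof.
  intros HG. pose proof Hpi as Hpi.
  set (H := fun w => (G (Cexp w) * Cexp w)%C).
  assert (HH : forall w, Re w <= s -> hol H w).
  { intros w Hw. unfold H. apply hol_mult; [now apply (hol_exp_disc G w)|auto with hol]. }
  assert (Hper : forall w, H (w + RtoC (2 * PI) * Ci)%C = H w).
  { intros w. unfold H. rewrite Cexp_add, Cexp_2PI, Cmult_1_r. auto. }
  assert (J : forall s', s' < s -> seg H s' Ci 0 (2 * PI) = circ H).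
  { intros s' Hs'.
    assert (G0 : bdry H s' s 0 (2 * PI) = 0).
    { apply Goursat; auto. intros x y Hx Hy. apply HH. simpl. lra. }
    unfold bdry in G0. unfold circ.
    assert (E : seg H (Ci * RtoC (2 * PI)) 1 s' s = seg H (Ci * RtoC 0) 1 s' s).
    { unfold seg. apply (RInt_ext (V := C_R_CompleteNormedModule)). intros t _.
      replace (Ci * RtoC (2 * PI) + t * 1)%C with ((Ci * RtoC 0 + t * 1) + RtoC (2 * PI) * Ci)%C by ring.
      now rewrite Hper. }
    rewrite E in G0.
    transitivity (seg H s' Ci 0 (2 * PI) + 0)%C; [ring|]. rewrite <- G0. ring. }
  destruct (hol_cont G (RtoC 0) (HG (RtoC 0) ltac:(rewrite Cmod_0; lra)) 1 Rlt_0_1) as [d [Hd Hw]].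
  set (M := Cmod (G (RtoC 0)) + 1).
  assert (HM : 0 < M) by (pose proof (Cmod_ge_0 (G (RtoC 0))); unfold M; lra).
  apply Cmod_eq_0, Rle_antisym; [|apply Cmod_ge_0]. apply Rnot_lt_le. intros Hp.
  set (c := Cmod (circ H)) in *.
  set (e := Rmin (Rmin (d / 2) (r / 2)) (c / (2 * M * (2 * PI)))).
  assert (Hc : 0 < c / (2 * M * (2 * PI))).
  { apply Rdiv_lt_0_compat; auto. apply Rmult_lt_0_compat; lra. }
  assert (He : 0 < e) by (unfold e; repeat apply Rmin_pos; lra).
  assert (E1 : e <= d / 2) by (unfold e; eapply Rle_trans; [apply Rmin_l|apply Rmin_l]).
  assert (E2 : e <= r / 2) by (unfold e; eapply Rle_trans; [apply Rmin_l|apply Rmin_r]).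
  assert (E3 : e <= c / (2 * M * (2 * PI))) by (unfold e; apply Rmin_r).
  assert (Hs' : ln e < s) by (unfold s; apply ln_increasing; lra).
  specialize (J (ln e) Hs').
  assert (B : Cmod (seg H (ln e) Ci 0 (2 * PI)) <= (M * e) * Cmod Ci * Rabs (2 * PI - 0)).
  { apply seg_bound.
    - intros t _. apply HH. simpl. lra.
    - intros t _. unfold H. rewrite Cmod_mult.
      assert (Ee : Cmod (Cexp (ln e + t * Ci)) = e).
      { rewrite Cmod_Cexp. replace (Re (ln e + t * Ci)) with (ln e) by (simpl; ring).
        now apply exp_ln. }
      rewrite Ee. apply Rmult_le_compat_r; [lra|].
      set (z := Cexp (ln e + t * Ci)) in *.
      specialize (Hw z). replace (z - 0)%C with z in Hw by ring.
      pose proof (Cmod_rtriangle (G z) (G (RtoC 0))). unfold M. specialize (Hw ltac:(lra)). lra. }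
  rewrite J, Cmod_Ci, Rminus_0_r, Rabs_pos_eq in B by lra. fold c in B.
  assert (M * e * (2 * PI) <= c / 2).
  { apply Rle_trans with (M * (c / (2 * M * (2 * PI))) * (2 * PI)).
    - apply Rmult_le_compat_r; [lra|]. apply Rmult_le_compat_l; lra.
    - right. field. split; lra. }
  lra.
Qed.

(** Cauchy's kernel [x / (x - z)] for the measure [dx / x], at [x = exp w]. *)
Definition kern (z w : C) : C := (Cexp w / (Cexp w - z))%C.

Lemma kern_ne z w : Cmod z < r -> Re w = s -> (Cexp w - z)%C <> 0.
Proof.
  intros Hz Hw E.
  assert (E' : Cexp w = z) by (apply Ceq_minus; auto).
  rewrite <- E', Cmod_Cexp, Hw in Hz. unfold s in Hz. rewrite exp_ln in Hz; lra.
Qed.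

Lemma holF w : Re w = s -> hol (fun w => F (Cexp w)) w.
Proof.
  intros Hw. apply hol_exp_disc; [|lra]. intros z Hz. eexists. now apply HF.
Qed.

(** The divided difference of [F] at [z] has integral zero. *)
Lemma Cauchy_formula z : Cmod z < r ->
  circ (fun w => F (Cexp w) * kern z w)%C = (F z * circ (kern z))%C.
Proof.
  intros Hz.
  assert (HK : forall w, Re w = s -> hol (kern z) w).
  { intros w Hw. apply hol_div; auto with hol. now apply kern_ne. }
  assert (G0 := circ_zero (divdiff F f z)).
  assert (E : circ (fun w => divdiff F f z (Cexp w) * Cexp w)%C
            = circ (fun w => F (Cexp w) * kern z w - F z * kern z w)%C).
  { apply seg_ext. intros t _. set (w := (s + t * Ci)%C).
    assert (Hw : Re w = s) by (unfold w; simpl; ring).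
    pose proof (kern_ne z w Hz Hw) as N.
    rewrite divdiff_ne by (intros X; apply N; rewrite X; ring).
    unfold kern. field. auto. }
  rewrite E in G0. clear E.
  unfold circ in *. rewrite seg_minus, seg_scal in G0.
  - apply Ceq_minus. apply G0.
    intros w Hw. apply divdiff_hol with (r0 - Cmod z); [lra| | |].
    + intros u Hu. apply HF. replace u with ((u - z) + z)%C by ring.
      eapply Rle_lt_trans; [apply Cmod_triangle|]. lra.
    + apply Hf; lra.
    + eexists. now apply HF.
  - intros t _. apply HK. simpl; ring.
  - intros t _. apply hol_mult; [apply holF|apply HK]; simpl; ring.
  - intros t _. apply hol_mult; [auto with hol|apply HK]. simpl; ring.
Qed.

Definition coefF (n : nat) : C := circ (fun w => F (Cexp w) * (/ Cexp w) ^ n)%C.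

Lemma kern_geom z w N : Cmod z < r -> Re w = s ->
  kern z w = (csum (fun n => z ^ n * (/ Cexp w) ^ n)%C N + (z * / Cexp w) ^ N * kern z w)%C.
Proof.
  intros Hz Hw. pose proof (kern_ne z w Hz Hw) as N1. pose proof (Cexp_neq0 w) as N2.
  induction N as [|N IH]; [simpl; ring|].
  rewrite IH at 1. simpl csum. rewrite Cpow_S, <- Cpow_mult_l.
  replace (kern z w) with (1 + z * / Cexp w * kern z w)%C at 1.
  - ring.
  - unfold kern. field. auto.
Qed.

Lemma F_bounded : exists M, forall t, 0 <= t <= 2 * PI -> Cmod (F (Cexp (s + RtoC t * Ci))) <= M.
Proof.
  pose proof Hpi.
  destruct (continuity_ab_maj (fun t => Cmod (F (Cexp (s + RtoC t * Ci)))) 0 (2 * PI)) as [m Hm].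
  - lra.
  - intros t _. apply continuity_pt_filterlim, filterlim_locally. intros eps.
    assert (Hh : hol (fun w => F (Cexp w)) (s + RtoC t * Ci)%C) by (apply holF; simpl; ring).
    destruct (hol_cont _ _ Hh eps (cond_pos eps)) as [d [Hd Hw]].
    exists (mkposreal d Hd). intros y Hy.
    change (Rabs (Cmod (F (Cexp (s + RtoC y * Ci))) - Cmod (F (Cexp (s + RtoC t * Ci)))) < eps).
    change (Rabs (y - t) < d) in Hy.
    assert (K : Cmod (F (Cexp (s + y * Ci)) - F (Cexp (s + t * Ci))) < eps).
    { apply Hw. replace (s + y * Ci - (s + t * Ci))%C with (RtoC (y - t) * Ci)%C
        by (rewrite RtoC_minus; ring).
      rewrite Cmod_mult, Cmod_Ci, Cmod_R. lra. }
    pose proof (Cmod_rtriangle (F (Cexp (s + RtoC y * Ci))) (F (Cexp (s + RtoC t * Ci)))).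
    pose proof (Cmod_rtriangle (F (Cexp (s + RtoC t * Ci))) (F (Cexp (s + RtoC y * Ci)))) as T2.
    replace (F (Cexp (s + t * Ci)) - F (Cexp (s + y * Ci)))%C
      with (- (F (Cexp (s + y * Ci)) - F (Cexp (s + t * Ci))))%C in T2 by ring.
    rewrite Cmod_opp in T2. apply Rabs_lt_between. lra.
  - exists (Cmod (F (Cexp (s + RtoC m * Ci)))). intros t Ht. apply Hm. auto.
Qed.

Lemma hol_coef n w : Re w = s -> hol (fun w => F (Cexp w) * (/ Cexp w) ^ n)%C w.
Proof.
  intros Hw. apply hol_mult; [now apply holF|]. apply hol_pow, hol_inv; auto using Cexp_neq0 with hol.
Qed.

Lemma seg_csum (G : nat -> C -> C) p v a b N : (forall n, hol_seg (G n) p v a b) ->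
  hol_seg (fun w => csum (fun n => G n w) N) p v a b /\
  seg (fun w => csum (fun n => G n w) N) p v a b = csum (fun n => seg (G n) p v a b) N.
Proof.
  intros H. induction N as [|N [IH1 IH2]]; simpl.
  - split; [intros t _; auto with hol|].
    transitivity (seg (fun _ => RtoC 0 * 0)%C p v a b).
    { apply seg_ext. intros; ring. }
    rewrite seg_scal by (intros t _; auto with hol). ring.
  - split; [intros t Ht; apply hol_plus; [now apply IH1|now apply H]|].
    rewrite seg_plus, IH2; auto.
Qed.

(** Expand the kernel as a geometric series; its remainder tends to zero uniformly on the circle. *)
Lemma Cauchy_series z : Cmod z < r ->
  is_Clim (csum (fun n => coefF n * z ^ n)%C) (circ (fun w => F (Cexp w) * kern z w)%C).
Proof.
  intros Hz. destruct F_bounded as [M HM].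
  assert (HM0 : 0 <= M).
  { pose proof Hpi. eapply Rle_trans; [apply Cmod_ge_0|apply (HM 0); lra]. }
  assert (HK : forall w, Re w = s -> hol (kern z) w).
  { intros w Hw. apply hol_div; auto with hol. now apply kern_ne. }
  set (q := Cmod z / r). pose proof (Cmod_ge_0 z) as Hz0.
  assert (Hq : 0 <= q < 1).
  { unfold q; split; [apply Rdiv_le_0_compat; lra|]. apply Rmult_lt_reg_r with r; [lra|].
    unfold Rdiv. rewrite Rmult_assoc, Rinv_l; lra. }
  set (B := M * (r / (r - Cmod z)) * (2 * PI)).
  assert (E : forall N, (csum (fun n => coefF n * z ^ n) N - circ (fun w => F (Cexp w) * kern z w)
    = - circ (fun w => F (Cexp w) * kern z w * (z * / Cexp w) ^ N))%C).
  { intros N.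
    assert (Hc : forall n, hol_seg (fun w => z ^ n * (F (Cexp w) * (/ Cexp w) ^ n))%C s Ci 0 (2 * PI)).
    { intros n t _. apply hol_mult; [auto with hol|]. apply hol_coef. simpl; ring. }
    destruct (seg_csum _ s Ci 0 (2 * PI) N Hc) as [C1 C2].
    assert (E1 : circ (fun w => F (Cexp w) * kern z w)%C
      = circ (fun w => csum (fun n => z ^ n * (F (Cexp w) * (/ Cexp w) ^ n)) N
           + F (Cexp w) * kern z w * (z * / Cexp w) ^ N)%C).
    { apply seg_ext. intros t _. set (w := (s + t * Ci)%C).
      assert (Hw : Re w = s) by (unfold w; simpl; ring).
      rewrite (kern_geom z w N Hz Hw) at 1.
      rewrite Cmult_plus_distr_l, <- csum_scal. f_equal; [|ring].
      apply csum_ext. intros; ring. }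
    rewrite E1. unfold circ at 1. rewrite seg_plus; auto.
    - rewrite C2. fold (circ (fun w => F (Cexp w) * kern z w * (z * / Cexp w) ^ N)%C).
      rewrite (csum_ext (fun n => seg (fun w => z ^ n * (F (Cexp w) * (/ Cexp w) ^ n))%C
        s Ci 0 (2 * PI)) (fun n => coefF n * z ^ n)%C); [ring|].
      intros n _. rewrite seg_scal; [unfold coefF, circ; ring|].
      intros t _. apply hol_coef. simpl; ring.
    - intros t _. set (w := (s + t * Ci)%C). assert (Hw : Re w = s) by (unfold w; simpl; ring).
      apply hol_mult; [apply hol_mult; [now apply holF|now apply HK]|].
      apply hol_pow, hol_mult; [auto with hol|]. apply hol_inv; auto using Cexp_neq0 with hol. }
  assert (L : is_lim_seq (fun N => B * q ^ N) 0).
  { replace (Finite 0) with (Rbar_mult B 0) by (simpl; f_equal; ring).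
    apply is_lim_seq_scal_l, is_lim_seq_geom. rewrite Rabs_pos_eq; lra. }
  intros eps He. apply is_lim_seq_spec in L. destruct (L (mkposreal eps He)) as [N HN].
  exists N. intros n Hn. rewrite E, Cmod_opp. specialize (HN n Hn). simpl in HN.
  rewrite Rminus_0_r in HN. apply Rabs_lt_between in HN.
  eapply Rle_lt_trans; [|apply HN]. pose proof Hpi as Hpi.
  replace (B * q ^ n) with (M * (r / (r - Cmod z)) * q ^ n * Cmod Ci * Rabs (2 * PI - 0)).
  2:{ rewrite Cmod_Ci, Rminus_0_r, Rabs_pos_eq by lra. unfold B. ring. }
  apply seg_bound.
  - intros t _. set (w := (s + t * Ci)%C). assert (Hw : Re w = s) by (unfold w; simpl; ring).
    apply hol_mult; [apply hol_mult; [now apply holF|now apply HK]|].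
    apply hol_pow, hol_mult; [auto with hol|]. apply hol_inv; auto using Cexp_neq0 with hol.
  - intros t Ht. rewrite Rmin_left, Rmax_right in Ht by lra. specialize (HM t Ht).
    set (w := (s + t * Ci)%C) in *. assert (Hw : Re w = s) by (unfold w; simpl; ring).
    rewrite !Cmod_mult, Cmod_pow, Cmod_mult, Cmod_inv by apply Cexp_neq0.
    assert (Hm : Cmod (Cexp w) = r) by apply circle_point.
    rewrite Hm. fold (Cmod z / r). fold q.
    apply Rmult_le_compat_r; [apply pow_le; lra|].
    apply Rmult_le_compat; auto using Cmod_ge_0.
    unfold kern. rewrite Cmod_div by now apply kern_ne. rewrite Hm.
    apply Rmult_le_compat_l; [lra|]. apply Rinv_le_contravar; [lra|].
    pose proof (Cmod_rtriangle (Cexp w) z). lra.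
Qed.

Lemma coefF_bound : exists M, forall n, Cmod (coefF n) * r ^ n <= M.
Proof.
  destruct F_bounded as [M HM]. exists (M * (2 * PI)). intros n. pose proof Hpi as Hpi.
  assert (Hrn : 0 < r ^ n) by (apply pow_lt; lra).
  apply Rmult_le_reg_r with (/ r ^ n); [now apply Rinv_0_lt_compat|].
  rewrite Rmult_assoc, Rinv_r, Rmult_1_r by lra.
  replace (M * (2 * PI) * / r ^ n) with (M * / r ^ n * Cmod Ci * Rabs (2 * PI - 0)).
  2:{ rewrite Cmod_Ci, Rminus_0_r, Rabs_pos_eq by lra. ring. }
  apply seg_bound.
  - intros t _. apply hol_coef. simpl; ring.
  - intros t Ht. rewrite Rmin_left, Rmax_right in Ht by lra. specialize (HM t Ht).
    rewrite Cmod_mult, Cmod_pow, Cmod_inv, circle_point by apply Cexp_neq0.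
    rewrite pow_inv. apply Rmult_le_compat_r; auto. apply Rlt_le, Rinv_0_lt_compat; auto.
Qed.
End Cauchy.

(** Expand the kernel by [Cauchy_series] for the constant function 1: only the term of index 0 has a
    nonzero integral. *)
Lemma circ_kern r z : 0 < r -> Cmod z < r -> circ r (kern z) = (RtoC (2 * PI) * Ci)%C.
Proof.
  intros Hr Hz.
  assert (K := Cauchy_series (fun _ => RtoC 1) (fun _ => RtoC 0) (r + 1) r ltac:(lra)
    (fun w _ => CD_const 1 w) z Hz).
  transitivity (circ r (fun w => 1 * kern z w)%C).
  { apply seg_ext. intros; ring. }
  eapply is_Clim_unique; [exact K|].
  apply is_Clim_S. eapply is_Clim_ext; [|apply is_Clim_const]. intros n.
  rewrite csum_shift.
  assert (C0 : coefF (fun _ => RtoC 1) r 0 = (RtoC (2 * PI) * Ci)%C).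
  { unfold coefF, circ. rewrite (seg_ext _ (fun _ => RtoC 1)) by (intros; simpl; ring).
    rewrite (seg_FTC (fun w => w)); [ring| |].
    - intros. apply CD_id.
    - intros t _. auto with hol. }
  assert (CS : forall n, coefF (fun _ => RtoC 1) r (S n) = 0).
  { intros m. unfold coefF, circ.
    assert (Hm : RtoC (INR (S m)) <> RtoC 0) by (apply C_INR_neq0; lia).
    rewrite (seg_ext _ (fun w => Cexp (- INR (S m) * w))).
    2:{ intros t _. rewrite <- Cexp_opp, <- Cexp_INR, Cmult_1_l. f_equal. ring. }
    rewrite (seg_FTC (fun w => / (- INR (S m)) * Cexp (- INR (S m) * w))%C).
    - replace (- INR (S m) * (ln r + RtoC (2 * PI) * Ci))%C
        with (- INR (S m) * (ln r + RtoC 0 * Ci) + - (INR (S m) * (RtoC (2 * PI) * Ci)))%C by ring.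
      rewrite Cexp_add, Cexp_opp, Cexp_INR, Cexp_2PI, Cpow_1_l.
      replace (/ RtoC 1)%C with (RtoC 1) by (field; intros E; apply RtoC_inj in E; lra). ring.
    - intros t _. set (w := (ln r + t * Ci)%C).
      eapply CD_eq; [apply CD_scal; apply (CD_comp Cexp (fun w => - INR (S m) * w)%C);
        [apply CD_Cexp|apply CD_scal, CD_id]|reflexivity|].
      field. intros E. apply Hm. replace (RtoC (INR (S m))) with (- - INR (S m))%C by ring.
      rewrite E. ring.
    - intros t _. auto with hol. }
  rewrite C0.
  rewrite (csum_ext _ (fun _ => 0 * 0)%C), csum_scal by (intros k _; rewrite CS; ring).
  simpl. ring.
Qed.

(** The derivative is not assumed to be continuous. So Cauchy's formula is applied to a primitive, whose divided differences are differentiable; the power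
    series obtained is then differentiated. *)
Theorem hol_power_series (f : C -> C) z0 r : 0 < r -> (forall z, Cmod (z - z0) < r -> hol f z) ->
  exists b d, 0 < d /\ geom_bounded b d /\
    forall z, Cmod (z - z0) < d -> f z = PS b (z - z0)%C.
Proof.
  intros Hr Hf. destruct (primitive_disc f z0 r Hr Hf) as [F HF].
  set (F1 := fun w => F (z0 + w)%C). set (f1 := fun w => f (z0 + w)%C).
  assert (Hadd : forall w, (z0 + w - z0)%C = w) by (intros; ring).
  assert (Dadd : forall w, CD (fun w => z0 + w)%C w (RtoC 1)).
  { intros w. eapply CD_eq; [apply CD_plus; [apply CD_const|apply CD_id]|reflexivity|ring]. }
  assert (HF1 : forall w, Cmod w < r / 2 -> CD F1 w (f1 w)).
  { intros w Hw. eapply CD_eq; [apply (CD_comp F (fun w => z0 + w)%C)|reflexivity|].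
    - apply HF. now rewrite Hadd.
    - apply Dadd.
    - unfold f1. ring. }
  assert (Hf1 : forall w, Cmod w < r / 2 -> hol f1 w).
  { intros w Hw. apply (hol_comp f (fun w => z0 + w)%C); [|auto with hol].
    apply Hf. rewrite Hadd. lra. }
  set (p := r / 4). assert (Hp : 0 < p < r / 2) by (unfold p; lra).
  set (c := (RtoC (2 * PI) * Ci)%C).
  assert (Hc : c <> 0).
  { apply Cmult_neq_0; [|apply Ci_nz]. intros E. apply RtoC_inj in E. pose proof PI_RGT_0. lra. }
  set (a := fun n => (/ c * coefF F1 p n)%C).
  assert (Ha : geom_bounded a p).
  { destruct (coefF_bound F1 f1 (r / 2) p Hp HF1) as [M HM].
    exists (/ Cmod c * M). intros n. unfold a. rewrite Cmod_mult, Cmod_inv, Rmult_assoc by auto.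
    apply Rmult_le_compat_l; auto. apply Rlt_le, Rinv_0_lt_compat. now apply Cmod_gt_0. }
  assert (E : forall w, Cmod w < p -> F1 w = PS a w).
  { intros w Hw. symmetry. apply CSeries_unique.
    pose proof (Cauchy_series F1 f1 (r / 2) p Hp HF1 w Hw) as L.
    rewrite (Cauchy_formula F1 f1 (r / 2) p Hp HF1 Hf1 w Hw), circ_kern in L by lra.
    apply (is_Clim_scal (/ c)) in L. fold c in L.
    replace (/ c * (F1 w * c))%C with (F1 w) in L by (field; auto).
    eapply is_Clim_ext; [|exact L]. intros n. simpl. rewrite <- csum_scal.
    apply csum_ext. intros; unfold a; ring. }
  exists (PS_d a), (p / 2). split; [lra|]. split; [apply geom_bounded_d with p; auto; lra|].
  intros z Hz. set (w := (z - z0)%C) in *.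
  replace z with (z0 + w)%C by (unfold w; ring). fold (f1 w).
  rewrite <- (is_C_derive_unique F1 w (f1 w)) by (apply HF1; lra).
  apply is_C_derive_unique.
  apply CD_ext_loc with (PS a) (p / 2); [lra| |].
  - intros u Hu. symmetry. apply E. replace u with ((u - w) + w)%C by ring.
    eapply Rle_lt_trans; [apply Cmod_triangle|]. lra.
  - apply PS_derive with p; auto; lra.
Qed.

(** * Local structure of holomorphic functions *)

Definition hol_disc (f : C -> C) (z0 : C) (r : R) : Prop :=
  forall z, Cmod (z - z0) < r -> hol f z.

Lemma Cmod_diag z : Cmod (z - z) = 0.
Proof. replace (z - z)%C with (RtoC 0) by ring. apply Cmod_0. Qed.

Lemma PS_shift_hol b d z0 : 0 < d -> geom_bounded b d ->
  hol_disc (fun z => PS b (z - z0)%C) z0 d.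
Proof.
  intros Hd Hb z Hz. apply (hol_comp (PS b) (fun z => z - z0)%C); [|auto with hol].
  now apply PS_hol with d.
Qed.

Lemma hol_factor f z0 r : 0 < r -> hol_disc f z0 r -> exists g d, 0 < d /\ hol_disc g z0 d /\
  forall z, Cmod (z - z0) < d -> f z = (f z0 + (z - z0) * g z)%C.
Proof.
  intros Hr Hf. destruct (hol_power_series f z0 r Hr Hf) as (b & d & Hd & Hb & E).
  exists (fun z => PS (fun n => b (S n)) (z - z0)%C), d. split; [auto|]. split.
  - apply PS_shift_hol; auto using geom_bounded_S.
  - intros z Hz. rewrite (E z Hz), (E z0) by (rewrite Cmod_diag; auto).
    replace (z0 - z0)%C with (RtoC 0) by ring. rewrite PS_0. now apply PS_S with d.
Qed.

Lemma hol_disc_le f z0 r s : s <= r -> hol_disc f z0 r -> hol_disc f z0 s.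
Proof. intros H Hf z Hz. apply Hf. lra. Qed.

(** Divide by [z - z0] as often as the first coefficients of the power series vanish. *)
Lemma hol_zero_dichotomy f z0 r : 0 < r -> hol_disc f z0 r ->
  (exists d, 0 < d /\ forall z, Cmod (z - z0) < d -> f z = 0) \/
  (exists k g d, 0 < d /\ hol_disc g z0 d /\ forall z, Cmod (z - z0) < d ->
     g z <> 0 /\ f z = ((z - z0) ^ k * g z)%C).
Proof.
  intros Hr Hf. destruct (hol_power_series f z0 r Hr Hf) as (b & d & Hd & Hb & E).
  destruct (classic (exists k, b k <> 0)) as [Hk|Hk].
  - right.
    destruct (dec_inh_nat_subset_has_unique_least_element (fun k => b k <> 0)
      (fun k => classic _) Hk) as [k [[Hk1 Hk2] _]].
    assert (S : forall k, (forall m, (m < k)%nat -> b m = 0) ->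
      geom_bounded (fun n => b (k + n)%nat) d /\ forall z, Cmod (z - z0) < d ->
      f z = ((z - z0) ^ k * PS (fun n => b (k + n)%nat) (z - z0)%C)%C).
    { clear Hk1 Hk2. clear k. induction k as [|k IH]; intros Hm.
      - split; auto. intros z Hz. simpl. rewrite Cmult_1_l. auto.
      - destruct IH as [IH1 IH2]; [intros; apply Hm; lia|].
        assert (X : forall n, b (S k + n)%nat = b (k + S n)%nat) by (intros; f_equal; lia).
        assert (G : geom_bounded (fun n => b (k + S n)%nat) d)
          by exact (geom_bounded_S (fun n => b (k + n)%nat) d Hd IH1).
        split.
        + destruct G as [M HM]. exists M. intros n. rewrite X. auto.
        + intros z Hz. rewrite (IH2 z Hz), (PS_S _ d) by auto.
          rewrite Nat.add_0_r, (Hm k), Cplus_0_l by lia. rewrite Cpow_S.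
          replace (PS (fun n => b (S k + n)%nat) (z - z0)) with
            (PS (fun n => b (k + S n)%nat) (z - z0)); [ring|].
          apply CSeries_ext. intros n. now rewrite X. }
    destruct (S k) as [S1 S2].
    { intros m Hm. apply NNPP. intros N. specialize (Hk2 m N). lia. }
    set (g := fun z => PS (fun n => b (k + n)%nat) (z - z0)%C).
    assert (Hg : hol_disc g z0 d) by (apply PS_shift_hol; auto).
    assert (g0 : g z0 <> 0).
    { unfold g. replace (z0 - z0)%C with (RtoC 0) by ring. rewrite PS_0, Nat.add_0_r. auto. }
    destruct (hol_neq0 g z0) as [e [He Hn]]; auto.
    { apply Hg. rewrite Cmod_diag; auto. }
    exists k, g, (Rmin d e). pose proof (Rmin_l d e). pose proof (Rmin_r d e).
    split; [now apply Rmin_pos|]. split; [now apply hol_disc_le with d|].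
    intros z Hz. split; [apply Hn; lra|apply S2; lra].
  - left. exists d. split; auto. intros z Hz. rewrite (E z Hz).
    assert (B : forall n, b n = 0) by (intros n; apply NNPP; intros N; apply Hk; now exists n).
    apply CSeries_unique. eapply is_Clim_ext; [|apply is_Clim_const].
    intros n. symmetry. rewrite (csum_ext _ (fun _ => 0 * 0)%C), csum_scal.
    + ring.
    + intros k _. rewrite B. ring.
Qed.

(** ** Polar coordinates, logarithms *)

Lemma Cexp_surj (z : C) : z <> 0 -> exists w, Cexp w = z.
Proof.
  intros Hz. apply Cmod_gt_0 in Hz. set (m := Cmod z) in *.
  assert (Hm : Re z ^ 2 + Im z ^ 2 = m ^ 2) by (symmetry; apply Cmod2_alt).
  set (x := Re z / m).
  assert (E1 : Re z = m * x) by (unfold x; field; lra).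
  assert (Hx2 : x ^ 2 <= 1).
  { apply Rmult_le_reg_r with (m ^ 2); [nra|]. rewrite <- Rpow_mult_distr.
    rewrite (Rmult_comm x), <- E1. pose proof (pow2_ge_0 (Im z)). lra. }
  assert (Hx : -1 <= x <= 1) by nra.
  assert (E2 : (Im z) ^ 2 = m ^ 2 * (1 - x ^ 2)) by (replace (m ^ 2 * (1 - x ^ 2)) with (m ^ 2 - (m * x) ^ 2) by ring; rewrite <- E1; lra).
  assert (Hs : sqrt (1 - x²) ^ 2 = 1 - x ^ 2).
  { rewrite <- Rsqr_pow2, Rsqr_sqrt; unfold Rsqr; simpl in *; lra. }
  pose proof (sqrt_pos (1 - x²)) as Sp.
  destruct (Rle_dec 0 (Im z)) as [Hi|Hi].
  - exists (ln m, acos x). unfold Cexp, Re, Im in *; simpl.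
    rewrite exp_ln, cos_acos, sin_acos by auto.
    rewrite (surjective_pairing z). f_equal; [lra|].
    revert Hs Sp. generalize (sqrt (1 - x²)). intros q Hs Sp.
    apply Rsqr_inj; auto; [apply Rmult_le_pos; lra|]. rewrite !Rsqr_pow2, E2, Rpow_mult_distr, Hs. auto.
  - exists (ln m, - acos x). unfold Cexp, Re, Im in *; simpl.
    rewrite exp_ln, cos_neg, sin_neg, cos_acos, sin_acos by auto.
    rewrite (surjective_pairing z). f_equal; [lra|].
    apply Ropp_eq_reg. rewrite <- Ropp_mult_distr_r, Ropp_involutive.
    revert Hs Sp. generalize (sqrt (1 - x²)). intros q Hs Sp.
    apply Rsqr_inj; [apply Rmult_le_pos; lra|lra|].
    rewrite <- Rsqr_neg, !Rsqr_pow2, E2, Rpow_mult_distr, Hs. auto.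
Qed.

Lemma Cexp_period a : Cexp a = 1 -> exists n : Z, a = (RtoC (IZR n) * (RtoC (2 * PI) * Ci))%C.
Proof.
  destruct a as [x y]. unfold Cexp, Re, Im; simpl. intros E. injection E as E1 E2.
  pose proof (exp_pos x) as Hx.
  assert (S : sin y = 0) by (apply Rmult_integral in E2; destruct E2; lra).
  pose proof (sin2_cos2 y) as SC. rewrite S in SC. unfold Rsqr in SC.
  assert (Cy : cos y = 1) by nra.
  assert (Ex : exp x = 1) by (rewrite Cy in E1; lra).
  assert (X : x = 0) by (apply exp_inv; now rewrite exp_0).
  destruct (sin_eq_0_0 y S) as [k Hk].
  destruct (Z.Even_or_Odd k) as [[n Hn]|[n Hn]].
  - exists n. rewrite X, Hk, Hn, mult_IZR. unfold Cmult, RtoC, Ci; simpl. f_equal; ring.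
  - exfalso. rewrite Hk, Hn, plus_IZR, mult_IZR in Cy.
    replace ((2 * IZR n + 1) * PI) with (PI + 2 * IZR n * PI) in Cy by ring.
    assert (P : cos (PI + 2 * IZR n * PI) = cos PI).
    { destruct (Z_le_gt_dec 0 n) as [H|H].
      - rewrite <- (Z2Nat.id n), <- INR_IZR_INZ by auto. apply cos_period.
      - rewrite <- (cos_period (PI + 2 * IZR n * PI) (Z.to_nat (- n))).
        rewrite INR_IZR_INZ, Z2Nat.id, opp_IZR by lia. f_equal. ring. }
    rewrite P, cos_PI in Cy. lra.
Qed.

(** The inverse of the exponential is found by integrating [1 / t]. *)
Lemma local_log (t0 : C) : t0 <> 0 -> exists (l : C -> C) d, 0 < d /\ hol_disc l t0 d /\
  forall t, Cmod (t - t0) < d -> Cexp (l t) = t.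
Proof.
  intros H0. pose proof H0 as Hp. apply Cmod_gt_0 in Hp. set (r := Cmod t0) in *.
  assert (Hn : forall t, Cmod (t - t0) < r -> t <> 0).
  { intros t Ht E. rewrite E in Ht. replace (0 - t0)%C with (- t0)%C in Ht by ring.
    rewrite Cmod_opp in Ht. fold r in Ht. lra. }
  destruct (primitive_disc Cinv t0 r Hp) as [F HF].
  { intros t Ht. eexists. now apply CD_inv, Hn. }
  assert (E : forall t, Cmod (t - t0) < r / 2 -> (Cexp (F t) / t = Cexp (F t0) / t0)%C).
  { intros t Ht. apply (derive_zero_const (fun t => Cexp (F t) / t)%C t0 t). intros x Hx.
    assert (Hs : Cmod (t0 + x * (t - t0) - t0) < r / 2).
    { replace (t0 + x * (t - t0) - t0)%C with (RtoC x * (t - t0))%C by ring.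
      rewrite Cmod_mult, Cmod_R, Rabs_pos_eq by lra. pose proof (Cmod_ge_0 (t - t0)). nra. }
    set (s := (t0 + x * (t - t0))%C) in *.
    assert (Hs0 : s <> 0) by (apply Hn; lra).
    eapply CD_eq; [apply CD_div; [apply (CD_comp Cexp F); [apply CD_Cexp|now apply HF]|apply CD_id|auto]
      |reflexivity|]. simpl. field. auto. }
  destruct (Cexp_surj (Cexp (F t0) / t0)%C) as [c Hc].
  { apply Cmult_neq_0; [apply Cexp_neq0|]. intros X. apply C1_nz.
    rewrite <- (Cinv_r t0), X by auto. ring. }
  exists (fun t => F t - c)%C, (r / 2). split; [lra|]. split.
  - intros t Ht. apply hol_minus; auto with hol. eexists. now apply HF.
  - intros t Ht. unfold Cminus. rewrite Cexp_add, Cexp_opp, Hc, <- (E t Ht). field. split.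
    + apply Hn. lra.
    + apply Cexp_neq0.
Qed.

(** ** Maximum principle *)

Lemma unit_root_direction (c : C) (k : nat) : (0 < k)%nat -> c <> 0 ->
  exists w, Cmod w = 1 /\ (w ^ k * c)%C = RtoC (Cmod c).
Proof.
  intros Hk Hc. destruct (Cexp_surj c Hc) as [a Ha].
  exists (Cexp (RtoC (- Im a / INR k) * Ci)). pose proof (lt_0_INR k Hk) as Hk0. split.
  - rewrite Cmod_Cexp. replace (Re (RtoC (- Im a / INR k) * Ci)) with 0; [apply exp_0|].
    simpl. ring.
  - rewrite <- Cexp_INR, Cmult_assoc, <- RtoC_mult.
    replace (INR k * (- Im a / INR k)) with (- Im a) by (field; lra).
    rewrite <- Ha, <- Cexp_add, Cmod_Cexp, <- Cexp_R. f_equal.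
    rewrite (C_eq_xy a) at 2. rewrite RtoC_opp. ring.
Qed.

(** Otherwise [f z = f z0 + (z - z0) ^ k g z] with [g z0 <> 0], and in a suitable direction the
    second term increases the modulus. *)
Lemma local_max_principle f z0 r : 0 < r -> hol_disc f z0 r ->
  (forall z, Cmod (z - z0) < r -> Cmod (f z) <= Cmod (f z0)) ->
  exists d, 0 < d /\ forall z, Cmod (z - z0) < d -> f z = f z0.
Proof.
  intros Hr Hf Hmax.
  destruct (Ceq_dec (f z0) 0) as [E0|N0].
  { exists r. split; auto. intros z Hz. rewrite E0. apply Cmod_eq_0, Rle_antisym; [|apply Cmod_ge_0].
    rewrite <- Cmod_0, <- E0. auto. }
  destruct (hol_zero_dichotomy (fun z => f z - f z0)%C z0 r Hr) as [(d & Hd & Z)|(k & g & d & Hd & Hg & E)].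
  - intros z Hz. apply hol_minus; auto with hol.
  - exists d. split; auto. intros z Hz. apply Ceq_minus. auto.
  - exfalso.
    assert (Z0 : Cmod (z0 - z0) < d) by (rewrite Cmod_diag; auto).
    destruct (E z0 Z0) as [g0 Ez0].
    destruct k as [|k].
    { simpl in Ez0. apply g0. rewrite <- (Cmult_1_l (g z0)), <- Ez0. ring. }
    set (a := f z0) in *. pose proof N0 as Ha. apply Cmod_gt_0 in Ha.
    assert (Hc : (g z0 / a <> 0)%C).
    { intros X. apply g0. replace (g z0) with (g z0 / a * a)%C by (field; auto). rewrite X. ring. }
    destruct (unit_root_direction (g z0 / a)%C (S k) ltac:(lia) Hc) as [w [Hw1 Hw2]].
    set (c := Cmod (g z0 / a)) in *. assert (Hc0 : 0 < c) by (now apply Cmod_gt_0 in Hc).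
    destruct (hol_cont g z0 (Hg z0 Z0) (c * Cmod a / 2)) as [e [He Hge]].
    { apply Rdiv_lt_0_compat; [|lra]. apply Rmult_lt_0_compat; lra. }
    set (t := Rmin (Rmin d e) r / 2).
    assert (Ht : 0 < t /\ t < d /\ t < e /\ t < r).
    { pose proof (Rmin_l (Rmin d e) r). pose proof (Rmin_r (Rmin d e) r).
      pose proof (Rmin_l d e). pose proof (Rmin_r d e).
      assert (0 < Rmin (Rmin d e) r) by (repeat apply Rmin_pos; lra). unfold t. lra. }
    set (z := (z0 + RtoC t * w)%C).
    assert (Ez : (z - z0)%C = (RtoC t * w)%C) by (unfold z; ring).
    assert (Hz : Cmod (z - z0) = t).
    { rewrite Ez, Cmod_mult, Hw1, Cmod_R, Rabs_pos_eq; lra. }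
    assert (Fz : f z = (a * (1 + RtoC (t ^ S k * c)) + RtoC t ^ S k * w ^ S k * (g z - g z0))%C).
    { destruct (E z ltac:(lra)) as [_ Ez2]. rewrite Ez, Cpow_mult_l in Ez2.
      replace (f z) with ((f z - a) + a)%C by ring. rewrite Ez2.
      rewrite RtoC_mult, RtoC_pow, <- Hw2. field. auto. }
    assert (tk : 0 < t ^ S k) by (apply pow_lt; lra).
    assert (B : Cmod a * (1 + t ^ S k * c) - t ^ S k * (c * Cmod a / 2) <= Cmod (f z)).
    { rewrite Fz.
      pose proof (Cmod_rtriangle (a * (1 + RtoC (t ^ S k * c))) (- (RtoC t ^ S k * w ^ S k * (g z - g z0)))) as T.
      rewrite Cmod_opp, !Cmod_mult, !Cmod_pow, Hw1, pow1, Cmod_R, <- RtoC_plus, Cmod_R in T.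
      assert (0 < t ^ S k * c) by now apply Rmult_lt_0_compat.
      rewrite (Rabs_pos_eq (1 + t ^ S k * c)), (Rabs_pos_eq t) in T by lra.
      rewrite Rmult_1_r in T.
      assert (t ^ S k * Cmod (g z - g z0) <= t ^ S k * (c * Cmod a / 2)).
      { apply Rmult_le_compat_l; [lra|]. left. apply Hge. lra. }
      match goal with |- _ <= Cmod ?u => match type of T with _ <= Cmod ?v =>
        replace u with v by (rewrite RtoC_plus; ring) end end. lra. }
    specialize (Hmax z ltac:(lra)).
    assert (0 < t ^ S k * (c * Cmod a)) by (apply Rmult_lt_0_compat; [lra|apply Rmult_lt_0_compat; lra]).
    nra.
Qed.

(** ** The identity theorem on the upper half plane *)

Definition hol_H (f : C -> C) : Prop := forall z, 0 < Im z -> hol f z.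

Definition locally_zero (f : C -> C) (z0 : C) : Prop :=
  exists d, 0 < d /\ forall z, Cmod (z - z0) < d -> f z = 0.

Lemma H_disc f z0 : hol_H f -> 0 < Im z0 -> hol_disc f z0 (Im z0).
Proof.
  intros Hf H0 z Hz. apply Hf. pose proof (im_le_Cmod (z - z0)) as B.
  change (Im (z - z0)) with (Im z - Im z0) in B.
  assert (Rabs (Im z - Im z0) < Im z0) by lra. apply Rabs_lt_between in H. lra.
Qed.

Lemma real_induction (P : R -> Prop) : P 0 ->
  (forall t, 0 <= t <= 1 -> (forall s, 0 <= s < t -> P s) -> P t) ->
  (forall t, 0 <= t <= 1 -> P t -> exists e, 0 < e /\ forall s, t <= s < t + e -> P s) ->
  forall t, 0 <= t <= 1 -> P t.
Proof.
  intros H0 Hc Ho.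
  set (E := fun t => 0 <= t <= 1 /\ forall s, 0 <= s <= t -> P s).
  destruct (completeness E) as [u [U1 U2]].
  - exists 1. intros x [Hx _]. lra.
  - exists 0. split; [lra|]. intros s Hs. replace s with 0 by lra. auto.
  - assert (Hu : 0 <= u <= 1).
    { split.
      - apply U1. split; [lra|]. intros s Hs. replace s with 0 by lra. auto.
      - apply U2. intros x [Hx _]. lra. }
    assert (Below : forall s, 0 <= s < u -> P s).
    { intros s Hs. apply NNPP. intros N.
      assert (u <= s); [|lra]. apply U2. intros x [Hx1 Hx2]. apply Rnot_lt_le. intros L.
      apply N, Hx2. lra. }
    assert (Pu : P u) by (apply Hc; auto).
    destruct (Ho u Hu Pu) as [e [He Hs]].
    assert (u = 1).
    { apply Rle_antisym; [lra|]. apply Rnot_lt_le. intros L.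
      set (v := Rmin 1 (u + e / 2)).
      assert (u < v <= 1 /\ v < u + e).
      { unfold v, Rmin. destruct Rle_dec; lra. }
      assert (v <= u); [|lra]. apply U1. split; [lra|]. intros s Hsv.
      destruct (Rlt_dec s u); [apply Below; lra|apply Hs; lra]. }
    intros t Ht. destruct (Rlt_dec t u); [apply Below; lra|]. replace t with u by lra. auto.
Qed.

(** Being locally zero propagates along the segment from [p] to [q], by the dichotomy. *)
Lemma identity_H f p q : hol_H f -> 0 < Im p -> 0 < Im q -> locally_zero f p -> locally_zero f q.
Proof.
  intros Hf Hp Hq Hz.
  set (g := fun t : R => (p + RtoC t * (q - p))%C).
  assert (Hg : forall t, 0 <= t <= 1 -> 0 < Im (g t)).
  { intros t Ht. unfold g. replace (Im (p + RtoC t * (q - p))) with ((1 - t) * Im p + t * Im q)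
      by (unfold Im; simpl; ring). nra. }
  assert (D : forall s t, Cmod (g s - g t) = Rabs (s - t) * Cmod (q - p)).
  { intros s t. unfold g. rewrite <- Cmod_R, <- Cmod_mult. f_equal. rewrite RtoC_minus. ring. }
  assert (K : locally_zero f (g 1)).
  { apply (real_induction (fun t => locally_zero f (g t))); [| | |lra].
    - replace (g 0) with p by (unfold g; ring). auto.
    - intros t Ht Hs.
      destruct (hol_zero_dichotomy f (g t) (Im (g t)) (Hg t Ht) (H_disc f _ Hf (Hg t Ht)))
        as [Z|(k & h & d & Hd & _ & E)]; [exact Z|].
      destruct (Req_dec t 0) as [->|Nt].
      { replace (g 0) with p by (unfold g; ring). auto. }
      destruct (Ceq_dec q p) as [->|Npq].
      { replace (g t) with p by (unfold g; ring). auto. }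
      exfalso. pose proof (Cmod_neq q p Npq) as Hm.
      set (s := Rmax 0 (t - d / (2 * Cmod (q - p)))).
      assert (Hpos : 0 < d / (2 * Cmod (q - p))) by (apply Rdiv_lt_0_compat; lra).
      assert (Hs' : 0 <= s < t /\ t - s <= d / (2 * Cmod (q - p))).
      { unfold s, Rmax. destruct Rle_dec; lra. }
      destruct (Hs s ltac:(lra)) as [e [He Hze]].
      assert (Hd' : Cmod (g s - g t) < d).
      { rewrite D, Rabs_minus_sym, Rabs_pos_eq by lra.
        apply Rle_lt_trans with (d / (2 * Cmod (q - p)) * Cmod (q - p)).
        - apply Rmult_le_compat_r; lra.
        - replace (d / (2 * Cmod (q - p)) * Cmod (q - p)) with (d / 2) by (field; lra). lra. }
      destruct (E (g s) Hd') as [E1 E2].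
      rewrite Hze in E2 by (rewrite Cmod_diag; auto). symmetry in E2.
      assert (N : (g s - g t)%C <> 0).
      { apply Cmod_gt_0. rewrite D, Rabs_minus_sym, Rabs_pos_eq by lra.
        apply Rmult_lt_0_compat; lra. }
      apply (Cpow_nz _ k) in N. apply (Cmult_neq_0 _ _ N E1 E2).
    - intros t Ht [e [He Z]]. pose proof (Cmod_ge_0 (q - p)).
      exists (e / (2 * (1 + Cmod (q - p)))). split; [apply Rdiv_lt_0_compat; lra|].
      intros s Hs. exists (e / 2). split; [lra|]. intros z Hzz. apply Z.
      replace (z - g t)%C with ((z - g s) + (g s - g t))%C by ring.
      eapply Rle_lt_trans; [apply Cmod_triangle|]. rewrite D, Rabs_pos_eq by lra.
      assert ((s - t) * Cmod (q - p) <= e / 2); [|lra].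
      apply Rle_trans with (e / (2 * (1 + Cmod (q - p))) * (1 + Cmod (q - p))).
      + apply Rmult_le_compat; lra.
      + right. field. lra. }
  replace (g 1) with q in K by (unfold g; ring). exact K.
Qed.

Lemma locally_zero_at f z : locally_zero f z -> f z = 0.
Proof. intros [d [Hd H]]. apply H. rewrite Cmod_diag; auto. Qed.

(** The zeros on the axis accumulate, which excludes the second case of the dichotomy. *)
Lemma identity_imag_axis f : hol_H f -> (forall y, 0 < y -> f (Ci * RtoC y)%C = 0) ->
  forall z, 0 < Im z -> f z = 0.
Proof.
  intros Hf Hy z Hz. apply locally_zero_at.
  assert (HI : Im Ci = 1) by reflexivity.
  apply (identity_H f Ci z Hf); [lra|auto|].
  destruct (hol_zero_dichotomy f Ci 1 Rlt_0_1) as [Z|(k & g & d & Hd & _ & E)]; [|exact Z|].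
  { rewrite <- HI. apply H_disc; auto; lra. }
  exfalso. destruct (E (Ci * RtoC (1 + d / 2))%C) as [E1 E2].
  { replace (Ci * RtoC (1 + d / 2) - Ci)%C with (Ci * RtoC (d / 2))%C by (rewrite RtoC_plus; ring).
    rewrite Cmod_mult, Cmod_Ci, Cmod_R, Rabs_pos_eq; lra. }
  rewrite Hy in E2 by lra. symmetry in E2.
  replace (Ci * RtoC (1 + d / 2) - Ci)%C with (Ci * RtoC (d / 2))%C in E2 by (rewrite RtoC_plus; ring).
  refine (Cmult_neq_0 _ _ (Cpow_nz _ k _) E1 E2).
  apply Cmult_neq_0; [apply Ci_nz|]. intros X. apply RtoC_inj in X. lra.
Qed.

(** * Periodic functions and the parameter q *)

Lemma Cmod_qpar z : Cmod (qpar z) = exp (- (2 * PI * Im z)).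
Proof. unfold qpar. rewrite Cmod_Cexp. f_equal. unfold Re, Im. simpl. ring. Qed.

Lemma qpar_neq0 z : qpar z <> 0.
Proof. apply Cexp_neq0. Qed.

Lemma qpar_add a b : qpar (a + b) = (qpar a * qpar b)%C.
Proof. unfold qpar. rewrite <- Cexp_add. f_equal. ring. Qed.

Lemma hol_qpar f z : hol f z -> hol (fun w => qpar (f w)) z.
Proof. intros H. unfold qpar. auto with hol. Qed.
#[export] Hint Resolve hol_qpar : hol.

Lemma TwoPiCi_neq0 : (2 * PI * Ci)%C <> 0.
Proof.
  pose proof PI_RGT_0. apply Cmult_neq_0; [|apply Ci_nz].
  apply Cmult_neq_0; intros E; apply RtoC_inj in E; lra.
Qed.

Lemma qpar_eq a b : qpar a = qpar b -> exists n : Z, a = (b + RtoC (IZR n))%C.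
Proof.
  intros E. unfold qpar in E.
  assert (E1 : Cexp (2 * PI * Ci * a - 2 * PI * Ci * b) = 1).
  { unfold Cminus. rewrite Cexp_add, Cexp_opp, E. field. apply Cexp_neq0. }
  destruct (Cexp_period _ E1) as [n Hn]. exists n.
  pose proof TwoPiCi_neq0 as N.
  assert (X : ((2 * PI * Ci) * (a - b) = (2 * PI * Ci) * RtoC (IZR n))%C).
  { rewrite RtoC_mult in Hn. transitivity (2 * PI * Ci * a - 2 * PI * Ci * b)%C; [ring|]. rewrite Hn. ring. }
  revert N X. generalize (2 * PI * Ci)%C. intros c N X.
  replace (RtoC (IZR n)) with (/ c * (c * RtoC (IZR n)))%C by (field; auto).
  rewrite <- X. field. auto.
Qed.

Lemma qpar_surj t : t <> RtoC 0 -> exists z, qpar z = t.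
Proof.
  intros Ht. destruct (Cexp_surj t Ht) as [w Hw]. exists (w / (2 * PI * Ci))%C.
  unfold qpar. rewrite <- Hw. f_equal. field. split; [apply Ci_nz|].
  intros E; apply RtoC_inj in E; pose proof PI_RGT_0; lra.
Qed.

Lemma qpar_int (n : Z) : qpar (RtoC (IZR n)) = 1.
Proof.
  unfold qpar, Cexp, Re, Im; simpl.
  replace (((2 * PI - 0 * 0) * 0 - (2 * 0 + 0 * PI) * 1) * IZR n -
    ((2 * PI - 0 * 0) * 1 + (2 * 0 + 0 * PI) * 0) * 0) with 0 by ring.
  replace (((2 * PI - 0 * 0) * 0 - (2 * 0 + 0 * PI) * 1) * 0 +
    ((2 * PI - 0 * 0) * 1 + (2 * 0 + 0 * PI) * 0) * IZR n) with (IZR n * (2 * PI)) by ring.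
  rewrite exp_0.
  assert (K : cos (IZR n * (2 * PI)) = 1 /\ sin (IZR n * (2 * PI)) = 0).
  { destruct (Z_le_gt_dec 0 n) as [H|H].
    - rewrite <- (Z2Nat.id n), <- INR_IZR_INZ by auto.
      replace (INR (Z.to_nat n) * (2 * PI)) with (0 + 2 * INR (Z.to_nat n) * PI) by ring.
      rewrite cos_period, sin_period, cos_0, sin_0. auto.
    - replace (IZR n * (2 * PI)) with (- (0 + 2 * INR (Z.to_nat (- n)) * PI)).
      + rewrite cos_neg, sin_neg, cos_period, sin_period, cos_0, sin_0. split; ring.
      + rewrite INR_IZR_INZ, Z2Nat.id, opp_IZR by lia. ring. }
  destruct K as [K1 K2]. rewrite K1, K2. unfold RtoC. f_equal; ring.
Qed.

Lemma Cmod_qpar_div z (w : R) : 0 < w -> Cmod (qpar (z / w)) = exp (- (2 * PI * (Im z / w))).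
Proof.
  intros Hw. rewrite Cmod_qpar. do 4 f_equal. unfold Cdiv. rewrite <- RtoC_inv by lra.
  unfold Im. simpl. unfold Rdiv. ring.
Qed.

Lemma qpar_div_small (w d : R) : 0 < w -> 0 < d ->
  exists Y, 0 < Y /\ forall z, Y < Im z -> Cmod (qpar (z / w)) < d.
Proof.
  intros Hw Hd. pose proof PI_RGT_0 as HP.
  exists (Rmax 1 (- ln d * w / (2 * PI))). split; [eapply Rlt_le_trans; [apply Rlt_0_1|apply Rmax_l]|].
  intros z Hz. rewrite Cmod_qpar_div by auto. rewrite <- (exp_ln d) at 1 by auto.
  apply exp_increasing.
  assert (H : - ln d * w / (2 * PI) < Im z) by (eapply Rle_lt_trans; [apply Rmax_r|apply Hz]).
  apply (Rmult_lt_compat_r (2 * PI / w)) in H; [|apply Rdiv_lt_0_compat; lra].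
  replace (- ln d * w / (2 * PI) * (2 * PI / w)) with (- ln d) in H by (field; lra).
  replace (2 * PI * (Im z / w)) with (Im z * (2 * PI / w)) by (field; lra). lra.
Qed.

Lemma qpar_div_large (w Y : R) : 0 < w ->
  exists d, 0 < d /\ forall z, Cmod (qpar (z / w)) < d -> Y < Im z.
Proof.
  intros Hw. pose proof PI_RGT_0 as HP. exists (exp (- (2 * PI * (Y / w)))). split; [apply exp_pos|].
  intros z Hz. rewrite Cmod_qpar_div in Hz by auto. apply exp_lt_inv in Hz.
  assert (Y / w < Im z / w) by nra.
  apply (Rmult_lt_compat_r w) in H; auto. unfold Rdiv in H.
  rewrite !Rmult_assoc, Rinv_l, !Rmult_1_r in H; lra.
Qed.

(** A local logarithm makes [f] a holomorphic function of [q <> 0]. Clearing the pole with two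
    powers of [q] to spare makes it differentiable at [q = 0], with derivative zero. *)
Theorem q_expansion (f : C -> C) (w Y K : R) (m : nat) : 0 < w -> 0 <= K ->
  (forall z, Y < Im z -> hol f z) ->
  (forall z, Y < Im z -> f (z + w)%C = f z) ->
  (forall z, Y < Im z -> Cmod (f z) <= K * exp (2 * PI * INR m * (Im z / w))) ->
  exists (k : nat) (u : C -> C) (d Y' : R), 0 < d /\ hol_disc u 0 d /\
    forall z, Y' < Im z -> Cmod (qpar (z / w)) < d /\
      f z = (u (qpar (z / w)) / qpar (z / w) ^ k)%C.
Proof.
  intros Hw HK Hf Hper Hgr.
  destruct (qpar_div_large w Y Hw) as [d [Hd HY]].
  destruct (qpar_div_small w d Hw Hd) as [Y' [_ HY']].
  assert (HwC : RtoC w <> 0) by (intros E; apply RtoC_inj in E; lra).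
  assert (Hpi : RtoC PI <> 0) by (intros E; apply RtoC_inj in E; pose proof PI_RGT_0; lra).
  assert (H2 : RtoC 2 <> 0) by (intros E; apply RtoC_inj in E; lra).
  assert (Sur : forall t : C, exists z, t <> RtoC 0 -> qpar (z / w) = t).
  { intros t. destruct (Ceq_dec t 0) as [->|N]; [exists 0; tauto|].
    destruct (qpar_surj t N) as [z Hz]. exists (z * w)%C. intros _. rewrite <- Hz. f_equal. field. auto. }
  set (sect := fun t => proj1_sig (constructive_indefinite_description _ (Sur t))).
  assert (Hsect : forall t, t <> RtoC 0 -> qpar (sect t / w) = t).
  { intros t. unfold sect. destruct (constructive_indefinite_description _ (Sur t)); auto. }
  assert (PerN : forall n z, Y < Im z -> f (z + RtoC (INR n) * w)%C = f z).
  { induction n as [|n IH]; intros z Hz.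
    - f_equal. simpl INR. ring.
    - rewrite S_INR, RtoC_plus. replace (z + (INR n + 1) * w)%C with (z + INR n * w + w)%C by ring.
      rewrite Hper; [auto|]. replace (Im (z + INR n * w)) with (Im z); auto.
      unfold Im; simpl; ring. }
  assert (PerZ : forall n z, Y < Im z -> f (z + RtoC (IZR n) * w)%C = f z).
  { intros n z Hz. destruct (Z_le_gt_dec 0 n) as [H|H].
    - rewrite <- (Z2Nat.id n), <- INR_IZR_INZ by auto. auto.
    - rewrite <- (PerN (Z.to_nat (- n)) (z + IZR n * w)%C).
      + f_equal. rewrite INR_IZR_INZ, Z2Nat.id, opp_IZR, RtoC_opp by lia. ring.
      + replace (Im (z + IZR n * w)) with (Im z); auto. unfold Im; simpl; ring. }
  assert (Inv : forall z z', Y < Im z -> qpar (z / w) = qpar (z' / w) -> f z' = f z).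
  { intros z z' Hz E. destruct (qpar_eq _ _ (eq_sym E)) as [n Hn].
    rewrite <- (PerZ n z Hz). f_equal.
    transitivity (z' / w * w)%C; [field; auto|]. rewrite Hn. field. auto. }
  set (u := fun t => if Ceq_dec t 0 then RtoC 0 else (t ^ (m + 2) * f (sect t))%C).
  assert (Hu : forall t, t <> RtoC 0 -> u t = (t ^ (m + 2) * f (sect t))%C).
  { intros t Ht. unfold u. destruct (Ceq_dec t 0); tauto. }
  assert (Bu : forall t, Cmod (t - 0) < d -> Cmod (u t) <= K * Cmod t ^ 2).
  { intros t Ht. replace (t - 0)%C with t in Ht by ring.
    destruct (Ceq_dec t 0) as [->|N].
    - unfold u. destruct (Ceq_dec 0 0); [|tauto]. rewrite Cmod_0. simpl. lra.
    - rewrite Hu, Cmod_mult, Cmod_pow by auto. pose proof (Hsect t N) as E.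
      assert (Hz : Y < Im (sect t)) by (apply HY; now rewrite E).
      specialize (Hgr _ Hz). rewrite <- E in N |- * at 1.
      replace (exp (2 * PI * INR m * (Im (sect t) / w))) with (/ Cmod t ^ m) in Hgr.
      + assert (Ht0 : 0 < Cmod t) by (apply Cmod_gt_0; now rewrite <- E).
        rewrite E, pow_add. pose proof (pow_lt _ m Ht0). pose proof (pow_lt _ 2 Ht0).
        apply Rle_trans with (Cmod t ^ m * Cmod t ^ 2 * (K * / Cmod t ^ m)).
        * apply Rmult_le_compat_l; auto. apply Rmult_le_pos; lra.
        * right. field. lra.
      + rewrite <- E at 1. rewrite Cmod_qpar_div, <- pow_inv, <- exp_Ropp by auto.
        rewrite <- Rpower_pow by apply exp_pos. unfold Rpower. rewrite ln_exp. f_equal. ring. }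
  exists (m + 2)%nat, u, d, Y'. split; auto. split.
  - intros t Ht. destruct (Ceq_dec t 0) as [->|N].
    + exists (RtoC 0). apply is_derive_C_iff. intros eps He.
      assert (u0 : u 0 = 0) by (unfold u; destruct (Ceq_dec 0 0); tauto).
      exists (Rmin d (eps / (1 + K))). split; [apply Rmin_pos; auto; apply Rdiv_lt_0_compat; lra|].
      intros s Hs. pose proof (Rmin_l d (eps / (1 + K))). pose proof (Rmin_r d (eps / (1 + K))).
      rewrite u0. replace (u s - 0 - 0 * (s - 0))%C with (u s) by ring.
      eapply Rle_trans; [apply Bu; lra|]. replace (s - 0)%C with s in * by ring.
      pose proof (Cmod_ge_0 s). replace (K * Cmod s ^ 2) with (K * Cmod s * Cmod s) by ring.
      apply Rmult_le_compat_r; auto.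
      apply Rle_trans with ((1 + K) * (eps / (1 + K))); [|right; field; lra].
      apply Rmult_le_compat; lra.
    + destruct (local_log t N) as (l & e & He & Hl & El).
      set (zz := fun s => (w / (2 * PI * Ci) * l s)%C).
      assert (Ez : forall s, Cmod (s - t) < e -> qpar (zz s / w) = s).
      { intros s Hs. unfold qpar, zz. rewrite <- (El s Hs) at 2. f_equal. field.
        repeat split; auto. apply Ci_nz. }
      assert (Hsmall : exists e', 0 < e' /\ e' <= e /\ forall s, Cmod (s - t) < e' -> s <> RtoC 0 /\ Cmod s < d).
      { replace (t - 0)%C with t in Ht by ring. pose proof (proj1 (Cmod_gt_0 t) N) as Hp.
        exists (Rmin e (Rmin (Cmod t) (d - Cmod t))).
        pose proof (Rmin_l e (Rmin (Cmod t) (d - Cmod t))).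
        pose proof (Rmin_r e (Rmin (Cmod t) (d - Cmod t))).
        pose proof (Rmin_l (Cmod t) (d - Cmod t)). pose proof (Rmin_r (Cmod t) (d - Cmod t)).
        split; [repeat apply Rmin_pos; lra|]. split; auto. intros s Hs.
        pose proof (Cmod_rtriangle t (t - s)) as T1.
        pose proof (Cmod_rtriangle s t) as T2.
        replace (t - (t - s))%C with s in T1 by ring.
        replace (t - s)%C with (- (s - t))%C in T1 by ring. rewrite Cmod_opp in T1.
        split; [apply Cmod_gt_0|]; lra. }
      destruct Hsmall as [e' [He' [Hee Hs]]].
      apply hol_ext_loc with (fun s => s ^ (m + 2) * f (zz s))%C e'; auto.
      * intros s Hst. destruct (Hs s Hst) as [S1 S2]. rewrite Hu by auto. f_equal.
        apply Inv.
        -- apply HY. now rewrite Hsect.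
        -- rewrite Hsect, Ez; auto; lra.
      * apply hol_mult; [apply hol_pow, hol_id|].
        assert (T0 : Cmod (t - t) < e) by (rewrite Cmod_diag; auto).
        apply (hol_comp f zz).
        -- apply Hf, HY. rewrite Ez by auto. replace (t - 0)%C with t in Ht by ring. auto.
        -- unfold zz. apply hol_mult; [auto with hol|]. now apply Hl.
  - intros z Hz. specialize (HY' z Hz). split; auto.
    set (t := qpar (z / w)) in *. assert (Ht : t <> 0) by apply qpar_neq0.
    rewrite Hu by auto.
    rewrite (Inv z (sect t)).
    + field. now apply Cpow_nz.
    + apply HY. auto.
    + symmetry. now apply Hsect.
Qed.

(** * Meromorphic functions with values in the sphere *)

(** In the case of a pole, divide by the vanishing order of the inverse. *)
Lemma meromorphic_laurent G z0 : meromorphic_at G z0 ->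
  exists (k : nat) (u : C -> C) d, 0 < d /\ hol_disc u z0 d /\
    forall z, z <> z0 -> Cmod (z - z0) < d -> G z = Some (u z / (z - z0) ^ k)%C.
Proof.
  intros [[phi H]|[phi [H0 H]]]; apply locally_C in H; destruct H as [d [Hd H]].
  - exists O, phi, d. split; auto. split; [intros z Hz; now apply H|].
    intros z _ Hz. rewrite (proj2 (H z Hz)). f_equal. simpl. field.
  - destruct (hol_zero_dichotomy phi z0 d Hd) as [(e & He & Z)|(k & g & e & He & Hg & E)].
    + intros z Hz. now apply H.
    + exfalso.
      assert (X : RtoC 1 = RtoC 0).
      { set (t := Rmin d e / 2). assert (Ht : 0 < t /\ t < d /\ t < e).
        { unfold t. pose proof (Rmin_l d e). pose proof (Rmin_r d e).
          assert (0 < Rmin d e) by now apply Rmin_pos. lra. }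
        assert (Ez : Cmod (z0 + RtoC t - z0) = t).
        { replace (z0 + RtoC t - z0)%C with (RtoC t) by ring. rewrite Cmod_R, Rabs_pos_eq; lra. }
        destruct (H (z0 + RtoC t)%C) as [_ [N _]]; [rewrite Ez; lra|].
        exfalso. apply N; [|apply Z; rewrite Ez; lra].
        intros E. rewrite E, Cmod_diag in Ez. lra. }
      apply RtoC_inj in X. lra.
    + exists k, (fun z => / g z)%C, (Rmin d e).
      pose proof (Rmin_l d e). pose proof (Rmin_r d e).
      split; [now apply Rmin_pos|]. split.
      * intros z Hz. destruct (E z ltac:(lra)) as [E1 _]. apply hol_inv; auto. apply Hg. lra.
      * intros z N Hz. destruct (E z ltac:(lra)) as [E1 E2].
        destruct (H z ltac:(lra)) as [_ [N2 EG]]. rewrite EG. unfold sphere_inv.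
        specialize (N2 N). destruct (Ceq_dec (phi z) 0) as [X|_]; [tauto|].
        rewrite E2. f_equal. field. split; auto. apply Cpow_nz. now apply Cminus_eq_contra.
Qed.

(** The numerator [u] may vanish at [z0], to an order below, equal to or above [k]. *)
Lemma laurent_meromorphic (k : nat) (u : C -> C) z0 d : 0 < d -> hol_disc u z0 d ->
  exists G e, 0 < e /\ meromorphic_at G z0 /\
    forall z, z <> z0 -> Cmod (z - z0) < e -> G z = Some (u z / (z - z0) ^ k)%C.
Proof.
  intros Hd Hu.
  destruct (hol_zero_dichotomy u z0 d Hd Hu) as [(e & He & Z)|(n & g & e & He & Hg & E)].
  - exists (fun _ => Some (RtoC 0)), e. split; auto. split.
    + left. exists (fun _ => RtoC 0). apply locally_C. exists 1. split; [lra|]. auto with hol.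
    + intros z _ Hz. rewrite Z by auto. f_equal. unfold Cdiv. ring.
  - assert (Nz : forall z m, z <> z0 -> ((z - z0) ^ m)%C <> 0).
    { intros z m N. apply Cpow_nz. now apply Cminus_eq_contra. }
    destruct (le_lt_dec k n) as [L|L].
    + exists (fun z => Some ((z - z0) ^ (n - k) * g z)%C), e. split; auto. split.
      * left. exists (fun z => ((z - z0) ^ (n - k) * g z)%C). apply locally_C. exists e. split; auto.
        intros w Hw. split; auto. apply hol_mult; [auto with hol|]. now apply Hg.
      * intros z N Hz. f_equal. rewrite (proj2 (E z Hz)).
        replace ((z - z0) ^ n)%C with ((z - z0) ^ (n - k) * (z - z0) ^ k)%C.
        -- field. auto.
        -- rewrite <- Cpow_add_r. f_equal. lia.
    + exists (fun z => sphere_inv ((z - z0) ^ (k - n) / g z)%C), e. split; auto. split.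
      * right. exists (fun z => ((z - z0) ^ (k - n) / g z)%C). split.
        -- replace (z0 - z0)%C with (RtoC 0) by ring.
           destruct (k - n)%nat eqn:X; [lia|]. simpl. unfold Cdiv. ring.
        -- apply locally_C. exists e. split; auto. intros w Hw. destruct (E w Hw) as [E1 _].
           split; [apply hol_div; auto with hol; now apply Hg|]. split; auto.
           intros N X. apply (Nz w (k - n)%nat N).
           replace ((w - z0) ^ (k - n))%C with (((w - z0) ^ (k - n) / g w) * g w)%C by (field; auto).
           rewrite X. ring.
      * intros z N Hz. destruct (E z Hz) as [E1 E2]. unfold sphere_inv.
        destruct (Ceq_dec _ 0) as [X|_].
        { exfalso. apply (Nz z (k - n)%nat N).
          replace ((z - z0) ^ (k - n))%C with (((z - z0) ^ (k - n) / g z) * g z)%C by (field; auto).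
          rewrite X. ring. }
        f_equal. rewrite E2.
        replace ((z - z0) ^ k)%C with ((z - z0) ^ (k - n) * (z - z0) ^ n)%C.
        -- field. repeat split; auto.
        -- rewrite <- Cpow_add_r. f_equal. lia.
Qed.

Lemma punctured_point (z0 : C) d : 0 < d -> exists z, z <> z0 /\ Cmod (z - z0) < d.
Proof.
  intros Hd. exists (z0 + RtoC (d / 2))%C.
  assert (E : Cmod (z0 + RtoC (d / 2) - z0) = d / 2).
  { replace (z0 + RtoC (d / 2) - z0)%C with (RtoC (d / 2)) by ring. rewrite Cmod_R, Rabs_pos_eq; lra. }
  split; [|lra]. intros X. rewrite X, Cmod_diag in E. lra.
Qed.

(** At a pole the values nearby are unbounded, while those of [psi] are not. *)
Lemma meromorphic_value_finite G z0 (psi : C -> C) d : meromorphic_at G z0 -> 0 < d -> hol psi z0 ->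
  (forall z, z <> z0 -> Cmod (z - z0) < d -> G z = Some (psi z)) -> G z0 = Some (psi z0).
Proof.
  intros [[phi H]|[phi [H0 H]]] Hd Hpsi E; apply locally_C in H; destruct H as [e [He H]].
  - assert (Z0 : Cmod (z0 - z0) < e) by (rewrite Cmod_diag; auto).
    rewrite (proj2 (H z0 Z0)). f_equal.
    assert (X : (phi z0 - psi z0 = 0)%C); [|now apply Ceq_minus].
    apply (punctured_limit (fun z => phi z - psi z)%C z0 _ (Rmin d e)); [now apply Rmin_pos| |].
    + apply (hol_cont (fun z => phi z - psi z)%C). apply hol_minus; auto. now apply H.
    + intros z N Hz. pose proof (Rmin_l d e). pose proof (Rmin_r d e).
      pose proof (E z N ltac:(lra)) as E1. rewrite (proj2 (H z ltac:(lra))) in E1.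
      injection E1 as ->. ring.
  - exfalso.
    assert (X : (phi z0 * psi z0 = 1)%C).
    { apply (punctured_limit (fun z => phi z * psi z)%C z0 _ (Rmin d e)); [now apply Rmin_pos| |].
      - apply (hol_cont (fun z => phi z * psi z)%C). apply hol_mult; auto. apply H. rewrite Cmod_diag; auto.
      - intros z N Hz. pose proof (Rmin_l d e). pose proof (Rmin_r d e).
        pose proof (E z N ltac:(lra)) as E1. destruct (H z ltac:(lra)) as [_ [N2 E2]].
        rewrite E2 in E1. unfold sphere_inv in E1. destruct (Ceq_dec (phi z) 0); [discriminate|].
        injection E1 as <-. apply Cinv_r. auto. }
    rewrite H0, Cmult_0_l in X. apply RtoC_inj in X. lra.
Qed.

Lemma meromorphic_ext G1 G2 z0 d : 0 < d -> (forall z, Cmod (z - z0) < d -> G1 z = G2 z) ->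
  meromorphic_at G1 z0 -> meromorphic_at G2 z0.
Proof.
  intros Hd E [[phi H]|[phi [H0 H]]]; apply locally_C in H; destruct H as [e [He H]];
    pose proof (Rmin_l d e); pose proof (Rmin_r d e).
  - left. exists phi. apply locally_C. exists (Rmin d e). split; [now apply Rmin_pos|].
    intros z Hz. rewrite <- E by lra. apply H. lra.
  - right. exists phi. split; auto. apply locally_C. exists (Rmin d e). split; [now apply Rmin_pos|].
    intros z Hz. rewrite <- E by lra. apply H. lra.
Qed.

Lemma hol_meromorphic (phi : C -> C) z0 d : 0 < d -> hol_disc phi z0 d ->
  meromorphic_at (fun z => Some (phi z)) z0.
Proof. intros Hd H. left. exists phi. apply locally_C. exists d. split; auto. Qed.

Lemma inv_meromorphic (phi : C -> C) z0 d : 0 < d -> hol_disc phi z0 d -> ~ locally_zero phi z0 ->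
  meromorphic_at (fun z => sphere_inv (phi z)) z0.
Proof.
  intros Hd H Hn.
  destruct (hol_zero_dichotomy phi z0 d Hd H) as [Z|(k & g & e & He & Hg & E)]; [tauto|].
  pose proof (Rmin_l d e) as M1. pose proof (Rmin_r d e) as M2.
  assert (Hm : 0 < Rmin d e) by now apply Rmin_pos.
  assert (Z0 : Cmod (z0 - z0) < e) by (rewrite Cmod_diag; auto).
  destruct (Ceq_dec (phi z0) 0) as [P0|P0].
  - right. exists phi. split; auto. apply locally_C. exists (Rmin d e). split; auto.
    intros z Hz. split; [apply H; lra|]. split; auto.
    intros N. destruct (E z ltac:(lra)) as [E1 E2]. rewrite E2. apply Cmult_neq_0; auto.
    apply Cpow_nz. now apply Cminus_eq_contra.
  - destruct (hol_neq0 phi z0) as [e' [He' Hn']]; auto.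
    { apply H. rewrite Cmod_diag; auto. }
    pose proof (Rmin_l d e'). pose proof (Rmin_r d e').
    left. exists (fun z => / phi z)%C. apply locally_C. exists (Rmin d e'). split; [now apply Rmin_pos|].
    intros z Hz. specialize (Hn' z ltac:(lra)). split; [apply hol_inv; auto; apply H; lra|].
    unfold sphere_inv. destruct (Ceq_dec (phi z) 0); tauto.
Qed.

(** * Partial fractions by the Herglotz trick *)

Lemma ex_series_telescope (u v : nat -> R) : (forall n, 0 <= u n <= v n - v (S n)) ->
  (forall n, 0 <= v n) -> ex_series u.
Proof.
  intros Hu Hv.
  assert (B : forall n, sum_n u n <= v O - v (S n)).
  { induction n as [|n IH]; [rewrite sum_O; apply Hu|].
    rewrite sum_Sn. unfold plus; simpl. specialize (Hu (S n)). lra. }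
  destruct (ex_finite_lim_seq_incr (sum_n u) (v O)) as [l Hl].
  - intros n. rewrite sum_Sn. unfold plus; simpl. specialize (Hu (S n)). lra.
  - intros n. specialize (B n). specialize (Hv (S n)). lra.
  - exists l. exact Hl.
Qed.

Lemma INR_S_pos n : 0 < INR (S n).
Proof. apply lt_0_INR; lia. Qed.

Lemma ex_series_inv_sq : ex_series (fun n => (/ INR (S n)) ^ 2).
Proof.
  apply ex_series_telescope with (fun n => 2 * / INR (S n)).
  - intros n. pose proof (INR_S_pos n) as P. rewrite (S_INR (S n)).
    set (x := INR (S n)) in *.
    assert (1 <= x) by (unfold x; rewrite S_INR; pose proof (pos_INR n); lra).
    split; [apply pow2_ge_0|].
    replace (2 * / x - 2 * / (x + 1)) with ((/ x) ^ 2 * (2 * x / (x + 1))) by (field; lra).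
    rewrite <- (Rmult_1_r ((/ x) ^ 2)) at 1. apply Rmult_le_compat_l; [apply pow2_ge_0|].
    apply Rmult_le_reg_r with (x + 1); [lra|]. unfold Rdiv. rewrite Rmult_assoc, Rinv_l; lra.
  - intros n. pose proof (INR_S_pos n) as P. apply Rinv_0_lt_compat in P. lra.
Qed.

(** The powers of negative exponent, as powers of the inverse. *)
Definition pw (k : nat) (z : C) : C := (/ z) ^ k.

Lemma Cmod_pw k (z : C) : z <> 0 -> Cmod (pw k z) = (/ Cmod z) ^ k.
Proof. intros H. unfold pw. now rewrite Cmod_pow, Cmod_inv. Qed.

Lemma pw_bound k z r : 0 < r -> r <= Cmod z -> Cmod (pw k z) <= (/ r) ^ k.
Proof.
  intros Hr H. rewrite Cmod_pw by (apply Cmod_gt_0; lra).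
  apply pow_incr. split; [apply Rlt_le, Rinv_0_lt_compat; lra|apply Rinv_le_contravar; lra].
Qed.

Lemma pw_half k (z : C) : z <> 0 -> pw k (z / 2)%C = (2 ^ k * pw k z)%C.
Proof.
  intros H. unfold pw. rewrite <- Cpow_mult_l. f_equal. field. auto.
Qed.

(** The terms of index [n + 1] and [- (n + 1)] of the sum of [(z + n) ^ (- k)] over all integers. *)
Definition pf_term (k : nat) (z : C) (n : nat) : C :=
  (pw k (z + INR (S n)) + pw k (z - INR (S n)))%C.

Definition pf (k : nat) (z : C) : C := (pw k z + CSeries (pf_term k z))%C.

(** A box between two neighbouring integers; it is stable under the two maps [z / 2] and
    [(z + 1) / 2] of the doubling formula. *)
Definition inQ (Y : R) (z : C) : Prop :=
  0 <= Re z <= 1 /\ 0 <= Im z <= Y /\ z <> 0 /\ z <> 1.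

Lemma Cmod_Re_lower z r : r <= Rabs (Re z) -> r <= Cmod z.
Proof. intros H. eapply Rle_trans; [apply H|apply re_le_Cmod]. Qed.

Lemma inQ_plus_neq0 Y z n : inQ Y z -> (z + INR n)%C <> 0.
Proof.
  intros (H1 & H2 & H3 & H4) E.
  assert (Er : Re z + INR n = 0) by (apply (f_equal Re) in E; exact E).
  assert (Ei : Im z = 0) by (apply (f_equal Im) in E; simpl in E; unfold Im in *; simpl in *; lra).
  pose proof (pos_INR n). apply H3. destruct z as [x y]; unfold Re, Im in *; simpl in *.
  unfold RtoC. f_equal; lra.
Qed.

Lemma inQ_minus_neq0 Y z n : inQ Y z -> (z - INR (S n))%C <> 0.
Proof.
  intros (H1 & H2 & H3 & H4) E.
  assert (Er : Re z - INR (S n) = 0) by (apply (f_equal Re) in E; exact E).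
  assert (Ei : Im z = 0) by (apply (f_equal Im) in E; simpl in E; unfold Im in *; simpl in *; lra).
  rewrite S_INR in Er. pose proof (pos_INR n). apply H4.
  destruct z as [x y]; unfold Re, Im in *; simpl in *.
  unfold RtoC. f_equal; lra.
Qed.

Lemma inv_pow_ge2 x k : (2 <= k)%nat -> 1 <= x -> (/ x) ^ k <= (/ x) ^ 2.
Proof.
  intros Hk Hx. replace k with ((k - 2) + 2)%nat by lia. rewrite pow_add.
  rewrite <- (Rmult_1_l ((/ x) ^ 2)) at 2. apply Rmult_le_compat_r; [apply pow2_ge_0|].
  rewrite <- (pow1 (k - 2)). apply pow_incr. split; [apply Rlt_le, Rinv_0_lt_compat; lra|].
  rewrite <- Rinv_1. apply Rinv_le_contravar; lra.
Qed.

Lemma pf_tail_bound k z n : (2 <= k)%nat -> 0 <= Re z <= 1 ->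
  Cmod (pf_term k z (S n)) <= 2 * (/ INR (S n)) ^ 2.
Proof.
  intros Hk Hz. unfold pf_term. pose proof (INR_S_pos n) as P.
  assert (1 <= INR (S n)) by (rewrite S_INR; pose proof (pos_INR n); lra).
  eapply Rle_trans; [apply Cmod_triangle|].
  assert (B1 : Cmod (pw k (z + INR (S (S n)))) <= (/ INR (S n)) ^ 2).
  { eapply Rle_trans; [apply (pw_bound k _ (INR (S n))); auto|now apply inv_pow_ge2].
    apply Cmod_Re_lower. replace (Re (z + INR (S (S n)))) with (Re z + INR (S (S n))) by reflexivity.
    rewrite (S_INR (S n)), Rabs_pos_eq; lra. }
  assert (B2 : Cmod (pw k (z - INR (S (S n)))) <= (/ INR (S n)) ^ 2).
  { eapply Rle_trans; [apply (pw_bound k _ (INR (S n))); auto|now apply inv_pow_ge2].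
    apply Cmod_Re_lower. replace (Re (z - INR (S (S n)))) with (Re z - INR (S (S n))) by reflexivity.
    rewrite (S_INR (S n)), Rabs_left1; lra. }
  lra.
Qed.

Lemma pf_abs_cv k z : (2 <= k)%nat -> 0 <= Re z <= 1 -> abs_cv (pf_term k z).
Proof.
  intros Hk Hz. apply abs_cv_S. apply abs_cv_le with (fun n => 2 * (/ INR (S n)) ^ 2).
  - intros n. now apply pf_tail_bound.
  - apply (ex_series_scal_l (V := R_NormedModule)), ex_series_inv_sq.
Qed.

Lemma inQ_half Y z : inQ Y z -> inQ Y (z / 2)%C /\ inQ Y ((z + 1) / 2)%C.
Proof.
  intros (H1 & H2 & H3 & H4).
  assert (E : forall w : C, Re (w / 2) = Re w / 2 /\ Im (w / 2) = Im w / 2).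
  { intros w. replace (w / 2)%C with (RtoC (/ 2) * w)%C.
    - destruct w; unfold Re, Im; simpl. split; field.
    - rewrite RtoC_inv by lra. unfold Cdiv. ring. }
  destruct (E z) as [E1 E2]. destruct (E (z + 1)%C) as [E3 E4].
  replace (Re (z + 1)) with (Re z + 1) in E3 by reflexivity.
  replace (Im (z + 1)) with (Im z) in E4 by (unfold Im; simpl; ring).
  assert (M : forall w : C, ((w / 2) * 2 = w)%C) by (intros; field).
  unfold inQ. rewrite E1, E2, E3, E4. repeat split; try lra; intros X.
  - apply H3. rewrite <- (M z), X. ring.
  - apply (f_equal Re) in X. rewrite E1 in X. simpl in X. lra.
  - apply (f_equal Re) in X. rewrite E3 in X. simpl in X. lra.
  - apply H4. replace z with ((z + 1) / 2 * 2 - 1)%C by field. rewrite X. ring.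
Qed.

(** The even and the odd translates of [z / 2] make up all translates of [z]. *)
Lemma pf_doubling_csum k Y z M : inQ Y z ->
  ((pw k (z / 2) + csum (pf_term k (z / 2)) M) +
   (pw k ((z + 1) / 2) + csum (pf_term k ((z + 1) / 2)) M) =
   2 ^ k * ((pw k z + csum (pf_term k z) (2 * M)) + pw k (z + INR (S (2 * M)))))%C.
Proof.
  intros HQ.
  induction M as [|M IH].
  - simpl csum. replace (z + INR (S (2 * 0)))%C with (z + 1)%C by (simpl; ring).
    rewrite !pw_half; [ring| |apply HQ].
    exact (inQ_plus_neq0 Y z 1 HQ).
  - replace (2 * S M)%nat with (S (S (2 * M))) by lia.
    assert (CS : forall a n, csum a (S n) = (csum a n + a n)%C) by reflexivity.
    rewrite !CS.
    set (s1 := csum (pf_term k (z / 2)) M) in *. set (s2 := csum (pf_term k ((z + 1) / 2)) M) in *.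
    set (s3 := csum (pf_term k z) (2 * M)) in *.
    assert (A : (pf_term k (z / 2) M + pf_term k ((z + 1) / 2) M =
      2 ^ k * (pw k (z + INR (S (S (2 * M)))) + pw k (z - INR (S (S (2 * M)))) +
        pw k (z + INR (S (S (S (2 * M))))) + pw k (z - INR (S (2 * M)))))%C).
    { unfold pf_term.
      replace (z / 2 + INR (S M))%C with ((z + INR (S (S (2 * M)))) / 2)%C.
      2:{ rewrite !S_INR, mult_INR. replace (INR 2) with 2 by (simpl; ring).
          rewrite !RtoC_plus, RtoC_mult. field. }
      replace (z / 2 - INR (S M))%C with ((z - INR (S (S (2 * M)))) / 2)%C.
      2:{ rewrite !S_INR, mult_INR. replace (INR 2) with 2 by (simpl; ring).
          rewrite !RtoC_plus, RtoC_mult. field. }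
      replace ((z + 1) / 2 + INR (S M))%C with ((z + INR (S (S (S (2 * M))))) / 2)%C.
      2:{ rewrite !S_INR, mult_INR. replace (INR 2) with 2 by (simpl; ring).
          rewrite !RtoC_plus, RtoC_mult. field. }
      replace ((z + 1) / 2 - INR (S M))%C with ((z - INR (S (2 * M))) / 2)%C.
      2:{ rewrite !S_INR, mult_INR. replace (INR 2) with 2 by (simpl; ring).
          rewrite !RtoC_plus, RtoC_mult. field. }
      rewrite !pw_half; try (eapply inQ_minus_neq0; eassumption); try (eapply inQ_plus_neq0; eassumption).
      ring. }
    transitivity ((pw k (z / 2) + s1 + (pw k ((z + 1) / 2) + s2))
      + (pf_term k (z / 2) M + pf_term k ((z + 1) / 2) M))%C; [ring|].
    rewrite IH, A. unfold pf_term. ring.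
Qed.

Lemma is_lim_inv_INR : is_lim_seq (fun n => / INR (S n)) 0.
Proof.
  apply is_lim_seq_spec. intros eps. destruct (archimed_cor1 eps (cond_pos eps)) as [N [H1 H2]].
  exists N. intros n Hn. rewrite Rminus_0_r, Rabs_pos_eq.
  - eapply Rle_lt_trans; [|apply H1]. apply Rinv_le_contravar; [now apply lt_0_INR|].
    apply le_INR. lia.
  - apply Rlt_le, Rinv_0_lt_compat, INR_S_pos.
Qed.

Lemma pf_doubling k Y z : (2 <= k)%nat -> inQ Y z ->
  (2 ^ k * pf k z = pf k (z / 2) + pf k ((z + 1) / 2))%C.
Proof.
  intros Hk HQ. destruct (inQ_half Y z HQ) as [Q1 Q2].
  assert (L : forall z, inQ Y z -> is_Clim (fun M => pw k z + csum (pf_term k z) M)%C (pf k z)).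
  { intros u Hu. apply is_Clim_plus; [apply is_Clim_const|]. apply CSeries_lim, pf_abs_cv; auto.
    apply Hu. }
  eapply is_Clim_unique; [|apply (is_Clim_plus _ _ _ _ (L _ Q1) (L _ Q2))].
  eapply is_Clim_ext; [intros n; symmetry; apply (pf_doubling_csum k Y z n HQ)|].
  apply is_Clim_scal. rewrite <- (Cplus_0_r (pf k z)). apply is_Clim_plus.
  - apply (is_Clim_subseq (fun M => pw k z + csum (pf_term k z) M)%C _ (fun n => (2 * n)%nat)).
    + intros; lia.
    + now apply L.
  - apply is_Clim_0_le with (fun n => / INR (S n)); [|apply is_lim_inv_INR].
    intros n. pose proof (INR_S_pos n) as P.
    assert (1 <= INR (S n)) by (rewrite S_INR; pose proof (pos_INR n); lra).
    eapply Rle_trans; [apply (pw_bound k _ (INR (S n))); auto|].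
    + apply Cmod_Re_lower. replace (Re (z + INR (S (2 * n)))) with (Re z + INR (S (2 * n))) by reflexivity.
      destruct HQ as [HQ _]. rewrite Rabs_pos_eq by (pose proof (pos_INR (S (2 * n))); lra).
      assert (INR (S n) <= INR (S (2 * n))) by (apply le_INR; lia). lra.
    + eapply Rle_trans; [now apply inv_pow_ge2|].
      replace ((/ INR (S n)) ^ 2) with (/ INR (S n) * / INR (S n)) by ring.
      assert (/ INR (S n) <= 1) by (rewrite <- Rinv_1; apply Rinv_le_contravar; lra).
      apply Rinv_0_lt_compat in P. nra.
Qed.

(** The weight that measures a difference of two functions with pole of order [k] at the integers,
    once their leading terms have cancelled. *)
Definition wt (k : nat) (z : C) : R := (/ Cmod z) ^ (k - 2).

Lemma wt_pos k (z : C) : z <> 0 -> 0 <= wt k z.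
Proof. intros H. apply pow_le, Rlt_le, Rinv_0_lt_compat. now apply Cmod_gt_0. Qed.

Lemma wt_half k (z : C) : z <> 0 -> wt k (z / 2)%C = 2 ^ (k - 2) * wt k z.
Proof.
  intros H. unfold wt. rewrite <- Rpow_mult_distr. f_equal.
  assert (H2 : RtoC 2 <> 0) by (intros E; apply RtoC_inj in E; lra).
  rewrite Cmod_div, Cmod_R, Rabs_pos_eq by (auto; lra). apply Cmod_gt_0 in H. field. lra.
Qed.

Lemma wt_le k (z z' : C) : z <> 0 -> Cmod z <= Cmod z' -> wt k z' <= wt k z.
Proof.
  intros H L. apply Cmod_gt_0 in H. apply pow_incr. split.
  - apply Rlt_le, Rinv_0_lt_compat; lra.
  - apply Rinv_le_contravar; lra.
Qed.

Lemma Cmod_le_Re z z' : Im z = Im z' -> Rabs (Re z) <= Rabs (Re z') -> Cmod z <= Cmod z'.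
Proof.
  intros H1 H2. apply Rsqr_incr_0; try apply Cmod_ge_0. rewrite !Rsqr_pow2, !Cmod2_alt, H1.
  apply Rplus_le_compat_r. rewrite <- !(pow2_abs (Re _)). apply pow_incr. split; auto using Rabs_pos.
Qed.

(** Two functions with the same doubling formula and the same polar part at the integers
    agree: the doubling formula at least halves the weighted size of the difference. *)
Theorem Herglotz (k : nat) (g : C -> C) (Y : R) : (2 <= k)%nat -> 0 <= Y ->
  (forall z, inQ Y z -> (2 ^ k * g z = g (z / 2) + g ((z + 1) / 2))%C) ->
  (forall z, g (z - 1)%C = g z) ->
  (exists K, forall z : C, z <> 0 -> Rabs (Re z) <= 1 / 2 -> 0 <= Im z <= Y ->
     Cmod (pw k z - g z) <= K * wt k z) ->
  forall z, inQ Y z -> pf k z = g z.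
Proof.
  intros Hk HY Hg Hper [K0 HK0].
  set (K := Rabs K0). assert (HK : 0 <= K) by apply Rabs_pos.
  assert (HKb : forall z : C, z <> 0 -> Rabs (Re z) <= 1 / 2 -> 0 <= Im z <= Y ->
     Cmod (pw k z - g z) <= K * wt k z).
  { intros z Z1 Z2 Z3. eapply Rle_trans; [now apply HK0|]. apply Rmult_le_compat_r; [now apply wt_pos|].
    apply Rle_abs. }
  set (W := fun z => wt k z + wt k (z - 1)%C).
  set (T := Series (fun n => 2 * (/ INR (S n)) ^ 2)).
  set (B := 1 + 2 ^ k + Rabs T).
  assert (HB : 0 <= B).
  { unfold B. pose proof (Rabs_pos T). pose proof (pow_le 2 k ltac:(lra)). lra. }
  set (c := (/ (2 + Y)) ^ (k - 2)).
  assert (Hc : 0 < c) by (apply pow_lt, Rinv_0_lt_compat; lra).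
  assert (Hz1 : forall z, inQ Y z -> (z - 1)%C <> 0).
  { intros z Hz. apply (inQ_minus_neq0 Y z O Hz). }
  assert (Wc : forall z, inQ Y z -> c <= W z).
  { intros z Hz. unfold W. pose proof (Hz1 z Hz) as N. destruct Hz as (Q1 & Q2 & Q3 & Q4).
    pose proof (wt_pos k _ N). assert (c <= wt k z); [|lra].
    apply pow_incr. apply Cmod_gt_0 in Q3. split; [apply Rlt_le, Rinv_0_lt_compat; lra|].
    apply Rinv_le_contravar; auto. eapply Rle_trans; [apply Cmod_le_sum|]. rewrite !Rabs_pos_eq; lra. }
  (* a first bound for the difference, to be improved by the doubling formula *)
  set (K1 := K + B / c).
  assert (HK1 : 0 <= K1) by (unfold K1; pose proof (Rdiv_le_0_compat B c HB Hc); lra).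
  assert (Bound0 : forall z, inQ Y z -> Cmod (pf k z - g z) <= K1 * W z).
  { intros z Hz. pose proof (Hz1 z Hz) as N. pose proof (Wc z Hz) as Wz.
    pose proof (inQ_plus_neq0 Y z 1 Hz) as N1.
    destruct Hz as (Q1 & Q2 & Q3 & Q4).
    assert (Main : exists a : C, pf k z = (a + CSeries (fun n => pf_term k z (S n)))%C /\
       Cmod (a - g z) <= K * W z + (1 + 2 ^ k)).
    { exists (pw k z + (pw k (z + INR 1) + pw k (z - INR 1)))%C. split.
      { unfold pf. rewrite CSeries_S by (apply pf_abs_cv; auto). unfold pf_term at 1. ring. }
      simpl INR. simpl INR in N1.
      assert (P1 : Cmod (pw k (z + 1)) <= 1).
      { eapply Rle_trans; [apply (pw_bound k _ 1); [lra|]|rewrite Rinv_1, pow1; lra].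
        apply Cmod_Re_lower.
        replace (Re (z + 1)) with (Re z + 1) by reflexivity. rewrite Rabs_pos_eq; lra. }
      pose proof (wt_pos k z Q3). pose proof (wt_pos k _ N).
      destruct (Rle_dec (Re z) (1 / 2)) as [L|L].
      - assert (P2 : Cmod (pw k (z - 1)) <= 2 ^ k).
        { eapply Rle_trans; [apply (pw_bound k _ (1 / 2)); [lra|]|right; f_equal; field].
          apply Cmod_Re_lower.
          replace (Re (z - 1)) with (Re z - 1) by reflexivity. rewrite Rabs_left1; lra. }
        specialize (HKb z Q3 ltac:(rewrite Rabs_pos_eq; lra) Q2).
        replace (pw k z + (pw k (z + 1) + pw k (z - 1)) - g z)%C
          with ((pw k z - g z) + (pw k (z + 1) + pw k (z - 1)))%C by ring.
        pose proof (Cmod_triangle (pw k z - g z) (pw k (z + 1) + pw k (z - 1))).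
        pose proof (Cmod_triangle (pw k (z + 1)) (pw k (z - 1))).
        unfold W. assert (0 <= K * wt k (z - 1)%C) by (apply Rmult_le_pos; auto). lra.
      - assert (P2 : Cmod (pw k z) <= 2 ^ k).
        { eapply Rle_trans; [apply (pw_bound k _ (1 / 2)); [lra|]|right; f_equal; field].
          apply Cmod_Re_lower.
          rewrite Rabs_pos_eq; lra. }
        specialize (HKb (z - 1)%C N). rewrite Hper in HKb.
        replace (Re (z - 1)) with (Re z - 1) in HKb by reflexivity.
        replace (Im (z - 1)) with (Im z) in HKb by (unfold Im; simpl; ring).
        specialize (HKb ltac:(rewrite Rabs_left1; lra) Q2).
        replace (pw k z + (pw k (z + 1) + pw k (z - 1)) - g z)%C
          with ((pw k (z - 1) - g z) + (pw k (z + 1) + pw k z))%C by ring.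
        pose proof (Cmod_triangle (pw k (z - 1) - g z) (pw k (z + 1) + pw k z)).
        pose proof (Cmod_triangle (pw k (z + 1)) (pw k z)).
        unfold W. assert (0 <= K * wt k z) by (apply Rmult_le_pos; auto). lra. }
    destruct Main as [a [Ea Ba]]. rewrite Ea.
    assert (Tb : Cmod (CSeries (fun n => pf_term k z (S n))) <= Rabs T).
    { eapply Rle_trans; [|apply Rle_abs]. apply CSeries_bound_le.
      - intros n. now apply pf_tail_bound.
      - apply (ex_series_scal_l (V := R_NormedModule)), ex_series_inv_sq. }
    replace (a + CSeries (fun n => pf_term k z (S n)) - g z)%C
      with ((a - g z) + CSeries (fun n => pf_term k z (S n)))%C by ring.
    pose proof (Cmod_triangle (a - g z) (CSeries (fun n => pf_term k z (S n)))).
    assert (B <= B / c * W z).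
    { apply Rle_trans with (B / c * c); [right; field; lra|].
      apply Rmult_le_compat_l; auto. now apply Rdiv_le_0_compat. }
    unfold K1. rewrite Rmult_plus_distr_r. unfold B in *. lra. }
  assert (Wh : forall z, inQ Y z -> W (z / 2)%C + W ((z + 1) / 2)%C <= 2 ^ k / 2 * W z).
  { intros z Hz. pose proof (Hz1 z Hz) as N. pose proof (inQ_plus_neq0 Y z 1 Hz) as N1. simpl INR in N1.
    pose proof (inQ_minus_neq0 Y z 1 Hz) as N2. replace (INR 2) with 2 in N2 by (simpl; ring).
    destruct Hz as (Q1 & Q2 & Q3 & Q4).
    unfold W. replace (z / 2 - 1)%C with ((z - 2) / 2)%C by field.
    replace ((z + 1) / 2 - 1)%C with ((z - 1) / 2)%C by field.
    rewrite !wt_half by auto.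
    assert (I1 : wt k (z - 2)%C <= wt k (z - 1)%C).
    { apply wt_le; auto. apply Cmod_le_Re; [unfold Im; simpl; ring|].
      replace (Re (z - 1)) with (Re z - 1) by reflexivity.
      replace (Re (z - 2)) with (Re z - 2) by reflexivity. rewrite !Rabs_left1; lra. }
    assert (I2 : wt k (z + 1)%C <= wt k z).
    { apply wt_le; auto. apply Cmod_le_Re; [unfold Im; simpl; ring|].
      replace (Re (z + 1)) with (Re z + 1) by reflexivity. rewrite !Rabs_pos_eq; lra. }
    replace (2 ^ k / 2) with (2 ^ (k - 2) * 2).
    - pose proof (pow_lt 2 (k - 2) ltac:(lra)). nra.
    - replace k with ((k - 2) + 2)%nat at 2 by lia. rewrite pow_add. simpl. field. }
  assert (It : forall n z, inQ Y z -> Cmod (pf k z - g z) <= K1 * W z * (/ 2) ^ n).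
  { induction n as [|n IH]; intros z Hz; [simpl; rewrite Rmult_1_r; now apply Bound0|].
    destruct (inQ_half Y z Hz) as [Z1 Z2].
    pose proof (IH _ Z1) as I1. pose proof (IH _ Z2) as I2.
    pose proof (pow_lt 2 k ltac:(lra)) as P2.
    assert (E : (2 ^ k * (pf k z - g z) = (pf k (z / 2) - g (z / 2)) + (pf k ((z + 1) / 2) - g ((z + 1) / 2)))%C).
    { transitivity (2 ^ k * pf k z - 2 ^ k * g z)%C; [ring|].
      rewrite Hg, (pf_doubling k Y) by auto. ring. }
    apply (f_equal Cmod) in E. rewrite Cmod_mult, Cmod_pow, Cmod_R, (Rabs_pos_eq 2) in E by lra.
    pose proof (Cmod_triangle (pf k (z / 2) - g (z / 2)%C) (pf k ((z + 1) / 2) - g ((z + 1) / 2)%C)).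
    apply Rmult_le_reg_l with (2 ^ k); auto. rewrite E.
    pose proof (Wh z Hz) as Wz. pose proof (pow_lt (/ 2) n ltac:(lra)) as P3.
    apply Rle_trans with (K1 * (W (z / 2)%C + W ((z + 1) / 2)%C) * (/ 2) ^ n); [lra|].
    apply Rle_trans with (K1 * (2 ^ k / 2 * W z) * (/ 2) ^ n).
    - apply Rmult_le_compat_r; [lra|]. apply Rmult_le_compat_l; auto.
    - right. simpl. field. }
  intros z Hz. apply Ceq_minus, Cmod_eq_0, Rle_antisym; [|apply Cmod_ge_0].
  assert (L : is_lim_seq (fun n => K1 * W z * (/ 2) ^ n) 0).
  { replace (Finite 0) with (Rbar_mult (K1 * W z) 0) by (simpl; f_equal; ring).
    apply is_lim_seq_scal_l, is_lim_seq_geom. rewrite Rabs_pos_eq; lra. }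
  apply (is_lim_seq_le (fun _ => Cmod (pf k z - g z)) _ (Cmod (pf k z - g z)) 0 (fun n => It n z Hz)); auto.
  apply is_lim_seq_const.
Qed.

(** ** The weights 2 and 4 *)

Lemma RtoC_neq0 x : x <> 0 -> RtoC x <> 0.
Proof. intros H E. apply RtoC_inj in E. auto. Qed.

Ltac rne := apply RtoC_neq0; pose proof PI_RGT_0; let X := fresh in intros X; lra.

Lemma Cmod_plus_le a b A B : Cmod a <= A -> Cmod b <= B -> Cmod (a + b) <= A + B.
Proof. intros. eapply Rle_trans; [apply Cmod_triangle|lra]. Qed.

Lemma Cmod_minus_le a b A B : Cmod a <= A -> Cmod b <= B -> Cmod (a - b) <= A + B.
Proof. intros. apply Cmod_plus_le; auto. now rewrite Cmod_opp. Qed.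

Lemma Cmod_mult_le a b A B : Cmod a <= A -> Cmod b <= B -> Cmod (a * b) <= A * B.
Proof. intros. rewrite Cmod_mult. apply Rmult_le_compat; auto using Cmod_ge_0. Qed.

Lemma Cmod_R_le x : Cmod (RtoC x) <= Rabs x.
Proof. rewrite Cmod_R. lra. Qed.

Lemma exp_mono x y : x <= y -> exp x <= exp y.
Proof. intros [H|H]; [left; now apply exp_increasing|right; now rewrite H]. Qed.

(** The mean value inequality, three times. *)
Lemma Cexp_taylor w : Cmod (Cexp w - 1 - w - w * w / 2) <= 8 * exp (Cmod w) * Cmod w ^ 3.
Proof.
  set (E := exp (Cmod w)). assert (HE : 0 < E) by apply exp_pos.
  pose proof (Cmod_ge_0 w) as Hw.
  assert (Seg : forall u t, Cmod u <= Cmod w -> 0 <= t <= 1 -> Cmod (0 + RtoC t * (u - 0)) <= Cmod u).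
  { intros u t Hu Ht. replace (0 + t * (u - 0))%C with (RtoC t * u)%C by ring.
    rewrite Cmod_mult, Cmod_R, Rabs_pos_eq by lra. pose proof (Cmod_ge_0 u). nra. }
  assert (B1 : forall u, Cmod u <= Cmod w -> Cmod (Cexp u - 1) <= 2 * E * Cmod u).
  { intros u Hu. rewrite <- Cexp_0 at 1. replace (Cmod u) with (Cmod (u - 0)) at 1 by (f_equal; ring).
    apply (derive_bound Cexp Cexp 0 u E).
    - intros; apply CD_Cexp.
    - intros t Ht. rewrite Cmod_Cexp. specialize (Seg u t Hu Ht).
      apply exp_mono. pose proof (re_le_Cmod (0 + RtoC t * (u - 0))) as R1.
      pose proof (Rle_abs (Re (0 + RtoC t * (u - 0)))). lra. }
  assert (B2 : forall u, Cmod u <= Cmod w -> Cmod (Cexp u - 1 - u) <= 4 * E * Cmod u * Cmod u).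
  { intros u Hu.
    assert (K : Cmod ((Cexp u - u) - (Cexp 0 - 0)) <= 2 * (2 * E * Cmod u) * Cmod (u - 0)).
    { apply (derive_bound (fun u => Cexp u - u)%C (fun u => Cexp u - 1)%C 0 u).
      - intros. apply CD_minus; [apply CD_Cexp|apply CD_id].
      - intros t Ht. specialize (Seg u t Hu Ht). eapply Rle_trans; [apply B1; lra|].
        apply Rmult_le_compat_l; lra. }
    rewrite Cexp_0 in K. replace (Cexp u - u - (1 - 0))%C with (Cexp u - 1 - u)%C in K by ring.
    replace (u - 0)%C with u in K by ring. lra. }
  assert (K : Cmod ((Cexp w - w - w * w / 2) - (Cexp 0 - 0 - 0 * 0 / 2))
     <= 2 * (4 * E * Cmod w * Cmod w) * Cmod (w - 0)).
  { apply (derive_bound (fun u => Cexp u - u - u * u / 2)%C (fun u => Cexp u - 1 - u)%C 0 w).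
    - intros t _. eapply CD_eq; [apply CD_minus; [apply CD_minus; [apply CD_Cexp|apply CD_id]|];
        apply CD_div; [apply CD_mult; apply CD_id|apply (CD_const 2)|rne]|reflexivity|].
      cbv beta. field.
    - intros t Ht. specialize (Seg w t (Rle_refl _) Ht).
      set (v := (0 + RtoC t * (w - 0))%C) in *. pose proof (Cmod_ge_0 v).
      eapply Rle_trans; [apply B2; lra|]. apply Rmult_le_compat; try lra.
      + apply Rmult_le_pos; lra.
      + apply Rmult_le_compat_l; lra. }
  rewrite Cexp_0 in K. replace (Cexp w - w - w * w / 2 - (1 - 0 - 0 * 0 / 2))%C
    with (Cexp w - 1 - w - w * w / 2)%C in K by field.
  replace (w - 0)%C with w in K by ring. simpl. lra.
Qed.

Lemma sin_ge_quarter x : 0 <= x <= PI / 2 -> x / 4 <= sin x.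
Proof.
  intros Hx. pose proof PI_RGT_0 as HP. pose proof PI_4 as HP4.
  destruct (Rle_dec x (PI / 3)) as [H|H].
  - destruct (Req_dec x 0) as [->|N]; [rewrite sin_0; lra|].
    destruct (MVT_gen sin 0 x cos) as [c [Hc E]].
    + intros y _. apply is_derive_sin.
    + intros y _. apply continuity_pt_filterlim, continuous_sin.
    + rewrite Rmin_left, Rmax_right in Hc by lra. rewrite sin_0, !Rminus_0_r in E.
      assert (1 / 2 <= cos c) by (rewrite <- cos_PI3; apply cos_decr_1; lra).
      rewrite E. nra.
  - assert (1 / 2 <= sin x); [|lra].
    rewrite <- sin_PI6. apply sin_incr_1; lra.
Qed.

Lemma one_minus_cos_ge v : Rabs v <= PI -> v * v / 32 <= 1 - cos v.
Proof.
  intros Hv.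
  assert (K : forall x, 0 <= x <= PI -> x * x / 32 <= 1 - cos x).
  { intros x Hx. pose proof (sin_ge_quarter (x / 2) ltac:(lra)) as S.
    replace x with (2 * (x / 2)) at 3 by field. rewrite cos_2a_sin. nra. }
  destruct (Rcase_abs v) as [H|H].
  - rewrite Rabs_left in Hv by auto. specialize (K (- v) ltac:(lra)). rewrite cos_neg in K. lra.
  - rewrite Rabs_right in Hv by auto. apply K. lra.
Qed.

(** A lower bound for the denominators of [lip2] and [lip4] that is linear in the distance to the
    integers. *)
Lemma one_minus_Cexp_lower w U : - U <= Re w <= 0 -> Rabs (Im w) <= PI ->
  exp (- U) / 4 * Cmod w <= Cmod (1 - Cexp w).
Proof.
  destruct w as [u v]. unfold Re, Im; simpl fst; simpl snd. intros Hu Hv.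
  pose proof (exp_pos (- U)) as E1.
  apply Rsqr_incr_0; [|apply Rmult_le_pos; [lra|apply Cmod_ge_0]|apply Cmod_ge_0].
  rewrite Rsqr_mult, !Rsqr_pow2, !Cmod2_alt. unfold Cexp, Re, Im; simpl fst; simpl snd.
  replace (Rsqr (exp (- U) / 4)) with (exp (- U) * exp (- U) / 16) by (unfold Rsqr; field).
  pose proof (one_minus_cos_ge v Hv) as C1. pose proof (sin2_cos2 v) as SC. unfold Rsqr in SC.
  assert (E2 : exp (- U) <= exp u <= 1).
  { split; [apply exp_mono; lra|]. rewrite <- exp_0. apply exp_mono; lra. }
  assert (E3 : exp (- U) * (- u) <= 1 - exp u).
  { pose proof (exp_ineq1_le (- u)) as I. apply (Rmult_le_compat_l (exp u)) in I; [|lra].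
    rewrite <- exp_plus in I. replace (u + - u) with 0 in I by ring. rewrite exp_0 in I.
    assert (exp (- U) * (- u) <= exp u * (- u)) by (apply Rmult_le_compat_r; lra). lra. }
  set (a := exp (- U)) in *. set (e := exp u) in *.
  replace ((1 + - (e * cos v)) ^ 2 + (0 + - (e * sin v)) ^ 2)
    with ((1 - e) ^ 2 + 2 * e * (1 - cos v) + e * e * (sin v * sin v + cos v * cos v - 1)) by ring.
  rewrite SC.
  assert (0 <= a * - u) by (apply Rmult_le_pos; lra).
  assert (A1 : (a * u) ^ 2 <= (1 - e) ^ 2).
  { replace ((a * u) ^ 2) with ((a * - u) ^ 2) by ring. apply pow_incr. lra. }
  assert (A2 : a * (v * v / 32) <= e * (1 - cos v)).
  { apply Rmult_le_compat; try lra. nra. }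
  assert (A3 : a * a * (v * v) <= a * (v * v)).
  { apply Rmult_le_compat_r; nra. }
  assert (0 <= (a * u) ^ 2) by apply pow2_ge_0.
  nra.
Qed.

(** The right sides of Lipschitz' formulas, that is [(2 pi i) ^ k / (k - 1)!] times the sum of
    [n ^ (k - 1) q ^ n], for [k = 2] here and [k = 4] below. *)
Definition lip2 (z : C) : C := ((2 * PI * Ci) ^ 2 * (qpar z / (1 - qpar z) ^ 2))%C.

Definition lip4 (z : C) : C :=
  ((2 * PI * Ci) ^ 4 / 6 * (qpar z * (1 + 4 * qpar z + qpar z ^ 2) / (1 - qpar z) ^ 4))%C.

Lemma qpar_half : qpar (1 / 2)%C = (- (1))%C.
Proof.
  unfold qpar. replace (2 * PI * Ci * (1 / 2))%C with (RtoC PI * Ci)%C by field.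
  unfold Cexp, Re, Im; simpl. replace (PI * 0 - 0 * 1) with 0 by ring.
  replace (PI * 1 + 0 * 0) with PI by ring. rewrite exp_0, cos_PI, sin_PI.
  unfold Copp, RtoC; simpl. f_equal; ring.
Qed.

Lemma qpar_neq1 Y z : inQ Y z -> qpar z <> 1.
Proof.
  intros HQ E. rewrite <- (qpar_int 0) in E. destruct (qpar_eq _ _ E) as [n Hn].
  rewrite Cplus_0_l in Hn.
  destruct (Z_le_gt_dec n 0) as [H|H].
  - apply (inQ_plus_neq0 Y z (Z.to_nat (- n)) HQ). rewrite INR_IZR_INZ, Z2Nat.id, opp_IZR, RtoC_opp, Hn by lia.
    ring.
  - apply (inQ_minus_neq0 Y z (Z.to_nat (n - 1)) HQ).
    rewrite S_INR, INR_IZR_INZ, Z2Nat.id, minus_IZR, Hn by lia.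
    rewrite RtoC_plus, RtoC_minus. ring.
Qed.

Lemma qpar_sub1 z : qpar (z - 1)%C = qpar z.
Proof.
  replace (z - 1)%C with (z + RtoC (IZR (-1)))%C by (simpl; ring || (rewrite RtoC_opp; ring)).
  rewrite qpar_add, qpar_int. ring.
Qed.

Lemma qpar_halves Y z : inQ Y z -> exists r,
  qpar (z / 2)%C = r /\ qpar ((z + 1) / 2)%C = (- r)%C /\ qpar z = (r * r)%C /\
  (1 - r <> 0)%C /\ (1 + r <> 0)%C.
Proof.
  intros HQ. destruct (inQ_half Y z HQ) as [Q1 Q2]. exists (qpar (z / 2)).
  assert (E2 : qpar ((z + 1) / 2)%C = (- qpar (z / 2))%C).
  { replace ((z + 1) / 2)%C with (z / 2 + 1 / 2)%C by field. rewrite qpar_add, qpar_half. ring. }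
  repeat split; auto.
  - rewrite <- qpar_add. f_equal. field.
  - intros E. apply (qpar_neq1 _ _ Q1). replace (qpar (z / 2)) with (1 - (1 - qpar (z / 2)))%C by ring.
    rewrite E. ring.
  - intros E. apply (qpar_neq1 _ _ Q2). rewrite E2.
    replace (- qpar (z / 2))%C with (1 - (1 + qpar (z / 2)))%C by ring. rewrite E. ring.
Qed.

Lemma lip2_doubling Y z : inQ Y z -> (2 ^ 2 * lip2 z = lip2 (z / 2) + lip2 ((z + 1) / 2))%C.
Proof.
  intros HQ. destruct (qpar_halves Y z HQ) as (r & E1 & E2 & E3 & N1 & N2).
  unfold lip2. rewrite E1, E2, E3. field. repeat split; auto.
  - replace (1 - - r)%C with (1 + r)%C by ring. auto.
  - replace (1 - r * r)%C with ((1 - r) * (1 + r))%C by ring. now apply Cmult_neq_0.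
Qed.

Lemma lip4_doubling Y z : inQ Y z -> (2 ^ 4 * lip4 z = lip4 (z / 2) + lip4 ((z + 1) / 2))%C.
Proof.
  intros HQ. destruct (qpar_halves Y z HQ) as (r & E1 & E2 & E3 & N1 & N2).
  unfold lip4. rewrite E1, E2, E3. field. repeat split; auto.
  - replace (1 - - r)%C with (1 + r)%C by ring. auto.
  - replace (1 - r * r)%C with ((1 - r) * (1 + r))%C by ring. now apply Cmult_neq_0.
Qed.

(** Near an integer the second order expansion [q = 1 + w t], with [w = 2 pi i z], controls
    the polar parts; everything below is polynomial in [w], [rho] and [1 / t]. *)
Lemma qpar_local (Y : R) : 0 <= Y -> exists W0 R0 c, 0 < c /\
  forall z : C, z <> 0 -> Rabs (Re z) <= 1 / 2 -> 0 <= Im z <= Y ->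
  exists w rho v t : C, w = (2 * PI * Ci * z)%C /\ w <> 0 /\ v = (1 / 2 + w * rho)%C /\
    t = (1 + w * v)%C /\ qpar z = (1 + w * t)%C /\ t <> 0 /\
    Cmod w <= W0 /\ Cmod rho <= R0 /\ Cmod (/ t) <= c.
Proof.
  intros HY. pose proof PI_RGT_0 as HP.
  set (U := 2 * PI * Y). set (W0 := U + PI).
  exists W0, (8 * exp W0), (/ (exp (- U) / 4)).
  assert (Hc : 0 < exp (- U) / 4) by (pose proof (exp_pos (- U)); lra).
  split; [now apply Rinv_0_lt_compat|].
  intros z Hz Hr Hi.
  set (w := (2 * PI * Ci * z)%C).
  assert (Hw0 : w <> 0) by (apply Cmult_neq_0; auto using TwoPiCi_neq0).
  assert (Rw : Re w = - (2 * PI * Im z)) by (unfold w, Re, Im; simpl; ring).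
  assert (Iw : Im w = 2 * PI * Re z) by (unfold w, Re, Im; simpl; ring).
  assert (Iw' : Rabs (Im w) <= PI).
  { rewrite Iw, Rabs_mult, Rabs_pos_eq by lra. nra. }
  assert (Rw' : - U <= Re w <= 0) by (rewrite Rw; unfold U; split; nra).
  assert (Hw : Cmod w <= W0).
  { eapply Rle_trans; [apply Cmod_le_sum|]. unfold W0. rewrite Rabs_left1; lra. }
  pose proof (proj1 (Cmod_gt_0 w) Hw0) as Hwp.
  set (rho := ((Cexp w - 1 - w - w * w / 2) / (w * w * w))%C).
  assert (Hw3 : (w * w * w)%C <> 0) by (apply Cmult_neq_0; [now apply Cmult_neq_0|exact Hw0]).
  exists w, rho, (1 / 2 + w * rho)%C, (1 + w * (1 / 2 + w * rho))%C.
  assert (Eq : qpar z = (1 + w * (1 + w * (1 / 2 + w * rho)))%C).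
  { unfold qpar. fold w. unfold rho. field. auto. }
  assert (Lt : exp (- U) / 4 <= Cmod (1 + w * (1 / 2 + w * rho))).
  { pose proof (one_minus_Cexp_lower w U Rw' Iw') as L.
    change (Cexp w) with (qpar z) in L. rewrite Eq in L.
    replace (1 - (1 + w * (1 + w * (1 / 2 + w * rho))))%C with (- (w * (1 + w * (1 / 2 + w * rho))))%C in L by ring.
    rewrite Cmod_opp, Cmod_mult in L. apply Rmult_le_reg_l with (Cmod w); auto. lra. }
  assert (Nt : (1 + w * (1 / 2 + w * rho))%C <> 0) by (apply Cmod_gt_0; lra).
  repeat split; auto.
  - unfold rho. rewrite Cmod_div, !Cmod_mult by auto.
    pose proof (Cexp_taylor w) as T.
    apply Rmult_le_reg_r with (Cmod w * Cmod w * Cmod w); [repeat apply Rmult_lt_0_compat; auto|].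
    unfold Rdiv. rewrite Rmult_assoc, Rinv_l, Rmult_1_r
      by (apply Rgt_not_eq; repeat apply Rmult_lt_0_compat; auto).
    eapply Rle_trans; [apply T|].
    replace (Cmod w * Cmod w * Cmod w) with (Cmod w ^ 3) by ring.
    apply Rmult_le_compat_r; [apply pow_le; lra|]. apply Rmult_le_compat_l; [lra|]. now apply exp_mono.
  - rewrite Cmod_inv by auto. now apply Rinv_le_contravar.
Qed.

Ltac cbound := repeat first [ eassumption | apply Cmod_R_le | apply Cmod_minus_le | apply Cmod_plus_le
   | apply Cmod_mult_le ].

Lemma lip2_local (Y : R) : 0 <= Y ->
  exists K, forall z : C, z <> 0 -> Rabs (Re z) <= 1 / 2 -> 0 <= Im z <= Y ->
     Cmod (pw 2 z - lip2 z) <= K * wt 2 z.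
Proof.
  intros HY. destruct (qpar_local Y HY) as (W0 & R0 & c & Hc & H).
  set (V := Rabs (1 / 2) + W0 * R0).
  eexists. intros z Hz Hr Hi.
  destruct (H z Hz Hr Hi) as (w & rho & v & t & Ew & Nw & Ev & Et & Eq & Nt & Bw & Br & Bt).
  assert (Bv : Cmod v <= V).
  { rewrite Ev. unfold V. replace (1 / 2)%C with (RtoC (1 / 2)) by (rewrite RtoC_div; auto; lra). cbound. }
  assert (Ez : pw 2 z = ((2 * PI * Ci) * (2 * PI * Ci) * (/ w * / w))%C).
  { rewrite Ew. unfold pw. field. split; auto. split; [apply Ci_nz|]. rne. }
  assert (E : (pw 2 z - lip2 z)%C
     = ((2 * PI * Ci) * (2 * PI * Ci) * ((2 * rho + v * v - v) * (/ t * / t)))%C).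
  { rewrite Ez. unfold lip2. rewrite Eq.
    replace (1 - (1 + w * t))%C with (- (w * t))%C by ring.
    transitivity ((2 * PI * Ci) * (2 * PI * Ci) * ((t * t - (1 + w * t)) / (w * w * t * t)))%C.
    { field. split; auto. }
    replace (t * t - (1 + w * t))%C with (w * w * (2 * rho + v * v - v))%C.
    - field. auto.
    - rewrite Et, Ev. field. }
  rewrite E. unfold wt. simpl. rewrite Rmult_1_r. rewrite Cmod_mult.
  apply Rmult_le_compat_l; [apply Cmod_ge_0|]. cbound.
Qed.

Lemma lip4_local (Y : R) : 0 <= Y ->
  exists K, forall z : C, z <> 0 -> Rabs (Re z) <= 1 / 2 -> 0 <= Im z <= Y ->
     Cmod (pw 4 z - lip4 z) <= K * wt 4 z.
Proof.
  intros HY. destruct (qpar_local Y HY) as (W0 & R0 & c & Hc & H).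
  set (V := Rabs (1 / 2) + W0 * R0). set (T := Rabs 1 + W0 * V).
  eexists. intros z Hz Hr Hi.
  destruct (H z Hz Hr Hi) as (w & rho & v & t & Ew & Nw & Ev & Et & Eq & Nt & Bw & Br & Bt).
  assert (Bv : Cmod v <= V).
  { rewrite Ev. unfold V. replace (1 / 2)%C with (RtoC (1 / 2)) by (rewrite RtoC_div; auto; lra). cbound. }
  assert (BT : Cmod t <= T) by (rewrite Et; unfold T; cbound).
  set (p := (2 * PI * Ci)%C) in *. assert (Np : p <> 0) by apply TwoPiCi_neq0.
  assert (Ez : pw 4 z = (p * p * (/ w * / w) * (/ z * / z))%C).
  { rewrite Ew. unfold pw. field. split; auto. }
  assert (E : (pw 4 z - lip4 z)%C
     = (p * p / 6 * (24 * rho + 6 * (v * v * (6 + 4 * (w * v) + (w * v) * (w * v))) - 12 * v - 7 * (t * t)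
          - w * (t * t * t)) * ((/ t * / t) * (/ t * / t)) * (/ z * / z))%C).
  { rewrite Ez. unfold lip4. fold p. rewrite Eq.
    replace (1 - (1 + w * t))%C with (- (w * t))%C by ring.
    transitivity (p * p / 6 * (/ z * / z) * ((6 * (t * t * t * t) - (1 + w * t) * (1 + 4 * (1 + w * t) + (1 + w * t) ^ 2))
       / (w * w * (t * t * t * t))))%C.
    { rewrite Ew. field. repeat split; auto. }
    replace (6 * (t * t * t * t) - (1 + w * t) * (1 + 4 * (1 + w * t) + (1 + w * t) ^ 2))%C
      with (w * w * (24 * rho + 6 * (v * v * (6 + 4 * (w * v) + (w * v) * (w * v))) - 12 * v - 7 * (t * t)
          - w * (t * t * t)))%C.
    - field. repeat split; auto.
    - rewrite Et, Ev. field. }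
  rewrite E. rewrite Cmod_mult.
  replace (Cmod (/ z * / z)) with (wt 4 z).
  2:{ unfold wt. simpl. rewrite Cmod_mult, Cmod_inv by auto. ring. }
  apply Rmult_le_compat_r; [now apply wt_pos|]. rewrite <- Cmult_assoc, Cmod_mult.
  apply Rmult_le_compat_l; [apply Cmod_ge_0|]. cbound.
Qed.

Theorem Lipschitz2 z Y : inQ Y z -> 0 <= Y -> pf 2 z = lip2 z.
Proof.
  intros HQ HY. apply (Herglotz 2 lip2 Y); auto.
  - intros u Hu. now apply lip2_doubling with Y.
  - intros u. unfold lip2. now rewrite qpar_sub1.
  - now apply lip2_local.
Qed.

Theorem Lipschitz4 z Y : inQ Y z -> 0 <= Y -> pf 4 z = lip4 z.
Proof.
  intros HQ HY. apply (Herglotz 4 lip4 Y); auto.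
  - intros u Hu. now apply lip4_doubling with Y.
  - intros u. unfold lip4. now rewrite qpar_sub1.
  - now apply lip4_local.
Qed.

(** * Rearrangement of real series *)

Fixpoint rsum (a : nat -> R) (n : nat) : R :=
  match n with O => 0 | S n => rsum a n + a n end.

Lemma rsum_sum_n a n : rsum a (S n) = sum_n a n.
Proof.
  induction n.
  - rewrite sum_O. simpl. ring.
  - rewrite sum_Sn, <- IHn. reflexivity.
Qed.

Lemma is_series_rsum (a : nat -> R) (l : R) : is_series a l <-> is_lim_seq (rsum a) l.
Proof.
  rewrite is_lim_seq_incr_1. split; intros H.
  - exact (is_lim_seq_ext (sum_n a) (fun n => rsum a (S n)) (Finite l)
      (fun n => eq_sym (rsum_sum_n a n)) H).
  - exact (is_lim_seq_ext (fun n => rsum a (S n)) (sum_n a) (Finite l) (rsum_sum_n a) H).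
Qed.

Lemma rsum_le_Series a n : (forall k, 0 <= a k) -> ex_series a -> rsum a n <= Series a.
Proof.
  intros Ha He. apply (is_lim_seq_incr_compare (rsum a)).
  - apply is_series_rsum. now apply Series_correct.
  - intros k. simpl. specialize (Ha k). lra.
Qed.

Lemma ex_series_bounded a B : (forall k, 0 <= a k) -> (forall n, rsum a n <= B) ->
  ex_series a /\ Series a <= B.
Proof.
  intros Ha HB.
  destruct (ex_finite_lim_seq_incr (rsum a) B) as [l Hl]; auto.
  - intros n. simpl. specialize (Ha n). lra.
  - assert (E : is_series a l) by now apply is_series_rsum.
    split; [now exists l|]. rewrite (is_series_unique _ _ E).
    apply (is_lim_seq_le (rsum a) (fun _ => B) l B); auto using is_lim_seq_const.
Qed.

Lemma Series_rsum (a : nat -> nat -> R) n : (forall k, ex_series (a k)) ->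
  ex_series (fun m => rsum (fun k => a k m) n) /\
  Series (fun m => rsum (fun k => a k m) n) = rsum (fun k => Series (a k)) n.
Proof.
  intros H. induction n as [|n [IH1 IH2]]; simpl.
  - assert (E : is_series (fun _ : nat => 0) 0).
    { apply is_series_rsum. apply (is_lim_seq_ext (fun _ => 0)); [|apply is_lim_seq_const].
      induction n; simpl; lra. }
    split; [now exists 0|now apply is_series_unique].
  - split; [now apply (ex_series_plus (V := R_NormedModule))|]. rewrite Series_plus, IH2; auto.
Qed.

(** Finitely many inner sums in one order are bounded by the total in the other order; exchange the
    roles for the opposite inequality. *)
Lemma Fubini_nonneg (a : nat -> nat -> R) : (forall m n, 0 <= a m n) ->
  (forall m, ex_series (a m)) -> ex_series (fun m => Series (a m)) ->
  (forall n, ex_series (fun m => a m n)) /\ ex_series (fun n => Series (fun m => a m n)) /\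
  Series (fun n => Series (fun m => a m n)) = Series (fun m => Series (a m)).
Proof.
  assert (K : forall a : nat -> nat -> R, (forall m n, 0 <= a m n) ->
    (forall m, ex_series (a m)) -> ex_series (fun m => Series (a m)) ->
    (forall n, ex_series (fun m => a m n)) /\ ex_series (fun n => Series (fun m => a m n)) /\
    Series (fun n => Series (fun m => a m n)) <= Series (fun m => Series (a m))).
  { clear. intros a Ha H1 H2.
    assert (Hpt : forall m n, a m n <= Series (a m)).
    { intros m n. eapply Rle_trans; [|apply (rsum_le_Series (a m) (S n)); auto]. simpl.
      assert (0 <= rsum (a m) n); [|lra]. clear -Ha. induction n; simpl; [lra|]. specialize (Ha m n). lra. }
    assert (C : forall n, ex_series (fun m => a m n)).
    { intros n. apply (ex_series_le (V := R_CompleteNormedModule) _ (fun m => Series (a m))); auto.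
      intros m. change (Rabs (a m n) <= Series (a m)). rewrite Rabs_pos_eq; auto. }
    split; auto. apply ex_series_bounded.
    - intros n. apply Series_ge_0; auto.
    - intros N. destruct (Series_rsum (fun n m => a m n) N C) as [E1 E2]. rewrite <- E2.
      apply Series_le; auto. intros m. split.
      + clear -Ha. induction N; simpl; [lra|]. specialize (Ha m N). lra.
      + now apply rsum_le_Series. }
  intros Ha H1 H2. destruct (K a Ha H1 H2) as (C & D & L). repeat split; auto.
  apply Rle_antisym; auto. apply (K (fun n m => a m n)); auto.
Qed.

Lemma Fubini (a : nat -> nat -> R) :
  (forall m, ex_series (fun n => Rabs (a m n))) -> ex_series (fun m => Series (fun n => Rabs (a m n))) ->
  (forall n, ex_series (fun m => a m n)) /\ ex_series (fun n => Series (fun m => a m n)) /\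
  Series (fun n => Series (fun m => a m n)) = Series (fun m => Series (a m)).
Proof.
  intros H1 H2.
  set (b := fun m n => a m n + Rabs (a m n)).
  assert (Hb : forall m n, 0 <= b m n <= 2 * Rabs (a m n)).
  { intros m n. unfold b. pose proof (Rle_abs (a m n)). pose proof (Rle_abs (- a m n)).
    rewrite Rabs_Ropp in H0. lra. }
  assert (B1 : forall m, ex_series (b m)).
  { intros m. apply (ex_series_plus (V := R_NormedModule)); auto. now apply ex_series_Rabs. }
  assert (B2 : ex_series (fun m => Series (b m))).
  { apply (ex_series_le (V := R_CompleteNormedModule) _ (fun m => 2 * Series (fun n => Rabs (a m n)))).
    - intros m. change (Rabs (Series (b m)) <= 2 * Series (fun n => Rabs (a m n))).
      rewrite Rabs_pos_eq by (apply Series_ge_0; auto; apply Hb). rewrite <- Series_scal_l.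
      apply Series_le; [apply Hb|]. now apply (ex_series_scal_l (V := R_NormedModule)).
    - now apply (ex_series_scal_l (V := R_NormedModule)). }
  destruct (Fubini_nonneg b (fun m n => proj1 (Hb m n)) B1 B2) as (P1 & P2 & P3).
  destruct (Fubini_nonneg (fun m n => Rabs (a m n)) (fun m n => Rabs_pos _) H1 H2) as (Q1 & Q2 & Q3).
  assert (E : forall m n, a m n = b m n - Rabs (a m n)) by (intros; unfold b; ring).
  assert (S1 : forall n, ex_series (fun m => a m n)) by (intros n; now apply ex_series_Rabs).
  assert (S2 : forall n, Series (fun m => a m n) = Series (fun m => b m n) - Series (fun m => Rabs (a m n))).
  { intros n. rewrite <- Series_minus; auto. apply Series_ext. intros; apply E. }
  split; auto. split.
  - apply ex_series_ext with (fun n => Series (fun m => b m n) - Series (fun m => Rabs (a m n))).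
    + intros; symmetry; apply S2.
    + now apply (ex_series_minus (V := R_NormedModule)).
  - rewrite (Series_ext _ _ S2), Series_minus, P3, Q3, <- Series_minus by auto.
    apply Series_ext. intros m. rewrite <- Series_minus; auto. apply Series_ext. intros; symmetry; apply E.
Qed.

(** The contribution of the divisor [S d] to the sums over divisors. *)
Lemma is_series_sparse (u : nat -> R) (d : nat) (l : R) : is_series u l ->
  is_series (fun n => if (S n mod S d =? 0)%nat then u (S n / S d - 1)%nat else 0) l.
Proof.
  rewrite !is_series_rsum. intros H.
  assert (E : forall M, rsum (fun n => if (S n mod S d =? 0)%nat then u (S n / S d - 1)%nat else 0) M
     = rsum u (M / S d)).
  { induction M as [|M IH].
    - rewrite Nat.div_0_l by lia. auto.
    - cbn [rsum]. rewrite IH.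
      pose proof (Nat.div_mod_eq M (S d)) as D1. pose proof (Nat.mod_upper_bound M (S d) ltac:(lia)) as D2.
      set (q := (M / S d)%nat) in *. set (r := (M mod S d)%nat) in *.
      destruct (Nat.eq_dec r d) as [Hr|Hr].
      + assert (X : (S M = S q * S d)%nat) by nia.
        rewrite X, Nat.Div0.mod_mul, Nat.div_mul by lia. simpl. now rewrite Nat.sub_0_r.
      + assert (X : (S M = S d * q + S r)%nat) by nia.
        rewrite <- (Nat.div_unique (S M) (S d) q (S r)) by lia.
        rewrite <- (Nat.mod_unique (S M) (S d) q (S r)) by lia. simpl. ring. }
  apply is_lim_seq_ext with (fun M => rsum u (M / S d)); [intros; auto|].
  apply is_lim_seq_spec in H. apply is_lim_seq_spec. intros eps. destruct (H eps) as [N HN].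
  exists (N * S d)%nat. intros n Hn. apply HN. apply Nat.div_le_lower_bound; lia.
Qed.

(** Divisor sums of any exponent; [sigma3] is convertible to the case of exponent 3. *)
Definition sigma (k n : nat) : nat :=
  list_sum (map (fun d => (d ^ k)%nat) (filter (fun d => (n mod d =? 0)%nat) (seq 1 n))).

Lemma INR_list_sum_filter (f : nat -> nat) (p : nat -> bool) n :
  INR (list_sum (map f (filter p (seq 1 n)))) = rsum (fun d => if p (S d) then INR (f (S d)) else 0) n.
Proof.
  induction n as [|n IH]; [reflexivity|].
  rewrite seq_S, filter_app, map_app, list_sum_app, plus_INR, IH. cbn [rsum]. f_equal.
  simpl. destruct (p (S n)); simpl; [now rewrite Nat.add_0_r|reflexivity].
Qed.

Lemma is_series_finite (a : nat -> R) N : (forall n, (N <= n)%nat -> a n = 0) -> is_series a (rsum a N).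
Proof.
  intros H. apply is_series_rsum. apply is_lim_seq_spec. intros eps. exists N. intros n Hn.
  replace (rsum a n) with (rsum a N).
  - rewrite Rminus_diag, Rabs_R0. apply cond_pos.
  - induction Hn; auto. cbn [rsum]. rewrite <- IHHn, H by auto. ring.
Qed.

Lemma ex_series_pow_geom k x : 0 <= x < 1 -> ex_series (fun n => INR n ^ k * x ^ n).
Proof.
  revert x. induction k as [|k IH]; intros x Hx.
  - apply ex_series_ext with (fun n => x ^ n); [intros; simpl; ring|].
    apply ex_series_geom. rewrite Rabs_pos_eq; lra.
  - set (t := 1 - (1 - x) / 2). assert (Ht : 0 <= t < 1) by (unfold t; lra).
    assert (Hxt : x <= t * t) by (unfold t; nra).
    apply (ex_series_le (V := R_CompleteNormedModule) _ (fun n => / (1 - t) * (INR n ^ k * t ^ n))).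
    + intros n. change (Rabs (INR n ^ S k * x ^ n) <= / (1 - t) * (INR n ^ k * t ^ n)).
      pose proof (pos_INR n) as P. pose proof (pow_le x n (proj1 Hx)). pose proof (pow_le t n (proj1 Ht)).
      pose proof (pow_le (INR n) k P). pose proof (nx_pow_bound t n Ht).
      rewrite Rabs_pos_eq by (apply Rmult_le_pos; auto; now apply pow_le).
      apply Rle_trans with (INR n ^ S k * (t ^ n * t ^ n)).
      * apply Rmult_le_compat_l; [now apply pow_le|]. rewrite <- Rpow_mult_distr. apply pow_incr; lra.
      * replace (INR n ^ S k * (t ^ n * t ^ n)) with ((INR n * t ^ n) * (INR n ^ k * t ^ n)) by (simpl; ring).
        apply Rmult_le_compat_r; auto. now apply Rmult_le_pos.
    + apply (ex_series_scal_l (V := R_NormedModule)). auto.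
Qed.

Definition powsum (k : nat) (x : R) : R := Series (fun n => INR (S n) ^ k * x ^ S n).

Lemma powsum_ex k x : 0 <= x < 1 -> ex_series (fun n => INR (S n) ^ k * x ^ S n).
Proof. intros H. apply (ex_series_incr_1 (fun n => INR n ^ k * x ^ n)), ex_series_pow_geom, H. Qed.

(** Group the pairs [(d, m)] by their product, where [d ^ k] contributes to [sigma k (d m)]. *)
Lemma Lambert k x : 0 < x < 1 ->
  ex_series (fun m => powsum k (x ^ S m)) /\
  ex_series (fun n => INR (sigma k (S n)) * x ^ S n) /\
  Series (fun n => INR (sigma k (S n)) * x ^ S n) = Series (fun m => powsum k (x ^ S m)).
Proof.
  intros Hx.
  assert (Hxp : forall n, 0 < x ^ n) by (intros; apply pow_lt; lra).
  assert (Hx1 : forall n, x ^ S n < 1).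
  { intros n. apply pow_lt_1_compat; [lra|lia]. }
  set (a := fun m d => INR (S d) ^ k * (x ^ S m) ^ S d).
  assert (Ha : forall m d, 0 <= a m d).
  { intros m d. apply Rmult_le_pos; [apply pow_le, pos_INR|]. apply pow_le, Rlt_le, Hxp. }
  assert (Ha1 : forall m, ex_series (a m)).
  { intros m. apply powsum_ex. split; [apply Rlt_le, Hxp|apply Hx1]. }
  assert (Hle : forall m d, a m d <= x ^ m * (INR (S d) ^ k * x ^ S d)).
  { intros m d. unfold a. rewrite <- pow_mult.
    replace (x ^ m * (INR (S d) ^ k * x ^ S d)) with (INR (S d) ^ k * x ^ (m + S d)) by (rewrite pow_add; ring).
    apply Rmult_le_compat_l; [apply pow_le, pos_INR|].
    replace (S m * S d)%nat with ((m + S d) + m * d)%nat by lia. rewrite pow_add.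
    rewrite <- (Rmult_1_r (x ^ (m + S d))) at 2. apply Rmult_le_compat_l; [apply Rlt_le, Hxp|].
    rewrite <- (pow1 (m * d)). apply pow_incr. lra. }
  assert (Ha2 : ex_series (fun m => powsum k (x ^ S m))).
  { apply (ex_series_le (V := R_CompleteNormedModule) _ (fun m => powsum k x * x ^ m)).
    - intros m. change (Rabs (Series (a m)) <= powsum k x * x ^ m).
      rewrite Rabs_pos_eq by (apply Series_ge_0; auto). rewrite Rmult_comm. unfold powsum.
      rewrite <- Series_scal_l. apply Series_le; auto.
      apply (ex_series_scal_l (V := R_NormedModule)), powsum_ex. lra.
    - apply (ex_series_scal_l (V := R_NormedModule)), ex_series_geom. rewrite Rabs_pos_eq; lra. }
  destruct (Fubini_nonneg a Ha Ha1 Ha2) as (F1 & F2 & F3).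
  set (b := fun d n => if (S n mod S d =? 0)%nat then INR (S d) ^ k * x ^ S n else 0).
  assert (Hb : forall d n, 0 <= b d n).
  { intros d n. unfold b. destruct (_ =? _)%nat; [|lra].
    apply Rmult_le_pos; [apply pow_le, pos_INR|apply Rlt_le, Hxp]. }
  assert (Hb1 : forall d, is_series (b d) (Series (fun m => a m d))).
  { intros d.
    apply is_series_ext with (fun n => if (S n mod S d =? 0)%nat then (fun m => a m d) (S n / S d - 1)%nat else 0).
    - intros n. unfold b. destruct (S n mod S d =? 0)%nat eqn:E; auto. apply Nat.eqb_eq in E.
      unfold a. f_equal. rewrite <- pow_mult. f_equal.
      pose proof (Nat.div_mod_eq (S n) (S d)) as D. rewrite E in D.
      assert (S n / S d <> 0)%nat by nia. nia.
    - apply (is_series_sparse (fun m => a m d)). apply Series_correct, F1. }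
  assert (Hb2 : forall d, Series (b d) = Series (fun m => a m d)) by (intros; now apply is_series_unique).
  destruct (Fubini_nonneg b Hb) as (G1 & G2 & G3).
  { intros d. eexists. apply Hb1. }
  { eapply ex_series_ext; [|exact F2]. intros; symmetry; apply Hb2. }
  assert (Hs : forall n, Series (fun d => b d n) = INR (sigma k (S n)) * x ^ S n).
  { intros n. unfold sigma. rewrite INR_list_sum_filter.
    transitivity (rsum (fun d => b d n) (S n)).
    - apply is_series_unique, is_series_finite. intros d Hd. unfold b.
      rewrite Nat.mod_small by lia. reflexivity.
    - assert (K : forall M, rsum (fun d => b d n) M
         = rsum (fun d => if (S n mod S d =? 0)%nat then INR (S d ^ k) else 0) M * x ^ S n).
      { induction M as [|M IH]; cbn [rsum]; [ring|].
        rewrite IH, Rmult_plus_distr_r. f_equal. unfold b. destruct (_ =? _)%nat; [|ring].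
        now rewrite pow_INR. }
      apply K. }
  split; auto. split.
  - eapply ex_series_ext; [|exact G2]. intros; apply Hs.
  - rewrite <- (Series_ext _ _ Hs), G3, (Series_ext _ _ Hb2), F3. reflexivity.
Qed.

(** Abel summation, which lowers the degree of the coefficients as polynomials in [n]. *)
Lemma Abel_step (a : nat -> R) x : ex_series (fun n => a n * x ^ n) -> a O = 0 ->
  (1 - x) * Series (fun n => a (S n) * x ^ S n) = Series (fun n => (a (S n) - a n) * x ^ S n).
Proof.
  intros He H0.
  assert (E1 : ex_series (fun n => a (S n) * x ^ S n)) by (apply (ex_series_incr_1 (fun n => a n * x ^ n)); auto).
  assert (E2 : Series (fun n => a n * x ^ n) = Series (fun n => a (S n) * x ^ S n)).
  { rewrite Series_incr_1 by auto. rewrite H0. ring. }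
  assert (E3 : ex_series (fun n => x * (a n * x ^ n))) by now apply (ex_series_scal_l (V := R_NormedModule)).
  rewrite Rmult_minus_distr_r, Rmult_1_l. rewrite <- E2 at 2. rewrite <- Series_scal_l, <- Series_minus by auto.
  apply Series_ext. intros n. simpl. ring.
Qed.

Lemma powsum_0 x : 0 <= x < 1 -> (1 - x) * powsum 0 x = x.
Proof.
  intros Hx. unfold powsum. rewrite (Series_ext _ (fun n => x * x ^ n)) by (intros; simpl; ring).
  rewrite Series_scal_l, Series_geom by (rewrite Rabs_pos_eq; lra). field. lra.
Qed.

Lemma powsum_1 x : 0 <= x < 1 -> powsum 1 x = x / (1 - x) ^ 2.
Proof.
  intros Hx.
  assert (E : (1 - x) * powsum 1 x = powsum 0 x).
  { unfold powsum. rewrite (Abel_step (fun n => INR n ^ 1)).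
    - apply Series_ext. intros n. rewrite S_INR. simpl. ring.
    - now apply ex_series_pow_geom.
    - simpl. ring. }
  pose proof (powsum_0 x Hx) as E0. rewrite <- E in E0. rewrite <- E0 at 2. field. lra.
Qed.

Lemma powsum_3 x : 0 <= x < 1 -> powsum 3 x = x * (1 + 4 * x + x ^ 2) / (1 - x) ^ 4.
Proof.
  intros Hx.
  assert (X : forall k, ex_series (fun n => INR (S n) ^ k * x ^ S n)) by (intros; now apply powsum_ex).
  assert (Y : forall c k, ex_series (fun n => c * (INR (S n) ^ k * x ^ S n)))
    by (intros; now apply (ex_series_scal_l (V := R_NormedModule))).
  assert (E2 : (1 - x) * powsum 2 x = 2 * powsum 1 x - powsum 0 x).
  { unfold powsum. rewrite (Abel_step (fun n => INR n ^ 2)).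
    - rewrite <- Series_scal_l, <- Series_minus by auto.
      apply Series_ext. intros n. rewrite S_INR. simpl. ring.
    - now apply ex_series_pow_geom.
    - simpl. ring. }
  assert (E3 : (1 - x) * powsum 3 x = 3 * powsum 2 x - 3 * powsum 1 x + powsum 0 x).
  { unfold powsum. rewrite (Abel_step (fun n => INR n ^ 3)).
    - rewrite <- !Series_scal_l, <- Series_minus, <- Series_plus by
        (auto; now apply (ex_series_minus (V := R_NormedModule))).
      apply Series_ext. intros n. rewrite S_INR. simpl. ring.
    - now apply ex_series_pow_geom.
    - simpl. ring. }
  pose proof (powsum_0 x Hx) as E0. rewrite (powsum_1 x Hx) in E2, E3.
  assert (P0 : powsum 0 x = x / (1 - x)) by (rewrite <- E0 at 2; field; lra).
  rewrite P0 in E2, E3.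
  assert (P2 : powsum 2 x = (2 * (x / (1 - x) ^ 2) - x / (1 - x)) / (1 - x)) by (rewrite <- E2; field; lra).
  rewrite P2 in E3.
  apply Rmult_eq_reg_l with (1 - x); [|lra]. rewrite E3. field. lra.
Qed.

(** * Eisenstein series of weight 4 and 2 on the imaginary axis *)

(** The parameter [q] at the point [i x]. *)
Definition qre (x : R) : R := exp (- (2 * PI * x)).

Lemma qpar_imag x : qpar (Ci * RtoC x) = RtoC (qre x).
Proof.
  unfold qpar, qre. rewrite <- Cexp_R. f_equal. unfold Cmult, RtoC, Ci; simpl. f_equal; ring.
Qed.

Lemma qre_range x : 0 < x -> 0 < qre x < 1.
Proof.
  intros Hx. split; [apply exp_pos|]. rewrite <- exp_0. apply exp_increasing.
  pose proof PI_RGT_0. nra.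
Qed.

Lemma qre_S x m : qre x ^ S m = qre (INR (S m) * x).
Proof.
  unfold qre. rewrite <- Rpower_pow by apply exp_pos. unfold Rpower. rewrite ln_exp. f_equal. ring.
Qed.

Definition lat (k : nat) (x : R) (n : nat) : R := Re (pw k (INR n + Ci * RtoC x)).

Lemma pw_opp_even j z : pw (2 * j) (- z) = pw (2 * j) z.
Proof.
  unfold pw. rewrite !Cpow_mult_r. f_equal. destruct (Ceq_dec z 0) as [->|N].
  - now replace (- RtoC 0)%C with (RtoC 0) by ring.
  - field. auto.
Qed.

Lemma pw_conj k z : z <> RtoC 0 -> pw k (Cconj z) = Cconj (pw k z).
Proof. intros H. unfold pw. now rewrite <- Cinv_conj, Cpow_conj. Qed.

Lemma lattice_neq0 (n x : R) : x <> 0 -> (RtoC n + Ci * RtoC x)%C <> 0.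
Proof.
  intros H E. apply (f_equal Im) in E. unfold Im in E; simpl in E. lra.
Qed.

(** On the imaginary axis the terms of index [n] and [- n] are complex conjugates. *)
Lemma pf_imag j x : 0 < x ->
  Re (pf (2 * j) (Ci * RtoC x)) =
  Re (pw (2 * j) (Ci * RtoC x)) + Series (fun n => 2 * lat (2 * j) x (S n)).
Proof.
  intros Hx. unfold pf.
  change (Re (pw (2 * j) (Ci * x) + CSeries (pf_term (2 * j) (Ci * x))))
    with (Re (pw (2 * j) (Ci * x)) + Series (fun n => Re (pf_term (2 * j) (Ci * x) n))).
  f_equal. apply Series_ext. intros n. unfold pf_term, lat.
  assert (E : pw (2 * j) (Ci * x - INR (S n)) = Cconj (pw (2 * j) (INR (S n) + Ci * x))).
  { rewrite <- pw_conj by (apply lattice_neq0; lra). rewrite <- pw_opp_even. f_equal.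
    unfold Cconj, Cminus, Copp, Cplus, Cmult, RtoC, Ci. cbn [fst snd]. f_equal; ring. }
  rewrite E, (Cplus_comm (Ci * x)).
  change (Re (pw (2 * j) (INR (S n) + Ci * x) + Cconj (pw (2 * j) (INR (S n) + Ci * x))))
    with (Re (pw (2 * j) (INR (S n) + Ci * x)) + Re (Cconj (pw (2 * j) (INR (S n) + Ci * x)))).
  rewrite re_conj. ring.
Qed.

Lemma inQ_imag x : 0 < x -> inQ x (Ci * RtoC x).
Proof.
  intros Hx. unfold inQ. replace (Re (Ci * x)) with 0 by (unfold Re; simpl; ring).
  replace (Im (Ci * x)) with x by (unfold Im; simpl; ring).
  repeat split; try lra; intros E; apply (f_equal Im) in E; unfold Im in E; simpl in E; lra.
Qed.

Lemma Ci2 : (Ci * Ci)%C = (- (1))%C.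
Proof. unfold Cmult, Copp, RtoC, Ci; simpl. f_equal; ring. Qed.

Lemma Lipschitz2_imag x : 0 < x ->
  - (/ x) ^ 2 + Series (fun n => 2 * lat 2 x (S n)) = - (2 * PI) ^ 2 * powsum 1 (qre x).
Proof.
  intros Hx. pose proof (qre_range x Hx) as Q.
  pose proof (Lipschitz2 _ x (inQ_imag x Hx) ltac:(lra)) as L. apply (f_equal Re) in L.
  pose proof (pf_imag 1 x Hx) as EL. simpl (2 * 1)%nat in EL. rewrite EL in L.
  replace (Re (pw 2 (Ci * x))) with (- (/ x) ^ 2) in L.
  2:{ replace (pw 2 (Ci * x)) with (RtoC (- (/ x) ^ 2)); [auto|].
      unfold pw. rewrite RtoC_opp, RtoC_pow, RtoC_inv by lra.
      assert (X : RtoC x <> 0) by (intros E; apply RtoC_inj in E; lra).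
      transitivity (/ (Ci * Ci) * (/ x * / x))%C; [rewrite Ci2; field; auto|field; split; auto using Ci_nz]. }
  rewrite L. unfold lip2. rewrite qpar_imag, powsum_1 by lra.
  replace ((2 * PI * Ci) ^ 2 * (qre x / (1 - qre x) ^ 2))%C
    with (RtoC (- (2 * PI) ^ 2 * (qre x / (1 - qre x) ^ 2))); [auto|].
  rewrite RtoC_mult, RtoC_opp, RtoC_div, !RtoC_pow, RtoC_mult, RtoC_minus by (apply pow_nonzero; lra).
  rewrite <- !Cmult_assoc. transitivity ((2 * PI) ^ 2 * (Ci * Ci) * (qre x / (1 - qre x) ^ 2))%C;
    [rewrite Ci2; ring|ring].
Qed.

Lemma Lipschitz4_imag x : 0 < x ->
  (/ x) ^ 4 + Series (fun n => 2 * lat 4 x (S n)) = (2 * PI) ^ 4 / 6 * powsum 3 (qre x).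
Proof.
  intros Hx. pose proof (qre_range x Hx) as Q.
  pose proof (Lipschitz4 _ x (inQ_imag x Hx) ltac:(lra)) as L. apply (f_equal Re) in L.
  pose proof (pf_imag 2 x Hx) as EL. simpl (2 * 2)%nat in EL. rewrite EL in L.
  replace (Re (pw 4 (Ci * x))) with ((/ x) ^ 4) in L.
  2:{ replace (pw 4 (Ci * x)) with (RtoC ((/ x) ^ 4)); [auto|].
      unfold pw. rewrite RtoC_pow, RtoC_inv by lra.
      assert (X : RtoC x <> 0) by (intros E; apply RtoC_inj in E; lra).
      transitivity (/ ((Ci * Ci) * (Ci * Ci)) * (/ x) ^ 4)%C; [rewrite Ci2; field; auto|field; split; auto using Ci_nz]. }
  rewrite L. unfold lip4. rewrite qpar_imag, powsum_3 by lra.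
  set (q := qre x) in *.
  replace ((2 * PI * Ci) ^ 4 / 6 * (q * (1 + 4 * q + q ^ 2) / (1 - q) ^ 4))%C
    with (RtoC ((2 * PI) ^ 4 / 6 * (q * (1 + 4 * q + q ^ 2) / (1 - q) ^ 4))); [auto|].
  assert (X : (1 - q)%C <> 0) by (rewrite <- RtoC_minus; intros E; apply RtoC_inj in E; lra).
  rewrite RtoC_mult, !RtoC_div, RtoC_mult, !RtoC_plus, !RtoC_pow, !RtoC_mult, RtoC_minus
    by (try lra; apply pow_nonzero; lra).
  transitivity ((2 * PI) ^ 4 * ((Ci * Ci) * (Ci * Ci)) / 6 * (q * (1 + 4 * q + q ^ 2) / (1 - q) ^ 4))%C;
    [rewrite Ci2; field; auto|field; auto].
Qed.

(** ** The values of zeta at 2 and 4, from the partial fractions at 1/2 *)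

Lemma CSeries_RtoC (u : nat -> R) : CSeries (fun n => RtoC (u n)) = RtoC (Series u).
Proof.
  unfold CSeries, RtoC. f_equal.
  rewrite (Series_ext (fun n => Im (u n, 0)) (fun n => 0 * 0)) by (intros; simpl; ring).
  rewrite (Series_scal_l 0 (fun _ => 0)). ring.
Qed.

Lemma ex_series_zeta k : (2 <= k)%nat -> ex_series (fun n => (/ INR (S n)) ^ k).
Proof.
  intros Hk. apply (ex_series_le (V := R_CompleteNormedModule) _ (fun n => (/ INR (S n)) ^ 2)).
  - intros n. change (Rabs ((/ INR (S n)) ^ k) <= (/ INR (S n)) ^ 2). pose proof (INR_S_pos n).
    rewrite Rabs_pos_eq by (apply pow_le, Rlt_le, Rinv_0_lt_compat; auto).
    apply inv_pow_ge2; auto. rewrite S_INR. pose proof (pos_INR n). lra.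
  - apply ex_series_inv_sq.
Qed.

(** At [z = 1/2] the partial fractions run over the odd integers. *)
Lemma zeta_from_half j : (1 <= j)%nat ->
  pf (2 * j) (RtoC (1 / 2)) = RtoC (2 * (2 ^ (2 * j) - 1) * Series (fun n => (/ INR (S n)) ^ (2 * j))).
Proof.
  intros Hj. set (k := (2 * j)%nat). assert (Hk : (2 <= k)%nat) by (unfold k; lia).
  set (o := fun n => (/ (2 * INR n + 1)) ^ k).
  assert (Pn : forall n, 0 < 2 * INR n + 1) by (intros n; pose proof (pos_INR n); lra).
  assert (Ho : ex_series o).
  { apply (ex_series_le (V := R_CompleteNormedModule) _ (fun n => (/ INR (S n)) ^ k)).
    - intros n. change (Rabs (o n) <= (/ INR (S n)) ^ k). unfold o. specialize (Pn n).
      rewrite Rabs_pos_eq by (apply pow_le, Rlt_le, Rinv_0_lt_compat; auto).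
      apply pow_incr. split; [apply Rlt_le, Rinv_0_lt_compat; auto|].
      apply Rinv_le_contravar; [apply INR_S_pos|]. rewrite S_INR. pose proof (pos_INR n). lra.
    - now apply ex_series_zeta. }
  assert (Hz := ex_series_zeta k Hk). set (zeta := Series (fun n => (/ INR (S n)) ^ k)) in *.
  assert (P2 : 0 < 2 ^ k) by (apply pow_lt; lra).
  (* splitting zeta into odd and even terms *)
  assert (E1 : zeta = Series o + (/ 2 ^ k) * zeta).
  { pose proof (proj1 (is_series_rsum _ _) (Series_correct _ Hz)) as L.
    apply (is_lim_seq_subseq _ _ (fun M => (2 * M)%nat)) in L.
    2:{ intros P [N HN]. exists N. intros n Hn. apply HN. lia. }
    pose proof (proj1 (is_series_rsum _ _) (Series_correct _ Ho)) as L1.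
    pose proof (is_lim_seq_scal_l _ (/ 2 ^ k) _ (proj1 (is_series_rsum _ _) (Series_correct _ Hz))) as L2.
    pose proof (is_lim_seq_plus' _ _ _ _ L1 L2) as L3.
    assert (EE : forall M, rsum (fun n => (/ INR (S n)) ^ k) (2 * M)
      = rsum o M + (/ 2 ^ k) * rsum (fun n => (/ INR (S n)) ^ k) M).
    { induction M as [|M IH]; [simpl; ring|].
      replace (2 * S M)%nat with (S (S (2 * M))) by lia. cbn [rsum]. rewrite IH.
      replace ((/ INR (S (2 * M))) ^ k) with (o M).
      2:{ unfold o. do 2 f_equal. rewrite S_INR, mult_INR. simpl. ring. }
      replace ((/ INR (S (S (2 * M)))) ^ k) with (/ 2 ^ k * (/ INR (S M)) ^ k); [ring|].
      rewrite <- pow_inv, <- Rpow_mult_distr, <- Rinv_mult. do 2 f_equal.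
      rewrite !S_INR, mult_INR. simpl. ring. }
    apply is_lim_seq_unique in L, L3.
    rewrite (Lim_seq_ext _ _ EE), L3 in L. injection L as L. symmetry. exact L. }
  assert (ES : ex_series (fun n => o (S n))) by now apply (ex_series_incr_1 o).
  assert (E2 : pf k (RtoC (1 / 2)) = RtoC (2 ^ k * (2 * Series o))).
  { unfold pf.
    assert (Epw : forall a : R, 0 < a -> pw k (RtoC (a / 2)) = RtoC (2 ^ k * (/ a) ^ k)).
    { intros a Ha. unfold pw. rewrite <- RtoC_inv, <- RtoC_pow by lra. f_equal.
      rewrite <- Rpow_mult_distr. f_equal. field. lra. }
    assert (Et : forall n, pf_term k (RtoC (1 / 2)) n = RtoC (2 ^ k * (o (S n) + o n))).
    { intros n. unfold pf_term.
      replace (RtoC (1 / 2) + INR (S n))%C with (RtoC ((2 * INR (S n) + 1) / 2)).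
      2:{ rewrite <- RtoC_plus. f_equal. field. }
      assert (En : pw k (RtoC (1 / 2) - INR (S n)) = pw k (RtoC ((2 * INR n + 1) / 2))).
      { unfold k. rewrite <- pw_opp_even. f_equal. rewrite <- RtoC_minus, <- RtoC_opp. f_equal.
        rewrite S_INR. field. }
      rewrite En, !Epw, <- RtoC_plus by apply Pn. f_equal. unfold o. ring. }
    rewrite (CSeries_ext _ _ Et), (Epw 1) by lra.
    rewrite (CSeries_RtoC (fun n => 2 ^ k * (o (S n) + o n))), <- RtoC_plus. f_equal.
    rewrite Series_scal_l, Series_plus by auto.
    pose proof (Series_incr_1 o Ho) as SI.
    replace (o O) with 1 in SI by (unfold o; simpl INR; replace (/ (2 * 0 + 1)) with 1 by field; now rewrite pow1).
    rewrite Rinv_1, pow1, SI. ring. }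
  rewrite E2. f_equal.
  assert (Series o = zeta - / 2 ^ k * zeta) by lra. rewrite H. field. lra.
Qed.

Lemma inQ_half_pt : inQ 0 (RtoC (1 / 2)).
Proof.
  unfold inQ. rewrite re_RtoC, im_RtoC. repeat split; try lra; intros E; apply RtoC_inj in E; lra.
Qed.

Lemma qpar_half' : qpar (RtoC (1 / 2)) = (- (1))%C.
Proof. rewrite RtoC_div by lra. apply qpar_half. Qed.

Lemma zeta2 : Series (fun n => (/ INR (S n)) ^ 2) = PI ^ 2 / 6.
Proof.
  pose proof (zeta_from_half 1 ltac:(lia)) as Z. simpl (2 * 1)%nat in Z.
  rewrite (Lipschitz2 _ 0 inQ_half_pt) in Z by lra. unfold lip2 in Z. rewrite qpar_half' in Z.
  assert (E : RtoC (2 * (2 ^ 2 - 1) * Series (fun n => (/ INR (S n)) ^ 2)) = RtoC (PI ^ 2)).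
  { rewrite <- Z, RtoC_pow.
    transitivity (PI ^ 2 * - (Ci * Ci))%C; [field|rewrite Ci2; ring]. }
  apply RtoC_inj in E. lra.
Qed.

Lemma zeta4 : Series (fun n => (/ INR (S n)) ^ 4) = PI ^ 4 / 90.
Proof.
  pose proof (zeta_from_half 2 ltac:(lia)) as Z. simpl (2 * 2)%nat in Z.
  rewrite (Lipschitz4 _ 0 inQ_half_pt) in Z by lra. unfold lip4 in Z. rewrite qpar_half' in Z.
  assert (E : RtoC (2 * (2 ^ 4 - 1) * Series (fun n => (/ INR (S n)) ^ 4)) = RtoC (PI ^ 4 / 3)).
  { rewrite <- Z, RtoC_div, RtoC_pow by lra.
    transitivity (PI ^ 4 * ((Ci * Ci) * (Ci * Ci)) / 3)%C; [field|rewrite Ci2; field]. }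
  apply RtoC_inj in E. lra.
Qed.

(** ** Lattice sums *)

(** [E4re] and [E2re] are the values at [i y] of the Eisenstein series of weight 4 and 2. *)
Definition E4re (y : R) : R := 1 + 240 * Series (fun n => INR (sigma 3 (S n)) * qre y ^ S n).
Definition E2re (y : R) : R := 1 - 24 * Series (fun n => INR (sigma 1 (S n)) * qre y ^ S n).

Lemma Cmod_lattice (n x : R) : Cmod (RtoC n + Ci * RtoC x) ^ 2 = n ^ 2 + x ^ 2.
Proof.
  rewrite Cmod2_alt. unfold Re, Im; simpl. ring.
Qed.

Lemma lattice_lower (n x : R) : 0 < n -> 0 < x -> n * x <= Cmod (RtoC n + Ci * RtoC x) ^ 2.
Proof. intros Hn Hx. rewrite Cmod_lattice. nra. Qed.

Lemma Fubini_prod (a : nat -> nat -> R) (u v : nat -> R) : (forall m n, Rabs (a m n) <= u m * v n) ->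
  (forall m, 0 <= u m) -> ex_series u -> ex_series v ->
  (forall m, ex_series (a m)) /\ ex_series (fun m => Series (a m)) /\
  (forall n, ex_series (fun m => a m n)) /\ ex_series (fun n => Series (fun m => a m n)) /\
  Series (fun n => Series (fun m => a m n)) = Series (fun m => Series (a m)).
Proof.
  intros Ha Hu Eu Ev.
  assert (H1 : forall m, ex_series (fun n => Rabs (a m n))).
  { intros m. apply (ex_series_le (V := R_CompleteNormedModule) _ (fun n => u m * v n)).
    - intros n. change (Rabs (Rabs (a m n)) <= u m * v n). rewrite Rabs_Rabsolu. auto.
    - now apply (ex_series_scal_l (V := R_NormedModule)). }
  assert (Hb : forall m, Series (fun n => Rabs (a m n)) <= Series v * u m).
  { intros m. rewrite Rmult_comm, <- Series_scal_l. apply Series_le.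
    - intros n; split; [apply Rabs_pos|auto].
    - now apply (ex_series_scal_l (V := R_NormedModule)). }
  assert (Eb : ex_series (fun m => Series v * u m)) by now apply (ex_series_scal_l (V := R_NormedModule)).
  assert (H2 : ex_series (fun m => Series (fun n => Rabs (a m n)))).
  { apply (ex_series_le (V := R_CompleteNormedModule) _ (fun m => Series v * u m)); auto.
    intros m. change (Rabs (Series (fun n => Rabs (a m n))) <= Series v * u m).
    rewrite Rabs_pos_eq; auto. apply Series_ge_0; auto. intros; apply Rabs_pos. }
  destruct (Fubini a H1 H2) as (F1 & F2 & F3).
  split; [intros m; now apply ex_series_Rabs|]. split; auto.
  apply (ex_series_le (V := R_CompleteNormedModule) _ (fun m => Series (fun n => Rabs (a m n)))); auto.
  intros m. change (Rabs (Series (a m)) <= Series (fun n => Rabs (a m n))). apply Series_Rabs; auto.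
Qed.

(** [n + i m / y = (i / y) (m - i n y)]. *)
Lemma lat_swap j y m n : 0 < y -> 0 < m -> 0 < n ->
  Re (pw (2 * j) (RtoC n + Ci * RtoC (m * / y))) =
  (-1) ^ j * y ^ (2 * j) * Re (pw (2 * j) (RtoC m + Ci * RtoC (n * y))).
Proof.
  intros Hy Hm Hn.
  assert (N1 : (RtoC m - Ci * RtoC (n * y))%C <> 0).
  { intros E. apply (f_equal Re) in E. unfold Re in E; simpl in E. lra. }
  assert (E : pw (2 * j) (RtoC n + Ci * RtoC (m * / y))
     = (RtoC ((-1) ^ j * y ^ (2 * j)) * Cconj (pw (2 * j) (RtoC m + Ci * RtoC (n * y))))%C).
  { rewrite <- pw_conj by (apply lattice_neq0; nra).
    replace (Cconj (RtoC m + Ci * RtoC (n * y))) with (RtoC m - Ci * RtoC (n * y))%C.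
    2:{ unfold Cconj, Cminus, Copp, Cplus, Cmult, RtoC, Ci. cbn [fst snd]. f_equal; ring. }
    replace (RtoC n + Ci * RtoC (m * / y))%C with (Ci * / RtoC y * (RtoC m - Ci * RtoC (n * y)))%C.
    2:{ rewrite !RtoC_mult, RtoC_inv by lra.
        transitivity (Ci * / y * m - (Ci * Ci) * n * (/ y * y))%C; [ring|].
        rewrite Ci2, Cinv_l by (intros X; apply RtoC_inj in X; lra). ring. }
    set (w := (RtoC m - Ci * RtoC (n * y))%C) in *.
    assert (Ny : RtoC y <> 0) by (intros X; apply RtoC_inj in X; lra).
    unfold pw. rewrite RtoC_mult, !Cpow_mult_r, !RtoC_pow, Cpow_mult_r.
    rewrite <- !Cpow_mult_l. f_equal.
    transitivity (/ (Ci * Ci) * (y * y) * (/ w) ^ 2)%C.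
    - field. repeat split; auto using Ci_nz.
    - rewrite Ci2. field. auto. }
  rewrite E. rewrite re_scal_l, re_conj. reflexivity.
Qed.

Lemma lat_abs k x n : 0 < x -> Rabs (lat k x n) <= (/ Cmod (INR n + Ci * RtoC x)) ^ k.
Proof.
  intros Hx. unfold lat. eapply Rle_trans; [apply re_le_Cmod|].
  rewrite Cmod_pw; [lra|]. apply lattice_neq0. lra.
Qed.

(** The lattice sum over the first quadrant. The order of summation is part of the definition: in
    weight 2 it matters. *)
Definition latsum (k : nat) (y : R) : R :=
  Series (fun m => Series (fun n => lat k (INR (S m) * y) (S n))).

Lemma lat4_bound y m n : 0 < y ->
  Rabs (lat 4 (INR (S m) * y) (S n)) <= (/ y) ^ 2 * (/ INR (S m)) ^ 2 * (/ INR (S n)) ^ 2.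
Proof.
  intros Hy. pose proof (INR_S_pos m) as Pm. pose proof (INR_S_pos n) as Pn.
  assert (Px : 0 < INR (S m) * y) by now apply Rmult_lt_0_compat.
  eapply Rle_trans; [now apply lat_abs|].
  pose proof (lattice_lower (INR (S n)) _ Pn Px) as L.
  set (c := Cmod _) in *. rewrite !pow_inv. replace (c ^ 4) with (c ^ 2 * c ^ 2) by ring.
  set (A := INR (S n) * (INR (S m) * y)) in *.
  assert (0 < A) by now apply Rmult_lt_0_compat.
  rewrite <- !Rinv_mult. apply Rinv_le_contravar.
  - assert (0 < INR (S m) ^ 2) by (apply pow_lt; auto). assert (0 < INR (S n) ^ 2) by (apply pow_lt; auto).
    assert (0 < y ^ 2) by (apply pow_lt; auto).
    apply Rmult_lt_0_compat; [apply Rmult_lt_0_compat|]; auto.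
  - replace (y ^ 2 * INR (S m) ^ 2 * INR (S n) ^ 2) with (A * A) by (unfold A; ring).
    apply Rmult_le_compat; lra.
Qed.

(** Exchange the two summations, which converge absolutely in weight 4. *)
Lemma latsum4_inv y : 0 < y -> latsum 4 (/ y) = y ^ 4 * latsum 4 y.
Proof.
  intros Hy. assert (Hiy : 0 < / y) by now apply Rinv_0_lt_compat.
  destruct (Fubini_prod (fun m n => lat 4 (INR (S m) * y) (S n))
    (fun m => (/ y) ^ 2 * (/ INR (S m)) ^ 2) (fun n => (/ INR (S n)) ^ 2)) as (F1 & F2 & F3 & F4 & F5).
  - intros m n. now apply lat4_bound.
  - intros m. apply Rmult_le_pos; apply pow2_ge_0.
  - apply (ex_series_scal_l (V := R_NormedModule)), ex_series_inv_sq.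
  - apply ex_series_inv_sq.
  - unfold latsum. rewrite <- F5, <- Series_scal_l. apply Series_ext. intros m.
    rewrite <- Series_scal_l. apply Series_ext. intros n. unfold lat.
    pose proof (lat_swap 2 y (INR (S m)) (INR (S n)) Hy (INR_S_pos m) (INR_S_pos n)) as E.
    simpl (2 * 2)%nat in E. rewrite E. simpl. ring.
Qed.

(** Lipschitz' formula for the inner sums, and the value of zeta at 4 for the terms on the axes. *)
Lemma E4re_lattice y : 0 < y -> PI ^ 4 / 90 * E4re y = PI ^ 4 / 90 * (1 + (/ y) ^ 4) + 2 * latsum 4 y.
Proof.
  intros Hy. destruct (Lambert 3 (qre y) (qre_range y Hy)) as (L1 & L2 & L3).
  unfold E4re. rewrite L3.
  assert (F : forall m, ex_series (fun n => lat 4 (INR (S m) * y) (S n)) ).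
  { intros m. apply ex_series_Rabs.
    apply (ex_series_le (V := R_CompleteNormedModule) _ (fun n => (/ y) ^ 2 * (/ INR (S m)) ^ 2 * (/ INR (S n)) ^ 2)).
    - intros n. change (Rabs (Rabs (lat 4 (INR (S m) * y) (S n))) <= (/ y) ^ 2 * (/ INR (S m)) ^ 2 * (/ INR (S n)) ^ 2).
      rewrite Rabs_Rabsolu. now apply lat4_bound.
    - apply (ex_series_scal_l (V := R_NormedModule)), ex_series_inv_sq. }
  assert (E : forall m, (2 * PI) ^ 4 / 6 * powsum 3 (qre y ^ S m)
     = (/ y) ^ 4 * (/ INR (S m)) ^ 4 + 2 * Series (fun n => lat 4 (INR (S m) * y) (S n))).
  { intros m. rewrite qre_S. pose proof (INR_S_pos m) as Pm.
    rewrite <- Lipschitz4_imag by now apply Rmult_lt_0_compat.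
    rewrite Series_scal_l. f_equal. rewrite Rinv_mult, Rpow_mult_distr. ring. }
  assert (G : ex_series (fun m => Series (fun n => lat 4 (INR (S m) * y) (S n)))).
  { destruct (Fubini_prod (fun m n => lat 4 (INR (S m) * y) (S n))
      (fun m => (/ y) ^ 2 * (/ INR (S m)) ^ 2) (fun n => (/ INR (S n)) ^ 2)) as (F1 & F2 & _); auto.
    - intros m n. now apply lat4_bound.
    - intros m. apply Rmult_le_pos; apply pow2_ge_0.
    - apply (ex_series_scal_l (V := R_NormedModule)), ex_series_inv_sq.
    - apply ex_series_inv_sq. }
  assert (S4 : ex_series (fun m => (/ INR (S m)) ^ 4)) by (apply ex_series_zeta; lia).
  transitivity (PI ^ 4 / 90 + (2 * PI) ^ 4 / 6 * Series (fun m => powsum 3 (qre y ^ S m))); [field|].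
  rewrite <- Series_scal_l, (Series_ext _ _ E), Series_plus, !Series_scal_l, zeta4
    by now apply (ex_series_scal_l (V := R_NormedModule)).
  unfold latsum. ring.
Qed.

Theorem E4re_inv y : 0 < y -> E4re (/ y) = y ^ 4 * E4re y.
Proof.
  intros Hy. assert (Hiy : 0 < / y) by now apply Rinv_0_lt_compat.
  pose proof (E4re_lattice y Hy) as A. pose proof (E4re_lattice (/ y) Hiy) as B.
  rewrite latsum4_inv, Rinv_inv in B by auto.
  pose proof (pow_lt PI 4 PI_RGT_0).
  apply Rmult_eq_reg_l with (PI ^ 4 / 90); [|apply Rgt_not_eq; lra].
  rewrite B. transitivity (y ^ 4 * (PI ^ 4 / 90 * E4re y)); [|ring]. rewrite A.
  field. lra.
Qed.

(** ** The exchange of summations in weight 2 *)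

(** The real part of [1 / (N + i x)]. *)
Definition res (N x : R) : R := N / (N ^ 2 + x ^ 2).

Lemma res_Re N x : 0 < x -> Re (/ (RtoC N + Ci * RtoC x)) = res N x.
Proof.
  intros Hx. unfold res, Cinv, Re, Cplus, Cmult, RtoC, Ci; simpl. f_equal; ring.
Qed.

Lemma atan_le x : 0 <= x -> atan x <= x.
Proof.
  intros Hx. destruct (Req_dec x 0) as [->|N]; [rewrite atan_0; lra|].
  destruct (MVT_gen atan 0 x (fun t => / (1 + t ^ 2))) as [c [Hc E]].
  - intros t _. apply is_derive_Reals, derivable_pt_lim_atan.
  - intros t _. apply derivable_continuous_pt, derivable_pt_atan.
  - rewrite atan_0, !Rminus_0_r in E. rewrite E. rewrite <- (Rmult_1_l x) at 2.
    apply Rmult_le_compat_r; auto. rewrite <- Rinv_1. pose proof (pow2_ge_0 c).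
    apply Rinv_le_contravar; lra.
Qed.

Section ResidueSum.
Variable y : R.
Hypothesis Hy : 0 < y.

Definition Rres (N : R) : R := Series (fun m => res N (INR (S m) * y)).

(** A primitive of [res N (t y)] in [t], for comparing [Rres N] with an integral. *)
Definition hres (N t : R) : R := / y * atan (t * y / N).

Lemma res_bounds N x : 0 < N -> 0 < x -> 0 <= res N x <= N * (/ x) ^ 2.
Proof.
  intros HN Hx. unfold res. assert (0 < x ^ 2) by (apply pow_lt; auto).
  assert (0 < N ^ 2) by (apply pow_lt; auto).
  split; [apply Rdiv_le_0_compat; lra|]. unfold Rdiv. rewrite pow_inv.
  apply Rmult_le_compat_l; [lra|]. apply Rinv_le_contravar; lra.
Qed.

Lemma Rres_ex N : 0 < N -> ex_series (fun m => res N (INR (S m) * y)).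
Proof.
  intros HN.
  apply (ex_series_le (V := R_CompleteNormedModule) _ (fun m => N * (/ y) ^ 2 * (/ INR (S m)) ^ 2)).
  - intros m. change (Rabs (res N (INR (S m) * y)) <= N * (/ y) ^ 2 * (/ INR (S m)) ^ 2).
    pose proof (INR_S_pos m).
    destruct (res_bounds N (INR (S m) * y) HN ltac:(now apply Rmult_lt_0_compat)) as [A B].
    rewrite Rabs_pos_eq by auto. eapply Rle_trans; [apply B|].
    right. rewrite Rinv_mult, Rpow_mult_distr. ring.
  - apply (ex_series_scal_l (V := R_NormedModule)), ex_series_inv_sq.
Qed.

Lemma hres_derive N t : 0 < N -> is_derive (hres N) t (res N (t * y)).
Proof.
  intros HN. unfold hres.
  evar_last.
  - apply (is_derive_scal (fun t => atan (t * y / N)) t (/ y)).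
    apply (is_derive_comp atan (fun t => t * y / N)).
    + apply is_derive_Reals, derivable_pt_lim_atan.
    + apply is_derive_ext with (fun t => (y / N) * t); [intros u; simpl; field; lra|].
      apply (is_derive_scal (fun t => t) t (y / N) 1). exact (is_derive_id (K := R_AbsRing) t).
  - unfold res, scal; simpl. unfold mult; simpl. unfold Rsqr. field.
    assert (0 < N * N) by nra. assert (0 <= (t * y) * (t * y)) by apply Rle_0_sqr.
    repeat split; try lra; apply Rgt_not_eq; nra.
Qed.

Lemma hres_step N t : 0 < N -> 0 <= t ->
  res N ((t + 1) * y) <= hres N (t + 1) - hres N t <= res N (t * y).
Proof.
  intros HN Ht.
  destruct (MVT_gen (hres N) t (t + 1) (fun s => res N (s * y))) as [c [Hc E]].
  - intros s _. now apply hres_derive.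
  - intros s _. apply continuity_pt_filterlim, @ex_derive_continuous. eexists. now apply hres_derive.
  - rewrite Rmin_left, Rmax_right in Hc by lra. replace (t + 1 - t) with 1 in E by ring.
    rewrite Rmult_1_r in E. rewrite E. unfold res, Rdiv.
    assert (0 < N ^ 2) by (apply pow_lt; auto).
    assert (M : forall a b, 0 <= a <= b -> (a * y) ^ 2 <= (b * y) ^ 2).
    { intros a b Hab. apply pow_incr. split; [nra|]. apply Rmult_le_compat_r; lra. }
    pose proof (M t c ltac:(lra)). pose proof (M c (t + 1) ltac:(lra)). pose proof (pow2_ge_0 (t * y)).
    split; (apply Rmult_le_compat_l; [lra|]); apply Rinv_le_contravar; lra.
Qed.

Lemma Rres_limit_bounds N : 0 < N -> PI / (2 * y) - / N <= Rres N <= PI / (2 * y).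
Proof.
  intros HN.
  pose proof (Rres_ex N HN) as He.
  assert (Hpos : forall m, 0 <= res N (INR (S m) * y)).
  { intros m. apply res_bounds; auto. apply Rmult_lt_0_compat; auto. apply INR_S_pos. }
  assert (H0 : hres N 0 = 0).
  { unfold hres. replace (0 * y / N) with 0 by (field; lra). rewrite atan_0. ring. }
  assert (Hiy : 0 < / y) by now apply Rinv_0_lt_compat.
  split.
  - assert (B : forall M, hres N (INR (S M)) - hres N 1 <= rsum (fun m => res N (INR (S m) * y)) M).
    { induction M as [|M IH]; [simpl; lra|]. cbn [rsum].
      destruct (hres_step N (INR (S M)) HN (pos_INR _)) as [_ U]. rewrite <- S_INR in U. lra. }
    assert (H1 : hres N 1 <= / N).
    { unfold hres. apply Rle_trans with (/ y * (1 * y / N)); [|right; field; lra].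
      apply Rmult_le_compat_l; [lra|]. apply atan_le. apply Rdiv_le_0_compat; lra. }
    assert (B2 : forall M, PI / (2 * y) - / N - (/ y * (N / y)) * / INR (S M) <= Rres N).
    { intros M. pose proof (INR_S_pos M) as PM.
      pose proof (rsum_le_Series _ M Hpos He) as B1. specialize (B M). fold (Rres N) in B1.
      assert (X : 0 < INR (S M) * y / N).
      { apply Rdiv_lt_0_compat; auto. now apply Rmult_lt_0_compat. }
      assert (A : PI / 2 - N / (INR (S M) * y) <= atan (INR (S M) * y / N)).
      { pose proof (atan_inv _ X) as AI.
        assert (Y0 : / (INR (S M) * y / N) = N / (INR (S M) * y)) by (field; repeat split; lra).
        rewrite Y0 in AI. pose proof (atan_le (N / (INR (S M) * y))) as AL.
        assert (0 <= N / (INR (S M) * y)) by (apply Rdiv_le_0_compat; [lra|now apply Rmult_lt_0_compat]).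
        specialize (AL H). lra. }
      apply (Rmult_le_compat_l (/ y)) in A; [|lra]. fold (hres N (INR (S M))) in A.
      replace (/ y * (PI / 2 - N / (INR (S M) * y)))
        with (PI / (2 * y) - (/ y * (N / y)) * / INR (S M)) in A by (field; repeat split; lra).
      lra. }
    assert (L : is_lim_seq (fun M => PI / (2 * y) - / N - (/ y * (N / y)) * / INR (S M))
       (PI / (2 * y) - / N - (/ y * (N / y)) * 0)).
    { apply is_lim_seq_minus'; [apply is_lim_seq_const|].
      apply (is_lim_seq_scal_l _ _ (Finite 0)), is_lim_inv_INR. }
    rewrite Rmult_0_r, Rminus_0_r in L.
    apply (is_lim_seq_le _ (fun _ => Rres N) _ (Rres N) B2 L), is_lim_seq_const.
  - apply (ex_series_bounded _ (PI / (2 * y)) Hpos). intros M.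
    assert (B : rsum (fun m => res N (INR (S m) * y)) M <= hres N (INR M)).
    { induction M as [|M IH]; [simpl; rewrite H0; lra|]. cbn [rsum].
      destruct (hres_step N (INR M) HN (pos_INR _)) as [U _]. rewrite <- S_INR in U. lra. }
    eapply Rle_trans; [apply B|]. unfold hres.
    pose proof (atan_bound (INR M * y / N)) as [_ A].
    apply Rle_trans with (/ y * (PI / 2)); [apply Rmult_le_compat_l; lra|right; field; lra].
Qed.

Lemma Rres_lim : is_lim_seq (fun n => Rres (INR (S n))) (PI / (2 * y)).
Proof.
  apply is_lim_seq_le_le with (fun n => PI / (2 * y) - / INR (S n)) (fun _ => PI / (2 * y)).
  - intros n. apply Rres_limit_bounds, INR_S_pos.
  - replace (Finite (PI / (2 * y))) with (Finite (PI / (2 * y) - 0)) by (f_equal; ring).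
    apply is_lim_seq_minus'; [apply is_lim_seq_const|apply is_lim_inv_INR].
  - apply is_lim_seq_const.
Qed.

(** The real part of [1 / (w (w + 1))] at [w = n + 1 + i (m + 1) y]. The lattice sum of weight 2
    converges only conditionally. Subtracting these terms makes it converge absolutely; they
    telescope in [n], and their sums over [m] are differences of the Riemann sums [Rres]. *)
Definition tel (m n : nat) : R := res (INR (S n)) (INR (S m) * y) - res (INR (S (S n))) (INR (S m) * y).
Definition err (m n : nat) : R := lat 2 (INR (S m) * y) (S n) - tel m n.

(** A convergent majorant with exponent 3/2, as [|w| ^ (- 3)] splits evenly between the two indices. *)
Definition w32 (n : nat) : R := / (INR (S n) * sqrt (INR (S n))).

Lemma w32_ex : ex_series w32.
Proof.
  apply ex_series_telescope with (fun n => 8 * / sqrt (INR (S n))).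
  - intros n. unfold w32. rewrite (S_INR (S n)).
    set (a := INR (S n)). assert (Ha : 1 <= a) by (unfold a; rewrite S_INR; pose proof (pos_INR n); lra).
    pose proof (sqrt_lt_R0 a ltac:(lra)) as S1. pose proof (sqrt_lt_R0 (a + 1) ltac:(lra)) as S2.
    pose proof (sqrt_sqrt a ltac:(lra)) as Q1. pose proof (sqrt_sqrt (a + 1) ltac:(lra)) as Q2.
    set (s := sqrt a) in *. set (t := sqrt (a + 1)) in *.
    split; [apply Rlt_le, Rinv_0_lt_compat, Rmult_lt_0_compat; lra|].
    assert (T2 : t <= 2 * s) by nra.
    assert (E : 8 * / s - 8 * / t = 8 / (s * t * (s + t))).
    { assert (X : t - s = 1 / (s + t)).
      { apply Rmult_eq_reg_r with (s + t); [|lra]. replace (1 / (s + t) * (s + t)) with 1 by (field; lra). nra. }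
      replace (8 * / s - 8 * / t) with (8 * (t - s) / (s * t)) by (field; lra). rewrite X. field. lra. }
    rewrite E. rewrite <- Q1.
    apply Rmult_le_reg_r with (s * t * (s + t)); [repeat apply Rmult_lt_0_compat; lra|].
    replace (8 / (s * t * (s + t)) * (s * t * (s + t))) with 8 by (field; lra).
    apply Rmult_le_reg_l with (s * s * s); [repeat apply Rmult_lt_0_compat; lra|].
    replace (s * s * s * (/ (s * s * s) * (s * t * (s + t)))) with (s * (t * (s + t))) by (field; lra).
    assert (t * (s + t) <= (2 * s) * (3 * s)) by (apply Rmult_le_compat; lra).
    assert (s * (t * (s + t)) <= s * (2 * s * (3 * s))) by (apply Rmult_le_compat_l; lra).
    assert (0 < s * s * s) by (repeat apply Rmult_lt_0_compat; lra). lra.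
  - intros n. pose proof (sqrt_lt_R0 _ (INR_S_pos n)) as P. apply Rinv_0_lt_compat in P. lra.
Qed.

Lemma err_bound m n : Rabs (err m n) <= / (y * sqrt y) * w32 m * w32 n.
Proof.
  unfold err, tel. pose proof (INR_S_pos m) as Pm. pose proof (INR_S_pos n) as Pn.
  set (N := INR (S n)) in *. set (x := INR (S m) * y).
  assert (Px : 0 < x) by now apply Rmult_lt_0_compat.
  set (w := (RtoC N + Ci * RtoC x)%C).
  assert (Nw : w <> 0) by (apply lattice_neq0; lra).
  assert (Nw1 : (w + 1)%C <> 0).
  { intros E. apply (f_equal Im) in E. unfold w, Im in E; simpl in E. lra. }
  assert (E : lat 2 x (S n) - (res N x - res (INR (S (S n))) x) = Re (/ (w * w * (w + 1)))%C).
  { rewrite <- !res_Re by auto. rewrite (S_INR (S n)). fold N. unfold lat. fold N. fold w.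
    replace (RtoC (N + 1) + Ci * x)%C with (w + 1)%C by (unfold w; rewrite RtoC_plus; ring).
    change (Re (pw 2 w) - (Re (/ w) - Re (/ (w + 1)))) with (Re (pw 2 w - (/ w - / (w + 1)))%C).
    f_equal. unfold pw. field. auto. }
  rewrite E. eapply Rle_trans; [apply re_le_Cmod|].
  rewrite Cmod_inv, !Cmod_mult by (repeat apply Cmult_neq_0; auto).
  set (c := Cmod w). assert (Hc : 0 < c) by now apply Cmod_gt_0.
  assert (C1 : c <= Cmod (w + 1)).
  { apply Cmod_le_Re; [unfold w, Im; simpl; ring|]. unfold w, Re; simpl.
    replace (N + (0 * x - 1 * 0) + 1) with (N + 1) by ring. replace (N + (0 * x - 1 * 0)) with N by ring.
    rewrite !Rabs_pos_eq; lra. }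
  assert (C2 : N * x <= c ^ 2) by (apply lattice_lower; auto).
  assert (C3 : sqrt N * sqrt x <= c).
  { rewrite <- sqrt_mult by lra. rewrite <- (sqrt_pow2 c) by lra. apply sqrt_le_1_alt. auto. }
  pose proof (sqrt_lt_R0 N Pn) as S1. pose proof (sqrt_lt_R0 x Px) as S2.
  unfold w32. fold N.
  replace (/ (y * sqrt y) * / (INR (S m) * sqrt (INR (S m))) * / (N * sqrt N))
    with (/ ((N * x) * (sqrt N * sqrt x))).
  2:{ unfold x. rewrite sqrt_mult by lra. pose proof (sqrt_lt_R0 _ Pm). pose proof (sqrt_lt_R0 _ Hy).
      field. repeat split; lra. }
  apply Rinv_le_contravar.
  - repeat apply Rmult_lt_0_compat; auto.
  - replace (c * c) with (c ^ 2) by ring. apply Rmult_le_compat; try lra.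
    + apply Rmult_le_pos; lra.
    + apply Rmult_le_pos; lra.
Qed.

(** The correction is what remains of the subtracted terms: they sum to [Rres 1] in one order and to
    [Rres 1] minus the limit of [Rres] in the other. *)
Lemma latsum2_swap :
  ex_series (fun m => Series (fun n => lat 2 (INR (S m) * y) (S n))) /\
  latsum 2 y = Series (fun n => Series (fun m => lat 2 (INR (S m) * y) (S n))) + PI / (2 * y).
Proof.
  assert (Hsy : 0 < / (y * sqrt y)).
  { apply Rinv_0_lt_compat, Rmult_lt_0_compat; auto. now apply sqrt_lt_R0. }
  assert (Hw : forall m, 0 <= w32 m).
  { intros m. apply Rlt_le, Rinv_0_lt_compat, Rmult_lt_0_compat; [apply INR_S_pos|apply sqrt_lt_R0, INR_S_pos]. }
  destruct (Fubini_prod err (fun m => / (y * sqrt y) * w32 m) w32) as (F1 & F2 & F3 & F4 & F5).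
  { apply err_bound. }
  { intros m. apply Rmult_le_pos; auto; lra. }
  { apply (ex_series_scal_l (V := R_NormedModule)), w32_ex. }
  { apply w32_ex. }
  assert (T1 : forall m, is_series (tel m) (res 1 (INR (S m) * y))).
  { intros m. set (x := INR (S m) * y). assert (Px : 0 < x) by (apply Rmult_lt_0_compat; auto; apply INR_S_pos).
    apply is_series_rsum.
    apply is_lim_seq_ext with (fun M => res 1 x - res (INR (S M)) x).
    { intros M. induction M as [|M IH]; [simpl; ring|]. cbn [rsum]. rewrite <- IH. unfold tel. fold x. ring. }
    replace (Finite (res 1 x)) with (Finite (res 1 x - 0)) by (f_equal; ring).
    apply is_lim_seq_minus'; [apply is_lim_seq_const|].
    apply is_lim_seq_le_le with (fun _ => 0) (fun M => / INR (S M)).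
    - intros M. pose proof (INR_S_pos M) as P. split; [now apply res_bounds|]. unfold res.
      apply Rle_trans with (INR (S M) / (INR (S M) ^ 2)); [|right; field; lra].
      unfold Rdiv. apply Rmult_le_compat_l; [lra|]. apply Rinv_le_contravar; [now apply pow_lt|].
      pose proof (pow2_ge_0 x). lra.
    - apply is_lim_seq_const.
    - apply is_lim_inv_INR. }
  assert (T2 : forall n, ex_series (fun m => tel m n) /\ Series (fun m => tel m n) = Rres (INR (S n)) - Rres (INR (S (S n)))).
  { intros n. pose proof (Rres_ex _ (INR_S_pos n)) as E1. pose proof (Rres_ex _ (INR_S_pos (S n))) as E2.
    split; [now apply (ex_series_minus (V := R_NormedModule))|]. unfold tel, Rres. now apply Series_minus. }
  assert (Lsplit : forall m n, lat 2 (INR (S m) * y) (S n) = tel m n + err m n) by (intros; unfold err; ring).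
  assert (A1 : forall m, Series (fun n => lat 2 (INR (S m) * y) (S n)) = res 1 (INR (S m) * y) + Series (err m)).
  { intros m. rewrite (Series_ext _ _ (Lsplit m)), Series_plus.
    - f_equal. now apply is_series_unique.
    - eexists; apply T1.
    - apply F1. }
  assert (A2 : forall n, Series (fun m => lat 2 (INR (S m) * y) (S n)) =
     (Rres (INR (S n)) - Rres (INR (S (S n)))) + Series (fun m => err m n)).
  { intros n. rewrite (Series_ext _ _ (fun m => Lsplit m n)), Series_plus.
    - f_equal. apply T2.
    - apply T2.
    - apply F3. }
  pose proof (Rres_ex 1 Rlt_0_1) as E1.
  split.
  { eapply ex_series_ext; [intros m; symmetry; apply A1|]. now apply (ex_series_plus (V := R_NormedModule)). }
  unfold latsum. rewrite (Series_ext _ _ A1), (Series_ext _ _ A2), Series_plus by auto.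
  assert (T3 : is_series (fun n => Rres (INR (S n)) - Rres (INR (S (S n)))) (Rres 1 - PI / (2 * y))).
  { apply is_series_rsum.
    apply is_lim_seq_ext with (fun M => Rres 1 - Rres (INR (S M))).
    { intros M. induction M as [|M IH]; [simpl; ring|]. cbn [rsum]. rewrite <- IH. ring. }
    apply is_lim_seq_minus'; [apply is_lim_seq_const|apply Rres_lim]. }
  rewrite Series_plus; [|eexists; apply T3|auto].
  rewrite (is_series_unique _ _ T3), F5. unfold Rres at 1. ring.
Qed.
End ResidueSum.

Lemma latsum2_inv y : 0 < y -> latsum 2 (/ y) = - y ^ 2 * (latsum 2 y - PI / (2 * y)).
Proof.
  intros Hy. destruct (latsum2_swap y Hy) as [_ E]. rewrite E.
  replace (- y ^ 2 * (Series (fun n => Series (fun m => lat 2 (INR (S m) * y) (S n))) + PI / (2 * y) - PI / (2 * y)))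
    with (- y ^ 2 * Series (fun n => Series (fun m => lat 2 (INR (S m) * y) (S n)))) by ring.
  unfold latsum. rewrite <- Series_scal_l. apply Series_ext. intros m.
  rewrite <- Series_scal_l. apply Series_ext. intros n. unfold lat.
  pose proof (lat_swap 1 y (INR (S m)) (INR (S n)) Hy (INR_S_pos m) (INR_S_pos n)) as X.
  simpl (2 * 1)%nat in X. rewrite X. simpl. ring.
Qed.

Lemma E2re_lattice y : 0 < y -> PI ^ 2 / 6 * E2re y = PI ^ 2 / 6 * (1 - (/ y) ^ 2) + 2 * latsum 2 y.
Proof.
  intros Hy. destruct (Lambert 1 (qre y) (qre_range y Hy)) as (L1 & L2 & L3).
  destruct (latsum2_swap y Hy) as [G _].
  unfold E2re. rewrite L3.
  assert (E : forall m, - (2 * PI) ^ 2 * powsum 1 (qre y ^ S m)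
     = - (/ y) ^ 2 * (/ INR (S m)) ^ 2 + 2 * Series (fun n => lat 2 (INR (S m) * y) (S n))).
  { intros m. rewrite qre_S. pose proof (INR_S_pos m) as Pm.
    rewrite <- Lipschitz2_imag by now apply Rmult_lt_0_compat.
    rewrite Series_scal_l. f_equal. rewrite Rinv_mult, Rpow_mult_distr. ring. }
  assert (S2 := ex_series_inv_sq).
  transitivity (PI ^ 2 / 6 + - (2 * PI) ^ 2 * Series (fun m => powsum 1 (qre y ^ S m))); [field|].
  rewrite <- Series_scal_l, (Series_ext _ _ E), Series_plus, !Series_scal_l, zeta2
    by now apply (ex_series_scal_l (V := R_NormedModule)).
  unfold latsum. ring.
Qed.

(** The failure of the exchange of summations is the quasi-modularity of [E2]. *)
Theorem E2re_inv y : 0 < y -> E2re (/ y) = - y ^ 2 * E2re y + 6 * y / PI.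
Proof.
  intros Hy. assert (Hiy : 0 < / y) by now apply Rinv_0_lt_compat. pose proof PI_RGT_0 as HP.
  pose proof (E2re_lattice y Hy) as A. pose proof (E2re_lattice (/ y) Hiy) as B.
  rewrite latsum2_inv, Rinv_inv in B by auto.
  pose proof (pow_lt PI 2 HP).
  apply Rmult_eq_reg_l with (PI ^ 2 / 6); [|apply Rgt_not_eq; lra].
  rewrite B. transitivity (- y ^ 2 * (PI ^ 2 / 6 * E2re y) + PI * y); [|field; lra]. rewrite A.
  field. lra.
Qed.

(** * The logarithmic derivative of the product defining tau *)

Section Formal.
Open Scope Z_scope.
Import ListNotations.

Fixpoint zsum (f : nat -> Z) (n : nat) : Z :=
  match n with O => 0 | S m => zsum f m + f (S m) end.

Lemma zsum_ext f g n : (forall j, (1 <= j <= n)%nat -> f j = g j) -> zsum f n = zsum g n.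
Proof. induction n; simpl; intros H; auto. rewrite IHn, H; auto; try lia. intros; apply H; lia. Qed.

Lemma zsum_split f a b : zsum f (a + b) = zsum f a + zsum (fun j => f (a + j)%nat) b.
Proof.
  induction b as [|b IH]; [rewrite Nat.add_0_r; simpl; ring|].
  rewrite Nat.add_succ_r. simpl. rewrite IH, Nat.add_succ_r. ring.
Qed.

Lemma zsum_plus f g n : zsum (fun j => f j + g j) n = zsum f n + zsum g n.
Proof. induction n; simpl; auto. rewrite IHn. ring. Qed.

Lemma zsum_0 f n : (forall j, (1 <= j <= n)%nat -> f j = 0) -> zsum f n = 0.
Proof. induction n; simpl; intros H; auto. rewrite IHn, H; auto; try lia. intros; apply H; lia. Qed.

Lemma zsum_scal c f n : zsum (fun j => c * f j) n = c * zsum f n.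
Proof. induction n; simpl; [ring|]. rewrite IHn. ring. Qed.

(** [theta a = s * a] for the derivation [theta = q d/dq]: [s] is the logarithmic derivative. *)
Definition log_deriv (s a : nat -> Z) : Prop :=
  forall n, Z.of_nat n * a n = zsum (fun j => s j * a (n - j)%nat) n.

(** The coefficients of [q ^ k / (1 - q ^ k)], which is the logarithmic derivative of [1 - q ^ k] up
    to the factor [- k]. *)
Definition div_ind (k j : nat) : Z := if (j mod k =? 0)%nat then 1 else 0.

Lemma telescope_multiples k a n : (1 <= k)%nat ->
  zsum (fun j => div_ind k j * mul_one_minus_qpow k a (n - j)%nat) n
  = if (k <=? n)%nat then a (n - k)%nat else 0.
Proof.
  intros Hk. induction n as [n IH] using (well_founded_induction Wf_nat.lt_wf).
  destruct (Nat.leb_spec k n) as [H|H].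
  - pose proof (zsum_split (fun j => div_ind k j * mul_one_minus_qpow k a (n - j)%nat) k (n - k)) as X.
    replace (k + (n - k))%nat with n in X by lia. rewrite X. clear X.
    rewrite (zsum_ext (fun j => div_ind k (k + j) * mul_one_minus_qpow k a (n - (k + j))%nat)
      (fun j => div_ind k j * mul_one_minus_qpow k a ((n - k) - j)%nat) (n - k)).
    2:{ intros j Hj. f_equal.
        - unfold div_ind. replace (k + j)%nat with (j + 1 * k)%nat by lia. now rewrite Nat.Div0.mod_add.
        - f_equal. lia. }
    rewrite IH by lia.
    assert (L1 : forall f : nat -> Z, zsum f k = zsum f (k - 1) + f k).
    { intros f. replace k with (S (k - 1)) at 1 3 by lia. reflexivity. }
    rewrite L1, zsum_0.
    2:{ intros j Hj. unfold div_ind. rewrite Nat.mod_small by lia.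
        destruct (Nat.eqb_spec j 0); [lia|ring]. }
    unfold div_ind. rewrite Nat.Div0.mod_same. simpl (0 =? 0)%nat.
    unfold mul_one_minus_qpow. destruct (Nat.leb_spec k (n - k)); [|ring].
    replace (n - k - k)%nat with (n - k - k)%nat by lia. ring.
  - apply zsum_0. intros j Hj. unfold div_ind. rewrite Nat.mod_small by lia.
    destruct (Nat.eqb_spec j 0); [lia|ring].
Qed.

Lemma log_deriv_mul s a k : (1 <= k)%nat -> log_deriv s a ->
  log_deriv (fun j => s j - Z.of_nat k * div_ind k j) (mul_one_minus_qpow k a).
Proof.
  intros Hk H n.
  rewrite (zsum_ext _ (fun j => s j * mul_one_minus_qpow k a (n - j)%nat
     + - Z.of_nat k * (div_ind k j * mul_one_minus_qpow k a (n - j)%nat))) by (intros; ring).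
  rewrite zsum_plus, zsum_scal, telescope_multiples by auto.
  unfold mul_one_minus_qpow at 1. destruct (Nat.leb_spec k n) as [L|L].
  - assert (E : zsum (fun j => s j * mul_one_minus_qpow k a (n - j)%nat) n
      = zsum (fun j => s j * a (n - j)%nat) n - zsum (fun j => s j * a ((n - k) - j)%nat) (n - k)).
    { pose proof (zsum_split (fun j => s j * mul_one_minus_qpow k a (n - j)%nat) (n - k) k) as X1.
      pose proof (zsum_split (fun j => s j * a (n - j)%nat) (n - k) k) as X2.
      replace (n - k + k)%nat with n in X1, X2 by lia. rewrite X1, X2. clear X1 X2.
      rewrite (zsum_ext (fun j => s j * mul_one_minus_qpow k a (n - j)%nat)
        (fun j => s j * a (n - j)%nat + - 1 * (s j * a ((n - k) - j)%nat)) (n - k)).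
      2:{ intros j Hj. unfold mul_one_minus_qpow. destruct (Nat.leb_spec k (n - j)); [|lia].
          replace (n - j - k)%nat with (n - k - j)%nat by lia. ring. }
      rewrite (zsum_ext (fun j => s (n - k + j)%nat * mul_one_minus_qpow k a (n - (n - k + j))%nat)
        (fun j => s (n - k + j)%nat * a (n - (n - k + j))%nat) k).
      2:{ intros j Hj. unfold mul_one_minus_qpow. destruct (Nat.leb_spec k (n - (n - k + j))); [lia|auto]. }
      rewrite zsum_plus, zsum_scal. ring. }
    rewrite E, <- !H, Nat2Z.inj_sub by auto. ring.
  - rewrite (zsum_ext _ (fun j => s j * a (n - j)%nat)).
    + rewrite <- H. ring.
    + intros j Hj. unfold mul_one_minus_qpow. destruct (Nat.leb_spec k (n - j)); [lia|auto].
Qed.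

Lemma log_deriv_iter s a k r : (1 <= k)%nat -> log_deriv s a ->
  log_deriv (fun j => s j - Z.of_nat r * (Z.of_nat k * div_ind k j)) (Nat.iter r (mul_one_minus_qpow k) a).
Proof.
  intros Hk H. induction r as [|r IH].
  - intros n. simpl Nat.iter. rewrite H. apply zsum_ext. intros; simpl; ring.
  - simpl Nat.iter. intros n. rewrite (log_deriv_mul _ _ k Hk IH n). apply zsum_ext.
    intros j _. f_equal. rewrite Nat2Z.inj_succ. ring.
Qed.

Lemma log_deriv_euler m :
  log_deriv (fun j => - 24 * zsum (fun k => Z.of_nat k * div_ind k j) m) (euler_prod24 m).
Proof.
  induction m as [|m IH].
  - intros n. simpl zsum. rewrite zsum_0 by (intros; ring). simpl.
    destruct (Nat.eqb_spec n 0) as [->|]; ring.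
  - intros n. change (euler_prod24 (S m)) with (Nat.iter 24 (mul_one_minus_qpow (S m)) (euler_prod24 m)).
    rewrite (log_deriv_iter _ _ (S m) 24 ltac:(lia) IH n). apply zsum_ext. intros j _.
    f_equal. change (Z.of_nat 24) with 24. cbn [zsum]. ring.
Qed.

Lemma iter_mul_low r k a i : (i < k)%nat -> Nat.iter r (mul_one_minus_qpow k) a i = a i.
Proof.
  intros H. induction r as [|r IH]; auto. simpl Nat.iter. unfold mul_one_minus_qpow at 1.
  destruct (Nat.leb_spec k i); [lia|]. auto.
Qed.

(** The factors of index above [i] do not change the coefficient of [q ^ i]. *)
Lemma euler_stable m i : (i <= m)%nat -> euler_prod24 m i = euler_prod24 i i.
Proof.
  intros H. induction H as [|m H IH]; auto. rewrite <- IH.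
  change (euler_prod24 (S m)) with (Nat.iter 24 (mul_one_minus_qpow (S m)) (euler_prod24 m)).
  apply iter_mul_low. lia.
Qed.

Lemma sigma1_zsum j m : (1 <= j <= m)%nat ->
  zsum (fun k => Z.of_nat k * div_ind k j) m = Z.of_nat (sigma 1 j).
Proof.
  intros H. replace m with (j + (m - j))%nat by lia. rewrite zsum_split.
  rewrite (zsum_0 (fun i => Z.of_nat (j + i) * div_ind (j + i) j)).
  2:{ intros i Hi. unfold div_ind. rewrite Nat.mod_small by lia. destruct (Nat.eqb_spec j 0); [lia|ring]. }
  rewrite Z.add_0_r. unfold sigma.
  assert (K : forall M, Z.of_nat (list_sum (map (fun d => (d ^ 1)%nat) (filter (fun d => (j mod d =? 0)%nat) (seq 1 M))))
     = zsum (fun k => Z.of_nat k * div_ind k j) M).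
  { induction M as [|M IHM]; [reflexivity|].
    rewrite seq_S, filter_app, map_app, list_sum_app, Nat2Z.inj_add, IHM. cbn [zsum]. f_equal.
    change (1 + M)%nat with (S M). unfold div_ind. cbn [filter].
    destruct (j mod S M =? 0)%nat; cbn [map]; unfold list_sum; cbn [fold_right];
      rewrite ?Nat.pow_1_r; lia. }
  now rewrite K.
Qed.

(** The logarithmic derivative of [prod (1 - q ^ n) ^ 24] is [- 24 sum sigma_1(n) q ^ n]. *)
Lemma tau_recursion n :
  Z.of_nat n * tau (S n) = - 24 * zsum (fun j => Z.of_nat (sigma 1 j) * tau (S (n - j))) n.
Proof.
  cbn [tau]. rewrite (log_deriv_euler n n), <- zsum_scal. apply zsum_ext. intros j Hj.
  rewrite sigma1_zsum, (euler_stable n (n - j)) by lia. ring.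
Qed.
End Formal.

(** * The discriminant and the Eisenstein series as functions of q *)

Lemma ex_series_term_bound (a : nat -> R) n : (forall k, 0 <= a k) -> ex_series a -> a n <= Series a.
Proof.
  intros Ha He. eapply Rle_trans; [|apply (rsum_le_Series a (S n)); auto]. simpl.
  assert (0 <= rsum a n); [|lra]. clear -Ha. induction n; simpl; [lra|]. specialize (Ha n). lra.
Qed.

Lemma sigma_le k n : INR (sigma k n) <= INR n ^ S k.
Proof.
  unfold sigma. rewrite INR_list_sum_filter.
  assert (H : forall m, (m <= n)%nat ->
    rsum (fun d => if (n mod S d =? 0)%nat then INR (S d ^ k) else 0) m <= INR m * INR n ^ k).
  { induction m as [|m IH]; intros Hm; [simpl; lra|]. cbn [rsum]. rewrite (S_INR m).
    assert (B : (if (n mod S m =? 0)%nat then INR (S m ^ k) else 0) <= INR n ^ k).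
    { destruct (_ =? _)%nat; [|apply pow_le, pos_INR]. rewrite pow_INR. apply pow_incr.
      split; [apply pos_INR|]. now apply le_INR. }
    specialize (IH ltac:(lia)). lra. }
  simpl. apply H. lia.
Qed.

Definition sig_coef (k : nat) (n : nat) : C := RtoC (INR (sigma k n)).

Lemma sig_geom k r : 0 < r < 1 -> geom_bounded (sig_coef k) r.
Proof.
  intros Hr. exists (Series (fun n => INR n ^ S k * r ^ n)). intros n. unfold sig_coef.
  rewrite Cmod_R, Rabs_pos_eq by apply pos_INR.
  pose proof (pow_lt r n ltac:(lra)) as P.
  eapply Rle_trans; [apply Rmult_le_compat_r; [lra|apply sigma_le]|].
  apply (ex_series_term_bound (fun n => INR n ^ S k * r ^ n)).
  - intros m. apply Rmult_le_pos; [apply pow_le, pos_INR|apply pow_le; lra].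
  - apply ex_series_pow_geom. lra.
Qed.

Lemma unit_disc_radius z : Cmod z < 1 -> exists r, 0 < r < 1 /\ Cmod z < r.
Proof. intros H. exists ((Cmod z + 1) / 2). pose proof (Cmod_ge_0 z). lra. Qed.

Definition Sig (k : nat) (q : C) : C := PS (sig_coef k) q.

Lemma Sig_hol k q : Cmod q < 1 -> hol (Sig k) q.
Proof.
  intros H. destruct (unit_disc_radius q H) as [r [H1 H2]].
  apply (PS_hol _ r); [lra| |auto]. now apply sig_geom.
Qed.

Definition tau_coef (n : nat) : C := RtoC (IZR (tau (S n))).

Lemma tau_recursion_R n : INR n * IZR (tau (S n)) =
  - 24 * rsum (fun i => INR (sigma 1 (S i)) * IZR (tau (S (n - S i)))) n.
Proof.
  pose proof (f_equal IZR (tau_recursion n)) as H. rewrite !mult_IZR, <- INR_IZR_INZ in H. rewrite H.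
  simpl (IZR (-24)). f_equal.
  assert (K : forall m, IZR (zsum (fun j => (Z.of_nat (sigma 1 j) * tau (S (n - j)))%Z) m)
     = rsum (fun i => INR (sigma 1 (S i)) * IZR (tau (S (n - S i)))) m).
  { induction m as [|m IH]; [reflexivity|]. cbn [zsum rsum].
    rewrite plus_IZR, mult_IZR, IH, <- INR_IZR_INZ. reflexivity. }
  apply K.
Qed.

Lemma Rabs_rsum a n : Rabs (rsum a n) <= rsum (fun k => Rabs (a k)) n.
Proof.
  induction n; simpl; [rewrite Rabs_R0; lra|]. eapply Rle_trans; [apply Rabs_triang|]. lra.
Qed.

Lemma rsum_le a b n : (forall k, (k < n)%nat -> a k <= b k) -> rsum a n <= rsum b n.
Proof.
  induction n; simpl; intros H; [lra|]. apply Rplus_le_compat; auto.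
Qed.

(** The recursion bounds [tau (n + 1)] by any geometric sequence of ratio larger than one: for large
    [n], the factor [n] on its left side dominates the convergent sum on its right side. *)
Lemma tau_geom r : 0 < r < 1 -> geom_bounded tau_coef r.
Proof.
  intros Hr.
  (* if all earlier terms are at most [M], the recursion bounds [n] times the next one by [M A] *)
  set (A := 24 * Series (fun i => INR (sigma 1 (S i)) * r ^ S i)).
  assert (Hs : forall i, 0 <= INR (sigma 1 (S i)) * r ^ S i).
  { intros i. apply Rmult_le_pos; [apply pos_INR|apply pow_le; lra]. }
  assert (He : ex_series (fun i => INR (sigma 1 (S i)) * r ^ S i)).
  { apply (ex_series_incr_1 (fun i => INR (sigma 1 i) * r ^ i)).
    apply (ex_series_le (V := R_CompleteNormedModule) _ (fun n => INR n ^ 2 * r ^ n)).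
    - intros n. change (Rabs (INR (sigma 1 n) * r ^ n) <= INR n ^ 2 * r ^ n).
      pose proof (pow_le r n ltac:(lra)). rewrite Rabs_pos_eq by (apply Rmult_le_pos; auto; apply pos_INR).
      apply Rmult_le_compat_r; auto. apply sigma_le.
    - apply ex_series_pow_geom. lra. }
  set (u := fun n => Rabs (IZR (tau (S n))) * r ^ n).
  assert (Hu : forall n, 0 <= u n) by (intros n; apply Rmult_le_pos; [apply Rabs_pos|apply pow_le; lra]).
  assert (Rec : forall n M, 0 <= M -> (forall m, (m < n)%nat -> u m <= M) -> INR n * u n <= M * A).
  { intros n M HM Hm. unfold u. rewrite <- Rmult_assoc, <- (Rabs_pos_eq (INR n)) at 1 by apply pos_INR.
    rewrite <- Rabs_mult, tau_recursion_R, Rabs_mult.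
    replace (Rabs (-24)) with 24 by (rewrite Rabs_left; lra).
    pose proof (pow_lt r n ltac:(lra)) as Pr.
    apply Rle_trans with (24 * rsum (fun i => M * (INR (sigma 1 (S i)) * r ^ S i)) n).
    - rewrite Rmult_assoc. apply Rmult_le_compat_l; [lra|].
      eapply Rle_trans; [apply Rmult_le_compat_r; [lra|apply Rabs_rsum]|].
      assert (E : forall m, rsum (fun k => Rabs (INR (sigma 1 (S k)) * IZR (tau (S (n - S k))))) m * r ^ n
        = rsum (fun k => Rabs (INR (sigma 1 (S k)) * IZR (tau (S (n - S k)))) * r ^ n) m).
      { induction m as [|m IH]; cbn [rsum]; [ring|]. rewrite <- IH. ring. }
      rewrite E. apply rsum_le. intros k Hk.
      rewrite Rabs_mult, (Rabs_pos_eq (INR _)) by apply pos_INR.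
      specialize (Hm (n - S k)%nat ltac:(lia)). unfold u in Hm.
      replace (r ^ n) with (r ^ (n - S k) * r ^ S k) by (rewrite <- pow_add; f_equal; lia).
      replace (INR (sigma 1 (S k)) * Rabs (IZR (tau (S (n - S k)))) * (r ^ (n - S k) * r ^ S k))
        with ((Rabs (IZR (tau (S (n - S k)))) * r ^ (n - S k)) * (INR (sigma 1 (S k)) * r ^ S k)) by ring.
      apply Rmult_le_compat_r; auto.
    - assert (E : forall m, rsum (fun i => M * (INR (sigma 1 (S i)) * r ^ S i)) m
        = M * rsum (fun i => INR (sigma 1 (S i)) * r ^ S i) m).
      { induction m as [|m IH]; cbn [rsum]; [ring|]. rewrite IH. ring. }
      rewrite E. unfold A.
      pose proof (rsum_le_Series (fun i => INR (sigma 1 (S i)) * r ^ S i) n Hs He) as L.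
      apply (Rmult_le_compat_l M) in L; auto. lra. }
  destruct (archimed_cor1 (/ (Rabs A + 1))) as [N [HN1 HN2]].
  { apply Rinv_0_lt_compat. pose proof (Rabs_pos A). lra. }
  assert (HNA : forall n, (N <= n)%nat -> A <= INR n).
  { intros n Hn. pose proof (Rabs_pos A). pose proof (Rle_abs A).
    assert (Rabs A + 1 < INR N).
    { apply Rinv_lt_cancel; [now apply lt_0_INR|]. auto. }
    apply le_INR in Hn. lra. }
  assert (HM : exists M, 0 <= M /\ forall n, (n <= N)%nat -> u n <= M).
  { clear -Hu. induction N as [|N [M [HM H]]].
    - exists (u O). split; auto. intros n Hn. replace n with O by lia. lra.
    - exists (Rmax M (u (S N))). split; [eapply Rle_trans; [apply HM|apply Rmax_l]|].
      intros n Hn. destruct (Nat.eq_dec n (S N)) as [->|E]; [apply Rmax_r|].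
      eapply Rle_trans; [apply H; lia|apply Rmax_l]. }
  destruct HM as [M [HM0 HM]].
  exists M. intros n. unfold tau_coef. rewrite Cmod_R. fold (u n).
  induction n as [n IH] using (well_founded_induction Wf_nat.lt_wf).
  destruct (le_lt_dec n N) as [H|H]; [now apply HM|].
  assert (Pn : 0 < INR n) by (apply lt_0_INR; lia).
  apply Rmult_le_reg_l with (INR n); auto. eapply Rle_trans; [apply (Rec n M HM0 IH)|].
  rewrite Rmult_comm. apply Rmult_le_compat_r; auto. apply HNA. lia.
Qed.

(** [Delta] divided by [q], as a function of [q]. *)
Definition Prod (q : C) : C := PS tau_coef q.

Lemma Prod_derive q : Cmod q < 1 -> CD Prod q (PS (PS_d tau_coef) q).
Proof.
  intros H. destruct (unit_disc_radius q H) as [r [H1 H2]].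
  apply (PS_derive _ r); [lra| |auto]. now apply tau_geom.
Qed.

Lemma Prod_hol q : Cmod q < 1 -> hol Prod q.
Proof. intros H. eexists. now apply Prod_derive. Qed.

(** The recursion for [tau], as a differential equation. *)
Lemma Prod_ode q : Cmod q < 1 ->
  (q * PS (PS_d tau_coef) q = - (24) * Sig 1 q * Prod q)%C.
Proof.
  intros H. destruct (unit_disc_radius q H) as [r [H1 H2]].
  assert (A1 : abs_cv (fun n => sig_coef 1 n * q ^ n)%C) by (apply PS_abs_cv with r; [lra|now apply sig_geom|auto]).
  assert (A2 : abs_cv (fun n => tau_coef n * q ^ n)%C) by (apply PS_abs_cv with r; [lra|now apply tau_geom|auto]).
  pose proof (CSeries_mult _ _ A1 A2) as L.
  assert (E : forall n, csum (fun k => sig_coef 1 k * q ^ k * (tau_coef (n - k)%nat * q ^ (n - k)%nat))%C (S n)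
     = (- / 24 * (RtoC (INR n) * tau_coef n * q ^ n))%C).
  { intros n. rewrite csum_shift.
    replace (sig_coef 1 0) with (RtoC 0) by reflexivity. rewrite !Cmult_0_l, Cplus_0_l.
    unfold tau_coef at 2. rewrite <- RtoC_mult, tau_recursion_R.
    assert (K : forall m, (m <= n)%nat -> csum (fun k => sig_coef 1 (S k) * q ^ S k * (tau_coef (n - S k)%nat * q ^ (n - S k)%nat))%C m
      = (RtoC (rsum (fun i => (INR (sigma 1 (S i)) * IZR (tau (S (n - S i))))%R) m) * q ^ n)%C).
    { induction m as [|m IH]; intros Hm; cbn [csum rsum]; [ring|]. rewrite IH by lia.
      rewrite RtoC_plus, RtoC_mult. unfold sig_coef, tau_coef.
      replace (q ^ n)%C with (q ^ S m * q ^ (n - S m))%C by (rewrite <- Cpow_add_r; f_equal; lia). ring. }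
    rewrite K by lia. rewrite RtoC_mult.
    replace (RtoC (- (24))) with (- RtoC 24)%C by (now rewrite <- RtoC_opp).
    field. }
  assert (A3 : abs_cv (fun n => INR n * tau_coef n * q ^ n)%C).
  { apply abs_cv_S. apply (abs_cv_ext (fun n => q * (PS_d tau_coef n * q ^ n))%C).
    - intros n. unfold PS_d. simpl. ring.
    - apply abs_cv_scal. set (s := (Cmod q + r) / 2). pose proof (Cmod_ge_0 q).
      apply PS_abs_cv with s; [unfold s; lra| |unfold s; lra].
      apply geom_bounded_d with r; [unfold s; lra|now apply tau_geom]. }
  assert (E2 : (q * PS (PS_d tau_coef) q = CSeries (fun n => INR n * tau_coef n * q ^ n))%C).
  { rewrite (CSeries_S _ A3). simpl INR.
    replace (0 * tau_coef 0 * q ^ 0)%C with (RtoC 0) by ring. rewrite Cplus_0_l.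
    unfold PS. rewrite <- CSeries_scal.
    - apply CSeries_ext. intros n. unfold PS_d. simpl. ring.
    - set (s := (Cmod q + r) / 2). pose proof (Cmod_ge_0 q).
      apply PS_abs_cv with s; [unfold s; lra| |unfold s; lra].
      apply geom_bounded_d with r; [unfold s; lra|now apply tau_geom]. }
  rewrite E2.
  assert (X : (CSeries (fun n => sig_coef 1 n * q ^ n) * CSeries (fun n => tau_coef n * q ^ n)
     = - / 24 * CSeries (fun n => INR n * tau_coef n * q ^ n))%C).
  { eapply is_Clim_unique; [exact L|].
    rewrite <- CSeries_scal by auto.
    eapply is_Clim_ext; [|apply CSeries_lim, abs_cv_scal, A3].
    intros n. apply csum_ext. intros k _. symmetry. apply E. }
  unfold Sig, Prod, PS. rewrite <- Cmult_assoc, X. field.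
Qed.

(** A power series with derivative [- 24 Sig 1 q / q]. *)
Definition log_coef (n : nat) : C := match n with O => 0 | S m => (- (24) * sig_coef 1 (S m) / INR (S m))%C end.

Lemma log_geom r : 0 < r < 1 -> geom_bounded log_coef r.
Proof.
  intros Hr. destruct (sig_geom 1 r Hr) as [M HM]. exists (24 * Rabs M). intros [|n].
  - simpl. rewrite Cmod_0. pose proof (Rabs_pos M). lra.
  - unfold log_coef. assert (N : RtoC (INR (S n)) <> 0) by (apply C_INR_neq0; lia).
    rewrite Cmod_div, Cmod_mult, Cmod_opp, !Cmod_R by auto.
    rewrite (Rabs_pos_eq 24), (Rabs_pos_eq (INR _)) by (try apply pos_INR; lra).
    specialize (HM (S n)). pose proof (Cmod_ge_0 (sig_coef 1 (S n))). pose proof (pow_lt r (S n) ltac:(lra)).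
    assert (I : / INR (S n) <= 1).
    { rewrite <- Rinv_1. apply Rinv_le_contravar; [lra|]. rewrite S_INR. pose proof (pos_INR n). lra. }
    assert (0 < / INR (S n)) by (apply Rinv_0_lt_compat, INR_S_pos).
    assert (0 <= Cmod (sig_coef 1 (S n)) * r ^ S n) by (apply Rmult_le_pos; lra).
    pose proof (Rle_abs M).
    replace (24 * Cmod (sig_coef 1 (S n)) / INR (S n) * r ^ S n)
      with (24 * (Cmod (sig_coef 1 (S n)) * r ^ S n * / INR (S n))) by (unfold Rdiv; ring).
    apply Rmult_le_compat_l; [lra|].
    apply Rle_trans with (Cmod (sig_coef 1 (S n)) * r ^ S n * 1); [apply Rmult_le_compat_l; lra|lra].
Qed.

(** Both sides satisfy the differential equation of [Prod_ode] and have value 1 at 0. *)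
Lemma Prod_exp q : Cmod q < 1 -> Prod q = Cexp (PS log_coef q).
Proof.
  intros H.
  set (G := PS log_coef).
  assert (DG : forall u, Cmod u < 1 -> CD G u (PS (PS_d log_coef) u)).
  { intros u Hu. destruct (unit_disc_radius u Hu) as [r [H1 H2]].
    apply (PS_derive _ r); [lra| |auto]. now apply log_geom. }
  assert (EG : forall u, Cmod u < 1 -> (u * PS (PS_d log_coef) u = - (24) * Sig 1 u)%C).
  { intros u Hu. destruct (unit_disc_radius u Hu) as [r [H1 H2]].
    assert (B : forall n, PS_d log_coef n = (- (24) * sig_coef 1 (S n))%C).
    { intros n. unfold PS_d, log_coef. field. apply C_INR_neq0. lia. }
    unfold Sig. rewrite (PS_S (sig_coef 1) r u) by (auto; try lra; now apply sig_geom).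
    replace (sig_coef 1 0) with (RtoC 0) by reflexivity.
    assert (X : PS (PS_d log_coef) u = (- (24) * PS (fun n => sig_coef 1 (S n)) u)%C).
    { unfold PS. rewrite <- CSeries_scal.
      - apply CSeries_ext. intros n. rewrite B. ring.
      - apply PS_abs_cv with r; [lra| |auto]. apply geom_bounded_S; [lra|]. now apply sig_geom. }
    rewrite X. ring. }
  assert (Z : forall u, Cmod u < 1 -> (PS (PS_d tau_coef) u - Prod u * PS (PS_d log_coef) u = 0)%C).
  { intros u Hu. destruct (Ceq_dec u 0) as [->|N].
    - unfold Prod. rewrite !PS_0. unfold PS_d, log_coef, tau_coef, sig_coef.
      replace (tau 2) with (-24)%Z by reflexivity. replace (tau 1) with 1%Z by reflexivity.
      replace (sigma 1 1) with 1%nat by reflexivity. simpl INR.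
      replace (RtoC (-24)) with (- RtoC 24)%C by (now rewrite <- RtoC_opp). field.
    - assert (E : (u * (PS (PS_d tau_coef) u - Prod u * PS (PS_d log_coef) u) = 0)%C).
      { transitivity (u * PS (PS_d tau_coef) u - Prod u * (u * PS (PS_d log_coef) u))%C; [ring|].
        rewrite Prod_ode, EG by auto. ring. }
      destruct (Ceq_dec (PS (PS_d tau_coef) u - Prod u * PS (PS_d log_coef) u) 0) as [|N2]; auto.
      exfalso. apply (Cmult_neq_0 _ _ N N2 E). }
  assert (K : (Prod q * Cexp (- G q) = Prod 0 * Cexp (- G 0))%C).
  { apply (derive_zero_const (fun u => Prod u * Cexp (- G u))%C 0 q). intros t Ht.
    set (u := (0 + RtoC t * (q - 0))%C).
    assert (Hu : Cmod u < 1).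
    { unfold u. replace (0 + t * (q - 0))%C with (RtoC t * q)%C by ring.
      rewrite Cmod_mult, Cmod_R, Rabs_pos_eq by lra. pose proof (Cmod_ge_0 q). nra. }
    eapply CD_eq; [apply CD_mult; [now apply Prod_derive|]|reflexivity|].
    - apply (CD_comp Cexp (fun u => - G u)%C); [apply CD_Cexp|]. apply CD_opp. now apply DG.
    - simpl. transitivity ((PS (PS_d tau_coef) u - Prod u * PS (PS_d log_coef) u) * Cexp (- G u))%C; [ring|].
      rewrite Z by auto. ring. }
  assert (P0 : Prod 0 = 1) by (unfold Prod; rewrite PS_0; reflexivity).
  assert (G0 : G 0 = 0) by (unfold G; rewrite PS_0; reflexivity).
  rewrite P0, G0 in K. replace (- RtoC 0)%C with (RtoC 0) in K by ring. rewrite Cexp_0, Cexp_opp in K.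
  transitivity (Prod q * / Cexp (G q) * Cexp (G q))%C; [field; apply Cexp_neq0|]. rewrite K. ring.
Qed.

Lemma Prod_neq0 q : Cmod q < 1 -> Prod q <> 0.
Proof. intros H. rewrite Prod_exp by auto. apply Cexp_neq0. Qed.

Lemma qpar_disc z : 0 < Im z -> Cmod (qpar z) < 1.
Proof.
  intros H. rewrite Cmod_qpar, <- exp_0. apply exp_increasing. pose proof PI_RGT_0. nra.
Qed.

Lemma Delta_Prod z : 0 < Im z -> Delta z = (qpar z * Prod (qpar z))%C.
Proof.
  intros H. pose proof (qpar_disc z H) as Hq. set (q := qpar z) in *.
  destruct (unit_disc_radius q Hq) as [r [H1 H2]].
  unfold Delta. fold q. unfold Prod. rewrite (PS_S _ r) by (auto; try lra; now apply tau_geom).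
  replace (tau_coef 0) with (RtoC 1) by reflexivity.
  assert (E : CSeries (fun n => RtoC (IZR (tau (n + 2))) * q ^ (n + 2))%C
     = (q * (q * PS (fun n => tau_coef (S n)) q))%C).
  { unfold PS. rewrite <- !CSeries_scal.
    - apply CSeries_ext. intros n. replace (n + 2)%nat with (S (S n)) by lia. unfold tau_coef.
      rewrite !Cpow_S. ring.
    - apply abs_cv_scal. apply PS_abs_cv with r; [lra| |auto]. apply geom_bounded_S; [lra|now apply tau_geom].
    - apply PS_abs_cv with r; [lra| |auto]. apply geom_bounded_S; [lra|now apply tau_geom]. }
  rewrite E. ring.
Qed.

Lemma Delta_neq0 z : 0 < Im z -> Delta z <> 0.
Proof.
  intros H. rewrite Delta_Prod by auto. apply Cmult_neq_0; [apply qpar_neq0|].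
  now apply Prod_neq0, qpar_disc.
Qed.

Lemma E4_Sig z : 0 < Im z -> E4 z = (1 + 240 * Sig 3 (qpar z))%C.
Proof.
  intros H. pose proof (qpar_disc z H) as Hq. unfold E4, Sig. set (q := qpar z) in *.
  destruct (unit_disc_radius q Hq) as [r [H1 H2]].
  do 2 f_equal. unfold PS. rewrite (CSeries_S (fun n => sig_coef 3 n * q ^ n)%C).
  - replace (sig_coef 3 0) with (RtoC 0) by reflexivity. rewrite Cmult_0_l, Cplus_0_l.
    apply CSeries_ext. intros n. rewrite Nat.add_1_r. reflexivity.
  - apply PS_abs_cv with r; [lra|now apply sig_geom|auto].
Qed.

(** The logarithmic derivative of [Delta], up to the factor [2 pi i]. *)
Definition E2 (z : C) : C := (1 - 24 * Sig 1 (qpar z))%C.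

Lemma H_near z : 0 < Im z -> forall w, Cmod (w - z) < Im z -> 0 < Im w.
Proof.
  intros H w Hw. pose proof (im_le_Cmod (w - z)) as B.
  change (Im (w - z)) with (Im w - Im z) in B.
  assert (X : Rabs (Im w - Im z) < Im z) by lra. apply Rabs_lt_between in X. lra.
Qed.

Lemma hol_H_ext (f g : C -> C) : (forall z, 0 < Im z -> f z = g z) -> hol_H f -> hol_H g.
Proof.
  intros E Hf z Hz. apply (hol_ext_loc f g z (Im z)); auto.
  intros w Hw. apply E. now apply H_near with z.
Qed.

Lemma hol_H_Sig k : hol_H (fun z => Sig k (qpar z)).
Proof.
  intros z Hz. apply (hol_comp (Sig k) qpar); [|apply hol_qpar, hol_id].
  now apply Sig_hol, qpar_disc.
Qed.

Lemma E4_hol : hol_H E4.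
Proof.
  apply hol_H_ext with (fun z => 1 + 240 * Sig 3 (qpar z))%C.
  - intros z Hz. symmetry. now apply E4_Sig.
  - intros z Hz. apply hol_plus; [apply hol_const|]. apply hol_mult; [apply hol_const|]. now apply hol_H_Sig.
Qed.

Lemma E2_hol : hol_H E2.
Proof.
  intros z Hz. apply hol_minus; [apply hol_const|]. apply hol_mult; [apply hol_const|]. now apply hol_H_Sig.
Qed.

Lemma CD_qpar z : CD qpar z (2 * PI * Ci * qpar z)%C.
Proof.
  eapply CD_eq; [apply (CD_comp Cexp (fun z => 2 * PI * Ci * z)%C); [apply CD_Cexp|apply CD_scal, CD_id]
    |reflexivity|]. simpl. unfold qpar. ring.
Qed.

Lemma Delta_derive z : 0 < Im z -> CD Delta z (2 * PI * Ci * E2 z * Delta z)%C.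
Proof.
  intros Hz. apply (CD_ext_loc (fun z => qpar z * Prod (qpar z))%C _ _ _ (Im z)); auto.
  { intros w Hw. symmetry. apply Delta_Prod. now apply H_near with z. }
  pose proof (qpar_disc z Hz) as Hq.
  eapply CD_eq; [apply CD_mult; [apply CD_qpar|]|reflexivity|].
  - apply (CD_comp Prod qpar); [now apply Prod_derive|apply CD_qpar].
  - rewrite Delta_Prod by auto. simpl. unfold E2.
    transitivity (2 * PI * Ci * qpar z * (Prod (qpar z) + qpar z * PS (PS_d tau_coef) (qpar z)))%C; [ring|].
    rewrite Prod_ode by auto. ring.
Qed.

Lemma Delta_hol : hol_H Delta.
Proof. intros z Hz. eexists. now apply Delta_derive. Qed.

(** ** Transformation under [z -> - 1 / z] *)

Lemma Sig_imag k y : 0 < y ->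
  Sig k (qpar (Ci * RtoC y)) = RtoC (Series (fun n => INR (sigma k (S n)) * qre y ^ S n)).
Proof.
  intros Hy. rewrite qpar_imag. pose proof (qre_range y Hy) as Q.
  assert (Hq : Cmod (RtoC (qre y)) < 1) by (rewrite Cmod_R, Rabs_pos_eq; lra).
  destruct (unit_disc_radius _ Hq) as [r [H1 H2]].
  unfold Sig, PS. rewrite CSeries_S by (apply PS_abs_cv with r; [lra|now apply sig_geom|auto]).
  replace (sig_coef k 0) with (RtoC 0) by reflexivity. rewrite Cmult_0_l, Cplus_0_l.
  rewrite <- CSeries_RtoC. apply CSeries_ext. intros n. unfold sig_coef.
  now rewrite RtoC_mult, RtoC_pow.
Qed.

Lemma E4_imag y : 0 < y -> E4 (Ci * RtoC y) = RtoC (E4re y).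
Proof.
  intros Hy. rewrite E4_Sig, Sig_imag by (auto; unfold Im; simpl; lra).
  unfold E4re. now rewrite RtoC_plus, RtoC_mult.
Qed.

Lemma E2_imag y : 0 < y -> E2 (Ci * RtoC y) = RtoC (E2re y).
Proof.
  intros Hy. unfold E2. rewrite Sig_imag by auto.
  unfold E2re. now rewrite RtoC_minus, RtoC_mult.
Qed.

Lemma H_neq0 (z : C) : 0 < Im z -> z <> 0.
Proof. intros H E. rewrite E in H. simpl in H. lra. Qed.

Lemma Im_inv_opp z : 0 < Im z -> 0 < Im (- (1) / z).
Proof.
  intros H. destruct z as [x y]. unfold Im in *; simpl in *.
  assert (0 < x * x + y * y) by nra.
  match goal with |- 0 < ?e => replace e with (y / (x * x + y * y)) by (field; lra) end.
  now apply Rdiv_lt_0_compat.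
Qed.

Lemma inv_opp_imag y : 0 < y -> (- (1) / (Ci * RtoC y) = Ci * RtoC (/ y))%C.
Proof.
  intros Hy. assert (N : RtoC y <> 0) by (intros E; apply RtoC_inj in E; lra).
  rewrite RtoC_inv by lra. rewrite <- Ci2. field. split; auto using Ci_nz.
Qed.

Lemma hol_S f : hol_H f -> hol_H (fun z => f (- (1) / z)%C).
Proof.
  intros Hf z Hz. apply (hol_comp f (fun z => - (1) / z)%C).
  - apply Hf. now apply Im_inv_opp.
  - apply hol_div; auto with hol. now apply H_neq0.
Qed.

(** Known on the imaginary axis, hence everywhere by the identity theorem. *)
Lemma E4_S z : 0 < Im z -> E4 (- (1) / z) = (z ^ 4 * E4 z)%C.
Proof.
  intros Hz. apply Ceq_minus.
  apply (identity_imag_axis (fun z => E4 (- (1) / z) - z ^ 4 * E4 z)%C); auto.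
  - intros w Hw. apply hol_minus; [now apply (hol_S E4 E4_hol)|].
    apply hol_mult; [auto with hol|now apply E4_hol].
  - intros y Hy. rewrite inv_opp_imag, !E4_imag by (auto; now apply Rinv_0_lt_compat).
    rewrite E4re_inv, RtoC_mult, RtoC_pow by auto.
    transitivity (RtoC y ^ 4 * RtoC (E4re y) * (1 - (Ci * Ci) * (Ci * Ci)))%C; [ring|rewrite Ci2; ring].
Qed.

Lemma E2_S z : 0 < Im z -> E2 (- (1) / z) = (z ^ 2 * E2 z + 6 * z / (PI * Ci))%C.
Proof.
  assert (NP : RtoC PI <> 0) by (intros E; apply RtoC_inj in E; pose proof PI_RGT_0; lra).
  intros Hz. apply Ceq_minus.
  apply (identity_imag_axis (fun z => E2 (- (1) / z) - (z ^ 2 * E2 z + 6 * z / (PI * Ci)))%C); auto.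
  - intros w Hw. apply hol_minus; [now apply (hol_S E2 E2_hol)|].
    apply hol_plus; [apply hol_mult; [auto with hol|now apply E2_hol]|].
    apply hol_div; auto with hol. apply Cmult_neq_0; auto using Ci_nz.
  - intros y Hy. rewrite inv_opp_imag, !E2_imag by (auto; now apply Rinv_0_lt_compat).
    rewrite E2re_inv, RtoC_plus, RtoC_div, !RtoC_mult, RtoC_opp, RtoC_pow by (auto; pose proof PI_RGT_0; lra).
    transitivity (- (RtoC y) ^ 2 * RtoC (E2re y) * (1 + Ci * Ci))%C; [field; auto using Ci_nz|rewrite Ci2; ring].
Qed.

(** The quotient of the two sides has logarithmic derivative zero by the transformation of [E2], and
    takes the value 1 at the fixed point [i]. *)
Theorem Delta_S z : 0 < Im z -> Delta (- (1) / z) = (z ^ 12 * Delta z)%C.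
Proof.
  intros Hz.
  assert (NP : RtoC PI <> 0) by (intros E; apply RtoC_inj in E; pose proof PI_RGT_0; lra).
  set (R := fun z => (Delta (- (1) / z) / (z ^ 12 * Delta z))%C).
  assert (N : forall w, 0 < Im w -> (w ^ 12 * Delta w)%C <> 0).
  { intros w Hw. apply Cmult_neq_0; [now apply Cpow_nz, H_neq0|now apply Delta_neq0]. }
  assert (D : forall w, 0 < Im w -> CD R w (RtoC 0)).
  { intros w Hw. pose proof (H_neq0 w Hw) as Nw.
    assert (D1 : CD (fun w => - (1) / w)%C w (/ (w * w))%C).
    { eapply CD_eq; [apply CD_div; [apply CD_const|apply CD_id|auto]|reflexivity|]. simpl. field. auto. }
    eapply CD_eq; [apply CD_div; [apply (CD_comp Delta (fun w => - (1) / w)%C); [apply Delta_derive|apply D1]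
      |apply CD_mult; [apply CD_pow|now apply Delta_derive]|auto]|reflexivity|].
    - now apply Im_inv_opp.
    - now apply N.
    - cbv beta. simpl pred. rewrite E2_S by auto. replace (INR 12) with 12 by (simpl; ring).
      field. repeat split; auto using Ci_nz, Delta_neq0. }
  assert (Im1 : Im Ci = 1) by reflexivity.
  assert (K : R z = R Ci).
  { apply (derive_zero_const R Ci z). intros t Ht. apply D.
    unfold Im in *. simpl. nra. }
  assert (RC : R Ci = 1).
  { unfold R. replace (- (1) / Ci)%C with Ci by (rewrite <- Ci2; field; apply Ci_nz).
    replace (Ci ^ 12)%C with (RtoC 1).
    - rewrite Cmult_1_l. field. apply Delta_neq0. lra.
    - transitivity (((Ci * Ci) * (Ci * Ci)) ^ 3)%C; [rewrite Ci2; ring|ring]. }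
  rewrite RC in K. unfold R in K.
  transitivity (Delta (- (1) / z) / (z ^ 12 * Delta z) * (z ^ 12 * Delta z))%C.
  - field. split; [now apply Delta_neq0|now apply H_neq0].
  - rewrite K. ring.
Qed.

(** * The action of SL2(Z) *)

Notation ZC n := (RtoC (IZR n)).

(** The factor of automorphy [c z + d]. *)
Definition autf (g : SL2Z) (z : C) : C := (ZC (mc g) * z + ZC (md g))%C.

Program Definition SL2Z_1 : SL2Z := mkSL2Z 1 0 0 1 _.
Program Definition SL2Z_S : SL2Z := mkSL2Z 0 (-1) 1 0 _.

Lemma SL2Z_eq g h : ma g = ma h -> mb g = mb h -> mc g = mc h -> md g = md h -> g = h.
Proof.
  destruct g as [a b c d H], h as [a' b' c' d' H']; simpl; intros -> -> -> ->.
  now rewrite (proof_irrelevance _ H H').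
Qed.

Ltac sl2_simpl := cbn [ma mb mc md SL2Z_mul SL2Z_1 SL2Z_S SL2Z_T SL2Z_inv].
Ltac sl2_eq := apply SL2Z_eq; sl2_simpl; ring.

Lemma SL2Z_mulA g h k : SL2Z_mul (SL2Z_mul g h) k = SL2Z_mul g (SL2Z_mul h k).
Proof. sl2_eq. Qed.

Lemma SL2Z_mul1l g : SL2Z_mul SL2Z_1 g = g.
Proof. sl2_eq. Qed.

Lemma SL2Z_mul1r g : SL2Z_mul g SL2Z_1 = g.
Proof. sl2_eq. Qed.

Lemma SL2Z_mulVl g : SL2Z_mul (SL2Z_inv g) g = SL2Z_1.
Proof. pose proof (SL2Z_det g). apply SL2Z_eq; sl2_simpl; lia. Qed.

Lemma SL2Z_mulVr g : SL2Z_mul g (SL2Z_inv g) = SL2Z_1.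
Proof. pose proof (SL2Z_det g). apply SL2Z_eq; sl2_simpl; lia. Qed.

Ltac pushZ := repeat (rewrite ?plus_IZR, ?minus_IZR, ?mult_IZR, ?opp_IZR, ?RtoC_plus, ?RtoC_minus, ?RtoC_mult, ?RtoC_opp).

Lemma affine_neq0 (a b : Z) z : 0 < Im z -> (a <> 0 \/ b <> 0)%Z -> (ZC a * z + ZC b)%C <> 0.
Proof.
  intros Hz H E. assert (E1 := f_equal Im E). assert (E2 := f_equal Re E).
  destruct z as [x y]. unfold Im, Re in *. simpl in *.
  assert (A : IZR a * y = 0) by lra. apply Rmult_integral in A. destruct A as [A|A]; [|lra].
  assert (B : IZR b = 0) by (rewrite A in E2; lra).
  apply eq_IZR in A. apply eq_IZR in B. lia.
Qed.

Lemma autf_neq0 g z : 0 < Im z -> autf g z <> 0.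
Proof.
  intros H. apply affine_neq0; auto. pose proof (SL2Z_det g).
  destruct (Z.eq_dec (mc g) 0) as [E|E]; auto. right. intros E2. rewrite E, E2 in *. lia.
Qed.

Lemma Im_mobius_pos g z : 0 < Im z -> 0 < Im (mobius g z).
Proof. intros H. apply (mobius_pos g (mkUHP z H)). Qed.

Lemma mobius_autf g z : mobius g z = ((ZC (ma g) * z + ZC (mb g)) / autf g z)%C.
Proof. reflexivity. Qed.

Lemma autf_mul g h z : 0 < Im z -> autf (SL2Z_mul g h) z = (autf g (mobius h z) * autf h z)%C.
Proof.
  intros H. pose proof (autf_neq0 h z H) as N. rewrite mobius_autf. unfold autf at 1 2. simpl. pushZ.
  transitivity (ZC (mc g) * (ZC (ma h) * z + ZC (mb h)) + ZC (md g) * autf h z)%C; [unfold autf; ring|].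
  field. auto.
Qed.

Lemma mobius_mul g h z : 0 < Im z -> mobius (SL2Z_mul g h) z = mobius g (mobius h z).
Proof.
  intros H. pose proof (autf_neq0 h z H) as N.
  pose proof (autf_neq0 g _ (Im_mobius_pos h z H)) as N'.
  rewrite (mobius_autf (SL2Z_mul g h)), (mobius_autf g), autf_mul by auto.
  assert (E : (ZC (ma (SL2Z_mul g h)) * z + ZC (mb (SL2Z_mul g h)) =
    (ZC (ma g) * mobius h z + ZC (mb g)) * autf h z)%C).
  { rewrite mobius_autf. simpl. pushZ.
    transitivity (ZC (ma g) * (ZC (ma h) * z + ZC (mb h)) + ZC (mb g) * autf h z)%C; [unfold autf; ring|].
    field. auto. }
  rewrite E. field. auto.
Qed.

Lemma mobius_1 z : mobius SL2Z_1 z = z.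
Proof. unfold mobius; simpl. field. Qed.

Lemma mobius_T n z : mobius (SL2Z_T n) z = (z + ZC n)%C.
Proof. unfold mobius; simpl. field. Qed.

Lemma mobius_S z : 0 < Im z -> mobius SL2Z_S z = (- (1) / z)%C.
Proof.
  intros H. unfold mobius; simpl. replace (RtoC (-1)) with (- RtoC 1)%C by (now rewrite <- RtoC_opp).
  field. now apply H_neq0.
Qed.

Lemma mobius_hol g z : 0 < Im z -> hol (mobius g) z.
Proof.
  intros H. apply hol_div; auto with hol. now apply autf_neq0.
Qed.

Lemma hol_H_mobius f g : hol_H f -> hol_H (fun z => f (mobius g z)).
Proof.
  intros Hf z Hz. apply (hol_comp f (mobius g)); [|now apply mobius_hol].
  apply Hf. now apply Im_mobius_pos.
Qed.

Lemma Cmod_sq (z : C) : Cmod z ^ 2 = Re z ^ 2 + Im z ^ 2.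
Proof. unfold Cmod. rewrite <- Rsqr_pow2, Rsqr_sqrt; [reflexivity|nra]. Qed.

Lemma Im_mobius g z : 0 < Im z -> Im (mobius g z) = Im z / Cmod (autf g z) ^ 2.
Proof.
  intros Hz. pose proof (autf_neq0 g z Hz) as N. apply Cmod_gt_0 in N.
  assert (P : 0 < Cmod (autf g z) ^ 2) by (now apply pow_lt). revert P.
  pose proof (SL2Z_det g) as H. apply (f_equal IZR) in H; rewrite minus_IZR, !mult_IZR in H.
  rewrite Cmod_sq. unfold autf, mobius. destruct z as [x y]. unfold Re, Im in *. simpl in *.
  revert H; generalize (IZR (ma g)) (IZR (mb g)) (IZR (mc g)) (IZR (md g)); clear.
  intros a b c d H P.
  transitivity (y * (a * d - b * c) / ((c * x - 0 * y + d) ^ 2 + (c * y + 0 * x + 0) ^ 2)); [field; nra|].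
  rewrite H, Rmult_1_r. reflexivity.
Qed.

(** ** Generation by the translation and the inversion *)

(** Euclid's algorithm on the first column: [g = T^n S h] with a smaller lower-left entry. *)
Lemma SL2Z_generation (P : SL2Z -> Prop) :
  (forall g, mc g = 0%Z -> P g) ->
  (forall n g, P g -> P (SL2Z_mul (SL2Z_T n) (SL2Z_mul SL2Z_S g))) -> forall g, P g.
Proof.
  intros H0 HS.
  assert (K : forall n g, (Z.abs (mc g) < Z.of_nat n)%Z -> P g).
  { induction n as [|n IH]; intros g Hg; [lia|].
    destruct (Z.eq_dec (mc g) 0) as [E|E]; [now apply H0|].
    set (q := (ma g / mc g)%Z).
    set (h := SL2Z_mul (SL2Z_inv SL2Z_S) (SL2Z_mul (SL2Z_T (- q)) g)).
    replace g with (SL2Z_mul (SL2Z_T q) (SL2Z_mul SL2Z_S h)).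
    - apply HS, IH. unfold h. sl2_simpl.
      pose proof (Z.div_mod (ma g) (mc g) E). fold q in H.
      assert (Z.abs (ma g mod mc g) < Z.abs (mc g))%Z.
      { destruct (Z_lt_le_dec 0 (mc g)).
        - pose proof (Z.mod_pos_bound (ma g) (mc g)). lia.
        - pose proof (Z.mod_neg_bound (ma g) (mc g)). lia. }
      lia.
    - unfold h. sl2_eq. }
  intros g. apply (K (S (Z.abs_nat (mc g)))). lia.
Qed.

Lemma unipotent_cases g : mc g = 0%Z ->
  (ma g = 1 /\ md g = 1)%Z \/ (ma g = -1 /\ md g = -1)%Z.
Proof.
  intros E. pose proof (SL2Z_det g) as D. rewrite E in D.
  assert (ma g * md g = 1)%Z by lia.
  destruct (Z.mul_eq_1 (ma g) (md g)) as [A|A]; auto; rewrite A in *; lia.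
Qed.

Lemma translation_int (f : C -> C) : (forall z, 0 < Im z -> f (z + 1)%C = f z) ->
  forall n z, 0 < Im z -> f (z + ZC n)%C = f z.
Proof.
  intros H.
  assert (K : forall n z, 0 < Im z -> f (z + ZC (Z.of_nat n))%C = f z).
  { induction n as [|n IH]; intros z Hz.
    - simpl. now rewrite Cplus_0_r.
    - rewrite Nat2Z.inj_succ, <- Z.add_1_r, plus_IZR, RtoC_plus.
      replace (z + (ZC (Z.of_nat n) + 1))%C with ((z + ZC (Z.of_nat n)) + 1)%C by ring.
      rewrite H; [now apply IH|]. unfold Im in *. simpl. lra. }
  intros n z Hz. destruct (Z_le_gt_dec 0 n).
  - rewrite <- (Z2Nat.id n) by lia. now apply K.
  - rewrite <- (K (Z.to_nat (- n)) (z + ZC n)%C).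
    + f_equal. rewrite Z2Nat.id by lia. pushZ. ring.
    + unfold Im in *. simpl. lra.
Qed.

(** The factor of automorphy is a cocycle, so a transformation law needs to be checked on generators
    only. The weight is even because [- 1] acts trivially. *)
Lemma modular_of_ST (f : C -> C) m :
  (forall z, 0 < Im z -> f (z + 1)%C = f z) ->
  (forall z, 0 < Im z -> f (- (1) / z)%C = (z ^ (2 * m) * f z)%C) ->
  forall g z, 0 < Im z -> f (mobius g z) = (autf g z ^ (2 * m) * f z)%C.
Proof.
  intros HT HS g.
  assert (M1 : ((- (1)) ^ (2 * m) = 1)%C).
  { rewrite Cpow_mult_r. replace ((- (1)) ^ 2)%C with (RtoC 1) by ring. apply Cpow_1_l. }
  apply (SL2Z_generation (fun g => forall z, 0 < Im z -> f (mobius g z) = (autf g z ^ (2 * m) * f z)%C)).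
  - clear g. intros g E z Hz. rewrite mobius_autf. unfold autf. rewrite E.
    destruct (unipotent_cases g E) as [[A D]|[A D]]; rewrite A, D.
    + replace ((1 * z + ZC (mb g)) / (0 * z + 1))%C with (z + ZC (mb g))%C by field.
      rewrite translation_int by auto. replace (0 * z + 1)%C with (RtoC 1) by ring.
      rewrite Cpow_1_l. ring.
    + replace (RtoC (-1)) with (- (1))%C by (now rewrite <- RtoC_opp).
      replace ((- (1) * z + ZC (mb g)) / (0 * z + - (1)))%C with (z + ZC (- mb g))%C by (pushZ; field).
      rewrite translation_int by auto. replace (0 * z + - (1))%C with (- (1))%C by ring.
      rewrite M1. ring.
  - clear g. intros n g IH z Hz. pose proof (Im_mobius_pos g z Hz) as Hg.
    assert (HSg : 0 < Im (mobius SL2Z_S (mobius g z))) by (now apply Im_mobius_pos).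
    rewrite !mobius_mul, mobius_T, translation_int, mobius_S, HS, IH by (auto; now rewrite <- mobius_mul by auto).
    rewrite !autf_mul, Cmult_assoc, <- Cpow_mult_l by auto. f_equal. f_equal.
    unfold autf. simpl. ring.
Qed.

Lemma qpar_T z : qpar (z + 1) = qpar z.
Proof. rewrite qpar_add. replace (qpar 1) with (RtoC 1); [ring|]. symmetry. apply (qpar_int 1). Qed.

Lemma Delta_modular g z : 0 < Im z -> Delta (mobius g z) = (autf g z ^ 12 * Delta z)%C.
Proof.
  apply (modular_of_ST Delta 6); [|exact Delta_S].
  intros w _. unfold Delta. now rewrite qpar_T.
Qed.

Lemma E4_modular g z : 0 < Im z -> E4 (mobius g z) = (autf g z ^ 4 * E4 z)%C.
Proof.
  apply (modular_of_ST E4 2); [|exact E4_S].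
  intros w _. unfold E4. now rewrite qpar_T.
Qed.

Lemma jfun_inv g z : 0 < Im z -> jfun (mobius g z) = jfun z.
Proof.
  intros H. unfold jfun. rewrite Delta_modular, E4_modular by auto.
  field. split; [now apply Delta_neq0|now apply autf_neq0].
Qed.

Lemma jfun_hol : hol_H jfun.
Proof.
  intros z H. apply hol_div; [apply hol_pow; now apply E4_hol|now apply Delta_hol|now apply Delta_neq0].
Qed.

(** ** Reduction to the strip [|Re z| <= 1/2], [Im z >= 1/2] *)

Lemma nearest_int x : exists n : Z, Rabs (x + IZR n) <= 1 / 2.
Proof.
  exists (1 - up (x + 1 / 2))%Z. rewrite minus_IZR. destruct (archimed (x + 1 / 2)) as [A B].
  apply Rabs_le. lra.
Qed.

(** As long as [Im z < 1/2] and [|Re z| <= 1/2], the inversion at least doubles the imaginary part. *)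
Lemma reduction z : 0 < Im z -> exists g,
  Rabs (Re (mobius g z)) <= 1 / 2 /\ 1 / 2 <= Im (mobius g z).
Proof.
  assert (K : forall n z, 0 < Im z -> 1 / 2 <= 2 ^ n * Im z -> exists g,
    Rabs (Re (mobius g z)) <= 1 / 2 /\ 1 / 2 <= Im (mobius g z)).
  { clear z. induction n as [|n IH]; intros z Hz Hn.
    - destruct (nearest_int (Re z)) as [k Hk]. exists (SL2Z_T k). rewrite mobius_T.
      unfold Re, Im in *. simpl in *. split; [exact Hk|lra].
    - destruct (nearest_int (Re z)) as [k Hk].
      destruct (Rle_lt_dec (1 / 2) (Im z)) as [C|C].
      + exists (SL2Z_T k). rewrite mobius_T. unfold Re, Im in *. simpl in *. split; [exact Hk|lra].
      + set (w := mobius (SL2Z_T k) z). assert (Hw : 0 < Im w) by (now apply Im_mobius_pos).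
        destruct (IH (mobius SL2Z_S w)) as [g Hg].
        * now apply Im_mobius_pos.
        * rewrite Im_mobius by auto. rewrite Cmod_sq.
          replace (autf SL2Z_S w) with w by (unfold autf; simpl; ring).
          assert (Iw : Im w = Im z) by (unfold w; rewrite mobius_T; unfold Im; simpl; ring).
          assert (Rw : Rabs (Re w) <= 1 / 2) by (unfold w; rewrite mobius_T; exact Hk).
          rewrite Iw.
          assert (Q : Re w ^ 2 <= 1 / 4).
          { rewrite <- (pow2_abs (Re w)). pose proof (Rabs_pos (Re w)). nra. }
          assert (0 < 2 ^ n) by (apply pow_lt; lra).
          assert (Den : 0 < Re w ^ 2 + Im z ^ 2) by (pose proof (pow2_ge_0 (Re w)); nra).
          apply Rmult_le_reg_r with (Re w ^ 2 + Im z ^ 2); auto.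
          replace (2 ^ n * (Im z / (Re w ^ 2 + Im z ^ 2)) * (Re w ^ 2 + Im z ^ 2)) with (2 ^ n * Im z) by (field; lra).
          simpl pow in Hn |- *. simpl pow in Q. nra.
        * exists (SL2Z_mul g (SL2Z_mul SL2Z_S (SL2Z_T k))).
          rewrite !mobius_mul by (auto; now apply Im_mobius_pos). exact Hg. }
  intros Hz.
  destruct (Pow_x_infinity 2 ltac:(rewrite Rabs_pos_eq; lra) (/ Im z)) as [n Hn].
  apply (K n); auto. specialize (Hn n (Nat.le_refl n)).
  rewrite Rabs_pos_eq in Hn by (apply pow_le; lra).
  apply Rge_le in Hn. apply Rmult_le_compat_r with (r := Im z) in Hn; [|lra]. rewrite Rinv_l in Hn by lra. lra.
Qed.

(** ** The function [Delta (N z) / Delta z] *)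

Definition hfun (N : nat) (z : C) : C := (Delta (RtoC (INR N) * z) / Delta z)%C.

Lemma Im_scal (a : R) z : Im (RtoC a * z) = a * Im z.
Proof. unfold Im; simpl; ring. Qed.

Lemma Gamma0_mul N g h : Gamma0 N g -> Gamma0 N h -> Gamma0 N (SL2Z_mul g h).
Proof.
  intros A B. unfold Gamma0 in *. sl2_simpl. apply Z.divide_add_r.
  - now apply Z.divide_mul_l.
  - now apply Z.divide_mul_r.
Qed.

Lemma Gamma0_inv N g : Gamma0 N g -> Gamma0 N (SL2Z_inv g).
Proof. intros A. unfold Gamma0 in *. sl2_simpl. now apply Z.divide_opp_r. Qed.

Lemma Gamma0_1 N : Gamma0 N SL2Z_1.
Proof. apply Z.divide_0_r. Qed.

Lemma INR_pos N : (2 <= N)%nat -> 0 < INR N.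
Proof. intros H. apply lt_0_INR. lia. Qed.

Lemma hfun_hol N : (2 <= N)%nat -> hol_H (hfun N).
Proof.
  intros HN z H. pose proof (INR_pos N HN). apply hol_div; [|now apply Delta_hol|now apply Delta_neq0].
  apply (hol_comp Delta (fun z => RtoC (INR N) * z)%C); auto with hol.
  apply Delta_hol. rewrite Im_scal. nra.
Qed.

(** Write [(N 0; 0 1) g = g' (A B; 0 D)] with [A] the gcd of the first column of the left side. If
    [D = 1] then [A = N], so that [N] divides the lower-left entry of [g]. *)
Lemma hermite_form N g : (2 <= N)%nat -> exists g' A B D, (0 < A /\ 0 < D /\ A * D = Z.of_nat N)%Z /\
  (D = 1%Z -> Gamma0 N g) /\
  (Z.of_nat N * ma g = ma g' * A /\ Z.of_nat N * mb g = ma g' * B + mb g' * D /\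
   mc g = mc g' * A /\ md g = mc g' * B + md g' * D)%Z.
Proof.
  intros HN. set (n := Z.of_nat N). pose proof (SL2Z_det g) as Det.
  assert (Hn : (0 < n)%Z) by (unfold n; lia).
  set (A := Z.gcd (n * ma g) (mc g)).
  assert (HA : (0 < A)%Z).
  { pose proof (Z.gcd_nonneg (n * ma g) (mc g)) as P. fold A in P.
    destruct (Z.eq_dec A 0) as [E|E]; [|lia]. exfalso.
    apply Z.gcd_eq_0 in E. destruct E as [E1 E2]. rewrite E2 in Det.
    assert (ma g = 0%Z) by nia. rewrite H in Det. lia. }
  destruct (Z.gcd_divide_l (n * ma g) (mc g)) as [a Ha]. fold A in Ha.
  destruct (Z.gcd_divide_r (n * ma g) (mc g)) as [c Hc]. fold A in Hc.
  destruct (Z.gcd_bezout (n * ma g) (mc g) A eq_refl) as [u [v Huv]].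
  assert (K : (u * a + v * c = 1)%Z).
  { apply Z.mul_reg_r with A; [lia|]. rewrite Z.mul_1_l.
    rewrite Ha, Hc in Huv. transitivity (u * (a * A) + v * (c * A))%Z; [ring|exact Huv]. }
  assert (Dg : (a * u - (- v) * c = 1)%Z) by lia.
  set (g' := mkSL2Z a (- v) c u Dg).
  (* [B] and [D] are the second column of [g'^-1 (N 0; 0 1) g] *)
  set (B := (u * (n * mb g) + v * md g)%Z). set (D := (- c * (n * mb g) + a * md g)%Z).
  exists g', A, B, D.
  assert (AD : (A * D = n)%Z).
  { unfold D. transitivity ((a * A) * md g - (c * A) * (n * mb g))%Z; [ring|].
    rewrite <- Ha, <- Hc. transitivity (n * (ma g * md g - mb g * mc g))%Z; [ring|rewrite Det; ring]. }
  assert (HD : (0 < D)%Z) by nia.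
  split; [split; [|split]; auto|split].
  - intros E. exists c. rewrite Hc. f_equal. fold n. nia.
  - unfold g'. sl2_simpl. split; [lia|]. split; [|split; [lia|]].
    + unfold B, D. transitivity ((u * a + v * c) * (n * mb g))%Z; [rewrite K; ring|ring].
    + unfold B, D. transitivity ((u * a + v * c) * md g)%Z; [rewrite K; ring|ring].
Qed.

(** The triangular matrix of [hermite_form] shows the order of [hfun] at the cusp of [g]. *)
Lemma hfun_coset N g : (2 <= N)%nat -> exists A B D : Z, (0 < A /\ 0 < D /\ A * D = Z.of_nat N)%Z /\
  (D = 1%Z -> Gamma0 N g) /\
  forall z, 0 < Im z -> let w := ((ZC A * z + ZC B) / ZC D)%C in
    Im w = IZR A / IZR D * Im z /\
    hfun N (mobius g z) = (Delta w / (ZC D ^ 12 * Delta z))%C.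
Proof.
  intros HN. destruct (hermite_form N g HN) as (g' & A & B & D & (HA & HD & HAD) & HD1 & E1 & E2 & E3 & E4).
  exists A, B, D. split; [auto|]. split; auto. intros z Hz w.
  assert (PA : 0 < IZR A) by (now apply IZR_lt). assert (PD : 0 < IZR D) by (now apply IZR_lt).
  assert (ND : ZC D <> 0) by (intros E; apply RtoC_inj in E; lra).
  assert (Iw : Im w = IZR A / IZR D * Im z).
  { unfold w. unfold Cdiv. rewrite <- RtoC_inv by lra. destruct z as [x y]. unfold Im. simpl. field. lra. }
  assert (Pw : 0 < Im w).
  { rewrite Iw. apply Rmult_lt_0_compat; auto. now apply Rdiv_lt_0_compat. }
  split; auto.
  assert (Au : autf g z = (ZC D * autf g' w)%C).
  { unfold autf. rewrite E3, E4. pushZ. unfold w. field. auto. }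
  pose proof (autf_neq0 g z Hz) as N1. pose proof (autf_neq0 g' w Pw) as N2.
  assert (Mo : (RtoC (INR N) * mobius g z = mobius g' w)%C).
  { rewrite !mobius_autf, Au. rewrite INR_IZR_INZ.
    assert (X : (ZC (Z.of_nat N) * (ZC (ma g) * z + ZC (mb g)) = ZC D * (ZC (ma g') * w + ZC (mb g')))%C).
    { transitivity (ZC (Z.of_nat N * ma g) * z + ZC (Z.of_nat N * mb g))%C; [pushZ; ring|].
      rewrite E1, E2. pushZ. unfold w. field. auto. }
    transitivity ((ZC (Z.of_nat N) * (ZC (ma g) * z + ZC (mb g))) / (ZC D * autf g' w))%C; [field; auto|].
    rewrite X. field. auto. }
  unfold hfun. rewrite Mo, !Delta_modular, Au by auto.
  field. repeat split; auto. now apply Delta_neq0.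
Qed.

(** Here [(N 0; 0 1) g = g' (N 0; 0 1)] with [g'] in [SL2Z]. *)
Lemma hfun_inv N g z : (2 <= N)%nat -> Gamma0 N g -> 0 < Im z -> hfun N (mobius g z) = hfun N z.
Proof.
  intros HN [c Hc] Hz. pose proof (INR_pos N HN) as PN. pose proof (SL2Z_det g) as Det.
  assert (Dg : (ma g * md g - (Z.of_nat N * mb g) * c = 1)%Z) by (rewrite Hc in Det; lia).
  set (g' := mkSL2Z _ _ _ _ Dg).
  set (w := (RtoC (INR N) * z)%C).
  assert (Hw : 0 < Im w) by (unfold w; rewrite Im_scal; nra).
  assert (Au : autf g' w = autf g z).
  { unfold autf, w, g'. sl2_simpl. rewrite Hc, INR_IZR_INZ. pushZ. ring. }
  pose proof (autf_neq0 g z Hz) as N1.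
  assert (Mo : (RtoC (INR N) * mobius g z = mobius g' w)%C).
  { rewrite !mobius_autf, Au. unfold g', w. sl2_simpl. rewrite INR_IZR_INZ. pushZ. field. auto. }
  unfold hfun. rewrite Mo, !Delta_modular, Au by auto. fold w.
  field. split; auto. now apply Delta_neq0.
Qed.

(** ** Finitely many cosets *)

Section Representatives.
Context {T : Type} (eqv : T -> T -> Prop).
Hypothesis eqv_sym : forall x y, eqv x y -> eqv y x.
Hypothesis eqv_trans : forall x y z, eqv x y -> eqv y z -> eqv x z.

Fixpoint separated (L : list T) : Prop :=
  match L with nil => True | x :: l => (forall y, In y l -> ~ eqv x y) /\ separated l end.

Definition covers (L L' : list T) : Prop := forall x, In x L -> exists y, In y L' /\ eqv x y.

Lemma separated_remove l1 y l2 : separated (l1 ++ y :: l2) ->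
  separated (l1 ++ l2) /\ forall v, In v (l1 ++ l2) -> ~ eqv v y.
Proof.
  induction l1 as [|x l1 IH]; simpl.
  - intros [A B]. split; auto. intros v Hv E. apply (A v Hv). auto.
  - intros [A B]. destruct (IH B) as [C D]. split; [split; auto|].
    + intros v Hv. apply A. rewrite in_app_iff in *. simpl. tauto.
    + intros v [<-|Hv]; auto. apply A. rewrite in_app_iff. simpl. auto.
Qed.

(** Two systems of representatives correspond bijectively, and [f] does not see the choice. *)
Lemma separated_perm {U : Type} (f : T -> U) L : (forall x y, eqv x y -> f x = f y) ->
  forall L', separated L -> separated L' -> covers L L' -> covers L' L ->
  Permutation (map f L) (map f L').
Proof.
  intros Hf. induction L as [|x l IH]; intros L' S S' C C'.
  - destruct L' as [|y L']; [constructor|]. destruct (C' y) as [u [[] _]]. now left.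
  - destruct (C x) as [y [Hy E]]; [now left|]. destruct (in_split y L' Hy) as [l1 [l2 ->]].
    destruct (separated_remove _ _ _ S') as [S1 S2]. destruct S as [S3 S4].
    rewrite map_app. simpl. rewrite (Hf x y E).
    apply Permutation_trans with (f y :: map f (l1 ++ l2)).
    + apply perm_skip, IH; auto.
      * intros u Hu. destruct (C u) as [v [Hv Ev]]; [now right|].
        exists v. split; auto. rewrite in_app_iff in *. simpl in Hv.
        destruct Hv as [Hv|[<-|Hv]]; auto. exfalso. apply (S3 u Hu). eauto.
      * intros v Hv. destruct (C' v) as [u [[<-|Hu] Eu]]; [|exfalso; apply (S2 v Hv); eauto|eauto].
        rewrite in_app_iff in *. simpl. tauto.
    + rewrite map_app. apply Permutation_middle.
Qed.

(** Go through the finitely many keys and add an element for each class not yet met; the class of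
    [x0] is represented by [x0] itself. *)
Lemma finite_representatives {K : Type} (key : T -> K) (keys : list K) x0 :
  (forall x, In (key x) keys) -> (forall x y, key x = key y -> eqv x y) ->
  exists l, separated (x0 :: l) /\ forall x, exists y, In y (x0 :: l) /\ eqv x y.
Proof.
  intros Hk He.
  assert (X : exists l, separated (x0 :: l) /\
    forall x, In (key x) keys -> exists y, In y (x0 :: l) /\ eqv x y).
  { clear Hk. induction keys as [|k keys [l [IH1 IH2]]].
    - exists nil. simpl. split; [split; tauto|]. intros x [].
    - destruct (classic (exists x, key x = k /\ forall y, In y (x0 :: l) -> ~ eqv x y)) as [[x [Ex Nx]]|No].
      + exists (x :: l). destruct IH1 as [I1 I2]. split; [split; [|split; auto]|].
        * intros y [<-|Hy]; auto. intros E. apply (Nx x0); simpl; auto.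
        * intros y Hy. apply Nx. now right.
        * intros y [Ey|Hy].
          -- exists x. split; [simpl; auto|]. apply He. congruence.
          -- destruct (IH2 y Hy) as [v [Hv Ev]]. exists v. split; auto. simpl in *. tauto.
      + exists l. split; auto. intros x [Ex|Hx]; auto.
        destruct (classic (exists y, In y (x0 :: l) /\ eqv x y)) as [Y|N]; auto.
        exfalso. apply No. exists x. split; auto. intros y Hy E. apply N. eauto. }
  destruct X as [l [X1 X2]]. exists l. auto.
Qed.
End Representatives.

Definition cong (N : nat) (g h : SL2Z) : Prop := Gamma0 N (SL2Z_mul g (SL2Z_inv h)).

Lemma cong_sym N g h : cong N g h -> cong N h g.
Proof.
  intros H. apply Gamma0_inv in H. unfold cong.
  replace (SL2Z_mul h (SL2Z_inv g)) with (SL2Z_inv (SL2Z_mul g (SL2Z_inv h))); auto. sl2_eq.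
Qed.

Lemma SL2Z_mulKl g h : SL2Z_mul (SL2Z_inv g) (SL2Z_mul g h) = h.
Proof. now rewrite <- SL2Z_mulA, SL2Z_mulVl, SL2Z_mul1l. Qed.

Lemma SL2Z_mulVKl g h : SL2Z_mul g (SL2Z_mul (SL2Z_inv g) h) = h.
Proof. now rewrite <- SL2Z_mulA, SL2Z_mulVr, SL2Z_mul1l. Qed.

Lemma cong_trans N g h k : cong N g h -> cong N h k -> cong N g k.
Proof.
  intros A B. unfold cong in *. pose proof (Gamma0_mul N _ _ A B) as C.
  now rewrite SL2Z_mulA, SL2Z_mulKl in C.
Qed.

Lemma cong_mul_r N g h k : cong N g h -> cong N (SL2Z_mul g k) (SL2Z_mul h k).
Proof.
  unfold cong. intros H.
  replace (SL2Z_mul (SL2Z_mul g k) (SL2Z_inv (SL2Z_mul h k))) with (SL2Z_mul g (SL2Z_inv h)); auto.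
  replace (SL2Z_inv (SL2Z_mul h k)) with (SL2Z_mul (SL2Z_inv k) (SL2Z_inv h)) by sl2_eq.
  now rewrite SL2Z_mulA, SL2Z_mulVKl.
Qed.

Lemma cong_inv {U : Type} N (f : C -> U) g h z : 0 < Im z ->
  (forall k z, Gamma0 N k -> 0 < Im z -> f (mobius k z) = f z) ->
  cong N g h -> f (mobius g z) = f (mobius h z).
Proof.
  intros Hz Hf H. rewrite <- (Hf _ (mobius h z) H) by (now apply Im_mobius_pos).
  rewrite <- mobius_mul by auto. f_equal. f_equal.
  now rewrite SL2Z_mulA, SL2Z_mulVl, SL2Z_mul1r.
Qed.

(** The coset of [g] depends only on the second row of [g] modulo [N]. *)
Lemma coset_representatives N : (2 <= N)%nat -> exists l,
  separated (cong N) (SL2Z_1 :: l) /\ forall g, exists h, In h (SL2Z_1 :: l) /\ cong N g h.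
Proof.
  intros HN. set (n := Z.of_nat N). assert (Hn : (0 < n)%Z) by (unfold n; lia).
  set (res := map Z.of_nat (seq 0 N)).
  assert (Hres : forall a, In (a mod n)%Z res).
  { intros a. pose proof (Z.mod_pos_bound a n Hn). unfold res.
    apply in_map_iff. exists (Z.to_nat (a mod n)). split; [lia|]. apply in_seq. unfold n in *. lia. }
  apply (finite_representatives (cong N) (fun g h => cong_sym N g h)
    (fun g => (mc g mod n, md g mod n)%Z) (list_prod res res)).
  - intros g. apply in_prod; auto.
  - intros g h E. injection E as E1 E2. unfold cong, Gamma0. sl2_simpl. fold n.
    apply Z.mod_divide; [lia|].
    rewrite Z.add_mod, <- Z.mul_mod_idemp_l, E1, (Z.mul_mod (md g)), E2, <- Z.mul_mod, Z.mul_mod_idemp_l, <- Z.add_mod by lia.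
    replace (mc h * md h + md h * - mc h)%Z with 0%Z by ring. apply Z.mod_0_l. lia.
Qed.

(** * Growth at the cusps *)

(** Moderate growth towards the cusp at infinity: at most a pole in [q]. *)
Definition MG (f : C -> C) : Prop := exists Y K (m : nat), 0 <= K /\
  forall z, Y < Im z -> Cmod (f z) <= K * exp (2 * PI * INR m * Im z).

Lemma MG_const c : MG (fun _ => c).
Proof.
  exists 0, (Cmod c), O. split; [apply Cmod_ge_0|]. intros z Hz. simpl.
  replace (2 * PI * 0 * Im z) with 0 by ring. rewrite exp_0. lra.
Qed.

Lemma MG_ext f g : (forall z, 0 < Im z -> f z = g z) -> MG f -> MG g.
Proof.
  intros E (Y & K & m & HK & H). exists (Rmax 0 Y), K, m. split; auto. intros z Hz.
  pose proof (Rmax_l 0 Y). pose proof (Rmax_r 0 Y). rewrite <- E by lra. apply H. lra.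
Qed.

Lemma two_PI_mono (m n : nat) y : (m <= n)%nat -> 0 <= y -> exp (2 * PI * INR m * y) <= exp (2 * PI * INR n * y).
Proof.
  intros H Hy. apply exp_mono. apply le_INR in H. pose proof PI_RGT_0. pose proof (pos_INR m).
  apply Rmult_le_compat_r; auto. apply Rmult_le_compat_l; lra.
Qed.

Lemma MG_plus f g : MG f -> MG g -> MG (fun z => f z + g z)%C.
Proof.
  intros (Y1 & K1 & m1 & P1 & H1) (Y2 & K2 & m2 & P2 & H2).
  exists (Rmax 0 (Rmax Y1 Y2)), (K1 + K2), (m1 + m2)%nat. split; [lra|]. intros z Hz.
  pose proof (Rmax_l 0 (Rmax Y1 Y2)). pose proof (Rmax_r 0 (Rmax Y1 Y2)).
  pose proof (Rmax_l Y1 Y2). pose proof (Rmax_r Y1 Y2).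
  eapply Rle_trans; [apply Cmod_triangle|]. rewrite Rmult_plus_distr_r. apply Rplus_le_compat.
  - eapply Rle_trans; [apply H1; lra|]. apply Rmult_le_compat_l; auto. apply two_PI_mono; [lia|lra].
  - eapply Rle_trans; [apply H2; lra|]. apply Rmult_le_compat_l; auto. apply two_PI_mono; [lia|lra].
Qed.

Lemma MG_mult f g : MG f -> MG g -> MG (fun z => f z * g z)%C.
Proof.
  intros (Y1 & K1 & m1 & P1 & H1) (Y2 & K2 & m2 & P2 & H2).
  exists (Rmax 0 (Rmax Y1 Y2)), (K1 * K2), (m1 + m2)%nat. split; [nra|]. intros z Hz.
  pose proof (Rmax_l 0 (Rmax Y1 Y2)). pose proof (Rmax_r 0 (Rmax Y1 Y2)).
  pose proof (Rmax_l Y1 Y2). pose proof (Rmax_r Y1 Y2).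
  rewrite Cmod_mult, plus_INR.
  replace (2 * PI * (INR m1 + INR m2) * Im z) with (2 * PI * INR m1 * Im z + 2 * PI * INR m2 * Im z) by ring.
  rewrite exp_plus.
  replace (K1 * K2 * (exp (2 * PI * INR m1 * Im z) * exp (2 * PI * INR m2 * Im z))) with
    ((K1 * exp (2 * PI * INR m1 * Im z)) * (K2 * exp (2 * PI * INR m2 * Im z))) by ring.
  apply Rmult_le_compat; try apply Cmod_ge_0; [apply H1|apply H2]; lra.
Qed.

Lemma exp_INR_pow n x : exp (INR n * x) = exp x ^ n.
Proof.
  induction n as [|n IH]; [simpl; now rewrite Rmult_0_l, exp_0|].
  rewrite S_INR, Rmult_plus_distr_r, exp_plus, IH, Rmult_1_l. simpl. ring.
Qed.

Lemma hol_bounded u d : 0 < d -> hol_disc u 0 d -> exists e M, 0 < e <= d /\ 0 <= M /\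
  forall t, Cmod t < e -> Cmod (u t) <= M.
Proof.
  intros Hd Hu. destruct (hol_cont u (RtoC 0) (Hu (RtoC 0) ltac:(now rewrite Cmod_diag)) 1 ltac:(lra)) as [e [He H]].
  exists (Rmin d e), (Cmod (u 0) + 1). pose proof (Cmod_ge_0 (u 0)).
  split; [split; [now apply Rmin_glb_lt|apply Rmin_l]|]. split; [lra|].
  intros t Ht. pose proof (Rmin_r d e). specialize (H t).
  replace (t - 0)%C with t in H by ring. specialize (H ltac:(lra)).
  replace (u t) with (u 0 + (u t - u 0))%C by ring. eapply Rle_trans; [apply Cmod_triangle|]. lra.
Qed.

Lemma MG_laurent f (w : R) (k : nat) u d Y : 1 <= w -> 0 < d -> hol_disc u 0 d ->
  (forall z, Y < Im z -> f z = (u (qpar (z / w)) / qpar (z / w) ^ k)%C) -> MG f.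
Proof.
  intros Hw Hd Hu E. destruct (hol_bounded u d Hd Hu) as (e & M & [He _] & HM & HB).
  destruct (qpar_div_small w e) as [Y' [HY' HS]]; try lra.
  exists (Rmax Y Y'), M, k. split; auto. intros z Hz.
  pose proof (Rmax_l Y Y'). pose proof (Rmax_r Y Y').
  assert (N : (qpar (z / w) ^ k)%C <> 0) by (apply Cpow_nz, qpar_neq0).
  rewrite E, Cmod_div, Cmod_pow, Cmod_qpar_div by (auto; lra).
  apply Rmult_le_compat; try apply Cmod_ge_0.
  - apply Rlt_le, Rinv_0_lt_compat, pow_lt, exp_pos.
  - apply HB, HS. lra.
  - rewrite <- exp_INR_pow. rewrite <- exp_Ropp. apply exp_mono.
    assert (Im z / w <= Im z).
    { apply Rmult_le_reg_r with w; [lra|]. unfold Rdiv. rewrite Rmult_assoc, Rinv_l by lra. nra. }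
    pose proof PI_RGT_0. pose proof (pos_INR k).
    replace (- (INR k * - (2 * PI * (Im z / w)))) with (2 * PI * INR k * (Im z / w)) by ring.
    apply Rmult_le_compat_l; auto. apply Rmult_le_pos; lra.
Qed.

(** [jfun] times [q], as a function of [q]. *)
Definition jq (t : C) : C := ((1 + 240 * Sig 3 t) ^ 3 / Prod t)%C.

Lemma jfun_q z : 0 < Im z -> jfun z = (jq (qpar z) / qpar z)%C.
Proof.
  intros H. unfold jfun, jq. rewrite E4_Sig, Delta_Prod by auto. field.
  split; [now apply Prod_neq0, qpar_disc|apply qpar_neq0].
Qed.

Lemma jq_hol : hol_disc jq 0 1.
Proof.
  intros t Ht. replace (t - 0)%C with t in Ht by ring.
  apply hol_div; [|now apply Prod_hol|now apply Prod_neq0].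
  apply hol_pow, hol_plus; [apply hol_const|]. apply hol_mult; [apply hol_const|now apply Sig_hol].
Qed.

Lemma Prod_0 : Prod 0 = 1.
Proof. unfold Prod. rewrite PS_0. reflexivity. Qed.

Lemma jq_0 : jq 0 = 1.
Proof.
  unfold jq. rewrite Prod_0. unfold Sig. rewrite PS_0. replace (sig_coef 3 0) with (RtoC 0) by reflexivity. field.
Qed.

Lemma near_one u d : 0 < d -> hol_disc u 0 d -> u 0 = 1 ->
  exists Y, 0 < Y /\ forall z, Y < Im z -> 1 / 2 <= Cmod (u (qpar z)) <= 2.
Proof.
  intros Hd Hu H1. destruct (hol_cont u (RtoC 0) (Hu (RtoC 0) ltac:(now rewrite Cmod_diag)) (1 / 2) ltac:(lra)) as [e [He H]].
  destruct (qpar_div_small 1 e) as [Y [HY HS]]; try lra. exists Y. split; auto. intros z Hz.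
  specialize (HS z Hz). replace (z / RtoC 1)%C with z in HS by field.
  specialize (H (qpar z)). replace (qpar z - 0)%C with (qpar z) in H by ring. specialize (H HS).
  rewrite H1 in H.
  pose proof (Cmod_rtriangle (u (qpar z)) 1) as A. pose proof (Cmod_rtriangle 1 (u (qpar z))) as B.
  rewrite <- (Cmod_opp (1 - _)) in B. replace (- (1 - u (qpar z)))%C with (u (qpar z) - 1)%C in B by ring.
  rewrite Cmod_1 in A, B. lra.
Qed.

Lemma jfun_MG : MG jfun.
Proof.
  apply (MG_laurent jfun 1 1 jq 1 0); [lra|lra|apply jq_hol|].
  intros z Hz. rewrite jfun_q by auto. replace (z / RtoC 1)%C with z by field. simpl. now rewrite Cmult_1_r.
Qed.

Lemma exp_gt_id x : x < exp x.
Proof. pose proof (exp_ineq1_le x). lra. Qed.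

Lemma jfun_ne_const c : exists Y, 0 < Y /\ forall z, Y < Im z -> jfun z <> c.
Proof.
  destruct (near_one jq 1 ltac:(lra) jq_hol jq_0) as [Y [HY H]].
  exists (Y + 2 * Cmod c). pose proof (Cmod_ge_0 c). split; [lra|].
  intros z Hz E. specialize (H z ltac:(lra)). rewrite jfun_q in E by lra.
  apply (f_equal Cmod) in E. rewrite Cmod_div, Cmod_qpar in E by apply qpar_neq0.
  unfold Rdiv in E. rewrite <- exp_Ropp, Ropp_involutive in E.
  assert (Im z < exp (2 * PI * Im z)).
  { eapply Rlt_le_trans; [apply exp_gt_id|]. apply exp_mono. pose proof PI2_1. unfold PI2 in *. nra. }
  nra.
Qed.

Lemma Delta_near : exists Y, 0 < Y /\ forall z, Y < Im z ->
  1 / 2 * exp (- (2 * PI * Im z)) <= Cmod (Delta z) <= 2 * exp (- (2 * PI * Im z)).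
Proof.
  destruct (near_one Prod 1 ltac:(lra)) as [Y [HY H]].
  - intros t Ht. replace (t - 0)%C with t in Ht by ring. now apply Prod_hol.
  - apply Prod_0.
  - exists Y. split; auto. intros z Hz. specialize (H z Hz).
    rewrite Delta_Prod, Cmod_mult, Cmod_qpar by lra. pose proof (exp_pos (- (2 * PI * Im z))). nra.
Qed.

(** As [Delta] has the size of [q], the order of [hfun] at the cusp of [g] is [A / D - 1] with
    [A D = N], by [hfun_coset]. *)
Lemma hfun_growth N g : (2 <= N)%nat -> exists A D Y, 0 < Y /\ 1 <= A /\ 1 <= D /\ A * D = INR N /\
  (~ Gamma0 N g -> 2 <= D) /\ (D = 1 -> Gamma0 N g) /\
  forall z, Y < Im z ->
    / (4 * D ^ 12) * exp (2 * PI * (1 - A / D) * Im z) <= Cmod (hfun N (mobius g z)) <= 4 * exp (2 * PI * (1 - A / D) * Im z).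
Proof.
  intros HN. pose proof (INR_pos N HN) as PN.
  destruct (hfun_coset N g HN) as (A & B & D & (HA & HD & HAD) & HD1 & E).
  destruct Delta_near as [Y [HY HDel]].
  assert (PA : 1 <= IZR A) by (apply IZR_le; lia). assert (PD : 1 <= IZR D) by (apply IZR_le; lia).
  assert (EN : IZR A * IZR D = INR N) by (rewrite INR_IZR_INZ, <- mult_IZR; now f_equal).
  exists (IZR A), (IZR D), (Y * INR N).
  assert (N1 : 1 <= INR N) by (rewrite <- EN; nra).
  split; [nra|]. split; auto. split; auto. split; auto.
  split; [|split].
  { intros HG. assert (D <> 1)%Z by tauto. apply IZR_le. lia. }
  { intros HG. apply HD1. now apply eq_IZR. }
  intros z Hz. assert (Pz : Y < Im z) by nra. destruct (E z ltac:(lra)) as [Iw ->].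
  set (w := ((ZC A * z + ZC B) / ZC D)%C) in *.
  assert (Pw : Y < Im w).
  { rewrite Iw. apply Rmult_lt_reg_r with (IZR D); [lra|].
    replace (IZR A / IZR D * Im z * IZR D) with (IZR A * Im z) by (field; apply not_0_IZR; lia).
    assert (IZR D <= INR N) by (rewrite <- EN; nra).
    assert (Y * IZR D <= Y * INR N) by (apply Rmult_le_compat_l; lra).
    assert (1 * Im z <= IZR A * Im z) by (apply Rmult_le_compat_r; lra). lra. }
  pose proof (HDel z Pz) as [L1 U1]. pose proof (HDel w Pw) as [L2 U2].
  assert (D12 : 1 <= IZR D ^ 12) by (now apply pow_R1_Rle).
  assert (ND : ZC D <> 0) by (intros X; apply RtoC_inj in X; lra).
  assert (NZ : Delta z <> 0) by (apply Delta_neq0; lra).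
  rewrite Cmod_div. 2:{ apply Cmult_neq_0; [now apply Cpow_nz|auto]. }
  rewrite Cmod_mult, Cmod_pow, Cmod_R, Rabs_pos_eq by lra.
  apply Cmod_gt_0 in NZ.
  replace (2 * PI * (1 - IZR A / IZR D) * Im z) with (- (2 * PI * Im w) + 2 * PI * Im z) by (rewrite Iw; field; lra).
  rewrite exp_plus.
  set (ew := exp (- (2 * PI * Im w))) in *. assert (0 < ew) by apply exp_pos.
  rewrite exp_Ropp in L1, U1. set (ez := exp (2 * PI * Im z)) in *. assert (Pe : 0 < ez) by apply exp_pos.
  set (dz := Cmod (Delta z)) in *. set (dw := Cmod (Delta w)) in *. set (p := IZR D ^ 12) in *.
  assert (L1' : 1 <= 2 * ez * dz).
  { apply Rmult_le_compat_l with (r := 2 * ez) in L1; [|lra].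
    replace (2 * ez * (1 / 2 * / ez)) with 1 in L1 by (field; lra). lra. }
  assert (U1' : ez * dz <= 2).
  { apply Rmult_le_compat_l with (r := ez) in U1; [|lra].
    replace (ez * (2 * / ez)) with 2 in U1 by (field; lra). lra. }
  assert (Q : 0 < p * dz) by nra.
  split.
  - apply Rmult_le_reg_r with (p * dz); auto.
    replace (/ (4 * p) * (ew * ez) * (p * dz)) with (/ 4 * ew * (ez * dz)) by (field; lra).
    replace (dw / (p * dz) * (p * dz)) with dw by (field; split; lra).
    apply Rle_trans with (/ 4 * ew * 2); [|lra]. apply Rmult_le_compat_l; lra.
  - apply Rmult_le_reg_r with (p * dz); auto.
    replace (dw / (p * dz) * (p * dz)) with dw by (field; split; lra).
    apply Rle_trans with (2 * ew); auto.
    apply Rle_trans with (2 * ew * (2 * ez * dz) * p); [|apply Req_le; ring].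
    assert (2 * ew * 1 <= 2 * ew * (2 * ez * dz)) by (apply Rmult_le_compat_l; lra).
    assert (0 <= 2 * ew * (2 * ez * dz)) by lra. nra.
Qed.

Lemma hfun_MG N g : (2 <= N)%nat -> MG (fun z => hfun N (mobius g z)).
Proof.
  intros HN. destruct (hfun_growth N g HN) as (A & D & Y & HY & HA & HD & _ & _ & _ & H).
  exists Y, 4, 1%nat. split; [lra|]. intros z Hz. eapply Rle_trans; [apply H; auto|].
  apply Rmult_le_compat_l; [lra|]. apply exp_mono. simpl INR.
  assert (0 < A / D) by (apply Rdiv_lt_0_compat; lra). pose proof PI_RGT_0.
  apply Rmult_le_compat_r; [lra|]. nra.
Qed.

(** At infinity [hfun] has order [N - 1]; on the other cosets [D >= 2] in [hfun_growth], and the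
    order is at most [N / 4 - 1]. This is why [jfun] and [hfun] generate. *)
Lemma hfun_separates N g : (2 <= N)%nat -> ~ Gamma0 N g ->
  exists Y, 0 < Y /\ forall z, Y < Im z -> hfun N z <> hfun N (mobius g z).
Proof.
  intros HN HG. destruct (hfun_growth N g HN) as (A & D & Y & HY & HA & HD & EN & HD2 & _ & H).
  destruct Delta_near as [Y1 [HY1 HDel]].
  specialize (HD2 HG). assert (N2 : 2 <= INR N) by (apply (le_INR 2); auto).
  assert (PD : 1 <= D ^ 12) by (now apply pow_R1_Rle).
  (* the ratio of the two functions has constants in the quotient [16 D ^ 12] and exponential rate
     at least 1 *)
  exists (Y + Y1 + 16 * D ^ 12). split; [lra|]. intros z Hz E.
  specialize (H z ltac:(lra)). destruct H as [H _]. rewrite <- E in H. unfold hfun in H.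
  assert (NZ : Delta z <> 0) by (apply Delta_neq0; lra).
  rewrite Cmod_div in H by auto. apply Cmod_gt_0 in NZ.
  destruct (HDel z ltac:(lra)) as [L _].
  destruct (HDel (RtoC (INR N) * z)%C) as [_ U]; [rewrite Im_scal; nra|]. rewrite Im_scal in U.
  set (dz := Cmod (Delta z)) in *. set (dw := Cmod _) in U, H.
  assert (B : dw / dz <= 4 * exp (- (2 * PI * (INR N - 1) * Im z))).
  { apply Rmult_le_reg_r with dz; auto. replace (dw / dz * dz) with dw by (field; lra).
    eapply Rle_trans; [apply U|].
    replace (- (2 * PI * (INR N * Im z))) with (- (2 * PI * (INR N - 1) * Im z) + - (2 * PI * Im z)) by ring.
    rewrite exp_plus. pose proof (exp_pos (- (2 * PI * (INR N - 1) * Im z))). nra. }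
  assert (Q : exp (2 * PI * (1 - A / D) * Im z) <= 16 * D ^ 12 * exp (- (2 * PI * (INR N - 1) * Im z))).
  { assert (X : / (4 * D ^ 12) * exp (2 * PI * (1 - A / D) * Im z) <= 4 * exp (- (2 * PI * (INR N - 1) * Im z))) by lra.
    apply (Rmult_le_compat_l (4 * D ^ 12)) in X; [|lra].
    rewrite <- Rmult_assoc, Rinv_r, Rmult_1_l in X by lra. lra. }
  apply (Rmult_le_compat_r (exp (2 * PI * (INR N - 1) * Im z))) in Q; [|apply Rlt_le, exp_pos].
  rewrite <- exp_plus in Q. set (X := 2 * PI * (INR N - 1) * Im z) in *.
  replace (16 * D ^ 12 * exp (- X) * exp X) with (16 * D ^ 12) in Q
    by (rewrite (Rmult_assoc _ (exp (- X))), <- exp_plus, Rplus_opp_l, exp_0; ring).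
  assert (AD : A / D <= INR N / 4).
  { apply Rmult_le_reg_r with (D * 4); [lra|].
    replace (A / D * (D * 4)) with (4 * A) by (field; lra).
    replace (INR N / 4 * (D * 4)) with (INR N * D) by field. rewrite <- EN. nra. }
  assert (G : Im z < exp (2 * PI * (1 - A / D) * Im z + X)).
  { eapply Rlt_le_trans; [apply exp_gt_id|]. apply exp_mono.
    unfold X. replace (2 * PI * (1 - A / D) * Im z + 2 * PI * (INR N - 1) * Im z)
      with ((2 * PI * (INR N - A / D)) * Im z) by ring.
    assert (1 <= 2 * PI * (INR N - A / D)) by (pose proof PI2_1; unfold PI2 in *; nra). nra. }
  lra.
Qed.

(** * Modular functions of level one *)

(** Subdivision of the box, applied to the existence of a datum valid on a part of it. *)
Lemma box_compact {X : Type} (Q : X -> C -> Prop) (a b c d : R) : a <= b -> c <= d ->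
  (forall x1 x2, exists x, forall z, Q x1 z \/ Q x2 z -> Q x z) ->
  (forall z0, a <= Re z0 <= b -> c <= Im z0 <= d ->
     exists x e, 0 < e /\ forall z, Cmod (z - z0) < e -> Q x z) ->
  exists x, forall z, a <= Re z <= b -> c <= Im z <= d -> Q x z.
Proof.
  intros Hab Hcd J L.
  apply (rect_induction (fun a b c d => exists x, forall z, a <= Re z <= b -> c <= Im z <= d -> Q x z)); auto.
  - intros a' m b' c' n d' _ _ _ _ _ _ [x1 H1] [x2 H2] [x3 H3] [x4 H4].
    destruct (J x1 x2) as [y1 J1]. destruct (J x3 x4) as [y2 J2]. destruct (J y1 y2) as [y J3].
    exists y. intros z [A B] [C D]. apply J3.
    destruct (Rle_lt_dec (Im z) n) as [E|E]; [left; apply J1|right; apply J2];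
      (destruct (Rle_lt_dec (Re z) m) as [E2|E2]; [left|right]); [apply H1|apply H2|apply H3|apply H4]; lra.
  - intros u v Hu Hv. destruct (L (u, v) Hu Hv) as [x [e [He H]]].
    exists (e / 2). split; [lra|]. intros a' b' c' d' Ha Hb Hc Hd S1 S2 _.
    exists x. intros z [A B] [C D]. apply H.
    eapply Rle_lt_trans; [apply Cmod_le_sum|].
    assert (Rabs (Re (z - (u, v))) < e / 2).
    { change (Re (z - (u, v))) with (Re z - u). apply Rabs_def1; lra. }
    assert (Rabs (Im (z - (u, v))) < e / 2).
    { change (Im (z - (u, v))) with (Im z - v). apply Rabs_def1; lra. }
    lra.
Qed.

Definition inv1 (f : C -> C) : Prop := forall g z, 0 < Im z -> f (mobius g z) = f z.

(** By reduction the modulus attains its maximum in a compact part of the strip, so [f] is constant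
    by the maximum principle. *)
Lemma liouville f : hol_H f -> inv1 f ->
  (forall eps, 0 < eps -> exists Y, forall z, Y < Im z -> Cmod (f z) < eps) ->
  forall z, 0 < Im z -> f z = 0.
Proof.
  intros Hf Hi Hl z1 Hz1. destruct (Ceq_dec (f z1) 0) as [E|N1]; auto. exfalso.
  set (a := Cmod (f z1)). assert (Ha : 0 < a) by (now apply Cmod_gt_0).
  destruct (Hl a Ha) as [Y0 HY0]. set (Y := Rmax 1 Y0).
  assert (HY1 : 1 <= Y) by apply Rmax_l. assert (HYY : Y0 <= Y) by apply Rmax_r.
  assert (HY : forall z, Y < Im z -> Cmod (f z) < a) by (intros z Hz; apply HY0; lra).
  clearbody Y. clear Y0 HY0 HYY.
  assert (Red : forall z, 0 < Im z -> exists w, f w = f z /\ -(1/2) <= Re w <= 1/2 /\ 1/2 <= Im w).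
  { intros z Hz. destruct (reduction z Hz) as [g [G1 G2]]. exists (mobius g z). split; [now apply Hi|].
    split; auto. now apply Rabs_le_between. }
  (* outside of the box the values are below [a], which is the value at a point of the box *)
  assert (Glob : forall M, (forall z, -(1/2) <= Re z <= 1/2 -> 1/2 <= Im z <= Y -> Cmod (f z) <= M) ->
    a <= M /\ forall z, 0 < Im z -> Cmod (f z) <= M).
  { intros M HM. assert (A : a <= M).
    { destruct (Red z1 Hz1) as [w [Ew [W1 W2]]]. unfold a. rewrite <- Ew. apply HM; auto. split; auto.
      destruct (Rle_lt_dec (Im w) Y); auto. specialize (HY w r). rewrite Ew in HY. unfold a in HY. lra. }
    split; auto. intros z Hz. destruct (Red z Hz) as [w [Ew [W1 W2]]]. rewrite <- Ew.
    destruct (Rle_lt_dec (Im w) Y) as [C|C]; [apply HM; auto|]. specialize (HY w C). lra. }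
  assert (Loc : forall z0 eps, 1/2 <= Im z0 -> 0 < eps ->
    exists e, 0 < e /\ forall z, Cmod (z - z0) < e -> Cmod (f z) <= Cmod (f z0) + eps).
  { intros z0 eps Hz0 He. destruct (hol_cont f z0 (Hf z0 ltac:(lra)) eps He) as [e [He' H]].
    exists e. split; auto. intros z Hz. specialize (H z Hz). pose proof (Cmod_rtriangle (f z) (f z0)). lra. }
  assert (Bd : exists M, forall z, 0 < Im z -> Cmod (f z) <= M).
  { destruct (box_compact (fun M z => Cmod (f z) <= M) (-(1/2)) (1/2) (1/2) Y) as [M HM]; try lra.
    - intros x1 x2. exists (Rmax x1 x2). intros z [H|H];
        [eapply Rle_trans; [exact H|apply Rmax_l]|eapply Rle_trans; [exact H|apply Rmax_r]].
    - intros z0 _ [A _]. exists (Cmod (f z0) + 1). apply Loc; lra.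
    - exists M. apply Glob. intros z A B. now apply HM. }
  destruct Bd as [M0 HM0].
  destruct (completeness (fun x => exists z, 0 < Im z /\ x = Cmod (f z))) as [M [U1 U2]].
  { exists M0. intros x [z [Hz ->]]. auto. }
  { exists a, z1. auto. }
  destruct (classic (exists z0, 0 < Im z0 /\ Cmod (f z0) = M)) as [[z0 [Hz0 E0]]|No].
  - destruct (local_max_principle f z0 (Im z0) Hz0 (H_disc f z0 Hf Hz0)) as [d [Hd Hc]].
    { intros z Hz. rewrite E0. apply U1. exists z. split; auto. now apply H_near with z0. }
    assert (Const : forall z, 0 < Im z -> (f z - f z0 = 0)%C).
    { intros z Hz. apply (locally_zero_at (fun z => f z - f z0)%C).
      apply (identity_H (fun z => f z - f z0)%C z0 z); auto.
      - intros w Hw. apply hol_minus; [now apply Hf|apply hol_const].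
      - exists d. split; auto. intros w Hw. rewrite Hc by auto. ring. }
    assert (C1 := Const z1 Hz1).
    set (w := (0, Y + 1) : C). assert (Hw : Im w = Y + 1) by reflexivity.
    assert (C2 := Const w ltac:(lra)). specialize (HY w ltac:(lra)).
    replace (f w) with (f z1) in HY; [fold a in HY; lra|].
    transitivity (f z0); [now apply Ceq_minus|symmetry; now apply Ceq_minus].
  - assert (Lt : forall z, 0 < Im z -> Cmod (f z) < M).
    { intros z Hz. destruct (U1 (Cmod (f z))) as [L|L]; [eauto|auto|]. exfalso. apply No. eauto. }
    destruct (box_compact (fun (c : {c : R | c < M}) z => Cmod (f z) <= proj1_sig c) (-(1/2)) (1/2) (1/2) Y) as [[c Hc] H]; try lra.
    + intros [c1 H1] [c2 H2]. assert (HR : Rmax c1 c2 < M) by (now apply Rmax_lub_lt).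
      exists (exist (fun c => c < M) _ HR). simpl. intros z [H|H];
        [eapply Rle_trans; [exact H|apply Rmax_l]|eapply Rle_trans; [exact H|apply Rmax_r]].
    + intros z0 _ [A _]. specialize (Lt z0 ltac:(lra)).
      destruct (Loc z0 ((M - Cmod (f z0)) / 2) A ltac:(lra)) as [e [He H]].
      assert (HR : Cmod (f z0) + (M - Cmod (f z0)) / 2 < M) by lra.
      exists (exist (fun c => c < M) _ HR), e. auto.
    + simpl in H. destruct (Glob c) as [_ G]; [intros; apply H; auto|].
      assert (M <= c); [|lra]. apply U2. intros x [z [Hz ->]]. auto.
Qed.

(** The algebra generated over C by [jfun] and [hfun N], as functions on the upper half plane. *)
Inductive Polyjh (N : nat) : (C -> C) -> Prop :=
| Polyjh_const c : Polyjh N (fun _ => c)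
| Polyjh_j : Polyjh N jfun
| Polyjh_h : Polyjh N (hfun N)
| Polyjh_plus f g : Polyjh N f -> Polyjh N g -> Polyjh N (fun z => f z + g z)%C
| Polyjh_mult f g : Polyjh N f -> Polyjh N g -> Polyjh N (fun z => f z * g z)%C
| Polyjh_ext f g : (forall z, 0 < Im z -> f z = g z) -> Polyjh N f -> Polyjh N g.

Lemma Polyjh_pow N f n : Polyjh N f -> Polyjh N (fun z => f z ^ n)%C.
Proof.
  intros H. induction n as [|n IH]; simpl; [apply Polyjh_const|now apply Polyjh_mult].
Qed.

Lemma Cpow_div (a b : C) n : b <> 0 -> ((a / b) ^ n = a ^ n / b ^ n)%C.
Proof.
  intros H. induction n as [|n IH]; [simpl; field|].
  rewrite !Cpow_S, IH. field. split; auto. now apply Cpow_nz.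
Qed.

(** Subtracting a multiple of [jfun ^ k] removes a pole of order [k] at infinity; without a pole, [f]
    minus its value at infinity is zero. *)
Lemma polar_part_induction N k : forall f u d Y, hol_H f -> inv1 f -> 0 < d -> hol_disc u 0 d ->
  (forall z, Y < Im z -> f z = (u (qpar z) / qpar z ^ k)%C) -> Polyjh N f.
Proof.
  induction k as [|k IH]; intros f u d Y Hf Hi Hd Hu E.
  - apply Polyjh_ext with (fun _ => u 0); [|apply Polyjh_const].
    intros z Hz. symmetry. apply Ceq_minus.
    apply (liouville (fun z => f z - u 0)%C); auto.
    + intros w Hw. apply hol_minus; [now apply Hf|apply hol_const].
    + intros g w Hw. now rewrite Hi.
    + intros eps He.
      destruct (hol_cont u (RtoC 0) (Hu (RtoC 0) ltac:(now rewrite Cmod_diag)) eps He) as [e [He' H]].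
      destruct (qpar_div_small 1 e) as [Y' [HY' HS]]; try lra.
      exists (Rmax Y Y'). intros w Hw. pose proof (Rmax_l Y Y'). pose proof (Rmax_r Y Y').
      rewrite E by lra. simpl. replace (u (qpar w) / RtoC 1)%C with (u (qpar w)) by field. apply H.
      specialize (HS w ltac:(lra)). replace (w / RtoC 1)%C with w in HS by field.
      now replace (qpar w - 0)%C with (qpar w) by ring.
  (* [u1] vanishes at 0, hence can be divided by the parameter *)
  - set (u1 := fun t => (u t - u 0 * jq t ^ S k)%C).
    assert (Hu1 : hol_disc u1 0 (Rmin d 1)).
    { intros t Ht. pose proof (Rmin_l d 1). pose proof (Rmin_r d 1).
      apply hol_minus; [apply Hu; lra|]. apply hol_mult; [apply hol_const|]. apply hol_pow, jq_hol. lra. }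
    assert (Hm : 0 < Rmin d 1) by (apply Rmin_glb_lt; lra).
    destruct (hol_factor u1 0 _ Hm Hu1) as (v & e & He & Hv & Fv).
    assert (Z : u1 0 = 0) by (unfold u1; rewrite jq_0, Cpow_1_l; ring).
    destruct (qpar_div_small 1 e) as [Y' [HY' HS]]; try lra.
    apply Polyjh_ext with (fun z => (f z - u 0 * jfun z ^ S k) + u 0 * jfun z ^ S k)%C; [intros; ring|].
    apply Polyjh_plus; [|apply Polyjh_mult; [apply Polyjh_const|apply Polyjh_pow, Polyjh_j]].
    apply (IH _ v e (Rmax Y Y')); auto.
    + intros w Hw. apply hol_minus; [now apply Hf|]. apply hol_mult; [apply hol_const|]. now apply hol_pow, jfun_hol.
    + intros g w Hw. now rewrite Hi, jfun_inv.
    + intros w Hw. pose proof (Rmax_l Y Y'). pose proof (Rmax_r Y Y').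
      pose proof (qpar_neq0 w) as Nq.
      rewrite E, jfun_q by lra.
      specialize (HS w ltac:(lra)). replace (w / RtoC 1)%C with w in HS by field.
      specialize (Fv (qpar w)). replace (qpar w - 0)%C with (qpar w) in Fv by ring.
      specialize (Fv HS). rewrite Z in Fv. unfold u1 in Fv.
      assert (Fv' : u (qpar w) = (u 0 * jq (qpar w) ^ S k + qpar w * v (qpar w))%C).
      { transitivity ((u (qpar w) - u 0 * jq (qpar w) ^ S k) + u 0 * jq (qpar w) ^ S k)%C; [ring|]. rewrite Fv. ring. }
      rewrite Fv', Cpow_div by auto. rewrite (Cpow_S (qpar w)). field. split; auto. now apply Cpow_nz.
Qed.

Theorem level_one N f : hol_H f -> inv1 f -> MG f -> Polyjh N f.
Proof.
  intros Hf Hi (Y & K & m & HK & HB).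
  assert (N1 : forall z : C, (z / RtoC 1)%C = z) by (intros; field).
  destruct (q_expansion f 1 (Rmax 0 Y) K m) as (k & u & d & Y' & Hd & Hu & H); auto; try lra.
  - intros z Hz. apply Hf. pose proof (Rmax_l 0 Y). lra.
  - intros z Hz. pose proof (Rmax_l 0 Y). rewrite <- (Hi (SL2Z_T 1) z) by lra. now rewrite mobius_T.
  - intros z Hz. pose proof (Rmax_r 0 Y). rewrite Rdiv_1_r. apply HB. lra.
  - apply (polar_part_induction N k f u d Y'); auto.
    intros z Hz. destruct (H z Hz) as [_ E]. now rewrite N1 in E.
Qed.

(** * Interpolation over the cosets *)

(** The functions that are holomorphic on the open modular curve and meromorphic at its cusps. *)
Definition MF (N : nat) (f : C -> C) : Prop :=
  hol_H f /\ (forall g z, Gamma0 N g -> 0 < Im z -> f (mobius g z) = f z) /\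
  forall g, MG (fun z => f (mobius g z)).

Lemma MF_const N c : MF N (fun _ => c).
Proof. split; [|split]; auto; [intros z _; apply hol_const|intros _; apply MG_const]. Qed.

Lemma MF_plus N f g : MF N f -> MF N g -> MF N (fun z => f z + g z)%C.
Proof.
  intros (A1 & A2 & A3) (B1 & B2 & B3). split; [|split].
  - intros z Hz. apply hol_plus; auto.
  - intros k z Hk Hz. now rewrite A2, B2.
  - intros k. now apply (MG_plus (fun z => f (mobius k z)) (fun z => g (mobius k z))).
Qed.

Lemma MF_mult N f g : MF N f -> MF N g -> MF N (fun z => f z * g z)%C.
Proof.
  intros (A1 & A2 & A3) (B1 & B2 & B3). split; [|split].
  - intros z Hz. apply hol_mult; auto.
  - intros k z Hk Hz. now rewrite A2, B2.
  - intros k. now apply (MG_mult (fun z => f (mobius k z)) (fun z => g (mobius k z))).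
Qed.

Lemma MF_ext N f g : (forall z, 0 < Im z -> f z = g z) -> MF N f -> MF N g.
Proof.
  intros E (A1 & A2 & A3). split; [|split].
  - now apply hol_H_ext with f.
  - intros k z Hk Hz. rewrite <- !E; auto. now apply Im_mobius_pos.
  - intros k. apply MG_ext with (fun z => f (mobius k z)); auto.
    intros z Hz. apply E. now apply Im_mobius_pos.
Qed.

Lemma MF_level_one N f : hol_H f -> inv1 f -> MG f -> MF N f.
Proof.
  intros A B C. split; [|split]; auto.
  intros g. apply MG_ext with f; auto. intros z Hz. now rewrite B.
Qed.

Lemma Polyjh_MF N f : (2 <= N)%nat -> Polyjh N f -> MF N f.
Proof.
  intros HN H. induction H.
  - apply MF_const.
  - apply MF_level_one; [apply jfun_hol|exact jfun_inv|apply jfun_MG].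
  - split; [now apply hfun_hol|split]; [intros; now apply hfun_inv|intros; now apply hfun_MG].
  - now apply MF_plus.
  - now apply MF_mult.
  - now apply MF_ext with f.
Qed.

(** For a list of pairs [(h_i, f_i)], [node_coef] and [interp_coef] are the coefficients in [X] of
    [prod_i (X - h_i)] and of [sum_i f_i prod_(k <> i) (X - h_k)]. *)
Fixpoint node_coef (l : list (C * C)) (k : nat) : C :=
  match l with
  | nil => match k with O => 1 | S _ => 0 end
  | x :: l => (match k with O => 0 | S k' => node_coef l k' end - fst x * node_coef l k)%C
  end.

Fixpoint interp_coef (l : list (C * C)) (k : nat) : C :=
  match l with
  | nil => 0
  | x :: l => (match k with O => 0 | S k' => interp_coef l k' end - fst x * interp_coef l k
               + snd x * node_coef l k)%C
  end.

Lemma node_coef_perm l l' : Permutation l l' -> forall k, node_coef l k = node_coef l' k.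
Proof.
  intros H. induction H; intros k; auto.
  - simpl. rewrite IHPermutation. destruct k; [reflexivity|]. now rewrite IHPermutation.
  - simpl. destruct k as [|[|k]]; simpl; ring.
  - now rewrite IHPermutation1.
Qed.

Lemma interp_coef_perm l l' : Permutation l l' -> forall k, interp_coef l k = interp_coef l' k.
Proof.
  intros H. induction H; intros k; auto.
  - simpl. rewrite IHPermutation, (node_coef_perm _ _ H). destruct k; [reflexivity|]. now rewrite IHPermutation.
  - simpl. destruct k as [|[|k]]; simpl; ring.
  - now rewrite IHPermutation1.
Qed.

Fixpoint node_poly (l : list (C * C)) (X : C) : C :=
  match l with nil => 1 | x :: l => ((X - fst x) * node_poly l X)%C end.

Fixpoint interp_poly (l : list (C * C)) (X : C) : C :=
  match l with nil => 0 | x :: l => ((X - fst x) * interp_poly l X + snd x * node_poly l X)%C end.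

Lemma csum_shift_pow (c : nat -> C) X n :
  csum (fun k => (match k with O => 0 | S k' => c k' end) * X ^ k)%C (S n)
    = (X * csum (fun k => c k * X ^ k) n)%C.
Proof.
  rewrite csum_shift, Cmult_0_l, Cplus_0_l, <- csum_scal.
  apply csum_ext. intros k _. rewrite Cpow_S. ring.
Qed.

Lemma node_coef_poly X l : forall n, (length l < n)%nat ->
  csum (fun k => node_coef l k * X ^ k)%C n = node_poly l X.
Proof.
  induction l as [|x l IH]; intros n Hn; (destruct n as [|n]; [simpl in Hn; lia|]).
  - rewrite csum_shift. simpl.
    rewrite (csum_ext _ (fun k => 0 * 0)%C) by (intros; ring). rewrite csum_scal. ring.
  - simpl in Hn. simpl node_poly. rewrite <- (IH (S n)) at 1 by lia.
    transitivity (csum (fun k => (match k with O => 0 | S k' => node_coef l k' end) * X ^ k)%C (S n)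
      + - fst x * csum (fun k => node_coef l k * X ^ k)%C (S n))%C.
    + rewrite <- csum_scal, <- csum_plus. apply csum_ext. intros k _. simpl. ring.
    + rewrite csum_shift_pow, !IH by lia. ring.
Qed.

Lemma interp_coef_poly X l : forall n, (length l < n)%nat ->
  csum (fun k => interp_coef l k * X ^ k)%C n = interp_poly l X.
Proof.
  induction l as [|x l IH]; intros n Hn; (destruct n as [|n]; [simpl in Hn; lia|]).
  - rewrite (csum_ext _ (fun k => 0 * 0)%C) by (intros; simpl; ring). rewrite csum_scal. simpl. ring.
  - simpl in Hn. simpl interp_poly.
    transitivity (csum (fun k => (match k with O => 0 | S k' => interp_coef l k' end) * X ^ k)%C (S n)
      + (- fst x * csum (fun k => interp_coef l k * X ^ k)%C (S n)
      + snd x * csum (fun k => node_coef l k * X ^ k)%C (S n)))%C.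
    + rewrite <- !csum_scal, <- !csum_plus. apply csum_ext. intros k _. simpl. ring.
    + rewrite csum_shift_pow, !IH, node_coef_poly by lia. ring.
Qed.

Lemma interp_poly_head h f l : interp_poly ((h, f) :: l) h = (f * node_poly l h)%C.
Proof. simpl. ring. Qed.

Section Interpolation.
Variables (N : nat) (L : list SL2Z).
Hypothesis HN : (2 <= N)%nat.
Hypothesis sepL : separated (cong N) L.
Hypothesis covL : forall g, exists h, In h L /\ cong N g h.

(** The conjugates of the pair [(hfun N, F)] over the functions of level one. *)
Definition conj_vals (F : C -> C) (L : list SL2Z) (z : C) : list (C * C) :=
  map (fun g => (hfun N (mobius g z), F (mobius g z))) L.

(** Right multiplication permutes the cosets. *)
Lemma conj_vals_perm F g z : MF N F -> 0 < Im z ->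
  Permutation (conj_vals F L z) (conj_vals F L (mobius g z)).
Proof.
  intros (_ & HF & _) Hz.
  set (phi := fun k => (hfun N (mobius k z), F (mobius k z))).
  replace (conj_vals F L (mobius g z)) with (map phi (map (fun k => SL2Z_mul k g) L)).
  2:{ rewrite map_map. apply map_ext. intros k. unfold phi. now rewrite mobius_mul. }
  assert (Canc : forall k, SL2Z_mul (SL2Z_mul k g) (SL2Z_inv g) = k).
  { intros k. now rewrite SL2Z_mulA, SL2Z_mulVr, SL2Z_mul1r. }
  apply (separated_perm (cong N) (cong_sym N) (cong_trans N)); auto.
  - intros k k' E. unfold phi. f_equal; apply (cong_inv N); auto. intros; now apply hfun_inv.
  - clear covL. induction L as [|x l IH]; simpl; auto. destruct sepL as [A B]. split; auto.
    intros y Hy E. apply in_map_iff in Hy. destruct Hy as [y' [<- Hy]]. apply (A y' Hy).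
    apply (cong_mul_r N _ _ (SL2Z_inv g)) in E. now rewrite !Canc in E.
  - intros x _. destruct (covL (SL2Z_mul x (SL2Z_inv g))) as [y [Hy E]].
    exists (SL2Z_mul y g). split; [now apply (in_map (fun k => SL2Z_mul k g))|].
    apply (cong_mul_r N _ _ g) in E. now rewrite SL2Z_mulA, SL2Z_mulVl, SL2Z_mul1r in E.
  - intros x _. apply covL.
Qed.

Lemma coef_class F l : MF N F -> forall k,
  (hol_H (fun z => node_coef (conj_vals F l z) k) /\ MG (fun z => node_coef (conj_vals F l z) k)) /\
  (hol_H (fun z => interp_coef (conj_vals F l z) k) /\ MG (fun z => interp_coef (conj_vals F l z) k)).
Proof.
  intros (F1 & _ & F3).
  assert (Cst : forall c, hol_H (fun _ => c) /\ MG (fun _ => c)).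
  { intros c. split; [intros z _; apply hol_const|apply MG_const]. }
  assert (Pl : forall f g, hol_H f /\ MG f -> hol_H g /\ MG g -> hol_H (fun z => f z + g z)%C /\ MG (fun z => f z + g z)%C).
  { intros f g [A B] [A' B']. split; [intros z Hz; apply hol_plus; auto|now apply MG_plus]. }
  assert (Mu : forall f g, hol_H f /\ MG f -> hol_H g /\ MG g -> hol_H (fun z => f z * g z)%C /\ MG (fun z => f z * g z)%C).
  { intros f g [A B] [A' B']. split; [intros z Hz; apply hol_mult; auto|now apply MG_mult]. }
  assert (Mi : forall f g, hol_H f /\ MG f -> hol_H g /\ MG g -> hol_H (fun z => f z - g z)%C /\ MG (fun z => f z - g z)%C).
  { intros f g A B. destruct (Pl f (fun z => - (1) * g z)%C A) as [X Y]; [apply (Mu (fun _ => - (1))%C); auto|].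
    split; [eapply hol_H_ext; [|exact X]|eapply MG_ext; [|exact Y]]; intros z _; simpl; ring. }
  assert (Hh : forall g, hol_H (fun z => hfun N (mobius g z)) /\ MG (fun z => hfun N (mobius g z))).
  { intros g. split; [now apply hol_H_mobius, hfun_hol|now apply hfun_MG]. }
  assert (HF : forall g, hol_H (fun z => F (mobius g z)) /\ MG (fun z => F (mobius g z))).
  { intros g. split; auto. now apply hol_H_mobius. }
  induction l as [|g l IH]; intros k.
  - simpl. split; apply Cst.
  - destruct (IH k) as [IH1 IH2]. unfold conj_vals in *. simpl. split.
    + apply (Mi (fun z => match k with O => RtoC 0 | S k' => node_coef (map (fun g => (hfun N (mobius g z), F (mobius g z))) l) k' end)
        (fun z => hfun N (mobius g z) * node_coef (map (fun g => (hfun N (mobius g z), F (mobius g z))) l) k)%C).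
      * destruct k as [|k]; [exact (Cst (RtoC 0))|exact (proj1 (IH k))].
      * exact (Mu _ _ (Hh g) IH1).
    + apply (Pl (fun z => (match k with O => RtoC 0 | S k' => interp_coef (map (fun g => (hfun N (mobius g z), F (mobius g z))) l) k' end)
        - hfun N (mobius g z) * interp_coef (map (fun g => (hfun N (mobius g z), F (mobius g z))) l) k)%C
        (fun z => F (mobius g z) * node_coef (map (fun g => (hfun N (mobius g z), F (mobius g z))) l) k)%C).
      * apply (Mi (fun z => match k with O => RtoC 0 | S k' => interp_coef (map (fun g => (hfun N (mobius g z), F (mobius g z))) l) k' end)
          (fun z => hfun N (mobius g z) * interp_coef (map (fun g => (hfun N (mobius g z), F (mobius g z))) l) k)%C).
        -- destruct k as [|k]; [exact (Cst (RtoC 0))|exact (proj2 (IH k))].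
        -- exact (Mu _ _ (Hh g) IH2).
      * exact (Mu _ _ (HF g) IH1).
Qed.

(** The coefficients are symmetric in the conjugates, hence of level one, hence polynomials in
    [jfun]. *)
Lemma interp_Polyjh F : MF N F ->
  Polyjh N (fun z => interp_poly (conj_vals F L z) (hfun N z)).
Proof.
  intros HF.
  assert (Co : forall k, Polyjh N (fun z => interp_coef (conj_vals F L z) k)).
  { intros k. destruct (coef_class F L HF k) as [_ [A B]]. apply level_one; auto.
    intros g z Hz. apply interp_coef_perm. symmetry. now apply conj_vals_perm. }
  apply Polyjh_ext with (fun z => csum (fun k => interp_coef (conj_vals F L z) k * hfun N z ^ k)%C (S (length L))).
  - intros z _. apply interp_coef_poly. unfold conj_vals. rewrite length_map. lia.
  - generalize (S (length L)). intros n. induction n as [|n IH]; [exact (Polyjh_const N (RtoC 0))|].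
    simpl. apply Polyjh_plus; auto. apply Polyjh_mult; auto. apply Polyjh_pow, Polyjh_h.
Qed.
End Interpolation.

Lemma node_poly_fst N F G l z X : node_poly (conj_vals N F l z) X = node_poly (conj_vals N G l z) X.
Proof. induction l as [|g l IH]; simpl; [reflexivity|now rewrite IH]. Qed.

(** Evaluate the interpolation polynomial at [hfun] itself, where only the term of the trivial coset
    survives. The common denominator [A] is [prod_(k > 1) (h - h_k)], that is the derivative of the
    characteristic polynomial of [hfun] at [hfun]; it is nonzero as [hfun] differs from its other
    conjugates, and the case [F = 1] shows that it is a polynomial in [jfun] and [hfun]. *)
Theorem interpolation N : (2 <= N)%nat -> exists A : C -> C, Polyjh N A /\
  (exists Y, forall z, Y < Im z -> A z <> 0) /\
  forall F, MF N F -> exists B, Polyjh N B /\ forall z, 0 < Im z -> B z = (F z * A z)%C.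
Proof.
  intros HN. destruct (coset_representatives N HN) as [l [Sep Cov]].
  set (A := fun z => node_poly (conj_vals N (fun _ => 1) l z) (hfun N z)).
  assert (Hd : forall F, MF N F -> forall z,
    interp_poly (conj_vals N F (SL2Z_1 :: l) z) (hfun N z) = (F z * A z)%C).
  { intros F HF z. unfold conj_vals. cbn [map]. rewrite mobius_1, interp_poly_head.
    unfold A. rewrite (node_poly_fst N (fun _ => RtoC 1) F). reflexivity. }
  exists A. split; [|split].
  - apply Polyjh_ext with (fun z => interp_poly (conj_vals N (fun _ => 1) (SL2Z_1 :: l) z) (hfun N z)).
    + intros z _. rewrite Hd by apply MF_const. ring.
    + apply interp_Polyjh; auto. apply MF_const.
  - assert (K : forall g, In g l -> ~ Gamma0 N g).
    { intros g Hg HG. destruct Sep as [S1 _]. apply (S1 g Hg). unfold cong. rewrite SL2Z_mul1l. now apply Gamma0_inv. }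
    unfold A. clear A Hd Sep Cov. induction l as [|g l IH].
    + exists 0. intros z _. simpl. apply C1_nz.
    + destruct IH as [Y1 H1]; [intros; apply K; now right|].
      destruct (hfun_separates N g HN) as [Y2 [_ H2]]; [apply K; now left|].
      exists (Rmax Y1 Y2). intros z Hz. pose proof (Rmax_l Y1 Y2). pose proof (Rmax_r Y1 Y2).
      simpl. apply Cmult_neq_0; [|apply H1; lra].
      intros E. apply (H2 z); [lra|]. now apply Ceq_minus.
  - intros F HF. exists (fun z => interp_poly (conj_vals N F (SL2Z_1 :: l) z) (hfun N z)). split.
    + exact (interp_Polyjh N (SL2Z_1 :: l) HN Sep Cov F HF).
    + intros z _. exact (Hd F HF z).
Qed.

(** * Meromorphic functions on the modular curve *)

Lemma pullback_val N F (z : UHP) : pullback N F z = F (proj N (HPoint z)).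
Proof.
  unfold pullback. destruct z as [z Hz]. simpl. destruct (Rlt_dec 0 (Im z)) as [H|H]; [|contradiction].
  now rewrite (proof_irrelevance _ H Hz).
Qed.

Lemma pullback_mobius N F g (z : UHP) : pullback N F (mobius g z) = F (proj N (HPoint (actH g z))).
Proof. exact (pullback_val N F (actH g z)). Qed.

Lemma pullback_mobius_H N F g z (Hz : 0 < Im z) :
  pullback N F (mobius g z) = F (proj N (HPoint (actH g (mkUHP z Hz)))).
Proof. exact (pullback_mobius N F g (mkUHP z Hz)). Qed.

Lemma UHP_eq (z w : UHP) : uhp_val z = uhp_val w -> z = w.
Proof.
  destruct z as [z Hz], w as [w Hw]. simpl. intros ->. now rewrite (proof_irrelevance _ Hz Hw).
Qed.

Lemma actH_mul g h z : actH (SL2Z_mul g h) z = actH g (actH h z).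
Proof. apply UHP_eq. simpl. apply mobius_mul, uhp_pos. Qed.

Lemma actH_1 z : actH SL2Z_1 z = z.
Proof. apply UHP_eq. simpl. apply mobius_1. Qed.

Lemma X0_eq N p p' : (forall q, orbit N p q <-> orbit N p' q) -> proj N p = proj N p'.
Proof.
  intros H. unfold proj.
  assert (E : orbit N p = orbit N p').
  { apply functional_extensionality. intros q. now apply propositional_extensionality. }
  apply eq_sig with E. apply proof_irrelevance.
Qed.

Lemma proj_actH N g z : Gamma0 N g -> proj N (HPoint (actH g z)) = proj N (HPoint z).
Proof.
  intros Hg. apply X0_eq. intros q. split; intros [k [Hk ->]].
  - exists (SL2Z_mul k g). split; [now apply Gamma0_mul|]. simpl. now rewrite actH_mul.
  - exists (SL2Z_mul k (SL2Z_inv g)). split; [now apply Gamma0_mul, Gamma0_inv|]. simpl.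
    now rewrite <- actH_mul, SL2Z_mulA, SL2Z_mulVl, SL2Z_mul1r.
Qed.

Lemma pullback_inv N F g z : Gamma0 N g -> 0 < Im z -> pullback N F (mobius g z) = pullback N F z.
Proof.
  intros Hg Hz. rewrite (pullback_mobius_H N F g z Hz).
  rewrite proj_actH by auto. now rewrite <- pullback_val.
Qed.

Lemma meromorphic_comp G (g : C -> C) z0 d : meromorphic_at G (g z0) -> 0 < d -> hol_disc g z0 d ->
  (forall z, Cmod (z - z0) < d -> z <> z0 -> g z <> g z0) -> meromorphic_at (fun z => G (g z)) z0.
Proof.
  intros HG Hd Hg Inj.
  assert (Near : forall P : C -> Prop, locally (g z0) P -> exists e, 0 < e <= d /\ forall z, Cmod (z - z0) < e -> P (g z)).
  { intros P HP. apply locally_C in HP. destruct HP as [e [He HP]].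
    destruct (hol_cont g z0 (Hg z0 ltac:(now rewrite Cmod_diag)) e He) as [e' [He' H]].
    exists (Rmin d e'). split; [split; [now apply Rmin_glb_lt|apply Rmin_l]|].
    intros z Hz. pose proof (Rmin_r d e'). apply HP, H. lra. }
  destruct HG as [[phi H]|[phi [H0 H]]]; destruct (Near _ H) as [e [[He1 He2] H1]].
  - left. exists (fun z => phi (g z)). apply locally_C. exists e. split; auto.
    intros z Hz. destruct (H1 z Hz) as [A B]. split; auto.
    apply (hol_comp phi g); auto. apply Hg. lra.
  - right. exists (fun z => phi (g z)). split; auto. apply locally_C. exists e. split; auto.
    intros z Hz. destruct (H1 z Hz) as [A [B D]]. split; [|split; auto].
    + apply (hol_comp phi g); auto. apply Hg. lra.
    + intros N. apply B. apply Inj; auto. lra.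
Qed.

Lemma mobius_inj g z w : 0 < Im z -> 0 < Im w -> mobius g z = mobius g w -> z = w.
Proof.
  intros Hz Hw E. apply (f_equal (mobius (SL2Z_inv g))) in E.
  rewrite <- !mobius_mul, SL2Z_mulVl, !mobius_1 in E by auto. exact E.
Qed.

Lemma meromorphic_mobius G g z : 0 < Im z -> meromorphic_at G (mobius g z) ->
  meromorphic_at (fun w => G (mobius g w)) z.
Proof.
  intros Hz H. apply (meromorphic_comp G (mobius g) z (Im z)); auto.
  - intros w Hw. apply mobius_hol. now apply H_near with z.
  - intros w Hw N E. apply N. apply (mobius_inj g w z); auto. now apply H_near with z.
Qed.

(** The value 0 at the poles is of no consequence: it is always multiplied by a function with a zero
    of larger order. *)
Definition fin (w : sphere) : C := match w with Some c => c | None => 0 end.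

(** At a pole of order [k], [jfun - jfun z0] to the power [k + 1] leaves a zero, in agreement with
    the value 0 of [fin] at the pole. *)
Lemma local_clear G z0 : 0 < Im z0 -> meromorphic_at G z0 -> exists m e, 0 < e /\
  forall z, Cmod (z - z0) < e -> hol (fun z => (jfun z - jfun z0) ^ m * fin (G z))%C z.
Proof.
  intros Hz0 [[phi H]|[phi [H0 H]]]; apply locally_C in H; destruct H as [e [He H]].
  - exists O, e. split; auto. intros z Hz.
    assert (Hd : 0 < e - Cmod (z - z0)) by lra.
    apply (hol_ext_loc phi _ z _ Hd); [|now apply H].
    intros w Hw. destruct (H w) as [_ ->]; [|simpl; ring].
    replace (w - z0)%C with ((w - z) + (z - z0))%C by ring. eapply Rle_lt_trans; [apply Cmod_triangle|]. lra.
  - destruct (hol_zero_dichotomy phi z0 e He) as [[d [Hd Z]]|(k & v & d & Hd & Hv & Hk)].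
    + intros z Hz. now apply H.
    + exfalso. assert (Hm : 0 < Rmin d e) by (now apply Rmin_glb_lt).
      destruct (punctured_point z0 _ Hm) as [w [W1 W2]]. pose proof (Rmin_l d e). pose proof (Rmin_r d e).
      destruct (H w ltac:(lra)) as [_ [A _]]. apply (A W1). apply Z. lra.
    + destruct (hol_factor jfun z0 (Im z0) Hz0 (H_disc jfun z0 jfun_hol Hz0)) as (u & d' & Hd' & Hu & Hj).
      set (r := Rmin e (Rmin d d')).
      assert (R1 : r <= e) by apply Rmin_l.
      assert (R2 : r <= d) by (eapply Rle_trans; [apply Rmin_r|apply Rmin_l]).
      assert (R3 : r <= d') by (eapply Rle_trans; [apply Rmin_r|apply Rmin_r]).
      assert (R0 : 0 < r) by (repeat apply Rmin_glb_lt; auto).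
      exists (S k), r. split; auto. intros z Hz.
      assert (Hr : 0 < r - Cmod (z - z0)) by lra.
      apply (hol_ext_loc (fun z => (z - z0) * u z ^ S k / v z)%C _ z _ Hr).
      * intros w Hw.
        assert (Hw' : Cmod (w - z0) < r).
        { replace (w - z0)%C with ((w - z) + (z - z0))%C by ring. eapply Rle_lt_trans; [apply Cmod_triangle|]. lra. }
        destruct (Hk w ltac:(lra)) as [Nv Ek]. destruct (H w ltac:(lra)) as [_ [Nz Eg]].
        rewrite Eg. unfold sphere_inv. destruct (Ceq_dec w z0) as [->|Nw].
        -- destruct (Ceq_dec (phi z0) 0); [|contradiction]. simpl. unfold Cminus. rewrite Cplus_opp_r. field. auto.
        -- destruct (Ceq_dec (phi w) 0) as [E|E]; [now apply Nz in Nw|]. simpl fin. rewrite Hj by lra.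
           replace (jfun z0 + (w - z0) * u w - jfun z0)%C with ((w - z0) * u w)%C by ring.
           rewrite Ek, Cpow_mult_l, (Cpow_S (w - z0)).
           assert (N1 : (w - z0)%C <> 0) by (intros X; apply Nw; now apply Ceq_minus).
           field. split; auto. now apply Cpow_nz.
      * apply hol_div; [|apply Hv; lra|apply Hk; lra]. apply hol_mult; [auto with hol|]. apply hol_pow, Hu. lra.
Qed.

(** The local coordinate is nonzero off the cusp, so the exceptional value of the Laurent expansion
    does not occur. *)
Lemma cusp_laurent N F g : meromorphic_at_cusp N F g -> exists (w : nat) k u d Y,
  (1 <= w)%nat /\ 0 < d /\ 0 <= Y /\ hol_disc u 0 d /\ forall z, Y < Im z ->
    Cmod (qpar (z / INR w)) < d /\
    pullback N F (mobius g z) = Some (u (qpar (z / INR w)) / qpar (z / INR w) ^ k)%C.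
Proof.
  intros (w & G & Y & [Hw _] & HG & _ & E).
  destruct (meromorphic_laurent G (RtoC 0) HG) as (k & u & d & Hd & Hu & EG).
  assert (Pw : 0 < INR w) by (apply lt_0_INR; lia).
  destruct (qpar_div_small (INR w) d Pw Hd) as [Y' [HY' HS]].
  exists w, k, u, d, (Rmax Y Y'). split; auto. split; auto.
  split; [eapply Rle_trans; [|apply Rmax_r]; lra|]. split; auto.
  intros z Hz. pose proof (Rmax_l Y Y'). pose proof (Rmax_r Y Y').
  specialize (HS z ltac:(lra)). split; auto.
  assert (Hz0 : 0 < Im z) by lra.
  rewrite (pullback_mobius_H N F g z Hz0), E by (simpl; lra). simpl uhp_val.
  rewrite EG; [|apply qpar_neq0|].
  - f_equal. now replace (qpar (z / INR w) - 0)%C with (qpar (z / INR w)) by ring.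
  - now replace (qpar (z / INR w) - 0)%C with (qpar (z / INR w)) by ring.
Qed.

(** The possible denominators: polynomials in [jfun] that are not zero. *)
Definition level_one_multiplier (D : C -> C) : Prop :=
  hol_H D /\ inv1 D /\ MG D /\ exists Y, forall z, Y < Im z -> D z <> 0.

Lemma multiplier_1 : level_one_multiplier (fun _ => 1).
Proof.
  repeat split; auto using MG_const; [intros z _; apply hol_const|].
  exists 0. intros z _. apply C1_nz.
Qed.

Lemma multiplier_mult D1 D2 : level_one_multiplier D1 -> level_one_multiplier D2 ->
  level_one_multiplier (fun z => D1 z * D2 z)%C.
Proof.
  intros (A1 & A2 & A3 & Y1 & A4) (B1 & B2 & B3 & Y2 & B4). split; [|split; [|split]].
  - intros z Hz. apply hol_mult; auto.
  - intros g z Hz. now rewrite A2, B2.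
  - now apply MG_mult.
  - exists (Rmax Y1 Y2). intros z Hz. pose proof (Rmax_l Y1 Y2). pose proof (Rmax_r Y1 Y2).
    apply Cmult_neq_0; [apply A4|apply B4]; lra.
Qed.

Lemma multiplier_j c m : level_one_multiplier (fun z => (jfun z - c) ^ m)%C.
Proof.
  induction m as [|m IH]; simpl; [apply multiplier_1|].
  apply (multiplier_mult (fun z => jfun z - c)%C); auto. split; [|split; [|split]].
  - intros z Hz. apply hol_minus; [now apply jfun_hol|apply hol_const].
  - intros g z Hz. now rewrite jfun_inv.
  - apply (MG_plus jfun (fun _ => - c)%C); [apply jfun_MG|apply MG_const].
  - destruct (jfun_ne_const c) as [Y [_ H]]. exists Y. intros z Hz E. apply (H z Hz). now apply Ceq_minus.
Qed.

Section ClearPoles.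
Variables (N : nat) (F : X0 N -> sphere).
Hypothesis HN : (2 <= N)%nat.
Hypothesis HF : function_field N F.

Let Fm (g : SL2Z) (z : C) : C := fin (pullback N F (mobius g z)).

(** A compact part of the strip contains the poles, each of which is cleared by a power of
    [jfun - jfun z0]. *)
Lemma clear_strip g : exists D, level_one_multiplier D /\
  forall z, -(1/2) <= Re z <= 1/2 -> 1/2 <= Im z -> hol (fun z => D z * Fm g z)%C z.
Proof.
  destruct HF as [HM HC].
  destruct (cusp_laurent N F g (HC g)) as (w & k & u & d & Y & Hw & Hd & HY & Hu & EL).
  assert (Pw : RtoC (INR w) <> 0) by (apply C_INR_neq0; lia).
  destruct (box_compact (fun (D : {D | level_one_multiplier D}) z =>
    0 < Im z -> hol (fun z => proj1_sig D z * Fm g z)%C z) (-(1/2)) (1/2) (1/2) (Y + 1)) as [[D HD] H]; try lra.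
  - intros [D1 H1] [D2 H2]. exists (exist level_one_multiplier _ (multiplier_mult D1 D2 H1 H2)). simpl.
    intros z [H|H] Hz; specialize (H Hz).
    + apply (hol_ext_loc (fun z => D2 z * (D1 z * Fm g z))%C _ z 1); [lra|intros; ring|].
      apply hol_mult; auto. now apply H2.
    + apply (hol_ext_loc (fun z => D1 z * (D2 z * Fm g z))%C _ z 1); [lra|intros; ring|].
      apply hol_mult; auto. now apply H1.
  - intros z0 _ [A _]. assert (Hz0 : 0 < Im z0) by lra.
    destruct (local_clear (fun z => pullback N F (mobius g z)) z0 Hz0) as (m & e & He & H).
    + apply meromorphic_mobius; auto. apply (HM (actH g (mkUHP z0 Hz0))).
    + exists (exist level_one_multiplier _ (multiplier_j (jfun z0) m)), e. split; auto.
  - exists D. split; auto. intros z A B. simpl in H.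
    destruct (Rle_lt_dec (Im z) (Y + 1)) as [L|L]; [apply H; auto; lra|].
    apply hol_mult; [apply HD; lra|].
    apply (hol_ext_loc (fun z => u (qpar (z / INR w)) / qpar (z / INR w) ^ k)%C _ z 1); [lra| |].
    + intros z' Hz'. unfold Fm. destruct (EL z') as [_ ->]; [|reflexivity].
      pose proof (im_le_Cmod (z' - z)) as I. change (Im (z' - z)) with (Im z' - Im z) in I.
      assert (X : Rabs (Im z' - Im z) < 1) by lra. apply Rabs_lt_between in X. lra.
    + assert (Hq : hol (fun z => qpar (z / INR w)) z).
      { apply hol_qpar, hol_div; auto with hol. }
      apply hol_div; [|now apply hol_pow|apply Cpow_nz, qpar_neq0].
      apply (hol_comp u (fun z => qpar (z / INR w))); auto.
      apply Hu. destruct (EL z ltac:(lra)) as [X _]. now replace (qpar (z / INR w) - 0)%C with (qpar (z / INR w)) by ring.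
Qed.

(** The strip is moved over all of the upper half plane by [SL2Z], up to the finitely many cosets, and
    the multipliers do not change. *)
Theorem clear_poles : exists D, level_one_multiplier D /\ MF N (fun z => D z * fin (pullback N F z))%C.
Proof.
  destruct (coset_representatives N HN) as [l [_ Cov]]. set (L := SL2Z_1 :: l) in *. clearbody L.
  assert (X : exists D, level_one_multiplier D /\ forall g, In g L ->
    forall z, -(1/2) <= Re z <= 1/2 -> 1/2 <= Im z -> hol (fun z => D z * Fm g z)%C z).
  { clear Cov. induction L as [|g L' [D1 [H1 H1']]].
    - exists (fun _ => 1). split; [apply multiplier_1|]. intros g [].
    - destruct (clear_strip g) as [D2 [H2 H2']].
      exists (fun z => D1 z * D2 z)%C. split; [now apply multiplier_mult|].
      intros k [<-|Hk] z A B.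
      + apply (hol_ext_loc (fun z => D1 z * (D2 z * Fm g z))%C _ z 1); [lra|intros; ring|].
        apply hol_mult; auto. apply H1. lra.
      + apply (hol_ext_loc (fun z => D2 z * (D1 z * Fm k z))%C _ z 1); [lra|intros; ring|].
        apply hol_mult; auto. apply H2. lra. }
  destruct X as [D [HD H]]. exists D. split; auto. destruct HD as (D1 & D2 & D3 & _).
  split; [|split].
  - intros z Hz. destruct (reduction z Hz) as [g [G1 G2]]. apply Rabs_le_between in G1.
    (* near [z] the function is the one for the coset [h], read at the reduced point [g z] *)
    destruct (Cov (SL2Z_inv g)) as [h [Hh Ch]].
    apply (hol_ext_loc (fun z => D (mobius g z) * Fm h (mobius g z))%C _ z (Im z)); auto.
    + intros w Hw. assert (Pw : 0 < Im w) by (now apply H_near with z).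
      rewrite D2 by auto. do 2 f_equal. unfold Fm.
      rewrite <- (cong_inv N (pullback N F) (SL2Z_inv g) h) by (auto using Im_mobius_pos, pullback_inv).
      now rewrite <- mobius_mul, SL2Z_mulVl, mobius_1.
    + apply (hol_comp (fun z => D z * Fm h z)%C (mobius g)); [now apply H|now apply mobius_hol].
  - intros g z Hg Hz. now rewrite D2, pullback_inv.
  - intros g. apply MG_mult with (f := fun z => D (mobius g z)) (g := fun z => Fm g z).
    + apply MG_ext with D; auto. intros z Hz. now rewrite D2.
    + destruct HF as [_ HC].
      destruct (cusp_laurent N F g (HC g)) as (w & k & u & d & Y & Hw & Hd & HY & Hu & EL).
      apply (MG_laurent _ (INR w) k u d Y); auto; [now apply (le_INR 1)|].
      intros z Hz. unfold Fm. destruct (EL z Hz) as [_ ->]. reflexivity.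
Qed.
End ClearPoles.

(** * Cusps *)

Lemma QcZ_mul a b : QcZ (a * b) = (QcZ a * QcZ b)%Qc.
Proof. apply Qc_is_canon. unfold QcZ, Qcmult, Q2Qc. cbn [this]. rewrite !Qred_correct, inject_Z_mult. reflexivity. Qed.

Lemma QcZ_add a b : QcZ (a + b) = (QcZ a + QcZ b)%Qc.
Proof. apply Qc_is_canon. unfold QcZ, Qcplus, Q2Qc. cbn [this]. rewrite !Qred_correct, inject_Z_plus. reflexivity. Qed.

Lemma QcZ_inj a b : QcZ a = QcZ b -> a = b.
Proof.
  intros H. apply (f_equal this) in H. unfold QcZ, Q2Qc in H. cbn [this] in H.
  assert (E : (inject_Z a == inject_Z b)%Q) by (rewrite <- (Qred_correct (inject_Z a)), H; apply Qred_correct).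
  unfold Qeq in E. simpl in E. lia.
Qed.

Lemma QcZ_neq0 a : a <> 0%Z -> QcZ a <> Q2Qc 0.
Proof. intros N E. apply N. now apply QcZ_inj. Qed.

Lemma actCusp_inf_0 g : mc g = 0%Z -> actCusp g None = None.
Proof. intros H. unfold actCusp. destruct (Z.eq_dec (mc g) 0); [reflexivity|contradiction]. Qed.

Lemma actCusp_inf_neq0 g : mc g <> 0%Z -> actCusp g None = Some (QcZ (ma g) / QcZ (mc g))%Qc.
Proof. intros H. unfold actCusp. destruct (Z.eq_dec (mc g) 0); [contradiction|reflexivity]. Qed.

Lemma actCusp_inf_eq g h : actCusp g None = actCusp h None -> (ma g * mc h = ma h * mc g)%Z.
Proof.
  destruct (Z.eq_dec (mc g) 0) as [Eg|Ng], (Z.eq_dec (mc h) 0) as [Eh|Nh].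
  - rewrite Eg, Eh. lia.
  - rewrite actCusp_inf_0, actCusp_inf_neq0 by auto. discriminate.
  - rewrite actCusp_inf_neq0, actCusp_inf_0 by auto. discriminate.
  - rewrite !actCusp_inf_neq0 by auto. intros E.
    apply (f_equal (fun o => match o with Some x => x | None => QcZ 0 end)) in E. cbv beta iota in E.
    apply QcZ_neq0 in Ng. apply QcZ_neq0 in Nh.
    apply QcZ_inj. rewrite !QcZ_mul.
    replace (QcZ (ma g)) with (QcZ (ma g) / QcZ (mc g) * QcZ (mc g))%Qc by (field; auto).
    rewrite E. field. auto.
Qed.

Lemma actCusp_inf_intro g h : mc g <> 0%Z -> (ma g * mc h = ma h * mc g)%Z -> mc h <> 0%Z -> actCusp g None = actCusp h None.
Proof.
  intros Ng E Nh. rewrite !actCusp_inf_neq0 by auto. f_equal.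
  apply QcZ_neq0 in Ng. apply QcZ_neq0 in Nh. apply (f_equal QcZ) in E. rewrite !QcZ_mul in E.
  replace (QcZ (ma g) / QcZ (mc g))%Qc with (QcZ (ma g) * QcZ (mc h) / (QcZ (mc g) * QcZ (mc h)))%Qc by (field; auto).
  rewrite E. field. auto.
Qed.

(** It suffices to know the action on the orbit of infinity, which is everything. *)
Lemma actCusp_mul g h : actCusp g (actCusp h None) = actCusp (SL2Z_mul g h) None.
Proof.
  destruct (Z.eq_dec (mc h) 0) as [Eh|Nh].
  - rewrite (actCusp_inf_0 h Eh).
    assert (mc (SL2Z_mul g h) = mc g * ma h)%Z by (sl2_simpl; rewrite Eh; ring).
    assert (ma (SL2Z_mul g h) = ma g * ma h)%Z by (sl2_simpl; rewrite Eh; ring).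
    assert (ma h <> 0)%Z by (destruct (unipotent_cases h Eh); lia).
    destruct (Z.eq_dec (mc g) 0) as [Eg|Ng].
    + rewrite !actCusp_inf_0; auto. rewrite H, Eg. ring.
    + apply actCusp_inf_intro; auto; [rewrite H, H0; ring|rewrite H; nia].
  - rewrite (actCusp_inf_neq0 h Nh). pose proof (QcZ_neq0 _ Nh) as Nq.
    unfold actCusp at 1.
    assert (Ed : (QcZ (mc g) * (QcZ (ma h) / QcZ (mc h)) + QcZ (md g) = QcZ (mc (SL2Z_mul g h)) / QcZ (mc h))%Qc).
    { sl2_simpl. rewrite QcZ_add, !QcZ_mul. field. auto. }
    assert (En : (QcZ (ma g) * (QcZ (ma h) / QcZ (mc h)) + QcZ (mb g) = QcZ (ma (SL2Z_mul g h)) / QcZ (mc h))%Qc).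
    { sl2_simpl. rewrite QcZ_add, !QcZ_mul. field. auto. }
    rewrite Ed, En. destruct (Z.eq_dec (mc (SL2Z_mul g h)) 0) as [E|E].
    + rewrite (actCusp_inf_0 _ E). rewrite E.
      destruct (Qc_eq_dec (QcZ 0 / QcZ (mc h)) (QcZ 0)) as [_|X]; [reflexivity|].
      exfalso. apply X. change (QcZ 0) with (Q2Qc 0). field. auto.
    + rewrite (actCusp_inf_neq0 _ E). pose proof (QcZ_neq0 _ E) as Nq2.
      destruct (Qc_eq_dec (QcZ (mc (SL2Z_mul g h)) / QcZ (mc h)) (QcZ 0)) as [X|_].
      * exfalso. apply Nq2. transitivity (QcZ (mc (SL2Z_mul g h)) / QcZ (mc h) * QcZ (mc h))%Qc; [field; auto|].
        rewrite X. change (QcZ 0) with (Q2Qc 0). ring.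
      * f_equal. field. auto.
Qed.

Lemma cusp_transitive (s : cusp) : exists g, s = actCusp g None.
Proof.
  destruct s as [r|].
  - pose proof (Qred_identity2 _ (canon r)) as Hg.
    destruct (Z.gcd_bezout _ _ _ Hg) as [u [v Huv]].
    set (a := Qnum r) in *. set (c := QDen r) in *.
    assert (Dg : (a * u - (- v) * c = 1)%Z) by lia.
    assert (Nc : c <> 0%Z) by (unfold c; lia).
    exists (mkSL2Z _ _ _ _ Dg). rewrite actCusp_inf_neq0 by exact Nc. f_equal. simpl.
    pose proof (QcZ_neq0 _ Nc) as Nq.
    assert (E : (r * QcZ c = QcZ a)%Qc).
    { apply Qc_is_canon. unfold QcZ, Qcmult, Q2Qc. cbn [this]. rewrite !Qred_correct. unfold Qeq, a, c. simpl. lia. }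
    rewrite <- E. field. auto.
  - exists SL2Z_1. reflexivity.
Qed.

Lemma X0_cases N (p : X0 N) : (exists z, p = proj N (HPoint z)) \/
  (exists g, p = proj N (HCusp (actCusp g None))).
Proof.
  destruct p as [S [q e]]. subst S. destruct q as [z|s].
  - left. exists z. reflexivity.
  - right. destruct (cusp_transitive s) as [g ->]. exists g. reflexivity.
Qed.

Lemma act_1 p : act SL2Z_1 p = p.
Proof.
  destruct p as [z|s]; cbn [act]; [now rewrite actH_1|].
  destruct (cusp_transitive s) as [g ->]. now rewrite actCusp_mul, SL2Z_mul1l.
Qed.

Lemma proj_eq_act N p p' : proj N p = proj N p' -> exists g, Gamma0 N g /\ p' = act g p.
Proof.
  intros E. apply (f_equal (@proj1_sig _ _)) in E. simpl in E.
  assert (X : orbit N p' p') by (exists SL2Z_1; split; [apply Gamma0_1|now rewrite act_1]).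
  rewrite <- E in X. exact X.
Qed.

Lemma mobius_unipotent g : mc g = 0%Z -> exists n : Z, forall z, mobius g z = (z + ZC n)%C.
Proof.
  intros E. destruct (unipotent_cases g E) as [[A D]|[A D]].
  - exists (mb g). intros z. unfold mobius. rewrite E, A, D. field.
  - exists (- mb g)%Z. intros z. unfold mobius. rewrite E, A, D. pushZ.
    replace (RtoC (-1)) with (- (1))%C by (now rewrite <- RtoC_opp). field.
Qed.

(** ** Values at the cusps as limits *)

(** Convergence in the Riemann sphere as [Im z] tends to infinity. The value of a function at a cusp
    is such a limit; in contrast to the local coordinate, it involves no width and is plainly
    unchanged by translations. *)
Definition clim (f : C -> sphere) (v : sphere) : Prop :=
  match v with
  | Some c => forall eps, 0 < eps -> exists Y, forall z, Y < Im z ->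
      exists c', f z = Some c' /\ Cmod (c' - c) < eps
  | None => forall M, exists Y, forall z, Y < Im z -> forall c', f z = Some c' -> M < Cmod c'
  end.

Lemma clim_unique f v v' : clim f v -> clim f v' -> v = v'.
Proof.
  assert (Far : forall Y1 Y2, exists z : C, Y1 < Im z /\ Y2 < Im z).
  { intros Y1 Y2. exists (0, Rmax Y1 Y2 + 1). unfold Im; simpl.
    pose proof (Rmax_l Y1 Y2). pose proof (Rmax_r Y1 Y2). lra. }
  assert (Mix : forall c, clim f (Some c) -> clim f None -> False).
  { intros c H1 H2. destruct (H1 1 ltac:(lra)) as [Y1 K1]. destruct (H2 (Cmod c + 1)) as [Y2 K2].
    destruct (Far Y1 Y2) as [z [Z1 Z2]]. destruct (K1 z Z1) as [c' [E L]]. specialize (K2 z Z2 c' E).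
    pose proof (Cmod_rtriangle c' c). lra. }
  destruct v as [c|], v' as [c'|]; intros H1 H2; auto; try (exfalso; eauto; fail).
  f_equal. apply NNPP. intros N. assert (P : 0 < Cmod (c - c')) by (now apply Cmod_neq).
  destruct (H1 (Cmod (c - c') / 2)) as [Y1 K1]; [lra|]. destruct (H2 (Cmod (c - c') / 2)) as [Y2 K2]; [lra|].
  destruct (Far Y1 Y2) as [z [Z1 Z2]]. destruct (K1 z Z1) as [a [E L]]. destruct (K2 z Z2) as [b [E' L']].
  rewrite E in E'. injection E' as <-.
  replace (c - c')%C with ((a - c') - (a - c))%C in P, L, L' by ring.
  pose proof (Cmod_triangle (a - c') (- (a - c))) as T. rewrite Cmod_opp in T.
  change (a - c' + - (a - c))%C with ((a - c') - (a - c))%C in T.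
  replace (a - c' - (a - c))%C with (c - c')%C in * by ring. lra.
Qed.

Lemma clim_ext f g v : (forall z, 0 < Im z -> f z = g z) -> clim f v -> clim g v.
Proof.
  intros E. destruct v as [c|]; intros H.
  - intros eps He. destruct (H eps He) as [Y K]. exists (Rmax 0 Y). intros z Hz.
    pose proof (Rmax_l 0 Y). pose proof (Rmax_r 0 Y). rewrite <- E by lra. apply K. lra.
  - intros M. destruct (H M) as [Y K]. exists (Rmax 0 Y). intros z Hz.
    pose proof (Rmax_l 0 Y). pose proof (Rmax_r 0 Y). rewrite <- E by lra. apply K. lra.
Qed.

Lemma clim_translate f v (n : Z) : clim f v -> clim (fun z => f (z + ZC n)%C) v.
Proof.
  assert (I : forall z, Im (z + ZC n)%C = Im z) by (intros; unfold Im; simpl; ring).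
  destruct v as [c|]; intros H.
  - intros eps He. destruct (H eps He) as [Y K]. exists Y. intros z Hz. apply K. now rewrite I.
  - intros M. destruct (H M) as [Y K]. exists Y. intros z Hz. apply K. now rewrite I.
Qed.

Lemma clim_meromorphic (f G : C -> sphere) (w Y : R) : 0 < w -> meromorphic_at G 0 ->
  (forall z, Y < Im z -> f z = G (qpar (z / w))) -> clim f (G 0).
Proof.
  intros Hw HG E.
  assert (Small : forall d, 0 < d -> exists Y', forall z, Y' < Im z ->
    f z = G (qpar (z / w)) /\ Cmod (qpar (z / w) - 0) < d).
  { intros d Hd. destruct (qpar_div_small w d Hw Hd) as [Y' [_ K]].
    exists (Rmax Y Y'). intros z Hz. pose proof (Rmax_l Y Y'). pose proof (Rmax_r Y Y').
    split; [apply E; lra|]. replace (qpar (z / w) - 0)%C with (qpar (z / w)) by ring. apply K. lra. }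
  assert (D0 : forall e, 0 < e -> Cmod (0 - 0) < e) by (intros e He; rewrite Cmod_diag; auto).
  destruct HG as [[phi H]|[phi [H0 H]]]; apply locally_C in H; destruct H as [d [Hd H]].
  - destruct (H (RtoC 0) (D0 d Hd)) as [A B]. rewrite B. intros eps He.
    destruct (hol_cont phi (RtoC 0) A eps He) as [e [He' HC]].
    destruct (Small (Rmin d e)) as [Y' K]; [now apply Rmin_glb_lt|].
    exists Y'. intros z Hz. destruct (K z Hz) as [Ez Lz]. pose proof (Rmin_l d e). pose proof (Rmin_r d e).
    exists (phi (qpar (z / w))). split; [rewrite Ez; apply H; lra|apply HC; lra].
  - destruct (H (RtoC 0) (D0 d Hd)) as [A [_ B]]. rewrite B. unfold sphere_inv at 1. rewrite H0.
    destruct (Ceq_dec 0 0) as [_|X]; [|now contradiction X].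
    intros M. set (M' := Rabs M + 1). assert (HM : 0 < M') by (unfold M'; pose proof (Rabs_pos M); lra).
    destruct (hol_cont phi (RtoC 0) A (/ M')) as [e [He' HC]]; [now apply Rinv_0_lt_compat|].
    destruct (Small (Rmin d e)) as [Y' K]; [now apply Rmin_glb_lt|].
    exists Y'. intros z Hz c Ec. destruct (K z Hz) as [Ez Lz]. pose proof (Rmin_l d e). pose proof (Rmin_r d e).
    destruct (H (qpar (z / w)) ltac:(lra)) as [_ [_ EG]]. rewrite Ez, EG in Ec. unfold sphere_inv in Ec.
    destruct (Ceq_dec (phi (qpar (z / w))) 0) as [|N]; [discriminate|]. injection Ec as <-.
    specialize (HC (qpar (z / w)) ltac:(lra)). rewrite H0 in HC.
    replace (phi (qpar (z / w)) - 0)%C with (phi (qpar (z / w))) in HC by ring.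
    rewrite Cmod_inv by auto. apply Cmod_gt_0 in N.
    apply Rlt_trans with M'; [unfold M'; pose proof (Rle_abs M); lra|].
    rewrite <- (Rinv_inv M'). apply Rinv_lt_contravar; auto.
    apply Rmult_lt_0_compat; auto. now apply Rinv_0_lt_compat.
Qed.

Lemma function_field_clim N F g : function_field N F ->
  clim (fun z => pullback N F (mobius g z)) (F (proj N (HCusp (actCusp g None)))).
Proof.
  intros [_ HC]. destruct (HC g) as (w & G & Y & [Hw _] & HG & -> & E).
  apply (clim_meromorphic _ G (INR w) (Rmax 0 Y)); auto; [apply lt_0_INR; lia|].
  intros z Hz. pose proof (Rmax_l 0 Y). pose proof (Rmax_r 0 Y).
  assert (Hz0 : 0 < Im z) by lra.
  rewrite (pullback_mobius_H N F g z Hz0), E by (simpl; lra). reflexivity.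
Qed.

(** ** Extension to the cusps *)

Section Lift.
Variables (N : nat) (f : C -> sphere).
Hypothesis f_inv : forall g z, Gamma0 N g -> 0 < Im z -> f (mobius g z) = f z.
Hypothesis f_mero : forall z, 0 < Im z -> meromorphic_at f z.
Hypothesis f_cusp : forall g, exists (w : nat) (G : C -> sphere) (Y : R), cusp_width N g w /\
  meromorphic_at G 0 /\ forall z, Y < Im z -> f (mobius g z) = G (qpar (z / INR w)).

Let value (S : X0 N) (v : sphere) : Prop :=
  (exists z, S = proj N (HPoint z) /\ v = f z) \/
  (exists g, S = proj N (HCusp (actCusp g None)) /\ clim (fun z => f (mobius g z)) v).

Let value_unique S v v' : value S v -> value S v' -> v = v'.
Proof.
  intros [[z [E Ev]]|[g [E Ev]]] [[z' [E' Ev']]|[g' [E' Ev']]]; rewrite E in E'.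
  - destruct (proj_eq_act N _ _ E') as [k [Hk X]].
    simpl in X. injection X as ->. rewrite Ev, Ev'. symmetry. apply f_inv; auto. apply uhp_pos.
  - destruct (proj_eq_act N _ _ E') as [k [Hk X]]. discriminate X.
  - destruct (proj_eq_act N _ _ E') as [k [Hk X]]. discriminate X.
  - destruct (proj_eq_act N _ _ E') as [k [Hk X]].
    cbn [act] in X. rewrite actCusp_mul in X.
    assert (X' : actCusp g' None = actCusp (SL2Z_mul k g) None) by congruence.
    apply actCusp_inf_eq in X'.
    destruct (mobius_unipotent (SL2Z_mul (SL2Z_inv g') (SL2Z_mul k g))) as [n Hn].
    { revert X'. sl2_simpl. intros X'. lia. }
    apply (clim_unique (fun z => f (mobius g z))); auto.
    apply (clim_ext (fun z => f (mobius g' (z + ZC n)%C))).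
    + intros z Hz. rewrite <- Hn, <- mobius_mul, SL2Z_mulVKl, mobius_mul by auto.
      apply f_inv; auto. now apply Im_mobius_pos.
    + apply (clim_translate (fun z => f (mobius g' z))). auto.
Qed.

(** The values at the cusps are limits. If [g oo] and [g' oo] are equivalent, [g] and [g'] differ by
    an element of [Gamma0 N] and a translation, which do not change the limit. *)
Theorem lift : exists F, function_field N F /\ forall z : UHP, F (proj N (HPoint z)) = f z.
Proof.
  set (F := fun S => epsilon (inhabits None) (value S)).
  assert (HF : forall S v, value S v -> F S = v).
  { intros S v Hv. apply (value_unique S); auto. apply epsilon_spec. eauto. }
  assert (Fp : forall z : UHP, F (proj N (HPoint z)) = f z).
  { intros z. apply HF. left. eauto. }
  exists F. split; auto. split.
  - intros z. apply (meromorphic_ext f _ z (Im z)); [apply uhp_pos| |apply f_mero, uhp_pos].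
    intros w Hw. assert (Pw : 0 < Im w) by (apply H_near with (uhp_val z); auto; apply uhp_pos).
    change w with (uhp_val (mkUHP w Pw)). now rewrite pullback_val, Fp.
  - intros g. destruct (f_cusp g) as (w & G & Y & Hw & HG & E). exists w, G, Y.
    split; auto. split; auto. split.
    + apply HF. right. exists g. split; auto.
      apply (clim_meromorphic _ G (INR w) Y); auto. destruct Hw as [Hw _]. apply lt_0_INR. lia.
    + intros z Hz. rewrite Fp. now apply E.
Qed.
End Lift.

Lemma least_nat (P : nat -> Prop) n : P n -> exists m, P m /\ forall k, P k -> (m <= k)%nat.
Proof.
  induction n as [n IH] using (well_founded_induction Wf_nat.lt_wf). intros Hn.
  destruct (classic (exists k, (k < n)%nat /\ P k)) as [[k [Hk Pk]]|No]; [eauto|].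
  exists n. split; auto. intros k Pk. destruct (le_lt_dec n k); auto. exfalso. apply No. eauto.
Qed.

(** [g T^N g^-1] has lower-left entry [- c^2 N]. *)
Lemma cusp_width_exists N g : (2 <= N)%nat -> exists w, cusp_width N g w.
Proof.
  intros HN.
  destruct (least_nat (fun k => (1 <= k)%nat /\
    Gamma0 N (SL2Z_mul (SL2Z_mul g (SL2Z_T (Z.of_nat k))) (SL2Z_inv g))) N) as [w [[W1 W2] W3]].
  - split; [lia|]. unfold Gamma0. sl2_simpl. exists (- mc g * mc g)%Z. ring.
  - exists w. split; [|split]; auto.
Qed.

Lemma cusp_periodic N f g w : (forall g z, Gamma0 N g -> 0 < Im z -> f (mobius g z) = f z) ->
  cusp_width N g w -> forall z, 0 < Im z -> f (mobius g (z + INR w)%C) = f (mobius g z) :> C.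
Proof.
  intros Hf (_ & Hw & _) z Hz.
  rewrite <- (Hf _ (mobius g z) Hw) by (now apply Im_mobius_pos).
  rewrite <- mobius_mul by auto. rewrite SL2Z_mulA, SL2Z_mulVl, SL2Z_mul1r, mobius_mul, mobius_T by auto.
  now rewrite INR_IZR_INZ.
Qed.

Lemma MF_expansion N f g w : (2 <= N)%nat -> MF N f -> cusp_width N g w ->
  exists k u d Y, 0 < d /\ hol_disc u 0 d /\ forall z, Y < Im z -> Cmod (qpar (z / INR w)) < d /\
    f (mobius g z) = (u (qpar (z / INR w)) / qpar (z / INR w) ^ k)%C.
Proof.
  intros HN (F1 & F2 & F3) Hw. destruct (F3 g) as (Y & K & m & HK & HB).
  assert (Pw : 0 < INR w) by (destruct Hw; apply lt_0_INR; lia).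
  destruct (q_expansion (fun z => f (mobius g z)) (INR w) (Rmax 0 Y) K (m * w)) as (k & u & d & Y' & Hd & Hu & H); auto.
  - intros z Hz. apply (hol_H_mobius f g F1). pose proof (Rmax_l 0 Y). lra.
  - intros z Hz. pose proof (Rmax_l 0 Y). apply (cusp_periodic N f g w F2 Hw). lra.
  - intros z Hz. pose proof (Rmax_r 0 Y). rewrite mult_INR.
    replace (2 * PI * (INR m * INR w) * (Im z / INR w)) with (2 * PI * INR m * Im z) by (field; lra).
    apply HB. lra.
  - exists k, u, d, Y'. auto.
Qed.

Lemma lift_MF N f : (2 <= N)%nat -> MF N f -> exists F, represents N F f.
Proof.
  intros HN Hf. destruct Hf as (F1 & F2 & F3) eqn:E. clear E.
  destruct (lift N (fun z => Some (f z))) as [F [A B]].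
  - intros g z Hg Hz. now rewrite F2.
  - intros z Hz. apply (hol_meromorphic f z (Im z)); auto. now apply H_disc.
  - intros g. destruct (cusp_width_exists N g HN) as [w Hw].
    destruct (MF_expansion N f g w HN Hf Hw) as (k & u & d & Y & Hd & Hu & H).
    destruct (laurent_meromorphic k u 0 d Hd Hu) as (G & e & He & HG & EG).
    assert (Pw : 0 < INR w) by (destruct Hw; apply lt_0_INR; lia).
    destruct (qpar_div_small (INR w) e Pw He) as [Y' [_ HS]].
    exists w, G, (Rmax Y Y'). split; auto. split; auto. intros z Hz.
    pose proof (Rmax_l Y Y'). pose proof (Rmax_r Y Y'). destruct (H z ltac:(lra)) as [_ ->].
    assert (X : (qpar (z / INR w) - 0)%C = qpar (z / INR w)) by ring.
    rewrite EG; [now rewrite X|apply qpar_neq0|rewrite X; apply HS; lra].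
  - exists F. split; auto.
Qed.

(** At a cusp [f] has the expansion [q ^ l v / q ^ k] with [v] nonzero, unless it vanishes near the
    cusp and then everywhere; the inverse is [q ^ k v^-1 / q ^ l]. *)
Lemma lift_inv N f Y0 : (2 <= N)%nat -> MF N f -> (forall z, Y0 < Im z -> f z <> 0) ->
  exists F, function_field N F /\ forall z : UHP, F (proj N (HPoint z)) = sphere_inv (f z).
Proof.
  intros HN Hf NZ. destruct Hf as (F1 & F2 & F3) eqn:E. clear E.
  assert (NL : forall z, 0 < Im z -> ~ locally_zero f z).
  { intros z Hz L. set (w := (0, Rmax 0 Y0 + 1) : C).
    assert (Hw : Im w = Rmax 0 Y0 + 1) by reflexivity. pose proof (Rmax_l 0 Y0). pose proof (Rmax_r 0 Y0).
    apply (NZ w); [lra|]. apply locally_zero_at. apply (identity_H f z w); auto. lra. }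
  apply (lift N (fun z => sphere_inv (f z))).
  - intros g z Hg Hz. now rewrite F2.
  - intros z Hz. apply (inv_meromorphic f z (Im z)); auto. now apply H_disc.
  - intros g. destruct (cusp_width_exists N g HN) as [w Hw].
    assert (Pw : 0 < INR w) by (destruct Hw; apply lt_0_INR; lia).
    destruct (MF_expansion N f g w HN Hf Hw) as (k & u & d & Y & Hd & Hu & H).
    destruct (hol_zero_dichotomy u 0 d Hd Hu) as [[e [He Z]]|(l & v & e & He & Hv & Ev)].
    (* if [u] is locally zero, then [f o g] vanishes at all [p] high up, and [f] near [g p] *)
    + exfalso. destruct (qpar_div_small (INR w) e Pw He) as [Y' [_ HS]].
      set (m := Rmax 0 (Rmax Y Y')). assert (M0 : 0 <= m) by apply Rmax_l.
      assert (M1 : Y <= m) by (eapply Rle_trans; [apply Rmax_l|apply Rmax_r]).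
      assert (M2 : Y' <= m) by (eapply Rle_trans; [apply Rmax_r|apply Rmax_r]).
      set (p := (0, m + 1) : C). assert (Hp : Im p = m + 1) by reflexivity.
      apply (NL (mobius g p)); [apply Im_mobius_pos; lra|].
      apply (identity_H f (mobius g p)); auto; try (apply Im_mobius_pos; lra).
      set (q := mobius g p). assert (Hq : 0 < Im q) by (apply Im_mobius_pos; lra).
      assert (Bk : mobius (SL2Z_inv g) q = p).
      { unfold q. rewrite <- mobius_mul by lra. now rewrite SL2Z_mulVl, mobius_1. }
      destruct (hol_cont (mobius (SL2Z_inv g)) q (mobius_hol _ q Hq) 1 ltac:(lra)) as [r [Hr HC]].
      exists (Rmin r (Im q)). split; [now apply Rmin_glb_lt|]. intros x Hx.
      pose proof (Rmin_l r (Im q)). pose proof (Rmin_r r (Im q)).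
      assert (Hx0 : 0 < Im x) by (apply H_near with q; lra).
      specialize (HC x ltac:(lra)). rewrite Bk in HC.
      set (y := mobius (SL2Z_inv g) x) in *.
      assert (Hy : m < Im y).
      { pose proof (im_le_Cmod (y - p)) as I. change (Im (y - p)) with (Im y - Im p) in I.
        assert (X : Rabs (Im y - Im p) < 1) by lra. apply Rabs_lt_between in X. lra. }
      replace x with (mobius g y) by (unfold y; rewrite <- mobius_mul by auto; now rewrite SL2Z_mulVr, mobius_1).
      destruct (H y ltac:(lra)) as [_ ->]. rewrite Z.
      * unfold Cdiv. ring.
      * replace (qpar (y / INR w) - 0)%C with (qpar (y / INR w)) by ring. apply HS. lra.
    + assert (Hu' : hol_disc (fun t => t ^ k / v t)%C 0 e).
      { intros t Ht. apply hol_div; [auto with hol|now apply Hv|now apply Ev]. }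
      destruct (laurent_meromorphic l _ 0 e He Hu') as (G & e' & He' & HG & EG).
      assert (Hm : 0 < Rmin e e') by (now apply Rmin_glb_lt).
      destruct (qpar_div_small (INR w) _ Pw Hm) as [Y' [_ HS]].
      exists w, G, (Rmax Y Y'). split; auto. split; auto. intros z Hz.
      pose proof (Rmax_l Y Y'). pose proof (Rmax_r Y Y').
      pose proof (Rmin_l e e'). pose proof (Rmin_r e e').
      destruct (H z ltac:(lra)) as [_ ->]. specialize (HS z ltac:(lra)).
      set (q := qpar (z / INR w)) in *.
      assert (X : (q - 0)%C = q) by ring. assert (Nq : q <> 0) by apply qpar_neq0.
      rewrite EG by (auto; rewrite X; lra). rewrite X.
      destruct (Ev q) as [Nv Eq]; [rewrite X; lra|]. rewrite X in Eq. rewrite Eq.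
      assert (N1 : (q ^ k)%C <> 0) by (now apply Cpow_nz). assert (N2 : (q ^ l)%C <> 0) by (now apply Cpow_nz).
      unfold sphere_inv. destruct (Ceq_dec (q ^ l * v q / q ^ k) 0) as [E|_].
      * exfalso. apply (Cmult_neq_0 _ _ N2 Nv).
        transitivity (q ^ l * v q / q ^ k * q ^ k)%C; [field; auto|rewrite E; ring].
      * f_equal. field. auto.
Qed.

(** ** Relations in the function field *)

(** A relation between values on the upper half plane passes to the cusps by continuity. *)
Lemma relation_intro N (op : C -> C -> C) F G S :
  (forall a b, forall eps, 0 < eps -> exists d, 0 < d /\ forall a' b',
     Cmod (a' - a) < d -> Cmod (b' - b) < d -> Cmod (op a' b' - op a b) < eps) ->
  function_field N F -> function_field N G -> function_field N S ->
  (forall (z : UHP) a b, F (proj N (HPoint z)) = Some a -> G (proj N (HPoint z)) = Some b ->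
     S (proj N (HPoint z)) = Some (op a b)) ->
  forall p a b, F p = Some a -> G p = Some b -> S p = Some (op a b).
Proof.
  intros Hop HF HG HS H p a b Fa Gb. destruct (X0_cases N p) as [[z ->]|[g ->]]; [now apply H|].
  pose proof (function_field_clim N F g HF) as CF. pose proof (function_field_clim N G g HG) as CG.
  rewrite Fa in CF. rewrite Gb in CG.
  eapply clim_unique; [now apply function_field_clim|].
  intros eps He. destruct (Hop a b eps He) as [d [Hd K]].
  destruct (CF d Hd) as [Y1 K1]. destruct (CG d Hd) as [Y2 K2].
  exists (Rmax 0 (Rmax Y1 Y2)). intros z Hz.
  pose proof (Rmax_l 0 (Rmax Y1 Y2)). pose proof (Rmax_r 0 (Rmax Y1 Y2)).
  pose proof (Rmax_l Y1 Y2). pose proof (Rmax_r Y1 Y2).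
  assert (Hz0 : 0 < Im z) by lra.
  destruct (K1 z ltac:(lra)) as [a' [Ea La]]. destruct (K2 z ltac:(lra)) as [b' [Eb Lb]].
  exists (op a' b'). split; [|now apply K].
  rewrite (pullback_mobius_H N F g z Hz0) in Ea. rewrite (pullback_mobius_H N G g z Hz0) in Eb.
  rewrite (pullback_mobius_H N S g z Hz0). now apply H.
Qed.

Lemma is_sum_intro N F G S : function_field N F -> function_field N G -> function_field N S ->
  (forall (z : UHP) a b, F (proj N (HPoint z)) = Some a -> G (proj N (HPoint z)) = Some b ->
     S (proj N (HPoint z)) = Some (a + b)%C) -> is_sum N F G S.
Proof.
  intros HF HG HS H. split; auto. apply (relation_intro N Cplus); auto.
  intros a b eps He. exists (eps / 2). split; [lra|]. intros a' b' A B.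
  replace (a' + b' - (a + b))%C with ((a' - a) + (b' - b))%C by ring.
  eapply Rle_lt_trans; [apply Cmod_triangle|]. lra.
Qed.

Lemma is_prod_intro N F G P : function_field N F -> function_field N G -> function_field N P ->
  (forall (z : UHP) a b, F (proj N (HPoint z)) = Some a -> G (proj N (HPoint z)) = Some b ->
     P (proj N (HPoint z)) = Some (a * b)%C) -> is_prod N F G P.
Proof.
  intros HF HG HS H. split; auto. apply (relation_intro N Cmult); auto.
  intros a b eps He. set (M := Cmod a + Cmod b + 2).
  pose proof (Cmod_ge_0 a). pose proof (Cmod_ge_0 b).
  assert (HM : 0 < M) by (unfold M; lra).
  exists (Rmin 1 (eps / M)). split; [apply Rmin_glb_lt; [lra|now apply Rdiv_lt_0_compat]|].
  intros a' b' A B. pose proof (Rmin_l 1 (eps / M)). pose proof (Rmin_r 1 (eps / M)).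
  replace (a' * b' - a * b)%C with ((a' - a) * b' + a * (b' - b))%C by ring.
  eapply Rle_lt_trans; [apply Cmod_triangle|]. rewrite !Cmod_mult.
  assert (Cmod b' <= Cmod b + 1).
  { pose proof (Cmod_rtriangle b' b). lra. }
  assert (E : eps = eps / M * M) by (field; lra). rewrite E.
  set (t := eps / M) in *. assert (0 < t) by (now apply Rdiv_lt_0_compat).
  pose proof (Cmod_ge_0 (a' - a)). pose proof (Cmod_ge_0 (b' - b)). pose proof (Cmod_ge_0 b').
  assert (Cmod (a' - a) * Cmod b' <= t * (Cmod b + 1)) by (apply Rmult_le_compat; lra).
  assert (Cmod a * Cmod (b' - b) <= Cmod a * t) by (apply Rmult_le_compat_l; lra).
  unfold M. nra.
Qed.

Lemma function_field_const N c : (2 <= N)%nat -> function_field N (const N c).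
Proof.
  intros HN. split.
  - intros z. apply (meromorphic_ext (fun _ => Some c) _ z (Im z)); [apply uhp_pos| |].
    + intros w Hw. unfold pullback. destruct (Rlt_dec 0 (Im w)) as [|X]; [reflexivity|].
      contradiction X. apply H_near with (uhp_val z); auto. apply uhp_pos.
    + apply (hol_meromorphic (fun _ => c) z 1); [lra|]. intros w _. apply hol_const.
  - intros g. destruct (cusp_width_exists N g HN) as [w Hw]. exists w, (fun _ => Some c), 0.
    split; auto. split; [|split; reflexivity].
    apply (hol_meromorphic (fun _ => c) 0 1); [lra|]. intros z _. apply hol_const.
Qed.

(** Each construction step of a polynomial extends to the cusps and is a sum or a product in the
    function field. *)
Lemma Polyjh_subfield N K J Phi : (2 <= N)%nat -> is_subfield N K -> K J -> K Phi ->
  represents N J jfun -> represents N Phi (hfun N) ->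
  forall f, Polyjh N f -> forall F, represents N F f -> K F.
Proof.
  intros HN [K1 K2 K3 K4 _] HJ HPhi RJ RPhi.
  assert (Same : forall f F G, K F -> represents N F f -> represents N G f -> K G).
  { intros f F G KF [F1 F2] [G1 G2]. apply (K3 F (const N (RtoC 0)) G); auto.
    apply is_sum_intro; auto using function_field_const.
    intros z a b Ea Eb. rewrite F2 in Ea. injection Ea as <-. injection Eb as <-. rewrite G2.
    f_equal. ring. }
  intros f H. induction H; intros F HF.
  - apply (Same (fun _ => c) (const N c) F); auto. split; auto using function_field_const.
  - now apply (Same jfun J F).
  - now apply (Same (hfun N) Phi F).
  - destruct (lift_MF N f HN (Polyjh_MF N f HN H)) as [F1 R1].
    destruct (lift_MF N g HN (Polyjh_MF N g HN H0)) as [F2 R2].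
    apply (K3 F1 F2 F); auto. destruct R1, R2, HF as [HF EF]. apply is_sum_intro; auto.
    intros z a b Ea Eb. rewrite H2 in Ea. rewrite H4 in Eb. injection Ea as <-. injection Eb as <-. now rewrite EF.
  - destruct (lift_MF N f HN (Polyjh_MF N f HN H)) as [F1 R1].
    destruct (lift_MF N g HN (Polyjh_MF N g HN H0)) as [F2 R2].
    apply (K4 F1 F2 F); auto. destruct R1, R2, HF as [HF EF]. apply is_prod_intro; auto.
    intros z a b Ea Eb. rewrite H2 in Ea. rewrite H4 in Eb. injection Ea as <-. injection Eb as <-. now rewrite EF.
  - apply IHPolyjh. destruct HF as [HF EF]. split; auto. intros z. rewrite EF, H; auto. apply uhp_pos.
Qed.

(** Clear the poles of [F], then apply [interpolation] to the result. *)
Lemma function_field_quotient N F : (2 <= N)%nat -> function_field N F -> exists A B Y,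
  Polyjh N A /\ Polyjh N B /\ (forall z, Y < Im z -> A z <> 0) /\
  forall z, 0 < Im z -> B z = (fin (pullback N F z) * A z)%C.
Proof.
  intros HN HF. destruct (interpolation N HN) as (A & HA & [Y1 NA] & HI).
  destruct (clear_poles N F HN HF) as (D & (D1 & D2 & D3 & Y2 & ND) & HMF).
  destruct (HI _ HMF) as (B & HB & EB).
  exists (fun z => D z * A z)%C, B, (Rmax Y1 Y2). split; [|split; [auto|split]].
  - apply Polyjh_mult; auto. now apply level_one.
  - intros z Hz. pose proof (Rmax_l Y1 Y2). pose proof (Rmax_r Y1 Y2).
    apply Cmult_neq_0; [apply ND|apply NA]; lra.
  - intros z Hz. rewrite EB by auto. ring.
Qed.

(** Where [A] is nonzero, [F] agrees with the holomorphic function [B / A] except possibly at the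
    point itself, hence also there. *)
Lemma quotient_is_prod N F A B Y I FB : (2 <= N)%nat -> function_field N F -> hol_H A -> hol_H B ->
  (forall z, Y < Im z -> A z <> 0) -> (forall z, 0 < Im z -> B z = (fin (pullback N F z) * A z)%C) ->
  function_field N I -> (forall z : UHP, I (proj N (HPoint z)) = sphere_inv (A z)) ->
  represents N FB B -> is_prod N FB I F.
Proof.
  intros HN HF HA HB NA E HI EI [HFB EFB]. apply is_prod_intro; auto.
  intros z a b Ea Eb. rewrite EFB in Ea. injection Ea as <-. rewrite EI in Eb. unfold sphere_inv in Eb.
  destruct (Ceq_dec (A z) 0) as [|Nz]; [discriminate|]. injection Eb as <-.
  pose proof (uhp_pos z) as Hz. rewrite <- pullback_val.
  destruct HF as [HM _]. specialize (HM z).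
  destruct (meromorphic_laurent _ _ HM) as (k & u & d & Hd & Hu & EL).
  destruct (hol_neq0 A (uhp_val z) (HA _ Hz) Nz) as (e & He & NAe).
  set (r := Rmin (Im z) (Rmin d e)).
  assert (R1 : r <= Im z) by apply Rmin_l.
  assert (R2 : r <= d) by (eapply Rle_trans; [apply Rmin_r|apply Rmin_l]).
  assert (R3 : r <= e) by (eapply Rle_trans; [apply Rmin_r|apply Rmin_r]).
  assert (R0 : 0 < r) by (repeat apply Rmin_glb_lt; auto).
  apply (meromorphic_value_finite (pullback N F) (uhp_val z) (fun z => B z * / A z)%C r); auto.
  - apply hol_mult; [now apply HB|]. apply hol_inv; auto.
  - intros w Nw Hw. rewrite E by (apply H_near with (uhp_val z); lra).
    rewrite EL by (auto; lra). simpl fin. f_equal. field. split; [|apply Cpow_nz].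
    + apply NAe. lra.
    + intros X. apply Nw. now apply Ceq_minus.
Qed.

Theorem corollary1p3 (N : nat) (hN : (2 <= N)%nat) :
  exists J Phi : X0 N -> sphere,
    represents N J jfun /\
    represents N Phi (fun z => (Delta (RtoC (INR N) * z) / Delta z)%C) /\
    (forall F : X0 N -> sphere, function_field N F <-> generated N J Phi F).
Proof.
  destruct (lift_MF N jfun hN (Polyjh_MF N _ hN (Polyjh_j N))) as [J RJ].
  destruct (lift_MF N (hfun N) hN (Polyjh_MF N _ hN (Polyjh_h N))) as [Phi RPhi].
  exists J, Phi. split; [exact RJ|]. split; [exact RPhi|]. intros F. split.
  - intros HF K HK KJ KPhi.
    destruct (function_field_quotient N F hN HF) as (A & B & Y & HA & HB & NA & E).
    pose proof (Polyjh_MF N A hN HA) as MA. pose proof (Polyjh_MF N B hN HB) as MB.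
    destruct (lift_MF N A hN MA) as [FA RA]. destruct (lift_MF N B hN MB) as [FB RB].
    destruct (lift_inv N A Y hN MA NA) as [I [HI EI]].
    assert (KA : K FA) by (now apply (Polyjh_subfield N K J Phi hN HK KJ KPhi RJ RPhi A)).
    assert (KB : K FB) by (now apply (Polyjh_subfield N K J Phi hN HK KJ KPhi RJ RPhi B)).
    assert (KI : K I).
    { apply (subfield_inv N K HK FA I); auto. destruct RA as [HFA EFA].
      apply is_prod_intro; auto using function_field_const.
      intros z a b Ea Eb. rewrite EFA in Ea. injection Ea as <-. rewrite EI in Eb. unfold sphere_inv in Eb.
      destruct (Ceq_dec (A z) 0) as [|Nz]; [discriminate|]. injection Eb as <-.
      unfold const. f_equal. field. auto. }
    apply (subfield_mul N K HK FB I F); auto.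
    apply (quotient_is_prod N F A B Y I FB); auto; [apply MA|apply MB].
  - intros HG. apply (HG (function_field N)).
    + split; auto using function_field_const.
      * intros ? ? S _ _ [HS _]. exact HS.
      * intros ? ? S _ _ [HS _]. exact HS.
    + apply RJ.
    + apply RPhi.
Qed.
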